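(* Let $n>2$, $2_*<q<2^*$ and $f(u,r)=-K(r)\,u|u|^{q-2}$, where $h$ satisfies (H) and $K$ satisfies (K) (see context). Set $l_u=l(q,\delta_0)$ and $l_s=l(q,\delta_\infty)$, and assume $2_*(\eta)<l_u<2^*$ and $2_*(\beta)<l_s<{\rm I}(\beta)$. Consider the equation $$u''+\frac{n-1}{r}u'+\frac{h(r)}{r^2}u+f(u,r)=0 .$$ Then there is an increasing sequence $(B_k)_{k\ge0}$ of positive numbers such that $v(r,B_k)$ is an $R_kf$-solution for every $k\ge0$. Moreover $v(r,L)$ is an $S_0f$-solution for any $0<L<B_0$, and for every $k\ge1$ there is $B_k^*\in[B_{k-1},B_k)$ such that $v(r,L)$ is an $S_kf$-solution whenever $B_k^*<L<B_k$. Consequently, there is an increasing sequence $(A_k)_{k\ge0}$ of positive numbers such that $u(r,A_k)$ is an $R_kf$-solution for any $k\ge0$.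
   Context: Condition (H): $h:(0,\infty)\to\mathbb R$ is differentiable, $h(r)<\frac{(n-2)^2}{4}$ for every $r>0$; $\lim_{r\to0}h(r)=\eta<\frac{(n-2)^2}{4}$ and $\frac{h(r)-\eta}{r}\in L^1(0,1]$; $\lim_{r\to\infty}h(r)=\beta<\frac{(n-2)^2}{4}$ and $\frac{h(r)-\beta}{r}\in L^1[1,\infty)$. Condition (K): $K:(0,\infty)\to\mathbb R$ is $C^1$ and there is $R>0$ with $K(r)<0$ for $0<r<R$ and $K(r)>0$ for $r>R$. Moreover $K(r)=k_0r^{\delta_0}+o(r^{\delta_0})$ as $r\to0$ and $K(r)=k_\infty r^{\delta_\infty}+o(r^{\delta_\infty})$ as $r\to\infty$, with constants $k_0<0<k_\infty$ and $\delta_0,\delta_\infty>-2$; and there is $\varpi>0$ (small) with $\lim_{r\to0}r^{-\varpi}\frac{d}{dr}[K(r)r^{-\delta_0}]=0$ and $\lim_{r\to\infty}r^{\varpi}\frac{d}{dr}[K(r)r^{-\delta_\infty}]=0$. Constants: $2_*=\frac{2(n-1)}{n-2}$, $2^*=\frac{2n}{n-2}$, $l(q,\delta)=2\frac{q+\delta}{2+\delta}$. For $\eta<\frac{(n-2)^2}{4}$: $2_*(\eta)=2\frac{n+\sqrt{(n-2)^2-4\eta}}{n-2+\sqrt{(n-2)^2-4\eta}}$; ${\rm I}(\eta)=+\infty$ if $\eta\le0$ and ${\rm I}(\eta)=2\frac{n-\sqrt{(n-2)^2-4\eta}}{n-2-\sqrt{(n-2)^2-4\eta}}$ if $0<\eta<\frac{(n-2)^2}{4}$;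 $\kappa(\eta)=\frac{(n-2)-\sqrt{(n-2)^2-4\eta}}{2}$. The same formulas with $\beta$ in place of $\eta$. Solutions. For $d\in\mathbb R$, $u(r,d)$ denotes the unique solution with $\lim_{r\to0}u(r,d)r^{\kappa(\eta)}=d$; such solutions are called R-solutions. A solution $u$ is an S-solution if $\lim_{r\to0}u(r)r^{\kappa(\eta)}=\pm\infty$. For $L\in\mathbb R$, $v(r,L)$ denotes the unique solution with $\lim_{r\to\infty}v(r,L)r^{n-2-\kappa(\beta)}=L$; such solutions are called fast decay (fd) solutions. An $R_kf$-solution (resp. $S_kf$-solution) is a solution that is both an R-solution and fd (resp. an S-solution and fd) and has exactly $k$ zeros in $(0,\infty)$, all nondegenerate. *)

(* Defs.v *)
From mathcomp Require Export all_boot all_order all_algebra.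
From mathcomp Require Export all_classical all_reals all_analysis.
Export Order.TTheory GRing.Theory Num.Theory.
Export numFieldNormedType.Exports.

Set Implicit Arguments.
Unset Strict Implicit.
Unset Printing Implicit Defensive.

Global Open Scope classical_set_scope.
Global Open Scope ring_scope.

Section Constants.
Variable R : realType.
Implicit Types n q delta eta : R.

Definition lower_star n : R := 2 * (n - 1) / (n - 2).
Definition upper_star n : R := 2 * n / (n - 2).
Definition ell q delta : R := 2 * ((q + delta) / (2 + delta)).

Definition hardy_const n : R := (n - 2) ^+ 2 / 4.
Definition disc n eta : R := Num.sqrt ((n - 2) ^+ 2 - 4 * eta).

Definition lower_star_of n eta : R :=
  2 * ((n + disc n eta) / (n - 2 + disc n eta)).
Definition I_of n eta : \bar R :=
  if eta <= 0 then +oo%E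
  else (2 * ((n - disc n eta) / (n - 2 - disc n eta)))%:E.
Definition kappa n eta : R := (n - 2 - disc n eta) / 2.

End Constants.

(* Functions on the half-line are total functions R -> R; every condition below
   only depends on their values at positive reals. *)

Section Conditions.
Variable R : realType.

Definition condH (n : R) (h : R -> R) (eta beta : R) : Prop :=
  [/\ forall r : R, 0 < r -> derivable h r 1 /\ h r < hardy_const n,
      h r @[r --> 0^'+] --> eta /\ eta < hardy_const n,
      lebesgue_measure.-integrable `]0, 1] (fun r : R => ((h r - eta) / r)%:E),
      h r @[r --> +oo] --> beta /\ beta < hardy_const n &
      lebesgue_measure.-integrable `[1, +oo[
        (fun r : R => ((h r - beta) / r)%:E)].

(* The littleo_def of landau.v, which is local to that file; the notation based
   on it needs a canonical filter_on structure, missing for +oo. *)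
Definition little_o (F : set_system R) (f g : R -> R) : Prop :=
  forall eps : R, 0 < eps -> \forall r \near F, `|f r| <= eps * `|g r|.

Definition condK (K : R -> R) (delta0 deltaoo : R) : Prop :=
  [/\ forall r : R, 0 < r -> derivable K r 1 /\ {for r, continuous (derive1 K)},
      exists2 r0 : R, 0 < r0 &
        (forall r : R, 0 < r < r0 -> K r < 0) /\
        (forall r : R, r0 < r -> 0 < K r),
      -2 < delta0 /\ -2 < deltaoo,
      exists k0 koo : R,
        [/\ k0 < 0 < koo,
            little_o 0^'+ (fun r => K r - k0 * r `^ delta0)
              (fun r => r `^ delta0) &
            little_o +oo (fun r => K r - koo * r `^ deltaoo)
              (fun r => r `^ deltaoo)] &
      exists2 w : R, 0 < w &
        r `^ (- w) * derive1 (fun s => K s * s `^ (- delta0)) r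
          @[r --> 0^'+] --> 0 /\
        r `^ w * derive1 (fun s => K s * s `^ (- deltaoo)) r
          @[r --> +oo] --> 0].

End Conditions.

Section Solutions.
Variable R : realType.
Variables (n : R) (h : R -> R) (f : R -> R -> R) (eta beta : R).
Implicit Types (D : set R) (u v w : R -> R) (d L : R) (k : nat).

(* Meant for D open, so that the derivatives of u at points of D only involve
   the values of u on D. *)
Definition solution_on D u : Prop :=
  forall r : R, D r ->
    [/\ derivable u r 1, derivable (derive1 u) r 1 &
        derive1 (derive1 u) r + (n - 1) / r * derive1 u r
          + h r / r ^+ 2 * u r + f (u r) r = 0 :> R].

Definition solution u : Prop := solution_on `]0, +oo[ u.

Definition limit_at_zero u d : Prop :=
  u r * r `^ kappa n eta @[r --> 0^'+] --> d.

Definition limit_at_infty v L : Prop :=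
  v r * r `^ (n - 2 - kappa n beta) @[r --> +oo] --> L.

(* u is the function u(., d), and it exists on the whole half-line. A solution
   of the equation may blow up at a finite positive r, so the uniqueness clauses
   compare with all solutions defined near 0, resp. near infinity. *)
Definition is_u d u : Prop :=
  [/\ solution u, limit_at_zero u d &
      forall (rho : R) w, 0 < rho -> solution_on `]0, rho[ w ->
        limit_at_zero w d ->
        forall r : R, 0 < r < rho -> w r = u r].

Definition is_v L v : Prop :=
  [/\ solution v, limit_at_infty v L &
      forall (rho : R) w, 0 <= rho -> solution_on `]rho, +oo[ w ->
        limit_at_infty w L -> forall r : R, rho < r -> w r = v r].

Definition R_solution u : Prop := solution u /\ exists d, limit_at_zero u d.

Definition S_solution u : Prop :=
  solution u /\
  (u r * r `^ kappa n eta @[r --> 0^'+] --> +oo \/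
   u r * r `^ kappa n eta @[r --> 0^'+] --> -oo).

Definition fd_solution u : Prop := solution u /\ exists L, limit_at_infty u L.

Definition exactly_nondegenerate_zeros k u : Prop :=
  ([set r : R | 0 < r /\ u r = 0] #= `I_k)%card /\
  forall r : R, 0 < r -> u r = 0 -> derive1 u r != 0.

Definition Rf_solution k u : Prop :=
  [/\ R_solution u, fd_solution u & exactly_nondegenerate_zeros k u].

Definition Sf_solution k u : Prop :=
  [/\ S_solution u, fd_solution u & exactly_nondegenerate_zeros k u].

End Solutions.

Definition power_nonlinearity (R : realType) (K : R -> R) (q u r : R) : R :=
  - K r * (u * `|u| `^ (q - 2)).

(* Main.v *)
(** Set r = e^t and y(t) = e^((n-2)t/2) u(e^t). The equation becomes y'' = a y + b y|y|^(q-2), where a > 0 tends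
    integrably to nu^2 at -oo and to mu^2 at +oo, and b changes sign once, from negative to positive. Fast decay
    solutions are those with y e^(mu t) -> L at +oo; they are constructed from infinity by a Picard iteration.
    Where b >= 0, convexity forces them to be monotone in t and in L.

    Towards -oo, s = -t and x = y e^(-gam s/2) give x'' = - gam x' + c x - k x|x|^(q-2), which is damped and
    asymptotically autonomous, and has a Lyapunov function. Either this function drops below its value at the
    saddle x = 0, and u is an S-solution whose number of zeros does not change for nearby L; or it never does,
    x tends to 0, u is an R-solution, and for nearby L the number of zeros increases by at most one. For small
    L > 0 there are no zeros. The number of zeros is unbounded in L, because few zeros bound the solution where b
    changes sign, hence bound L, and the set of the L whose solution is global is open. An ordering argument
    gives the B_k. Finally, A_k is the infimum of the d > 0 such that u(., d) has more than k zeros. *)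

(* Three exponent hypotheses have a dynamical meaning. Put gam = 2 (2 + delta0) / (q - 2) - (n - 2).
   That l_u is below the critical exponent says gam > 0, so that x = u r^((2 + delta0)/(q - 2))
   satisfies an equation which is damped towards r = 0. The lower bound on l_u says gam / 2 < nu, so
   that x = 0 is a saddle of the limit equation. The lower bound on l_s makes b e^(- mu (q - 2) t)
   integrable at +oo, which is what the Picard iteration needs. The obstacle is global existence:
   where b >= 0 the equation is repulsive and a solution may blow up at a finite t. Solutions
   therefore carry the left end of their half-line of definition. The stable manifold of the saddle
   is never constructed. Whether an orbit lies on it is decided by whether a Lyapunov function,
   whose limit value at the saddle is a constant C1, ever falls below C1; this is an open condition
   on L, whereas lying on the manifold is not. *)
Require Import Defs.
From mathcomp Require Import ring lra zify.

Set Implicit Arguments.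
Unset Strict Implicit.
Unset Printing Implicit Defensive.

(** * Calculus on the real line *)

Section Calculus.
Variable R : realType.
Implicit Types (f g y : R -> R) (a b t l k : R).

(* Made opaque below: otherwise unification unfolds is_derive to difference quotients. *)
Definition HD f t l : Prop := is_derive t (1 : R) f l.

Lemma HD_cv f t l l' : HD f t l -> l = l' -> HD f t l'.
Proof. by move=> h <-. Qed.

Lemma HD_c k t : HD (fun=> k) t 0.
Proof. exact: is_derive_cst. Qed.

Lemma HD_id t : HD (fun s => s) t 1.
Proof. exact: is_derive_id. Qed.

Lemma HD_D f g t k l : HD f t k -> HD g t l -> HD (fun s => f s + g s) t (k + l).
Proof. by move=> hf hg; exact: (@is_deriveD _ _ _ f g). Qed.

Lemma HD_N f t k : HD f t k -> HD (fun s => - f s) t (- k).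
Proof. by move=> hf; exact: (@is_deriveN _ _ _ f). Qed.

Lemma HD_M f g t k l :
  HD f t k -> HD g t l -> HD (fun s => f s * g s) t (k * g t + f t * l).
Proof.
move=> hf hg; apply: HD_cv (@is_deriveM _ _ f g t 1 k l hf hg) _.
by rewrite addrC /GRing.scale /= mulrC.
Qed.

Lemma HD_comp f g t k l : HD g t k -> HD f (g t) l -> HD (fun s => f (g s)) t (k * l).
Proof. by move=> hg hf; apply: HD_cv (@is_derive1_comp _ f g t l k hf hg) _; rewrite mulrC. Qed.

Lemma HD_exp f t k : HD f t k -> HD (fun s => expR (f s)) t (expR (f t) * k).
Proof. by move=> hf; apply: HD_cv (HD_comp hf (is_derive_expR _)) (mulrC _ _). Qed.

Lemma HD_sqr f t k : HD f t k -> HD (fun s => f s ^+ 2) t (2 * f t * k).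
Proof. by move=> hf; apply: HD_cv (HD_M hf hf) _; ring. Qed.

Lemma HD_V f t l : HD f t l -> f t != 0 -> HD (fun s => (f s)^-1) t (- l / f t ^+ 2).
Proof.
move=> hf f0; apply: (HD_cv (@is_deriveV _ f t l 1 f0 hf)).
by rewrite /GRing.scale /= -exprVn; ring.
Qed.

Lemma HD_near f g t l : (\forall s \near t, f s = g s) -> HD f t l -> HD g t l.
Proof. by move=> fg; apply: near_eq_is_derive. Qed.

Lemma HD_cts f t l : HD f t l -> {for t, continuous f}.
Proof. by case=> d _; apply: differentiable_continuous; apply/derivable1_diffP. Qed.

Lemma HD_derive1 f t l : HD f t l -> derive1 f t = l.
Proof. by move=> [_ <-]; rewrite derive1E. Qed.

Lemma HD_derivable f t l : HD f t l -> derivable f t 1.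
Proof. by case. Qed.

Lemma derivable_HD f t : derivable f t 1 -> HD f t (derive1 f t).
Proof. by move=> h; rewrite /HD derive1E; apply/derivableP. Qed.

Lemma HD_MVT f df a b : a < b -> (forall t, a <= t <= b -> HD f t (df t)) ->
  exists2 c, a < c < b & f b - f a = df c * (b - a).
Proof.
move=> ab h.
have [t||c] := @MVT R f df a b ab.
- by rewrite in_itv /= => /andP[at_ tb]; apply: h; rewrite !ltW.
- apply: continuous_in_subspaceT => t; rewrite inE /= in_itv /= => abt.
  exact: HD_cts (h _ abt).
- by rewrite in_itv /= => acb e; exists c.
Qed.

Lemma HD_le f df a b : a <= b -> (forall t, a <= t <= b -> HD f t (df t)) ->
  (forall t, a <= t <= b -> 0 <= df t) -> f a <= f b.
Proof.
rewrite le_eqVlt => /predU1P[-> //|ab] h h0; have [c /andP[ac cb] e] := HD_MVT ab h.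
by rewrite -subr_ge0 e; apply: mulr_ge0; [apply: h0; rewrite !ltW|rewrite subr_ge0 ltW].
Qed.

Lemma HD_lt f df a b : a < b -> (forall t, a <= t <= b -> HD f t (df t)) ->
  (forall t, a < t < b -> 0 < df t) -> f a < f b.
Proof.
move=> ab h h0; have [c acb e] := HD_MVT ab h.
by rewrite -subr_gt0 e; apply: mulr_gt0; [exact: h0|rewrite subr_gt0].
Qed.

Lemma HD_ge f df a b : a <= b -> (forall t, a <= t <= b -> HD f t (df t)) ->
  (forall t, a <= t <= b -> df t <= 0) -> f b <= f a.
Proof.
move=> ab h h0; rewrite -lerN2; apply: (HD_le (f := fun t => - f t) (df := fun t => - df t)) => //.
  by move=> t /h /HD_N.
by move=> t /h0; rewrite oppr_ge0.
Qed.

Lemma HD_bound f df a b C : a <= b -> (forall t, a <= t <= b -> HD f t (df t)) ->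
  (forall t, a <= t <= b -> `|df t| <= C) -> `|f b - f a| <= C * (b - a).
Proof.
rewrite le_eqVlt => /predU1P[->|ab] h hC; first by rewrite !subrr normr0 mulr0.
have [c /andP[ac cb] ->] := HD_MVT ab h.
have ba : 0 < b - a by rewrite subr_gt0.
by rewrite normrM (gtr0_norm ba) ler_pM2r// hC// !ltW.
Qed.

Definition cts f := forall t, {for t, continuous f}.

Lemma cts_eps f t : {for t, continuous f} <->
  (forall e, 0 < e -> exists2 d, 0 < d & forall s, `|s - t| < d -> `|f s - f t| < e).
Proof.
split=> [/cvgrPdist_lt h e e0|h].
  have /nbhs_ballP[d /= d0 hd] := h _ e0; exists d => // s st.
  by rewrite distrC; apply: hd; rewrite /ball /= distrC.
apply/cvgrPdist_lt => e e0; have [d d0 hd] := h _ e0.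
apply/nbhs_ballP; exists d => // s /=; rewrite /ball /= => st.
by rewrite distrC; apply: hd; rewrite distrC.
Qed.

Lemma cts_itv f a b : cts f -> {within `[a, b], continuous f}.
Proof. by move=> h; apply: continuous_subspaceT => t; exact: h. Qed.

Lemma within_itv f a b : (forall t, a <= t <= b -> {for t, continuous f}) ->
  {within `[a, b], continuous f}.
Proof.
move=> h; apply: continuous_in_subspaceT => t; rewrite inE /= in_itv /=; exact: h.
Qed.

Lemma cts_HD f df : (forall t, HD f t (df t)) -> cts f.
Proof. by move=> h t; exact: HD_cts (h t). Qed.

Lemma cts_bounded f a b : (forall t, a <= t <= b -> {for t, continuous f}) ->
  exists2 C : R, 0 < C & forall t, a <= t <= b -> `|f t| <= C.
Proof.
move=> h; have [ab|ba] := leP a b; last first.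
  by exists 1 => // t /andP[at_ tb]; move: ba; rewrite ltNge (le_trans at_ tb).
have [|c _ hc] := @EVT_max R (fun t => `|f t|) a b ab.
  apply: within_itv => t /h ct; apply: (cvg_comp _ _ ct); exact: norm_continuous.
exists (`|f c| + 1); first by rewrite ltr_wpDl.
by move=> t tab; rewrite (le_trans (hc t _)) ?in_itv//= lerDl.
Qed.

Lemma cts_posmin f a b : (forall t, a <= t <= b -> {for t, continuous f}) ->
  (forall t, a <= t <= b -> 0 < f t) ->
  exists2 C : R, 0 < C & forall t, a <= t <= b -> C <= f t.
Proof.
move=> h h0; have [ab|ba] := leP a b; last first.
  by exists 1 => // t /andP[at_ tb]; move: ba; rewrite ltNge (le_trans at_ tb).
have [|c cab hc] := @EVT_min R f a b ab; first exact: within_itv.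
exists (f c); first by apply: h0; move: cab; rewrite in_itv.
by move=> t tab; apply: hc; rewrite in_itv.
Qed.

Lemma IVT0 f a b : a <= b -> (forall t, a <= t <= b -> {for t, continuous f}) ->
  f a * f b <= 0 -> exists2 c, a <= c <= b & f c = 0.
Proof.
move=> ab h h0; have [||c] := @IVT R f a b 0 ab.
- exact: within_itv.
- rewrite ge_min le_max.
  have [fa|fa] := leP (f a) 0; have [fb|fb] := leP (f b) 0 => //=.
  + have := mulr_le0 fa fb; move=> h1.
    have /eqP : f a * f b = 0 by apply/eqP; rewrite eq_le h0.
    by rewrite mulf_eq0 => /orP[]/eqP ->; rewrite lexx ?orbT.
  + by rewrite (ltW fb) orbT.
  + by rewrite (ltW fa).
  + by have := mulr_gt0 fa fb; rewrite ltNge h0.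
- by rewrite in_itv /= => ? ?; exists c.
Qed.

Definition limp f l := forall e, 0 < e -> exists N, forall t, N <= t -> `|f t - l| < e.

Lemma limpP f l : limp f l <-> f t @[t --> +oo] --> l.
Proof.
split=> [h|/cvgrPdist_lt h e e0].
  apply/cvgrPdist_lt => e /h[N hN]; exists N; split; first exact: num_real.
  by move=> t Nt; rewrite distrC hN// ltW.
have [N [_ hN]] := h e e0; exists (N + 1) => t Nt.
by rewrite distrC; apply: hN; rewrite (lt_le_trans _ Nt)// ltrDl.
Qed.

Lemma limp_c l : limp (fun=> l) l.
Proof. by move=> e e0; exists 0 => t _; rewrite subrr normr0. Qed.

Lemma limpD f g k l : limp f k -> limp g l -> limp (fun t => f t + g t) (k + l).
Proof. by rewrite !limpP; exact: cvgD. Qed.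

Lemma limpN f k : limp f k -> limp (fun t => - f t) (- k).
Proof. by rewrite !limpP; exact: cvgN. Qed.

Lemma limpM f g k l : limp f k -> limp g l -> limp (fun t => f t * g t) (k * l).
Proof. by rewrite !limpP; exact: cvgM. Qed.

Lemma limp_comp f g k : limp f k -> {for k, continuous g} -> limp (fun t => g (f t)) (g k).
Proof. by rewrite !limpP => h1 h2; apply: (cvg_comp _ _ h1). Qed.

Lemma limp_uniq f k l : limp f k -> limp f l -> k = l.
Proof. by rewrite !limpP => h1 h2; apply: (cvg_unique _ h1 h2). Qed.

Lemma limp_ext f g N k : (forall t, N <= t -> f t = g t) -> limp f k -> limp g k.
Proof.
move=> fg h e /h[M hM]; exists (Num.max M N) => t.
by rewrite ge_max => /andP[Mt Nt]; rewrite -fg// hM.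
Qed.

Lemma limp_ge f N k b : limp f k -> (forall t, N <= t -> b <= f t) -> b <= k.
Proof.
move=> h hb; rewrite leNgt; apply/negP => kb.
have [|M hM] := h (b - k); first by rewrite subr_gt0.
have := hM (Num.max M N); rewrite le_max lexx => /(_ isT).
have := hb (Num.max M N); rewrite le_max lexx orbT => /(_ isT).
by rewrite ltr_norml => h1 /andP[_]; lra.
Qed.

Lemma limp_le f N k b : limp f k -> (forall t, N <= t -> f t <= b) -> k <= b.
Proof.
move=> /limpN h hb; rewrite -lerN2; apply: (limp_ge h (N := N)) => t Nt.
by rewrite lerN2 hb.
Qed.

Lemma limp_dominated f g N : limp g 0 -> (forall t, N <= t -> `|f t| <= g t) -> limp f 0.
Proof.
move=> h fg e /h[M hM]; exists (Num.max M N) => t; rewrite ge_max => /andP[Mt Nt].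
rewrite subr0; have := hM _ Mt; rewrite subr0; apply: le_lt_trans.
by rewrite (le_trans (fg _ Nt))// ler_norm.
Qed.

Lemma limp_bounded f k tl : limp f k -> (forall t, tl <= t -> {for t, continuous f}) ->
  exists2 C : R, 0 < C & forall t, tl <= t -> `|f t| <= C.
Proof.
move=> h hc; have [//|N hN] := h 1.
have [C C0 hC] := @cts_bounded f tl N (fun t => fun tlN => hc t (proj1 (andP tlN))).
exists (C + `|k| + 1) => [|t tlt]; first by have := normr_ge0 k; lra.
have [tN|Nt] := leP t N.
  by have := hC t; rewrite tlt tN => /(_ isT); have := normr_ge0 k; lra.
have := hN _ (ltW Nt); have := ler_normD (f t - k) k; rewrite subrK; lra.
Qed.

Lemma nondec_limp_le f df tl k : (forall t, tl < t -> HD f t (df t)) ->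
  (forall t, tl < t -> 0 <= df t) -> limp f k -> forall t, tl < t -> f t <= k.
Proof.
move=> h h0 hl t tt; apply: (limp_ge hl (N := t)) => s ts.
apply: (HD_le ts) => r /andP[tr _]; [apply: h|apply: h0]; exact: lt_le_trans tr.
Qed.

Lemma noninc_limp_ge f df tl k : (forall t, tl < t -> HD f t (df t)) ->
  (forall t, tl < t -> df t <= 0) -> limp f k -> forall t, tl < t -> k <= f t.
Proof.
move=> h h0 hl t tt; rewrite -lerN2.
apply: (nondec_limp_le (f := fun t => - f t) (df := fun t => - df t) (tl := tl)) => //.
- by move=> s /h/HD_N.
- by move=> s /h0; rewrite oppr_ge0.
- exact: limpN.
Qed.

Lemma limp_expN k : 0 < k -> limp (fun t => expR (- k * t)) 0.
Proof.
move=> k0 e e0; exists (- (ln e) / k + 1) => t Nt; rewrite subr0 gtr0_norm ?expR_gt0//.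
rewrite -[ltRHS]lnK ?posrE// ltr_expR mulNr ltrNl.
have : k * (- (ln e) / k + 1) <= k * t by rewrite ler_pM2l.
rewrite mulrDr mulr1 mulrC divfK ?gt_eqF//; lra.
Qed.

Lemma noninc_limp f df tl m : (forall t, tl < t -> HD f t (df t)) ->
  (forall t, tl < t -> df t <= 0) -> (forall t, tl < t -> m <= f t) ->
  exists2 l, m <= l & limp f l.
Proof.
move=> h h0 hm.
have mono s t : tl < s -> s <= t -> f t <= f s.
  move=> ts st; apply: (HD_ge st) => r /andP[sr _]; [apply: h|apply: h0]; exact: lt_le_trans sr.
pose A := [set f t | t in [set t | tl < t]].
have A0 : A !=set0 by exists (f (tl + 1)), (tl + 1) => //=; rewrite ltrDl.
have Am : lbound A m by move=> _ [t /= tt <-]; exact: hm.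
have hA : has_inf A by split => //; exists m.
exists (inf A); first exact: lb_le_inf.
move=> e e0; have [_ [s /= ts <-] hs] := inf_adherent e0 hA.
exists s => t st; have ft := mono s t ts st.
have : inf A <= f t by apply: ge_inf; [exists m|exists t => //=; exact: lt_le_trans st].
rewrite ltr_norml; lra.
Qed.

End Calculus.

(* [hd tac] differentiates a sum, product, exponential or square, solving the leaves by [tac], and leaves the
   equation between the computed and the expected derivative. *)
Ltac hd_rule tac :=
  lazymatch goal with
  | |- HD (fun _ => ?k) _ _ => exact: HD_c
  | |- HD (fun s => s) _ _ => exact: HD_id
  | |- HD (fun s => @?f s + @?g s) _ _ => apply: (@HD_D _ f g); hd_rule tac
  | |- HD (fun s => @?f s * @?g s) _ _ => apply: (@HD_M _ f g); hd_rule tac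
  | |- HD (fun s => - @?f s) _ _ => apply: (@HD_N _ f); hd_rule tac
  | |- HD (fun s => expR (@?f s)) _ _ => apply: (@HD_exp _ f); hd_rule tac
  | |- HD (fun s => (@?f s) ^+ 2) _ _ => apply: (@HD_sqr _ f); hd_rule tac
  | |- _ => tac
  end.
Tactic Notation "hd" tactic3(tac) := (eapply HD_cv; [hd_rule ltac:(solve [eassumption | tac])|cbv beta]).

(** * The nonlinearity y |y|^(q-2) and its truncation *)

Section Powers.
Variable R : realType.
Implicit Types (f g : R -> R) (x y t l M : R).

(** Serves the derivative of [psi] at the origin, where the product rule fails because |y|^(q-2)
    need not be differentiable. *)
Lemma HD_eps f t l :
  (forall e, 0 < e -> exists2 d, 0 < d &
     forall s, `|s - t| < d -> `|f s - f t - l * (s - t)| <= e * `|s - t|) ->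
  HD f t l.
Proof.
move=> h.
have hl : (fun s => s^-1 *: (f (s + t) - f t)) s @[s --> 0^'] --> l.
  apply/cvgrPdist_le => e e0; have [d d0 hd] := h _ e0.
  near=> s.
  have s0 : s != 0 by near: s; exact: nbhs_dnbhs_neq.
  have sd : `|s| < d by near: s; apply: dnbhs0_lt.
  have := hd (s + t); rewrite addrK => /(_ sd) h1.
  rewrite /GRing.scale /= distrC -(@ler_pM2r _ `|s|) ?normr_gt0// -normrM.
  by rewrite mulrBl mulrAC mulVf// mul1r.
have hl' : (fun s => s^-1 *: (f (s *: 1 + t) - f t)) s @[s --> 0^'] --> l.
  by under eq_fun do rewrite /GRing.scale /= mulr1.
by split; [apply/cvg_ex; exists l|apply/cvg_lim].
Unshelve. all: by end_near. Qed.

Lemma HD_opp_odd f t l : (forall s, f (- s) = - f s) -> HD f (- t) l -> HD f t l.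
Proof.
move=> fo h; have := HD_N (HD_comp (HD_N (HD_id t)) h).
rewrite mulN1r opprK; apply: HD_near; near=> s.
by rewrite fo opprK.
Unshelve. all: by end_near. Qed.

Variable q : R.
Hypothesis q2 : 2 < q.

Definition psi y : R := y * `|y| `^ (q - 2).

Lemma psiN y : psi (- y) = - psi y.
Proof. by rewrite /psi normrN mulNr. Qed.

Lemma psi0 : psi 0 = 0.
Proof. by rewrite /psi mul0r. Qed.

Lemma psi_pos y : 0 < y -> psi y = y `^ (q - 1).
Proof.
move=> y0; rewrite /psi gtr0_norm//.
have -> : q - 1 = q - 2 + 1 by ring.
by rewrite (@powRD _ _ (q - 2) 1) ?(gt_eqF y0) ?implybT// powRr1 ?ltW// mulrC.
Qed.

Lemma powR_small x e p : 0 < p -> 0 < e -> 0 <= x < e `^ (p^-1) -> x `^ p < e.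
Proof.
move=> p0 e0 /andP[x0 xe].
have -> : e = (e `^ (p^-1)) `^ p by rewrite -powRrM mulVf ?gt_eqF// powRr1// ltW.
by apply: gt0_ltr_powR => //; rewrite nnegrE// powR_ge0.
Qed.

Lemma cts_powR p : 0 < p -> cts (fun y : R => `|y| `^ p).
Proof.
move=> p0 y; have [->|y0] := eqVneq y 0.
  apply/cts_eps => e e0; exists (e `^ (p^-1)); first exact: powR_gt0.
  move=> s; rewrite subr0 normr0 powR0 ?gt_eqF// subr0 => se.
  by rewrite ger0_norm ?powR_ge0// powR_small// normr_ge0.
have n0 : 0 < `|y| by rewrite normr_gt0.
have hc : {for `|y|, continuous (fun x : R => x `^ p)}.
  exact: HD_cts (@is_derive1_powR _ p _ n0).
exact: (cvg_comp _ _ (@norm_continuous _ _ y) hc).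
Qed.

Lemma HD_psi y : HD psi y ((q - 1) * `|y| `^ (q - 2)).
Proof.
have pos z : 0 < z -> HD psi z ((q - 1) * `|z| `^ (q - 2)).
  move=> z0; have h := @is_derive1_powR _ (q - 1) _ z0.
  apply: (@HD_near _ (fun x => x `^ (q - 1))).
    near=> s; rewrite psi_pos//; near: s; exact: lt_nbhsr.
  by apply: HD_cv h _; rewrite gtr0_norm//; congr (_ * _ `^ _); ring.
have [y0|y0|y0] := ltgtP 0 y; first exact: pos.
  by apply: HD_opp_odd; [exact: psiN|rewrite -normrN; apply: pos; lra].
rewrite -y0; apply: HD_eps => e e0; exists (e `^ ((q - 2)^-1)); first exact: powR_gt0.
move=> s; rewrite !subr0 => se; rewrite psi0 subr0 normr0 powR0 ?gt_eqF ?subr_gt0//.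
rewrite mulr0 mul0r subr0 /psi normrM (ger0_norm (powR_ge0 _ _)) mulrC.
by rewrite ler_wpM2r// ltW// powR_small ?subr_gt0// normr_ge0.
Unshelve. all: by end_near. Qed.


Lemma mul_psi y : y * psi y = `|y| `^ q.
Proof.
have [->|y0] := eqVneq y 0; first by rewrite mul0r normr0 powR0// gt_eqF// (lt_trans _ q2).
have -> : `|y| `^ q = `|y| `^ (2 + (q - 2)) by congr (_ `^ _); ring.
rewrite (@powRD _ _ 2 (q - 2)) ?normr_eq0 ?y0 ?implybT//.
by rewrite /psi (powR_mulrn 2)// real_normK ?num_real// mulrA.
Qed.

Lemma HD_pow y : HD (fun y => `|y| `^ q) y (q * psi y).
Proof.
apply: (@HD_near _ (fun y => y * psi y)).
  by near=> s; rewrite mul_psi.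
apply: HD_cv (HD_M (HD_id y) (HD_psi y)) _; rewrite /psi; ring.
Unshelve. all: by end_near. Qed.

Lemma powR_le x M p : 0 <= p -> `|x| <= M -> `|x| `^ p <= M `^ p.
Proof.
by move=> p0 xM; apply: ge0_ler_powR => //; rewrite nnegrE//; apply: le_trans xM.
Qed.

Lemma psi_lip M x y : `|x| <= M -> `|y| <= M ->
  `|psi x - psi y| <= (q - 1) * M `^ (q - 2) * `|x - y|.
Proof.
wlog xy : x y / y <= x => [hw|] hx hy.
  have [xy|xy] := leP y x; first exact: hw.
  by rewrite distrC (distrC x); apply: hw => //; exact: ltW.
rewrite (ger0_norm (x := x - y)) ?subr_ge0//.
apply: (HD_bound xy (fun t _ => HD_psi t)) => t /andP[yt tx].
have q1 : 0 <= q - 1 by move: (q2); lra.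
rewrite ger0_norm ?mulr_ge0 ?powR_ge0// ler_wpM2l//.
apply: powR_le; first by move: (q2); lra.
by rewrite ler_norml; move: hx hy; rewrite !ler_norml => /andP[_ h1] /andP[h2 _]; lra.
Qed.

Lemma psi_homo x y : x <= y -> psi x <= psi y.
Proof.
move=> xy; apply: (HD_le xy (fun t _ => HD_psi t)) => t _.
by rewrite mulr_ge0 ?powR_ge0//; move: (q2); lra.
Qed.

Lemma psi_scale k y : 0 < k -> psi (k * y) = k * k `^ (q - 2) * psi y.
Proof.
move=> k0; rewrite /psi normrM gtr0_norm// powRM ?normr_ge0 ?ltW//; ring.
Qed.

(** Truncation makes [psi] globally Lipschitz, so that the Picard iteration converges on the whole
    line; its effect disappears wherever the solution obtained stays below the level M. *)
Definition clip M y : R := Num.max (- M) (Num.min M y).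

Lemma clip_norm M y : 0 <= M -> `|clip M y| <= M.
Proof.
move=> M0; rewrite /clip ler_norml le_max lexx /= ge_max ge_min lexx /= andbT; lra.
Qed.

Lemma clip_id M y : `|y| <= M -> clip M y = y.
Proof.
rewrite ler_norml /clip => /andP[h1 h2].
by rewrite min_r// max_r.
Qed.

Lemma clip_lip M x y : `|clip M x - clip M y| <= `|x - y|.
Proof.
have h5 := ler_norm (x - y); have h6 : y - x <= `|x - y| by rewrite distrC ler_norm.
have h7 := normr_ge0 (x - y).
rewrite /clip ler_norml; case: (ltP M x) => h1; case: (ltP M y) => h2.
- by rewrite subrr oppr_le0 normr_ge0.
- by case: (ltP (- M) M) => h3; case: (ltP (- M) y) => h4; apply/andP; split; lra.
- by case: (ltP (- M) M) => h3; case: (ltP (- M) x) => h4; apply/andP; split; lra.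
- by case: (ltP (- M) x) => h3; case: (ltP (- M) y) => h4; apply/andP; split; lra.
Qed.

Lemma psi_clip_lip M x y : 0 <= M ->
  `|psi (clip M x) - psi (clip M y)| <= (q - 1) * M `^ (q - 2) * `|x - y|.
Proof.
move=> M0; apply: (le_trans (psi_lip (clip_norm x M0) (clip_norm y M0))).
apply: ler_wpM2l; last exact: clip_lip.
by rewrite mulr_ge0 ?powR_ge0//; move: (q2); lra.
Qed.

End Powers.

(** * Antiderivatives and integrability at infinity *)

Section Tails.
Variable R : realType.
Implicit Types (f g n N F Y Z : R -> R) (t tl s k C : R).

Lemma cts_D f g : cts f -> cts g -> cts (fun t => f t + g t).
Proof. by move=> h1 h2 t; apply: cvgD; [exact: h1|exact: h2]. Qed.

Lemma cts_M f g : cts f -> cts g -> cts (fun t => f t * g t).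
Proof. by move=> h1 h2 t; apply: cvgM; [exact: h1|exact: h2]. Qed.

Lemma cts_N f : cts f -> cts (fun t => - f t).
Proof. by move=> h1 t; apply: cvgN; exact: h1. Qed.

Lemma cts_abs f : cts f -> cts (fun t => `|f t|).
Proof. by move=> h1 t; apply: (cvg_comp _ _ (h1 t)); exact: norm_continuous. Qed.

Lemma cts_c k : cts (fun _ : R => k).
Proof. by move=> t; exact: cvg_cst. Qed.

Lemma cts_id : cts (fun t : R => t).
Proof. by move=> t; exact: cvg_id. Qed.

Lemma cts_comp f g : cts f -> cts g -> cts (fun t => f (g t)).
Proof. by move=> h1 h2 t; apply: (cvg_comp _ _ (h2 t)); exact: h1. Qed.

Lemma cts_exp f : cts f -> cts (fun t => expR (f t)).
Proof. by move=> h; apply: cts_comp => // t; exact: continuous_expR. Qed.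

Lemma antiderivative f : cts f -> exists F, forall t, HD F t (f t).
Proof.
move=> cf.
pose mu := @lebesgue_measure R.
(* Integrals from - N exist only to the right of - N; normalising them to vanish at 0 makes those
   for different N agree where both are defined. *)
pose G (N t : R) := parameterized_integral mu (- N) t f - parameterized_integral mu (- N) 0 f.
have hG (N t : R) : - N < t -> HD (G N) t (f t).
  move=> Nt; have int : mu.-integrable `[(- N)%R, t + 1] (EFin \o f).
    by apply: continuous_compact_integrable; [exact: segment_compact|exact: cts_itv].
  have [//|d e] := @continuous_FTC1_closed _ f (- N) t (t + 1) _ int Nt (cf t).
    by rewrite ltrDl.
  rewrite -[f t]addr0; apply: HD_D; last exact: HD_c.
  by rewrite -e; exact: derivable_HD.
have GE (N M t : R) : 0 < N -> N <= M -> - N < t -> G N t = G M t.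
  move=> N0 NM Nt; apply/eqP; rewrite -subr_eq0; apply/eqP.
  have z : G N 0 - G M 0 = 0 by rewrite /G !subrr.
  rewrite -z.
  have hd s : - N < s -> HD (fun t => G N t - G M t) s 0.
    move=> Ns; apply: HD_cv (HD_D (hG _ _ Ns) (HD_N (hG M s _))) _; last by rewrite subrr.
    by apply: le_lt_trans Ns; rewrite lerN2.
  have cst a b : - N < a -> a <= b -> G N a - G M a = G N b - G M b.
    move=> Na ab; apply/eqP; rewrite eq_le; apply/andP; split.
      apply: (HD_le (f := fun t => G N t - G M t) (df := fun=> 0) ab) => // r /andP[ar _].
      by apply: hd; exact: lt_le_trans ar.
    apply: (HD_ge (f := fun t => G N t - G M t) (df := fun=> 0) ab) => // r /andP[ar _].
    by apply: hd; exact: lt_le_trans ar.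
  have [t0|t0] := leP t 0; first exact: cst.
  by apply/esym/cst; [rewrite oppr_lt0|exact: ltW].
exists (fun t => G (`|t| + 1) t) => t.
have p s : 0 < `|s| + 1 by have := normr_ge0 s; lra.
have m s : - (`|s| + 1) < s by have := ler_norm (- s); rewrite normrN; lra.
apply: (@HD_near _ (G (`|t| + 2))); last first.
  by apply: hG; have := ler_norm (- t); rewrite normrN; lra.
near=> s.
have st : `|s - t| < 1.
  near: s; apply/nbhs_ballP; exists 1 => //= r; by rewrite /ball /= distrC.
apply/esym/GE => //.
have := ler_normD (s - t) t; rewrite subrK; lra.
Unshelve. all: by end_near. Qed.

(** Comparison with a convergent integral: F + N is nonincreasing, and bounded below because F - N
    is nondecreasing. Hence F has a limit, which is then subtracted. *)
Lemma tail_antiderivative f n N s0 : cts f -> (forall t, s0 < t -> `|f t| <= n t) ->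
  (forall t, s0 < t -> HD N t (- n t)) -> limp N 0 ->
  exists2 F, forall t, HD F t (f t) & limp F 0.
Proof.
move=> cf fn hN N0; have [F hF] := antiderivative cf.
have h1 t : s0 < t -> HD (fun t => F t + N t) t (f t - n t).
  by move=> st; exact: HD_D (hF t) (hN _ st).
have h2 t : s0 < t -> HD (fun t => F t - N t) t (f t + n t).
  by move=> st; apply: HD_cv (HD_D (hF t) (HD_N (hN _ st))) _; ring.
have Nge t : s0 < t -> 0 <= N t.
  apply: (noninc_limp_ge hN _ N0) => s /fn hs; have := normr_ge0 (f s); lra.
have [t1 st1] : exists t1, s0 < t1 by exists (s0 + 1); lra.
have lo t : t1 < t -> F t1 - N t1 <= F t + N t.
  move=> tt; have := Nge t (lt_trans st1 tt).
  have : F t1 - N t1 <= F t - N t.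
    apply: (HD_le (f := fun t => F t - N t) (df := fun t => f t + n t) (ltW tt)).
      by move=> r /andP[tr _]; apply: h2; exact: lt_le_trans tr.
    move=> r /andP[tr _]; have := fn r (lt_le_trans st1 tr).
    by rewrite ler_norml => /andP[h _]; lra.
  lra.
have [|t tt|l _ hl] := noninc_limp (f := fun t => F t + N t) (df := fun t => f t - n t) (tl := t1) (m := F t1 - N t1) _ _ lo.
- by move=> t tt; apply: h1; exact: lt_trans tt.
- by have := fn t (lt_trans st1 tt); rewrite ler_norml => /andP[_ h]; lra.
exists (fun t => F t - l) => [t|].
  by apply: HD_cv (HD_D (hF t) (HD_c _ _)) _; ring.
have -> : 0 = (l - 0) - l by ring.
apply: limpD; last exact: limp_c.
by apply: limp_ext (limpD hl (limpN N0)) => // t _; ring.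
Unshelve. all: exact: 0. Qed.

(* For f >= 0 this says that the improper integral of f converges at +oo. *)
Definition Tail f := exists2 N, forall t, HD N t (- f t) & limp N 0.

Lemma Tail_le f n s0 : cts f -> (forall t, s0 < t -> `|f t| <= n t) -> Tail n ->
  Tail f.
Proof.
move=> cf fn [N hN N0].
have [F hF F0] := tail_antiderivative cf fn (fun t _ => hN t) N0.
exists (fun t => - F t) => [t|]; first exact: HD_N.
by rewrite -oppr0; exact: limpN.
Qed.

Lemma TailD f g : Tail f -> Tail g -> Tail (fun t => f t + g t).
Proof.
move=> [F hF F0] [G hG G0]; exists (fun t => F t + G t) => [t|].
  by apply: HD_cv (HD_D (hF t) (hG t)) _; ring.
by rewrite -[0]addr0; exact: limpD.
Qed.

Lemma TailZ k f : Tail f -> Tail (fun t => k * f t).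
Proof.
move=> [F hF F0]; exists (fun t => k * F t) => [t|].
  by apply: HD_cv (HD_M (HD_c _ _) (hF t)) _; ring.
by rewrite -(mulr0 k); apply: limpM => //; exact: limp_c.
Qed.

Lemma Tail_exp k : 0 < k -> Tail (fun t => expR (- k * t)).
Proof.
move=> k0; exists (fun t => k^-1 * expR (- k * t)) => [t|].
  by hd idtac; field; rewrite gt_eqF.
by rewrite -(mulr0 k^-1); apply: limpM; [exact: limp_c|exact: limp_expN].
Qed.

End Tails.

Global Opaque HD.

(** * Solutions with prescribed asymptotics *)

Section LinearEstimates.
Variable R : realType.
Implicit Types (F n N Y Z Q D l Lam : R -> R) (t tl s k C mu : R).

Lemma tail_ge0 n N tl : (forall t, tl < t -> 0 <= n t) ->
  (forall t, tl < t -> HD N t (- n t)) -> limp N 0 -> forall t, tl < t -> 0 <= N t.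
Proof.
by move=> n0 hN N0; apply: (noninc_limp_ge hN _ N0) => t /n0; rewrite oppr_le0.
Qed.

Lemma tail_bound F Q n N tl : (forall t, tl < t -> HD Q t (F t)) -> limp Q 0 ->
  (forall t, tl < t -> `|F t| <= n t) ->
  (forall t, tl < t -> HD N t (- n t)) -> limp N 0 ->
  forall t, tl < t -> `|Q t| <= N t.
Proof.
move=> hQ Q0 Fn hN N0 t tt; rewrite ler_norml; apply/andP; split.
  have : 0 <= Q t + N t.
    apply: (noninc_limp_ge (f := fun t => Q t + N t) (df := fun t => F t - n t) (tl := tl)) => //.
    - by move=> s ts; apply: HD_D; [exact: hQ|exact: hN].
    - by move=> s /Fn; rewrite ler_norml => /andP[_ h]; lra.
    - by rewrite -[0]addr0; exact: limpD.
  lra.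
have : Q t - N t <= 0.
  apply: (nondec_limp_le (f := fun t => Q t - N t) (df := fun t => F t - - n t) (tl := tl)) => //.
  - by move=> s ts; apply: HD_D; [exact: hQ|apply: HD_N; exact: hN].
  - by move=> s /Fn; rewrite ler_norml => /andP[h _]; lra.
  - by rewrite -[0]addr0 -{2}oppr0; apply: limpD => //; exact: limpN.
lra.
Qed.

(** The homogeneous equation Z' = 2 mu Z only has growing solutions. Once Z exceeds the tail N of
    the forcing it never comes back, because (Z - N) e^(- 2 mu t) is nondecreasing. The two bounds
    below follow by excluding this growth. *)
Lemma dichotomy_upper Z F n N mu tl : 0 < mu ->
  (forall t, tl < t -> HD Z t (2 * mu * Z t + F t)) ->
  (forall t, tl < t -> `|F t| <= n t) ->
  (forall t, tl < t -> HD N t (- n t)) -> limp N 0 ->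
  forall t1, tl < t1 -> forall t, t1 <= t -> N t1 < Z t1 -> Z t1 - N t1 <= Z t.
Proof.
move=> mu0 hZ Fn hN N0 t1 t11 t tt c0.
have n0 s : tl < s -> 0 <= n s by move=> /Fn; apply: le_trans.
have Nge := tail_ge0 n0 hN N0.
pose g t := (Z t - N t) * expR (- (2 * mu) * t).
have gmono : g t1 <= g t.
  apply: (HD_le (f := g) (df := fun t => (F t + n t + 2 * mu * N t) * expR (- (2 * mu) * t)) tt).
    move=> s /andP[s1 _]; have ts := lt_le_trans t11 s1.
    have h1 := hZ _ ts; have h2 := hN _ ts.
    by rewrite /g; hd idtac; ring.
  move=> s /andP[s1 _]; have ts := lt_le_trans t11 s1.
  apply: mulr_ge0; last exact: expR_ge0.
  have := Fn _ ts; rewrite ler_norml => /andP[h _].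
  have := mulr_ge0 (ltW mu0) (Nge _ ts); lra.
have e1 : expR (- (2 * mu) * t) <= expR (- (2 * mu) * t1).
  by rewrite ler_expR !mulNr lerN2 ler_pM2l//; lra.
have p0 := expR_gt0 (- (2 * mu) * t).
have h : Z t1 - N t1 <= Z t - N t.
  rewrite -(ler_pM2r p0); apply: le_trans gmono.
  by rewrite /g ler_pM2l//; lra.
have := Nge t (lt_le_trans t11 tt); lra.
Qed.

Lemma dichotomy_bound0 Z F n N mu tl : 0 < mu ->
  (forall t, tl < t -> HD Z t (2 * mu * Z t + F t)) -> limp Z 0 ->
  (forall t, tl < t -> `|F t| <= n t) ->
  (forall t, tl < t -> HD N t (- n t)) -> limp N 0 ->
  forall t, tl < t -> `|Z t| <= N t.
Proof.
move=> mu0.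
have main Z1 F1 : (forall t, tl < t -> HD Z1 t (2 * mu * Z1 t + F1 t)) -> limp Z1 0 ->
  (forall t, tl < t -> `|F1 t| <= n t) ->
  (forall t, tl < t -> HD N t (- n t)) -> limp N 0 ->
  forall t, tl < t -> Z1 t <= N t.
  move=> hZ Z0 Fn hN N0 t tt; rewrite leNgt; apply/negP => h.
  have := limp_ge Z0 (N := t) (fun s ts => dichotomy_upper mu0 hZ Fn hN N0 tt ts h); lra.
move=> hZ Z0 Fn hN N0 t tt; rewrite ler_norml lerNl; apply/andP; split; last exact: (main _ _ hZ).
apply: (main (fun t => - Z t) (fun t => - F t)) => //.
- by move=> s ts; apply: HD_cv (HD_N (hZ s ts)) _; ring.
- by rewrite -oppr0; exact: limpN.
- by move=> s ts; rewrite normrN; exact: Fn.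
Qed.

Lemma linear_growth Y Z t c : (forall s, t <= s -> HD Y s (Z s)) ->
  (forall s, t <= s -> c <= Z s) -> forall s, t <= s -> Y t + c * (s - t) <= Y s.
Proof.
move=> hY hc s ts.
have h : Y t - c * t <= Y s - c * s.
  apply: (HD_le (f := fun s => Y s - c * s) (df := fun s => Z s - c) ts).
    move=> r /andP[tr _]; have h1 := hY _ tr; by hd idtac; ring.
  by move=> r /andP[/hc h _]; lra.
lra.
Qed.

Lemma unbounded_growth Y Z t c C : 0 < c -> (forall s, t <= s -> HD Y s (Z s)) ->
  (forall s, t <= s -> c <= Z s) -> (forall s, t <= s -> `|Y s| <= C) -> False.
Proof.
move=> c0 hY hc hC.
have C0 : 0 <= C by apply: le_trans (hC t (lexx _)).
have ts : t <= t + (2 * C + 1) / c.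
  by rewrite lerDl divr_ge0//; lra.
have := linear_growth hY hc ts.
have := hC _ ts; have := hC _ (lexx t); rewrite !ler_norml => /andP[h1 h2] /andP[h3 h4].
rewrite addrAC subrr add0r mulrC divfK ?gt_eqF//; lra.
Qed.

(** Here the growth of Z is excluded by the boundedness of its antiderivative Y, so no limit of Z
    has to be known beforehand. *)
Lemma dichotomy_bound Y Z F n N mu tl C t2 : 0 < mu ->
  (forall t, tl < t -> HD Y t (Z t)) -> (forall t, t2 < t -> `|Y t| <= C) ->
  (forall t, tl < t -> HD Z t (2 * mu * Z t + F t)) ->
  (forall t, tl < t -> `|F t| <= n t) ->
  (forall t, tl < t -> HD N t (- n t)) -> limp N 0 ->
  forall t, tl < t -> `|Z t| <= N t.
Proof.
move=> mu0.
have main Y1 Z1 F1 : (forall t, tl < t -> HD Y1 t (Z1 t)) ->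
  (forall t, t2 < t -> `|Y1 t| <= C) ->
  (forall t, tl < t -> HD Z1 t (2 * mu * Z1 t + F1 t)) ->
  (forall t, tl < t -> `|F1 t| <= n t) ->
  (forall t, tl < t -> HD N t (- n t)) -> limp N 0 ->
  forall t, tl < t -> Z1 t <= N t.
  move=> hY hC hZ Fn hN N0 t tt; rewrite leNgt; apply/negP => h.
  pose t' := Num.max t (t2 + 1).
  have tt' : t <= t' by rewrite le_max lexx.
  have t2' : t2 < t' by rewrite lt_max ltrDl ltr01 orbT.
  apply: (@unbounded_growth Y1 Z1 t' (Z1 t - N t) C); first by rewrite subr_gt0.
  - by move=> s ts; apply: hY; rewrite (lt_le_trans tt)// (le_trans tt').
  - by move=> s ts; apply: (dichotomy_upper mu0 hZ Fn hN N0 tt) => //; exact: le_trans ts.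
  - by move=> s ts; apply: hC; exact: lt_le_trans ts.
move=> hY hC hZ Fn hN N0 t tt; rewrite ler_norml lerNl; apply/andP; split; last exact: (main _ _ _ hY hC hZ).
apply: (main (fun t => - Y t) (fun t => - Z t) (fun t => - F t)) => //.
- by move=> s ts; exact: HD_N (hY s ts).
- by move=> s ts; rewrite normrN; exact: hC.
- by move=> s ts; apply: HD_cv (HD_N (hZ s ts)) _; ring.
- by move=> s ts; rewrite normrN; exact: Fn.
Qed.

(** Z is the only decaying solution, e^(2 mu t) G with G' = e^(- 2 mu t) F and G -> 0. The product
    e^(- 2 mu t) N bounds the tail of G, so that |Z| <= N. *)
Lemma linear_solution F n N mu : 0 < mu -> cts F -> (forall t, `|F t| <= n t) ->
  (forall t, HD N t (- n t)) -> limp N 0 ->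
  exists Z Q, [/\ forall t, HD Z t (2 * mu * Z t + F t), forall t, HD Q t (F t),
    limp Z 0 & limp Q 0].
Proof.
move=> mu0 cF Fn hN N0.
have n0 t : 0 <= n t by apply: le_trans (Fn t).
have Nge t : 0 <= N t.
  by apply: (@tail_ge0 n N (t - 1)) => //; lra.
have [Q hQ Q0] := tail_antiderivative cF (fun t (_ : 0 < t) => Fn t) (fun t _ => hN t) N0.
pose E t := expR (- (2 * mu) * t).
have hE t : HD E t (- (2 * mu) * E t) by rewrite /E; hd idtac; ring.
have E0 t : 0 < E t by exact: expR_gt0.
pose m t := E t * n t + 2 * mu * (E t * N t).
have hm t : HD (fun t => E t * N t) t (- m t).
  have h1 := hE t; have h2 := hN t; by hd idtac; rewrite /m; ring.
have cG : cts (fun t => E t * F t) by apply: cts_M => //; exact: cts_HD hE.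
have Gm t : `|E t * F t| <= m t.
  rewrite normrM (gtr0_norm (E0 t)) /m.
  have : E t * `|F t| <= E t * n t by rewrite ler_pM2l.
  have : 0 <= 2 * mu * (E t * N t) by rewrite !mulr_ge0// ltW.
  lra.
have L0 : limp (fun t => E t * N t) 0.
  rewrite -(mul0r 0); apply: limpM => //; apply: limp_expN; lra.
have [G hG G0] := tail_antiderivative cG (fun t (_ : 0 < t) => Gm t) (fun t _ => hm t) L0.
have GN t : `|G t| <= E t * N t.
  apply: (@tail_bound (fun t => E t * F t) G m (fun t => E t * N t) (t - 1)) => //; lra.
exists (fun t => expR (2 * mu * t) * G t), Q; split=> //.
- move=> t; have h1 := hG t; hd idtac.
  have e : expR (2 * mu * t) * (E t * F t) = F t.
    rewrite mulrA /E -expRD.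
    have -> : 2 * mu * t + - (2 * mu) * t = 0 by ring.
    by rewrite expR0 mul1r.
  rewrite e; ring.
- apply: (limp_dominated N0 (N := 0)) => t _.
  rewrite normrM (gtr0_norm (expR_gt0 _)).
  apply: (le_trans (y := expR (2 * mu * t) * (E t * N t))).
    by rewrite ler_pM2l ?expR_gt0.
  rewrite mulrA /E -expRD.
  have -> : 2 * mu * t + - (2 * mu) * t = 0 by ring.
  by rewrite expR0 mul1r.
Qed.

End LinearEstimates.

(** * Contraction and Gronwall estimates from infinity *)

Section Weights.
Variables (R : realType) (l Lam : R -> R).
Hypothesis l0 : forall t, 0 <= l t.
Hypothesis hLam : forall t, HD Lam t (- l t).
Hypothesis Lam0 : limp Lam 0.
Variable mu : R.
Hypothesis mu0 : 0 < mu.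

(* Solves weight' = - (2 / mu) l weight, so that the Picard map is a contraction of ratio 1/2 for the norm
   sup |Y| / weight. *)
Definition weight t := expR (2 / mu * Lam t).

Lemma Lam_ge0 t : 0 <= Lam t.
Proof. by apply: (@tail_ge0 _ l Lam (t - 1)) => //; lra. Qed.

Lemma weight_ge1 t : 1 <= weight t.
Proof.
rewrite /weight -expR0 ler_expR mulr_ge0 ?Lam_ge0// divr_ge0 ?ltW//.
Qed.

Lemma weight_noninc s t : s <= t -> weight t <= weight s.
Proof.
move=> st; rewrite ler_expR; apply: ler_wpM2l; first by rewrite divr_ge0 ?ltW.
by apply: (HD_ge st (fun r _ => hLam r)) => r _; rewrite oppr_le0.
Qed.

(** The integral of [wdens C] from t to +oo, explicit thanks to the differential equation of the
    weight. *)
Definition wint C t := C * (mu / 2) * (weight t - 1).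
Definition wdens C t := C * l t * weight t.

Lemma HD_wint C t : HD (wint C) t (- wdens C t).
Proof.
rewrite /wint /wdens.
have h := hLam t; rewrite /weight; hd idtac; field; rewrite gt_eqF//.
Qed.

Lemma limp_wint C : limp (wint C) 0.
Proof.
rewrite /wint.
rewrite -(mulr0 (C * (mu / 2))); apply: limpM; first exact: limp_c.
have h : limp weight 1.
  have -> : 1 = expR (2 / mu * 0) :> R by rewrite mulr0 expR0.
  apply: (@limp_comp _ (fun t => 2 / mu * Lam t) expR); last exact: continuous_expR.
  by apply: limpM => //; exact: limp_c.
by rewrite -[X in limp _ X](subrr 1); apply: limpD => //; exact: limp_c.
Qed.

(** If |D| <= C weight then also |D| <= (|d| + C / 2) weight. Applied to the infimum of the
    admissible C, this self-improvement gives at most 2 |d|. *)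
Lemma gronwall_infty (D Z F : R -> R) (tl d : R) :
  (forall t, tl < t -> HD D t (Z t)) ->
  (forall t, tl < t -> HD Z t (2 * mu * Z t + F t)) ->
  (forall t, tl < t -> `|F t| <= l t * `|D t|) -> limp D d ->
  forall t, tl < t -> `|D t| <= 2 * `|d| * weight t /\ `|Z t| <= mu * `|d| * weight t.
Proof.
move=> hD hZ hF Dd t1 tt1.
pose t0 := (tl + t1) / 2.
have tt0 : tl < t0 by rewrite /t0; lra.
have t01 : t0 < t1 by rewrite /t0; lra.
have up t : t0 < t -> tl < t by exact: lt_trans.
have [C0 C00 hC0] : exists2 C, 0 < C & forall t, t0 <= t -> `|D t| <= C.
  by apply: limp_bounded Dd _ => t t0t; apply: HD_cts (hD _ _); exact: lt_le_trans t0t.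
pose A := [set C | 0 <= C /\ forall t, t0 < t -> `|D t| <= C * weight t].
have AC0 : A C0.
  split; first exact: ltW.
  move=> t t0t; apply: (le_trans (hC0 _ (ltW t0t))).
  by rewrite ler_peMr ?weight_ge1// ltW.
have hA : has_inf A by split; [exists C0|exists 0 => C []].
have est C : A C -> (forall t, t0 < t -> `|Z t| <= wint C t) /\
    A (`|d| + C / 2).
  move=> [C_ge hC].
  have Fn t : t0 < t -> `|F t| <= wdens C t.
    move=> t0t; apply: (le_trans (hF _ (up _ t0t))).
    by rewrite /wdens [C * _]mulrC -mulrA; apply: ler_wpM2l => //; exact: hC.
  have hZN : forall t, t0 < t -> `|Z t| <= wint C t.
    exact (@dichotomy_bound _ D Z F (wdens C) (wint C) mu t0 C0 t0 mu0
      (fun t tt => hD t (up t tt)) (fun t tt => hC0 t (ltW tt)) (fun t tt => hZ t (up t tt))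
      Fn (fun t _ => HD_wint C t) (limp_wint C)).
  split=> //; split; first by rewrite addr_ge0// divr_ge0.
  have Z0 : limp Z 0.
    apply: (limp_dominated (limp_wint C) (N := t0 + 1)) => t t0t; apply: hZN; lra.
  (* The quantity Q = Z - 2 mu D + 2 mu d has derivative F and limit 0, so 2 mu D = 2 mu d + Z - Q,
     where both Z and Q are bounded by [wint C]. *)
  have hQ : forall t, t0 < t -> `|Z t - 2 * mu * D t + 2 * mu * d| <= wint C t.
    have hQ' t : t0 < t -> HD (fun t => Z t - 2 * mu * D t + 2 * mu * d) t (F t).
      by move=> /up tt; have h1 := hD _ tt; have h2 := hZ _ tt; hd idtac; ring.
    have Q0 : limp (fun t => Z t - 2 * mu * D t + 2 * mu * d) 0.
      have -> : 0 = 0 - 2 * mu * d + 2 * mu * d :> R by ring.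
      apply: limpD; last exact: limp_c.
      apply: limpD; first exact: Z0.
      by apply: limpN; apply: limpM; [exact: limp_c|exact: Dd].
    exact (tail_bound hQ' Q0 Fn (fun t _ => HD_wint C t) (limp_wint C)).
  move=> t t0t.
  have e : 2 * mu * D t = 2 * mu * d + Z t - (Z t - 2 * mu * D t + 2 * mu * d) by ring.
  have h1 : 2 * mu * `|D t| <= 2 * mu * `|d| + C * mu * (weight t - 1).
    have m2 : 0 < 2 * mu by move: (mu0); lra.
    rewrite -[X in X * `|D t|](gtr0_norm m2) -normrM e.
    apply: (le_trans (ler_normB _ _)); apply: (le_trans (lerD (ler_normD _ _) (hQ _ t0t))).
    rewrite normrM (gtr0_norm m2); have := hZN _ t0t; rewrite /wint; lra.
  rewrite -(@ler_pM2l _ (2 * mu)); last by move: (mu0); lra.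
  apply: (le_trans h1).
  have := weight_ge1 t => w1.
  have h2 : 0 <= mu * `|d| * (weight t - 1) by rewrite !mulr_ge0 ?subr_ge0// ltW.
  have h3 : 0 <= C * mu by rewrite mulr_ge0// ltW.
  have -> : 2 * mu * ((`|d| + C / 2) * weight t) =
    2 * mu * `|d| + 2 * (mu * `|d| * (weight t - 1)) + C * mu * (weight t - 1) + C * mu by field.
  lra.
have inf_le : inf A <= 2 * `|d|.
  have h C : A C -> 2 * (inf A - `|d|) <= C.
    move=> AC; have [_ AC'] := est C AC.
    have := ge_inf (proj2 hA) AC'; lra.
  have : 2 * (inf A - `|d|) <= inf A.
    apply: lb_le_inf; [by exists C0|exact: h].
  lra.
have w0 t : 0 < weight t by exact: expR_gt0.
have hD2 t : t0 < t -> `|D t| <= 2 * `|d| * weight t.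
  move=> t0t; rewrite -ler_pdivrMr//; apply: le_trans inf_le.
  apply: lb_le_inf; first by exists C0.
  by move=> C [_ /(_ _ t0t)]; rewrite ler_pdivrMr.
split; first exact: hD2.
have [|h _] := est (2 * `|d|); first by split => //; rewrite mulr_ge0.
apply: (le_trans (h _ t01)).
have -> : wint (2 * `|d|) t1 = mu * `|d| * weight t1 - mu * `|d| by rewrite /wint; field.
by rewrite lerBlDr lerDl mulr_ge0// ltW.
Qed.

(** The intervals of radius 2 C / 2^n around u n are nested. *)
Lemma geometric_limit (u : nat -> R) C : 0 <= C ->
  (forall n, `|u n.+1 - u n| <= C / 2 ^+ n) ->
  exists x, forall n, `|u n - x| <= 2 * C / 2 ^+ n.
Proof.
move=> C0 hu.
pose lo n := u n - 2 * C / 2 ^+ n; pose hi n := u n + 2 * C / 2 ^+ n.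
have p n : 0 < (2 : R) ^+ n by rewrite exprn_gt0.
have step n : 2 * C / 2 ^+ n = C / 2 ^+ n + 2 * C / 2 ^+ n.+1.
  rewrite exprS; field; by rewrite gt_eqF.
have lo_step n : lo n <= lo n.+1.
  by have := hu n; rewrite ler_norml /lo step => /andP[h _]; lra.
have hi_step n : hi n.+1 <= hi n.
  by have := hu n; rewrite ler_norml /hi (step n) => /andP[_ h]; lra.
have lo_mono m n : (m <= n)%N -> lo m <= lo n.
  move=> /subnK <-; elim: (n - m)%N => [//|k]; rewrite addSn => h; exact: le_trans (lo_step _).
have hi_mono m n : (m <= n)%N -> hi n <= hi m.
  move=> /subnK <-; elim: (n - m)%N => [//|k]; rewrite addSn => h; exact: le_trans (hi_step _) h.
have lohi m n : lo m <= hi n.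
  have h : lo (maxn m n) <= hi (maxn m n).
    rewrite /lo /hi; have : 0 <= 2 * C / 2 ^+ maxn m n by apply: divr_ge0; [exact: mulr_ge0|exact: ltW].
    lra.
  by apply: le_trans (lo_mono _ _ (leq_maxl m n)) _; apply: le_trans h (hi_mono _ _ (leq_maxr m n)).
pose A := [set lo n | n in [set: nat]].
have hA : has_sup A.
  by split; [exists (lo 0%N), 0%N|exists (hi 0%N) => _ [n _ <-]].
exists (sup A) => n.
have h1 : lo n <= sup A by apply: sup_upper_bound => //; exists n.
have h2 : sup A <= hi n by apply: ge_sup; [exists (lo 0%N), 0%N|move=> _ [m _ <-]].
rewrite ler_norml; move: h1 h2; rewrite /lo /hi => h1 h2; apply/andP; split; lra.
Qed.

Variable H : R -> R -> R.
Hypothesis Hcts : forall Y, cts Y -> cts (fun t => H t (Y t)).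
Hypothesis H0 : forall t, H t 0 = 0.
Hypothesis Hlip : forall t x y, `|H t x - H t y| <= l t * `|x - y|.

(** Fixed point of the Picard map [rel]: if Z is the decaying solution of Z' = 2 mu Z + H(t, Y) and
    Q the decaying antiderivative of H(t, Y), the image is L + (Z - Q) / (2 mu). Its derivative is Z
    and its limit L. The map halves weighted distances; it is a relation because Z and Q come from
    existence statements. *)
Lemma exists_asymptotic (L : R) : exists Y Z : R -> R,
  [/\ forall t, HD Y t (Z t), forall t, HD Z t (2 * mu * Z t + H t (Y t)) & limp Y L].
Proof.
pose rel (Y Y' : R -> R) := exists Z Q : R -> R, [/\ Y' = (fun t => L + (Z t - Q t) / (2 * mu)),
  forall t, HD Z t (2 * mu * Z t + H t (Y t)), forall t, HD Q t (H t (Y t)),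
  limp Z 0 & limp Q 0].
have m2 : 0 < 2 * mu by move: (mu0); lra.
have w0 t : 0 < weight t by exact: expR_gt0.
have contr Y1 Y2 Y1' Y2' C : 0 <= C -> rel Y1 Y1' -> rel Y2 Y2' ->
    (forall t, `|Y1 t - Y2 t| <= C * weight t) ->
    forall t, `|Y1' t - Y2' t| <= C / 2 * weight t.
  move=> C0 [Z1 [Q1 [-> hZ1 hQ1 Z10 Q10]]] [Z2 [Q2 [-> hZ2 hQ2 Z20 Q20]]] hC t.
  have Fn s : `|H s (Y1 s) - H s (Y2 s)| <= wdens C s.
    apply: (le_trans (Hlip _ _ _)).
    by rewrite /wdens [C * _]mulrC -mulrA; apply: ler_wpM2l => //; exact: hC.
  have tl : t - 1 < t by lra.
  have hZ' s : t - 1 < s -> HD (fun t => Z1 t - Z2 t) s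
      (2 * mu * (Z1 s - Z2 s) + (H s (Y1 s) - H s (Y2 s))).
    by move=> _; have h1 := hZ1 s; have h2 := hZ2 s; hd idtac; ring.
  have Z0 : limp (fun t => Z1 t - Z2 t) 0.
    by rewrite -[X in limp _ X](subrr 0); apply: limpD; [exact: Z10|exact: limpN].
  have hZ := dichotomy_bound0 mu0 hZ' Z0 (fun s _ => Fn s) (fun t _ => HD_wint C t) (limp_wint C) tl.
  have hQ' s : t - 1 < s -> HD (fun t => Q1 t - Q2 t) s (H s (Y1 s) - H s (Y2 s)).
    by move=> _; have h1 := hQ1 s; have h2 := hQ2 s; hd idtac; ring.
  have Q0 : limp (fun t => Q1 t - Q2 t) 0.
    by rewrite -[X in limp _ X](subrr 0); apply: limpD; [exact: Q10|exact: limpN].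
  have hQ := tail_bound hQ' Q0 (fun s _ => Fn s) (fun t _ => HD_wint C t) (limp_wint C) tl.
  cbv beta in hZ, hQ.
  have -> : L + (Z1 t - Q1 t) / (2 * mu) - (L + (Z2 t - Q2 t) / (2 * mu)) =
    ((Z1 t - Z2 t) - (Q1 t - Q2 t)) / (2 * mu) by ring.
  rewrite normrM normfV (gtr0_norm m2) ler_pdivrMr//.
  apply: (le_trans (ler_normB _ _)).
  have h : 0 <= C * mu by rewrite mulr_ge0// ltW.
  have -> : C / 2 * weight t * (2 * mu) = 2 * (wint C t) + C * mu by rewrite /wint; field.
  lra.
have ex Y : cts Y -> (exists2 C, 0 <= C & forall t, `|Y t| <= C * weight t) ->
    exists Y', [/\ rel Y Y', cts Y' & exists2 C, 0 <= C & forall t, `|Y' t| <= C * weight t].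
  move=> cY [C C0 hC].
  have Fn t : `|H t (Y t)| <= wdens C t.
    have := Hlip t (Y t) 0; rewrite H0 !subr0 => h; apply: (le_trans h).
    by rewrite /wdens [C * _]mulrC -mulrA; apply: ler_wpM2l => //; exact: hC.
  have [Z [Q [hZ hQ Z0 Q0]]] := linear_solution mu0 (Hcts cY) Fn (HD_wint C) (limp_wint C).
  have r : rel Y (fun t => L + (Z t - Q t) / (2 * mu)) by exists Z, Q.
  exists (fun t => L + (Z t - Q t) / (2 * mu)); split => //.
    apply: (@cts_HD _ _ (fun t => (2 * mu * Z t + H t (Y t) - H t (Y t)) / (2 * mu))) => t.
    have h1 := hZ t; have h2 := hQ t; hd idtac; ring.
  exists (`|L| + C / 2); first by rewrite addr_ge0// divr_ge0.
  move=> t.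
  have r0 : rel (fun=> 0) (fun=> L).
    exists (fun=> 0), (fun=> 0); split; first by apply/funext => s; rewrite subrr mul0r addr0.
    - by move=> s; apply: HD_cv (HD_c _ _) _; rewrite H0; ring.
    - by move=> s; apply: HD_cv (HD_c _ _) _; rewrite H0.
    - exact: limp_c.
    - exact: limp_c.
  have hC' s : `|Y s - 0| <= C * weight s by rewrite subr0.
  have := contr _ _ _ _ C C0 r r0 hC' t.
  set y := L + _ => h1.
  have h2 := ler_normD (y - L) L; rewrite subrK in h2.
  have h3 : `|L| * 1 <= `|L| * weight t by rewrite ler_wpM2l// weight_ge1.
  by rewrite mulrDl; lra.
have /choice[T hT] : forall Y : R -> R, exists Y', cts Y ->
    (exists2 C, 0 <= C & forall t, `|Y t| <= C * weight t) ->
    [/\ rel Y Y', cts Y' & exists2 C, 0 <= C & forall t, `|Y' t| <= C * weight t].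
  move=> Y; case: (pselect (cts Y /\ exists2 C, 0 <= C & forall t, `|Y t| <= C * weight t)).
    by move=> [h1 h2]; have [Y' hY'] := ex _ h1 h2; exists Y'.
  by move=> h; exists Y => h1 h2; case: h.
pose y n := iter n T (fun=> 0).
have hy n : cts (y n) /\ exists2 C, 0 <= C & forall t, `|y n t| <= C * weight t.
  elim: n => [|n [h1 h2]].
    split; first exact: cts_c.
    by exists 0 => // t; rewrite normr0 mul0r.
  by have [_ ? ?] := hT _ h1 h2.
have hr n : rel (y n) (y n.+1) by have [h1 h2] := hy n; have [] := hT _ h1 h2.
have [C C0 hC] : exists2 C, 0 <= C & forall t, `|y 1%N t - y 0%N t| <= C * weight t.
  have [_ [C C0 hC]] := hy 1%N; exists C => // t; by rewrite subr0.
have geo n t : `|y n.+1 t - y n t| <= (C * weight t) / 2 ^+ n.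
  rewrite mulrAC; elim: n t => [|n IH] t; first by rewrite expr0 divr1.
  have cn : 0 <= C / 2 ^+ n by rewrite divr_ge0// exprn_ge0.
  have -> : C / 2 ^+ n.+1 = C / 2 ^+ n / 2 by rewrite exprSr invfM mulrA.
  exact: (contr _ _ _ _ _ cn (hr n.+1) (hr n) IH).
have /choice[Yl hYl] : forall t, exists x, forall n, `|y n t - x| <= 2 * (C * weight t) / 2 ^+ n.
  move=> t; apply: geometric_limit => [|n]; last exact: geo.
  by rewrite mulr_ge0// ltW.
have p n : 0 < (2 : R) ^+ n by rewrite exprn_gt0.
have small (x e : R) : 0 <= x -> 0 < e -> exists n, x / 2 ^+ n < e.
  move=> x0 e0.
  have [n hn] : exists n : nat, x / e < n%:R.
    exists (Num.bound (x / e)).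
    by apply: archi_boundP; rewrite divr_ge0// ltW.
  exists n; rewrite ltr_pdivrMr// mulrC -ltr_pdivrMr//; apply: (lt_le_trans hn).
  by rewrite -natrX ler_nat ltnW// ltn_expl.
(* The convergence is uniform on [t - 1, +oo) because the weight is nonincreasing. *)
have cYl : cts Yl.
  move=> t; apply/cts_eps => e e0.
  have e3 : 0 < e / 3 by lra.
  have [||n hn] := small (2 * (C * weight (t - 1))) (e / 3) => //.
    by apply: mulr_ge0 => //; apply: mulr_ge0 => //; exact: ltW.
  have near s : t - 1 <= s -> `|y n s - Yl s| < e / 3.
    move=> ts; apply: le_lt_trans (hYl s n) _; apply: le_lt_trans hn.
    rewrite ler_pM2r ?invr_gt0//; rewrite ler_wpM2l// ler_wpM2l//.
    exact: weight_noninc.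
  have [cn _] := hy n; have [d d0 hd] := (cts_eps _ _).1 (cn t) _ e3.
  exists (Num.min d 1) => [|s]; first by rewrite lt_min d0 ltr01.
  rewrite lt_min => /andP[sd s1].
  have h1 := hd s sd.
  have h2 : `|y n s - Yl s| < e / 3.
    by apply: near; move: s1; rewrite ltr_norml => /andP[h _]; lra.
  have h3 : `|y n t - Yl t| < e / 3 by apply: near; lra.
  have -> : Yl s - Yl t = (y n s - y n t) - (y n s - Yl s) + (y n t - Yl t) by ring.
  apply: (le_lt_trans (ler_normD _ _)).
  have := ler_normB (y n s - y n t) (y n s - Yl s); lra.
have bYl : exists2 C, 0 <= C & forall t, `|Yl t| <= C * weight t.
  exists (2 * C); first by rewrite mulr_ge0.
  move=> t; have := hYl t 0%N; rewrite expr0 divr1 sub0r normrN; lra.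
(* By contraction the image of the limit is as close to [y n.+1] as the limit is to [y n], up to a
   factor; letting n grow, it is the limit itself. *)
have [Y' [r' _ _]] := ex _ cYl bYl.
have Y'E : Y' = Yl.
  apply/funext => t; apply/eqP; rewrite -subr_eq0 -normr_le0; apply/ler_addgt0Pr => e e0.
  rewrite add0r.
  have [||n hn] := small (4 * (C * weight t)) e => //.
    by apply: mulr_ge0 => //; apply: mulr_ge0 => //; exact: ltW.
  have cn : 0 <= 2 * C / 2 ^+ n by apply: divr_ge0; [exact: mulr_ge0|exact: ltW].
  have hCn s : `|Yl s - y n s| <= 2 * C / 2 ^+ n * weight s.
    by rewrite distrC; apply: (le_trans (hYl s n)); rewrite le_eqVlt; apply/orP; left; apply/eqP; ring.
  have h1 := contr _ _ _ _ _ cn r' (hr n) hCn t.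
  have h2 := hYl t n.+1.
  have -> : Y' t - Yl t = (Y' t - y n.+1 t) + (y n.+1 t - Yl t) by ring.
  apply: (le_trans (ler_normD _ _)); apply: ltW; apply: le_lt_trans hn.
  have e1 : 2 * C / 2 ^+ n / 2 * weight t = C * weight t / 2 ^+ n by field; rewrite gt_eqF.
  have e2 : 2 * (C * weight t) / 2 ^+ n.+1 = C * weight t / 2 ^+ n by rewrite exprS; field; rewrite gt_eqF.
  rewrite e1 in h1; rewrite e2 in h2.
  have -> : 4 * (C * weight t) / 2 ^+ n = 4 * (C * weight t / 2 ^+ n) by ring.
  have := divr_ge0 (mulr_ge0 C0 (ltW (w0 t))) (ltW (p n)).
  lra.
have [Z [Q [Y'e hZ hQ Z0 Q0]]] := r'.
exists Yl, Z; split=> //.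
- move=> t; rewrite -Y'E Y'e; have h1 := hZ t; have h2 := hQ t.
  hd idtac; field; by rewrite gt_eqF.
- rewrite -Y'E Y'e.
  have e : L + (0 - 0) / (2 * mu) = L by ring.
  rewrite -[X in limp _ X]e.
  apply: limpD; first exact: limp_c.
  apply: limpM; last exact: limp_c.
  by apply: limpD => //; exact: limpN.
Qed.

End Weights.

(** * Fast decay solutions *)

Section FastDecay.
Variable R : realType.

Definition sol_at (q : R) (a b y z : R -> R) t :=
  HD y t (z t) /\ HD z t (a t * y t + b t * psi q (y t)).

(* With rate mu this describes the fast decay solutions; after the reflection t = - s, and with rate nu instead
   of mu, it describes the R-solutions. *)
Definition fdsol (q : R) (a b : R -> R) (mu tl : R) (y z : R -> R) (L : R) :=
  (forall t, tl < t -> sol_at q a b y z t) /\ limp (fun t => y t * expR (mu * t)) L.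

Lemma expR_powR (x p : R) : expR x `^ p = expR (x * p).
Proof. by rewrite /powR gt_eqF ?expR_gt0// expRK mulrC. Qed.

Lemma psi_exp (q x y : R) : psi q (expR x * y) = expR ((q - 1) * x) * psi q y.
Proof.
rewrite psi_scale ?expR_gt0// expR_powR -expRD; congr (expR _ * _); ring.
Qed.

Lemma fd_sub q a b mu t1 t2 y z L : t1 <= t2 -> fdsol q a b mu t1 y z L -> fdsol q a b mu t2 y z L.
Proof. by move=> t12 [h1 h2]; split=> // t tt; apply: h1; exact: le_lt_trans tt. Qed.

Lemma fd_opp q a b mu t1 y z L : fdsol q a b mu t1 y z L ->
  fdsol q a b mu t1 (fun t => - y t) (fun t => - z t) (- L).
Proof.
move=> [h1 h2]; split=> [t /h1[hy hz]|].
  split; first exact: HD_N.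
  by apply: HD_cv (HD_N hz) _; rewrite psiN; ring.
by apply: limp_ext (limpN h2) => // t _; rewrite mulNr.
Unshelve. exact: 0.
Qed.

Lemma fd_zero (q : R) a b mu tl : fdsol q a b mu tl (fun=> 0) (fun=> 0) 0.
Proof.
split=> [t _|].
  by split; apply: HD_cv (HD_c _ _) _ => //; rewrite psi0; ring.
by apply: limp_ext (limp_c 0) => // t _; rewrite mul0r.
Unshelve. exact: 0.
Qed.

Variables (q mu : R) (a b : R -> R).
Hypotheses (q2 : 2 < q) (mu0 : 0 < mu) (ca : cts a) (cb : cts b).
Hypothesis Ta : Tail (fun t => `|a t - mu ^+ 2|).
Hypothesis Tb : Tail (fun t => `|b t| * expR (- (mu * (q - 2)) * t)).

Local Notation fd := (fdsol q a b mu).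

(** With Y = y e^(mu t) and Z = Y' the equation reads Z' = 2 mu Z + (a - mu^2) Y + B psi(Y). [HM] is
    the right-hand perturbation truncated at level M, and [lM] its Lipschitz constant, integrable at
    +oo. *)
Let B t := b t * expR (- (mu * (q - 2)) * t).
Let lM M t := `|a t - mu ^+ 2| + (q - 1) * M `^ (q - 2) * `|B t|.
Let HM M t Y := (a t - mu ^+ 2) * Y + B t * psi q (clip M Y).

Let q1 : 0 < q - 1. Proof. by move: (q2); lra. Qed.

Let lM_ge0 M t : 0 <= lM M t.
Proof. by rewrite addr_ge0// !mulr_ge0 ?powR_ge0// ltW. Qed.

Let cB : cts B.
Proof.
apply: cts_M => //; apply: (@cts_HD _ _ (fun t => - (mu * (q - 2)) * expR (- (mu * (q - 2)) * t))) => t.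
by hd idtac; ring.
Qed.

Let TlM M : exists2 Lam, forall t, HD Lam t (- lM M t) & limp Lam 0.
Proof.
have [N hN N0] := TailD Ta (TailZ ((q - 1) * M `^ (q - 2)) Tb).
exists N => // t; apply: HD_cv (hN t) _; rewrite /lM /B normrM.
by rewrite (gtr0_norm (expR_gt0 _)).
Qed.

Let HM_cts (M : R) Y : 0 <= M -> cts Y -> cts (fun t => HM M t (Y t)).
Proof.
move=> M0 cY; apply: cts_D.
  by apply: cts_M cY; apply: cts_D ca _; exact: cts_c.
apply: cts_M cB _; apply: (cts_comp (f := fun y => psi q (clip M y)) _ cY) => y.
apply/cts_eps => e e0.
pose C := (q - 1) * M `^ (q - 2) + 1.
have C0 : 0 < C by rewrite ltr_wpDl// mulr_ge0 ?powR_ge0// ltW.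
exists (e / C) => [|s se]; first exact: divr_gt0.
apply: (le_lt_trans (psi_clip_lip q2 _ _ M0)).
apply: (le_lt_trans (y := C * `|s - y|)).
  by rewrite ler_wpM2r// /C lerDl.
by rewrite mulrC -ltr_pdivlMr.
Qed.

Let HM_lip (M : R) t x y : 0 <= M -> `|HM M t x - HM M t y| <= lM M t * `|x - y|.
Proof.
move=> M0.
have -> : HM M t x - HM M t y = (a t - mu ^+ 2) * (x - y)
  + B t * (psi q (clip M x) - psi q (clip M y)) by rewrite /HM; ring.
apply: (le_trans (ler_normD _ _)).
have h := ler_wpM2l (normr_ge0 (B t)) (psi_clip_lip q2 x y M0).
rewrite 2!normrM.
have -> : lM M t * `|x - y| = `|a t - mu ^+ 2| * `|x - y| +
  `|B t| * ((q - 1) * M `^ (q - 2) * `|x - y|) by rewrite /lM; ring.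
by rewrite lerD2l.
Qed.

Let HM0 (M : R) t : 0 <= M -> HM M t 0 = 0.
Proof. by move=> M0; rewrite /HM clip_id ?normr0// psi0; ring. Qed.

Let wY y t := y t * expR (mu * t).
Let wZ (y z : R -> R) t := (z t + mu * y t) * expR (mu * t).

Let exps t : expR (mu * t) * expR (- (mu * t)) = 1.
Proof. by rewrite -expRD subrr expR0. Qed.

Let HD_wY y z t : sol_at q a b y z t -> HD (wY y) t (wZ y z t).
Proof.
by move=> [hy hz]; rewrite /wY /wZ; hd idtac; ring.
Qed.

Let HD_wZ y z t : sol_at q a b y z t ->
  HD (wZ y z) t (2 * mu * wZ y z t + ((a t - mu ^+ 2) * wY y t + B t * psi q (wY y t))).
Proof.
move=> [hy hz]; rewrite /wY /wZ; hd idtac.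
rewrite (mulrC (y t) (expR _)) psi_exp.
have -> : B t * (expR ((q - 1) * (mu * t)) * psi q (y t)) = b t * psi q (y t) * expR (mu * t).
  rewrite /B; transitivity (b t * psi q (y t) * (expR (- (mu * (q - 2)) * t) * expR ((q - 1) * (mu * t)))).
    by ring.
  by rewrite -expRD; congr (_ * expR _); ring.
ring.
Qed.

(** The inverse substitution; [t0] is the truncation level, inactive at t. *)
Let unw (Y Z : R -> R) t0 t : HD Y t (Z t) -> HD Z t (2 * mu * Z t + HM t0 t (Y t)) ->
  `|Y t| <= t0 ->
  sol_at q a b (fun t => expR (- (mu * t)) * Y t) (fun t => expR (- (mu * t)) * (Z t - mu * Y t)) t.
Proof.
move=> hY hZ hM; split; first by hd idtac; ring.
hd idtac; rewrite /HM clip_id// psi_exp.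
have e : expR ((q - 1) * - (mu * t)) = expR (- (mu * t)) * expR (- (mu * (q - 2)) * t).
  by rewrite -expRD; congr expR; ring.
by rewrite e /B; ring.
Qed.

Let wY_unw (Y : R -> R) t : wY (fun t => expR (- (mu * t)) * Y t) t = Y t.
Proof. by rewrite /wY mulrC mulrA exps mul1r. Qed.

Let trunc M L : 0 <= M -> exists Y Z : R -> R,
  [/\ forall t, HD Y t (Z t), forall t, HD Z t (2 * mu * Z t + HM M t (Y t)) & limp Y L].
Proof.
move=> M0; have [Lam hLam Lam0] := TlM M.
apply: (exists_asymptotic (l := lM M) (Lam := Lam)) => //.
- by move=> Y; exact: HM_cts.
- by move=> t; exact: HM0.
- by move=> t x y; exact: HM_lip.
Qed.

Let cmp M Lam (Y1 Z1 Y2 Z2 F1 F2 : R -> R) tl L1 L2 : 0 <= M ->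
  (forall t, HD Lam t (- lM M t)) -> limp Lam 0 ->
  (forall t, tl < t -> HD Y1 t (Z1 t)) -> (forall t, tl < t -> HD Z1 t (2 * mu * Z1 t + F1 t)) ->
  (forall t, tl < t -> F1 t = HM M t (Y1 t)) -> limp Y1 L1 ->
  (forall t, tl < t -> HD Y2 t (Z2 t)) -> (forall t, tl < t -> HD Z2 t (2 * mu * Z2 t + F2 t)) ->
  (forall t, tl < t -> F2 t = HM M t (Y2 t)) -> limp Y2 L2 ->
  forall t, tl < t -> `|Y1 t - Y2 t| <= 2 * `|L1 - L2| * weight Lam mu t /\
    `|Z1 t - Z2 t| <= mu * `|L1 - L2| * weight Lam mu t.
Proof.
move=> M0 hLam Lam0 hY1 hZ1 hF1 l1 hY2 hZ2 hF2 l2.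
have hD t : tl < t -> HD (fun t => Y1 t - Y2 t) t (Z1 t - Z2 t).
  by move=> tt; exact: HD_D (hY1 _ tt) (HD_N (hY2 _ tt)).
have hZ t : tl < t -> HD (fun t => Z1 t - Z2 t) t (2 * mu * (Z1 t - Z2 t) + (F1 t - F2 t)).
  by move=> tt; apply: HD_cv (HD_D (hZ1 _ tt) (HD_N (hZ2 _ tt))) _; ring.
have hF t : tl < t -> `|F1 t - F2 t| <= lM M t * `|Y1 t - Y2 t|.
  by move=> tt; rewrite hF1// hF2//; exact: HM_lip.
exact (gronwall_infty (lM_ge0 M) hLam Lam0 mu0 hD hZ hF (limpD l1 (limpN l2))).
Qed.

Let HM_in M t Y : `|Y| <= M -> HM M t Y = (a t - mu ^+ 2) * Y + B t * psi q Y.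
Proof. by move=> h; rewrite /HM clip_id. Qed.

Lemma fd_bounded tl y z L : fd tl y z L -> forall t0, tl < t0 ->
  exists2 M : R, 0 < M & forall t, t0 <= t -> `|y t * expR (mu * t)| <= M.
Proof.
move=> [h1 h2] t0 tt0; apply: (limp_bounded h2) => t t0t.
exact: HD_cts (HD_wY (h1 _ (lt_le_trans tt0 t0t))).
Qed.

(** Both solutions are bounded in the variable Y, so beyond a point they solve the same truncated
    problem and [cmp] applies with equal limits. *)
Lemma fd_unique t1 t2 y1 z1 y2 z2 L : fd t1 y1 z1 L -> fd t2 y2 z2 L ->
  forall t, t1 < t -> t2 < t -> y1 t = y2 t /\ z1 t = z2 t.
Proof.
move=> f1 f2 t tt1 tt2.
pose t0 := (Num.max t1 t2 + t) / 2.
have tm : Num.max t1 t2 < t by rewrite gt_max tt1.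
have t0t : t0 < t by rewrite /t0; lra.
have m1 : t1 <= Num.max t1 t2 by rewrite le_max lexx.
have m2 : t2 <= Num.max t1 t2 by rewrite le_max lexx orbT.
have t10 : t1 < t0 by rewrite /t0; lra.
have t20 : t2 < t0 by rewrite /t0; lra.
have [M1 M10 hM1] := fd_bounded f1 t10; have [M2 M20 hM2] := fd_bounded f2 t20.
pose M := M1 + M2.
have [Lam hLam Lam0] := TlM M.
have M0 : 0 <= M by rewrite addr_ge0// ltW.
have b1 s : t0 < s -> `|wY y1 s| <= M.
  by move=> t0s; apply: (le_trans (hM1 _ (ltW t0s))); rewrite lerDl ltW.
have b2 s : t0 < s -> `|wY y2 s| <= M.
  by move=> t0s; apply: (le_trans (hM2 _ (ltW t0s))); rewrite lerDr ltW.
have u1 s : t0 < s -> sol_at q a b y1 z1 s by move=> h; apply: (proj1 f1); exact: lt_trans h.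
have u2 s : t0 < s -> sol_at q a b y2 z2 s by move=> h; apply: (proj1 f2); exact: lt_trans h.
have [] := cmp M0 hLam Lam0 (fun s h => HD_wY (u1 s h)) (fun s h => HD_wZ (u1 s h))
  (fun s h => esym (HM_in s (b1 s h))) (proj2 f1) (fun s h => HD_wY (u2 s h))
  (fun s h => HD_wZ (u2 s h)) (fun s h => esym (HM_in s (b2 s h))) (proj2 f2) t0t.
rewrite subrr normr0 !mulr0 !mul0r !normr_le0 !subr_eq0 /wY /wZ.
have e0 : expR (mu * t) != 0 by rewrite gt_eqF// expR_gt0.
move=> /eqP /(mulIf e0) e1 /eqP /(mulIf e0); rewrite e1 => /addIr e2; by split.
Qed.

(** The asymptotics of y' are not part of [fdsol]; they follow from the dichotomy because Y is
    bounded. *)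
Lemma fd_z0 tl y z L : fd tl y z L -> limp (fun t => (z t + mu * y t) * expR (mu * t)) 0.
Proof.
move=> f; have [|M M0 hM] := fd_bounded (t0 := tl + 1) f; first by lra.
have [Lam hLam Lam0] := TlM M.
have M0' := ltW M0.
have u s : tl + 1 < s -> sol_at q a b y z s by move=> h; apply: (proj1 f); lra.
have Fn s : tl + 1 < s -> `|(a s - mu ^+ 2) * wY y s + B s * psi q (wY y s)| <= M * lM M s.
  move=> h; rewrite -(HM_in s (hM s (ltW h))) -[HM M s _]subr0 -(HM0 s M0').
  apply: (le_trans (HM_lip _ _ _ M0')); rewrite subr0 mulrC ler_wpM2r ?lM_ge0//.
  exact: hM (ltW h).
have hN t : tl + 1 < t -> HD (fun t => M * Lam t) t (- (M * lM M t)).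
  by move=> _; have h := hLam t; hd idtac; ring.
have N0 : limp (fun t => M * Lam t) 0.
  by rewrite -(mulr0 M); apply: limpM => //; exact: limp_c.
have := dichotomy_bound mu0 (fun s h => HD_wY (u s h)) (fun t h => hM t (ltW h))
  (fun s h => HD_wZ (u s h)) Fn hN N0.
move=> h; apply: (limp_dominated N0 (N := tl + 2)) => t tt; apply: h; lra.
Qed.

Lemma fd_exists L : exists tl y z, fd tl y z L.
Proof.
(* The truncation is inactive as soon as Y is within 1 of its limit. *)
pose M := `|L| + 1.
have M0 : 0 <= M by rewrite addr_ge0.
have [Y [Z [hY hZ YL]]] := trunc L M0.
have [//|N hN] := YL 1.
exists N, (fun t => expR (- (mu * t)) * Y t), (fun t => expR (- (mu * t)) * (Z t - mu * Y t)).
split=> [t Nt|].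
  apply: (unw (hY t) (hZ t)).
  have := ler_normD (Y t - L) L; rewrite subrK; have := hN t (ltW Nt); rewrite /M; lra.
by apply: limp_ext YL => // t _; exact: esym (wY_unw Y t).
Unshelve. exact: 0.
Qed.

(** Continuous dependence on L, with [delta] and [C] depending only on M and tl and not on the
    reference solution; this uniformity is used in [SR_unbounded]. The extension by [eps] to the
    left of tl is what makes sets of parameters open and solutions continuable. *)
Lemma fd_near (M tl : R) : 0 <= M -> exists delta C : R, [/\ 0 < delta, 0 < C &
  forall yh zh Lh L, fd tl yh zh Lh -> (forall t, tl < t -> `|yh t * expR (mu * t)| <= M) ->
    `|L - Lh| < delta -> exists (eps : R) (y z : R -> R), [/\ 0 < eps, fd (tl - eps) y z L &
      forall t, tl < t -> `|y t - yh t| * expR (mu * t) <= C * `|L - Lh| /\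
        `|z t - zh t| * expR (mu * t) <= C * `|L - Lh|]].
Proof.
move=> M0; pose M1 := M + 1.
have M10 : 0 <= M1 by rewrite addr_ge0.
have [Lam hLam Lam0] := TlM M1.
pose w := weight Lam mu tl.
have w0 : 0 < w by exact: expR_gt0.
(* For |L - Lh| < 1 / (4 w) the difference in Y stays below 1/2, so Y remains half a unit under the
   truncation level M + 1 and can be continued a little. The other constant adds the bound 2 w for Y
   to the bound mu w + mu (2 w) for y'. *)
exists ((4 * w)^-1), ((2 + 3 * mu) * w); split.
- by rewrite invr_gt0 mulr_gt0.
- by rewrite mulr_gt0// addr_gt0// mulr_gt0.
move=> yh zh Lh L f hM dL.
have [Y [Z [hY hZ YL]]] := trunc L M10.
have u s : tl < s -> sol_at q a b yh zh s by exact: (proj1 f).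
have hM' s : tl < s -> `|wY yh s| <= M1 by move=> h; have := hM s h; rewrite /M1 /wY; lra.
have C t : tl < t -> `|Y t - wY yh t| <= 2 * `|L - Lh| * w /\
    `|Z t - wZ yh zh t| <= mu * `|L - Lh| * w.
  move=> tt; have [] := cmp M10 hLam Lam0 (fun s _ => hY s) (fun s _ => hZ s)
    (fun s _ => erefl) YL (fun s h => HD_wY (u s h)) (fun s h => HD_wZ (u s h))
    (fun s h => esym (HM_in s (hM' s h))) (proj2 f) tt.
  have hw : weight Lam mu t <= w by apply: (weight_noninc (lM_ge0 M1) hLam mu0); exact: ltW.
  move=> h1 h2; split; [apply: (le_trans h1)|apply: (le_trans h2)]; apply: ler_wpM2l => //.
  by rewrite mulr_ge0// ltW.
have YM t : tl < t -> `|Y t| <= M + 1 / 2.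
  move=> tt; have [h1 _] := C t tt.
  have h2 : `|L - Lh| * (4 * w) < 1 by rewrite -ltr_pdivlMr ?mul1r// mulr_gt0.
  have := hM t tt; have := ler_normD (Y t - wY yh t) (wY yh t); rewrite subrK /wY; lra.
have cY : cts Y := cts_HD hY.
have [d d0 hd] : exists2 d, 0 < d & forall s, `|s - tl| < d -> `|Y s| <= M1.
  have e4 : 0 < (1 / 4 : R) by lra.
  have [d d0 hd] := (cts_eps _ _).1 (cY tl) _ e4.
  have Ytl : `|Y tl| < M + 3 / 4.
    have := hd (tl + d / 2); rewrite addrAC subrr add0r gtr0_norm ?divr_gt0//.
    have -> : d / 2 < d by lra.
    move=> /(_ isT); rewrite distrC => h1.
    have := ler_normD (Y tl - Y (tl + d / 2)) (Y (tl + d / 2)); rewrite subrK.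
    have := YM (tl + d / 2); rewrite ltrDl divr_gt0// => /(_ isT); lra.
  exists d => // s /hd h1.
  have := ler_normD (Y s - Y tl) (Y tl); rewrite subrK /M1; lra.
have YM1 t : tl - d < t -> `|Y t| <= M1.
  move=> tt; have [ttl|ttl] := leP t tl; last by have := YM t ttl; rewrite /M1; lra.
  by apply: hd; rewrite ler0_norm; lra.
exists d, (fun t => expR (- (mu * t)) * Y t), (fun t => expR (- (mu * t)) * (Z t - mu * Y t)).
split; first exact: d0.
  split=> [t tt|]; first by apply: (unw (hY t) (hZ t)); exact: YM1.
  by apply: limp_ext YL => // t _; exact: esym (wY_unw Y t).
move=> t tt; have [h1 h2] := C t tt.
have E0 := expR_gt0 (mu * t).
rewrite -[X in `|expR (- (mu * t)) * Y t - yh t| * X](gtr0_norm E0) -normrM.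
rewrite -[X in _ * X <= _](gtr0_norm E0) -normrM.
have -> : (expR (- (mu * t)) * Y t - yh t) * expR (mu * t) = Y t - wY yh t.
  transitivity (Y t * (expR (mu * t) * expR (- (mu * t))) - yh t * expR (mu * t)).
    by ring.
  by rewrite exps mulr1.
have -> : (expR (- (mu * t)) * (Z t - mu * Y t) - zh t) * expR (mu * t) =
   (Z t - wZ yh zh t) - mu * (Y t - wY yh t).
  transitivity ((Z t - mu * Y t) * (expR (mu * t) * expR (- (mu * t))) - zh t * expR (mu * t)).
    by ring.
  by rewrite exps /wZ /wY; ring.
have p : 0 <= `|L - Lh| * w by rewrite mulr_ge0// ltW.
have pm : 0 <= mu * (`|L - Lh| * w) by rewrite mulr_ge0// ltW.
split; first by move: h1; lra.
apply: (le_trans (ler_normB _ _)); rewrite normrM (gtr0_norm mu0).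
have : mu * `|Y t - wY yh t| <= mu * (2 * `|L - Lh| * w) by rewrite ler_pM2l.
by lra.
Unshelve. exact: 0.
Qed.

(** At each t the value of some solution defined there is chosen; uniqueness makes the choice
    consistent. *)
Lemma fd_glue (A : set R) L : (forall tl, A tl -> exists y z, fd tl y z L) ->
  exists y z, forall tl, A tl -> fd tl y z L.
Proof.
move=> hA.
have /choice[Yt hYt] : forall tl, exists yz : (R -> R) * (R -> R), A tl -> fd tl yz.1 yz.2 L.
  move=> tl; case: (pselect (A tl)) => [/hA[y [z h]]|h]; first by exists (y, z).
  by exists (fun=> 0, fun=> 0).
have /choice[sel hsel] : forall t, exists tl, (exists2 s, A s & s < t) -> A tl /\ tl < t.
  move=> t; case: (pselect (exists2 s, A s & s < t)) => [[s As st]|h]; first by exists s.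
  by exists 0 => /h.
exists (fun t => (Yt (sel t)).1 t), (fun t => (Yt (sel t)).2 t) => tl Atl.
have e t : tl < t -> (Yt (sel t)).1 t = (Yt tl).1 t /\ (Yt (sel t)).2 t = (Yt tl).2 t.
  move=> tt; have [As st] := hsel t (ex_intro2 A (fun s => s < t) tl Atl tt).
  exact: fd_unique (hYt _ As) (hYt _ Atl) _ st tt.
have [h1 h2] := hYt _ Atl; split=> [t tt|].
  have [e1 e2] := e t tt; have [hy hz] := h1 _ tt.
  rewrite /sol_at e1 e2; split.
    apply: HD_near hy; near=> s; have [|//] := e s.
    by near: s; exact: lt_nbhsr.
  apply: HD_near hz; near=> s; have [|//] := e s.
  by near: s; exact: lt_nbhsr.
apply: (limp_ext (N := tl + 1)) h2 => t tt.
by have [|-> _] := e t; first lra.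
Unshelve. all: by end_near. Qed.

(** Blow-up alternative: if Y stayed bounded down to the infimum of the possible left ends,
    [fd_near] with the same L would continue the solution past it. *)
Lemma fd_maximal L : exists y z, (forall tl, fd tl y z L) \/
  (exists ts, [/\ fd ts y z L,
    forall M : R, ~ (forall t, ts < t -> `|y t * expR (mu * t)| <= M) &
    forall tl y' z', fd tl y' z' L -> ts <= tl]).
Proof.
pose A := [set tl | exists y z, fd tl y z L].
have [y [z h]] := fd_glue (A := A) (fun _ h => h).
exists y, z.
have [tl0 A0] : A !=set0 by have [tl [y0 [z0 h0]]] := fd_exists L; exists tl, y0, z0.
have up s t : A s -> s <= t -> A t.
  by move=> [y1 [z1 h1]] st; exists y1, z1; exact: fd_sub h1.
case: (pselect (has_lbound A)) => [lA|nlA]; last first.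
  left=> tl; apply: h; apply: contrapT => nA; apply: nlA; exists tl => s As.
  by rewrite leNgt; apply/negP => /ltW st; apply: nA; exact: up st.
right; exists (inf A).
have hA : has_inf A by split => //; exists tl0.
have f : fd (inf A) y z L.
  split; last by case: (h _ A0).
  move=> t tt; have [|s As st] := @inf_adherent _ A (t - inf A) _ hA; first by rewrite subr_gt0.
  by apply: (proj1 (h _ As)); move: st; rewrite addrC subrK.
split=> //; last first.
  by move=> tl y' z' f'; apply: (ge_inf lA); exists y', z'.
move=> M hM.
have M0 : 0 <= M by apply: le_trans (hM (inf A + 1) _); rewrite ?ltrDl.
have [delta [C [d0 _ hd]]] := fd_near (inf A) M0.
have [|eps [y1 [z1 [e0 f1 _]]]] := hd _ _ _ L f hM; first by rewrite subrr normr0.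
have : inf A <= inf A - eps by apply: (ge_inf lA); exists y1, z1.
lra.
Qed.

End FastDecay.

(** * Convexity, comparison with the linear equation, simple zeros *)

Section Convexity.
Variable R : realType.
Implicit Types (f y z a b A : R -> R) (t s tl T mu q L : R).

Lemma last_nonpos f (a b : R) : a <= b -> (forall t, a <= t <= b -> {for t, continuous f}) ->
  f a <= 0 -> 0 < f b ->
  exists2 c, a <= c < b & f c = 0 /\ forall s, c < s <= b -> 0 < f s.
Proof.
move=> ab cf fa fb.
pose A := [set t | a <= t <= b /\ f t <= 0].
have Aa : A a by split=> //; rewrite lexx.
have hA : has_sup A by split; [exists a|exists b => t [/andP[]]].
pose c := sup A.
have ac : a <= c by exact: sup_upper_bound.
have cb : c <= b by apply: ge_sup; [exists a|move=> t [/andP[]]].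
have fc : f c <= 0.
  rewrite leNgt; apply/negP => fc0.
  have [d d0 hd] := (cts_eps _ _).1 (cf c (introT andP (conj ac cb))) _ fc0.
  have [t [/andP[at_ tb] ft] ct] := sup_adherent d0 hA.
  have tc : t <= c by apply: sup_upper_bound => //; split => //; rewrite at_.
  have := hd t; rewrite ltr_norml ltr_norml => h.
  have /h : - d < t - c < d by apply/andP; split; rewrite -/c in ct; lra.
  by move=> /andP[h1 _]; lra.
have pos s : c < s <= b -> 0 < f s.
  move=> /andP[cs sb]; rewrite ltNge; apply/negP => fs.
  have : s <= c by apply: sup_upper_bound => //; split => //; rewrite sb (le_trans ac)// ltW.
  lra.
have cb' : c < b.
  by rewrite lt_neqAle cb andbT; apply/negP => /eqP e; move: fc; rewrite e leNgt fb.
exists c; first by rewrite ac.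
split=> //; apply/eqP; rewrite eq_le fc /= leNgt; apply/negP => fc0.
have nf0 : 0 < - f c by lra.
have [d d0 hd] := (cts_eps _ _).1 (cf c (introT andP (conj ac cb))) _ nf0.
pose s := Num.min (c + d / 2) b.
have cs : c < s by rewrite lt_min cb' andbT ltrDl divr_gt0.
have sb : s <= b by rewrite ge_min lexx orbT.
have sd : s <= c + d / 2 by rewrite ge_min lexx.
have := hd s; rewrite !ltr_norml => h.
have /h : - d < s - c < d by apply/andP; split; lra.
have := pos s; rewrite cs sb => /(_ isT) h1 /andP[_ h2]; lra.
Qed.

(** A function that is convex where positive and tends to 0 from above must decrease; followed
    backwards it increases, so it cannot meet 0 again. *)
Lemma positive_decreasing y z w tl :
  (forall t, tl < t -> HD y t (z t)) -> (forall t, tl < t -> HD z t (w t)) ->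
  (forall t, tl < t -> 0 < y t -> 0 < w t) -> limp y 0 ->
  (exists N, forall t, N <= t -> 0 < y t) ->
  forall t, tl < t -> 0 < y t /\ z t < 0.
Proof.
move=> hy hz hw y0 [N hN].
have neg t : tl < t -> (forall s, t < s -> 0 < y s) -> forall s, t < s -> z s < 0.
  move=> tt pos s ts; rewrite ltNge; apply/negP => zs.
  have zpos r : s <= r -> 0 <= z r.
    move=> sr; apply: le_trans zs _; apply: (HD_le (df := w) sr).
      by move=> r' /andP[h _]; apply: hz; lra.
    by move=> r' /andP[h _]; apply: ltW; apply: hw; [lra|apply: pos; lra].
  have : y s <= 0.
    apply: (limp_ge y0 (N := s)) => r sr; apply: (HD_le (df := z) sr).
      by move=> r' /andP[h _]; apply: hy; lra.
    by move=> r' /andP[h _]; exact: zpos.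
  by rewrite leNgt pos.
have pos t : tl < t -> 0 < y t.
  move=> tt; rewrite ltNge; apply/negP => yt.
  have tN : t <= N by rewrite leNgt; apply/negP => h; have := hN t (ltW h); lra.
  have [|||c /andP[tc cN] [yc hc]] := @last_nonpos y t N tN.
  - by move=> s /andP[ts _]; apply: HD_cts (hy s _); lra.
  - by [].
  - exact: hN.
  have cpos s : c < s -> 0 < y s.
    by move=> cs; have [sN|Ns] := leP s N; [apply: hc; rewrite cs|apply: hN; exact: ltW].
  have zneg := neg c (lt_le_trans tt tc) cpos.
  have : y (c + 1) < y c.
    have [||e /andP[ce _] e2] := @HD_MVT _ y z c (c + 1).
    - by rewrite ltrDl.
    - by move=> s /andP[cs _]; apply: hy; lra.
    have := zneg e ce; have -> : y (c + 1) = z e * (c + 1 - c) + y c by rewrite -e2; ring.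
    lra.
  by have := cpos (c + 1); rewrite ltrDl => /(_ ltr01); lra.
move=> t tt; split; first exact: pos.
have tm : (tl + t) / 2 < t by lra.
apply: (neg ((tl + t) / 2)) => //; first by lra.
by move=> s hs; apply: pos; lra.
Qed.

Lemma limp_exp_weight y mu L : 0 < mu -> limp (fun t => y t * expR (mu * t)) L -> limp y 0.
Proof.
move=> mu0 h; rewrite -(mulr0 L).
apply: (@limp_ext _ (fun t => y t * expR (mu * t) * expR (- mu * t)) _ 0).
  by move=> t _; rewrite -mulrA -expRD mulNr subrr expR0 mulr1.
by apply: limpM => //; exact: limp_expN.
Qed.

Lemma fd_lim0 q a b mu tl y z L : 0 < mu -> fdsol q a b mu tl y z L -> limp y 0.
Proof. by move=> mu0 [_ h]; exact: limp_exp_weight h. Qed.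

(** As [psi] is nondecreasing, the difference of the two solutions is convex where it is
    positive. *)
Lemma fd_comparison q a b mu tl y1 z1 L1 y2 z2 L2 : 2 < q -> 0 < mu ->
  (forall t, tl < t -> 0 < a t) -> (forall t, tl < t -> 0 <= b t) ->
  fdsol q a b mu tl y1 z1 L1 -> fdsol q a b mu tl y2 z2 L2 -> L1 < L2 ->
  forall t, tl < t -> y1 t < y2 t /\ z2 t < z1 t.
Proof.
move=> q2 mu0 a0 b0 f1 f2 L12 t tt.
have [|||||h1 h2] := @positive_decreasing (fun t => y2 t - y1 t) (fun t => z2 t - z1 t)
  (fun t => (a t * y2 t + b t * psi q (y2 t)) - (a t * y1 t + b t * psi q (y1 t))) tl _ _ _ _ _ t tt.
- move=> s ts; have [h _] := f1.1 _ ts; have [h' _] := f2.1 _ ts; exact: HD_D h' (HD_N h).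
- move=> s ts; have [_ h] := f1.1 _ ts; have [_ h'] := f2.1 _ ts; exact: HD_D h' (HD_N h).
- move=> s ts ys.
  have h1 : psi q (y1 s) <= psi q (y2 s) by apply: psi_homo => //; lra.
  have h2 : 0 <= b s * (psi q (y2 s) - psi q (y1 s)) by rewrite mulr_ge0 ?b0// subr_ge0.
  have h3 := mulr_gt0 (a0 _ ts) ys; lra.
- have -> : 0 = 0 - 0 :> R by ring.
  by apply: limpD; [|apply: limpN]; [exact: fd_lim0 f2|exact: fd_lim0 f1].
- have hl := limpD f2.2 (limpN f1.2).
  have [|N hN] := hl (L2 - L1); first by rewrite subr_gt0.
  exists N => s Ns; have := hN s Ns; rewrite ltr_norml => /andP[h _].
  rewrite -(pmulr_lgt0 _ (expR_gt0 (mu * s))); move: h; lra.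
by split; lra.
Qed.

Lemma fd_pos q a b mu tl y z L : 2 < q -> 0 < mu ->
  (forall t, tl < t -> 0 < a t) -> (forall t, tl < t -> 0 <= b t) ->
  fdsol q a b mu tl y z L -> 0 < L -> forall t, tl < t -> 0 < y t /\ z t < 0.
Proof.
by move=> q2 mu0 a0 b0 f L0 t tt; exact: (fd_comparison q2 mu0 a0 b0 (fd_zero q a b mu tl) f L0).
Qed.

Lemma linear_fd_exists q A mu : 2 < q -> 0 < mu -> cts A -> Tail (fun t => `|A t - mu ^+ 2|) ->
  exists phi zeta, forall tl, fdsol q A (fun=> 0) mu tl phi zeta 1.
Proof.
move=> q2 mu0 cA [Lam hLam Lam0].
have [||||Y [Z [hY hZ Y1]]] := @exists_asymptotic R (fun t => `|A t - mu ^+ 2|) Lam _ hLam Lam0 mu mu0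
  (fun t Y => (A t - mu ^+ 2) * Y) _ _ _ 1.
- by [].
- by move=> Y cY; apply: cts_M cY; apply: cts_D cA _; exact: cts_c.
- by move=> t; rewrite mulr0.
- by move=> t x y; rewrite -mulrBr normrM.
exists (fun t => expR (- (mu * t)) * Y t), (fun t => expR (- (mu * t)) * (Z t - mu * Y t)) => tl.
split=> [t _|]; last first.
  apply: limp_ext Y1 => // t _; rewrite mulrAC -expRD addrC subrr expR0 mul1r//.
have h1 := hY t; have h2 := hZ t.
by split; hd idtac; ring.
Unshelve. exact: 0.
Qed.

(** The Wronskian W = y' phi - y phi' has W' = (A - A0) y phi >= 0. If it were positive somewhere,
    (y phi)' = W + 2 y phi' would stay bounded below by a positive constant, since phi' -> 0 and y
    is bounded; but y phi is bounded. So W <= 0, which is the monotonicity of y / phi. *)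
Lemma fd_quotient_noninc q A0 mu tl phi zeta L y z A C : 2 < q -> 0 < mu -> cts A0 ->
  Tail (fun t => `|A0 t - mu ^+ 2|) ->
  fdsol q A0 (fun=> 0) mu tl phi zeta L -> (forall t, tl < t -> 0 < phi t) ->
  (forall t, tl < t -> HD y t (z t)) -> (forall t, tl < t -> HD z t (A t * y t)) ->
  (forall t, tl < t -> 0 < y t) -> (forall t, tl < t -> A0 t <= A t) ->
  (forall t, tl < t -> y t <= C) ->
  forall s t, tl < s -> s <= t -> y t / phi t <= y s / phi s.
Proof.
move=> q2 mu0 cA TA f phi0 hy hz y0 AA yC.
have TB : Tail (fun t => `|(fun=> 0 : R) t| * expR (- (mu * (q - 2)) * t)).
  exists (fun=> 0); last exact: limp_c.
  by move=> t; apply: HD_cv (HD_c _ _) _; rewrite normr0 mul0r oppr0.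
have hphi t : tl < t -> HD phi t (zeta t) by move=> /(f.1 _)[].
have hzeta t : tl < t -> HD zeta t (A0 t * phi t).
  by move=> /(f.1 _)[_ h]; apply: HD_cv h _; ring.
have zeta0 : limp zeta 0.
  have h := limp_exp_weight mu0 (fd_z0 q2 mu0 TA TB f).
  have h2 := fd_lim0 mu0 f.
  have -> : 0 = 0 - mu * 0 :> R by ring.
  apply: (@limp_ext _ (fun t => (zeta t + mu * phi t) - mu * phi t) _ 0); first by move=> t _; ring.
  by apply: limpD => //; apply: limpN; apply: limpM => //; exact: limp_c.
pose W t := z t * phi t - y t * zeta t.
have hW t : tl < t -> HD W t ((A t - A0 t) * (y t * phi t)).
  move=> tt; have h1 := hy _ tt; have h2 := hz _ tt; have h3 := hphi _ tt; have h4 := hzeta _ tt.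
  by rewrite /W; hd idtac; ring.
have Wle t1 : tl < t1 -> W t1 <= 0.
  move=> t11; rewrite leNgt; apply/negP => W0.
  have Wge t : t1 <= t -> W t1 <= W t.
    move=> tt; apply: (HD_le (f := W) (df := fun t => (A t - A0 t) * (y t * phi t)) tt).
      by move=> s /andP[ts _]; apply: hW; lra.
    move=> s /andP[ts _]; have ts' : tl < s by lra.
    by rewrite mulr_ge0 ?subr_ge0 ?AA// mulr_ge0// ltW ?y0 ?phi0.
  have C0 : 0 < C by apply: lt_le_trans (yC t1 t11); exact: y0.
  (* With this bound on phi' and y <= C, the term 2 y phi' consumes at most half of W t1. *)
  have [|N hN] := zeta0 (W t1 / (4 * C)); first by rewrite divr_gt0// mulr_gt0.
  have [P P0 hP] : exists2 P, 0 < P & forall t, t1 <= t -> `|phi t| <= P.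
    apply: (limp_bounded (fd_lim0 mu0 f)) => t tt; apply: HD_cts (hphi _ _); lra.
  pose t2 := Num.max t1 N.
  have t12 : t1 <= t2 by rewrite le_max lexx.
  have Nt2 : N <= t2 by rewrite le_max lexx orbT.
  apply: (@unbounded_growth _ (fun t => y t * phi t) (fun t => z t * phi t + y t * zeta t) t2
    (W t1 / 2) (C * P)); first by rewrite divr_gt0.
  - move=> s ts; have ts' : tl < s by lra.
    by have h1 := hy _ ts'; have h3 := hphi _ ts'; hd idtac; ring.
  - move=> s ts; have ts' : tl < s by lra.
    have h1 : W t1 <= W s by apply: Wge; lra.
    have := hN s (le_trans Nt2 ts); rewrite subr0 ltr_norml => /andP[h2 _].
    have h3 : - (W t1 / (4 * C)) * C <= zeta s * y s.
      have h4 : - (W t1 / (4 * C)) * y s <= zeta s * y s by rewrite ler_pM2r ?y0// ltW.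
      apply: le_trans h4; rewrite !mulNr lerN2 ler_pM2l ?yC//.
      by rewrite divr_gt0// mulr_gt0.
    have h5 : W t1 / (4 * C) * C = W t1 / 4 by field; rewrite gt_eqF.
    rewrite mulNr h5 in h3.
    by rewrite /W in h1 h3 W0 *; lra.
  - move=> s ts; have ts' : tl < s by lra.
    rewrite normrM; apply: ler_pM => //; last by apply: hP; lra.
    by rewrite gtr0_norm ?y0// yC.
move=> s t ts st.
apply: (HD_ge (f := fun t => y t / phi t) (df := fun t => W t / phi t ^+ 2) st).
  move=> r /andP[sr _]; have tr : tl < r by lra.
  have p0 : phi r != 0 by rewrite gt_eqF// phi0.
  apply: HD_cv (HD_M (hy r tr) (HD_V (hphi r tr) p0)) _.
  by rewrite /W; field.
move=> r /andP[sr _]; have tr : tl < r by lra.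
by rewrite mulr_le0_ge0 ?Wle// invr_ge0 sqr_ge0.
Qed.

(** The quotient by the decaying solution phi of the linear equation is positive and nonincreasing,
    hence converges, and phi e^(mu t) -> 1. Only a lower bound on A is required, so an a priori
    decay rate of y is not. *)
Lemma bounded_pos_fd A0 mu tl y z A C : 0 < mu -> cts A0 ->
  Tail (fun t => `|A0 t - mu ^+ 2|) ->
  (forall t, tl < t -> HD y t (z t)) -> (forall t, tl < t -> HD z t (A t * y t)) ->
  (forall t, tl < t -> 0 < y t) -> (forall t, tl < t -> A0 t <= A t) ->
  (forall t, tl < t -> y t <= C) -> exists L, limp (fun t => y t * expR (mu * t)) L.
Proof.
move=> mu0 cA TA hy hz y0 AA yC.
(* The comparison equation is linear, so any exponent above 2 may be used in [fdsol]. *)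
have q3 : 2 < (3 : R) by lra.
have [phi [zeta hphi]] := linear_fd_exists q3 mu0 cA TA.
have [//|N0 hN0] := (hphi tl).2 1.
pose N := Num.max N0 (tl + 1).
have tN : tl < N by rewrite lt_max ltrDl ltr01 orbT.
have N0N : N0 <= N by rewrite le_max lexx.
have phi0 t : N < t -> 0 < phi t.
  move=> Nt; have := hN0 t; rewrite ltr_norml => h.
  have /h /andP[h1 _] : N0 <= t by lra.
  rewrite -(pmulr_lgt0 _ (expR_gt0 (mu * t))); lra.
have up t : N < t -> tl < t by exact: lt_trans.
have mono := fd_quotient_noninc q3 mu0 cA TA (hphi N) phi0 (fun t h => hy t (up t h))
  (fun t h => hz t (up t h)) (fun t h => y0 t (up t h)) (fun t h => AA t (up t h)) (fun t h => yC t (up t h)).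
have [l _ hl] : exists2 l, 0 <= l & limp (fun t => y t / phi t) l.
  pose D t := (z t * phi t - y t * zeta t) / phi t ^+ 2.
  pose S := [set y t / phi t | t in [set t | N < t]].
  have S0 : S !=set0 by exists (y (N + 1) / phi (N + 1)), (N + 1) => //=; rewrite ltrDl.
  have Slb : lbound S 0.
    by move=> _ [t /= Nt <-]; rewrite divr_ge0// ltW// ?phi0// y0// up.
  have hS : has_inf S by split=> //; exists 0.
  exists (inf S); first exact: lb_le_inf.
  move=> e e0; have [_ [s /= Ns <-] hs] := inf_adherent e0 hS.
  exists s => t st; have ft := mono s t Ns st.
  have : inf S <= y t / phi t.
    by apply: ge_inf; [exists 0|exists t => //=; exact: lt_le_trans st].
  rewrite ltr_norml => h; apply/andP; split; lra.
exists l; rewrite -(mulr1 l).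
apply: (@limp_ext _ (fun t => (y t / phi t) * (phi t * expR (mu * t))) _ (N + 1)).
  move=> t Nt; have p : phi t != 0 by rewrite gt_eqF// phi0; lra.
  by field.
by apply: limpM => //; case: (hphi tl).
Qed.

(** Beyond T the quotient y / phi does not exceed its value at T. This turns a bound on y T into one
    on L and on the whole weighted solution, with a constant independent of the solution. *)
Lemma fd_bound_by_initial q a b mu T : 2 < q -> 0 < mu -> cts a -> (forall t, 0 < a t) ->
  Tail (fun t => `|a t - mu ^+ 2|) -> (forall t, T <= t -> 0 <= b t) ->
  exists2 C : R, 0 < C & forall tl y z L, tl < T -> fdsol q a b mu tl y z L -> 0 < L ->
    (forall t, T <= t -> 0 <= y t * expR (mu * t) <= C * y T) /\ L <= C * y T.
Proof.
move=> q2 mu0 ca a0 Ta b0.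
have [phi [zeta hphi]] := linear_fd_exists q2 mu0 ca Ta.
have phi0 t : 0 < phi t.
  have t1 : t - 1 < t by lra.
  by have [] := fd_pos q2 mu0 (fun s _ => a0 s) (fun s _ => lexx 0) (hphi (t - 1)) ltr01 t1.
have [P P0 hP] : exists2 P, 0 < P & forall t, T <= t -> `|phi t * expR (mu * t)| <= P.
  apply: (limp_bounded (hphi 0).2) => t _.
  have [h _] := (hphi (t - 1)).1 t ltac:(lra).
  by have h2 : HD (fun t => phi t * expR (mu * t)) t (zeta t * expR (mu * t) + phi t * (expR (mu * t) * mu));
    [hd idtac; ring|exact: HD_cts h2].
exists (P / phi T); first by rewrite divr_gt0.
move=> tl y z L tlT f L0.
have b0' t : T < t -> 0 <= b t by move=> /ltW; exact: b0.
have fT := fd_sub (ltW tlT) f.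
have pos t : T < t -> 0 < y t /\ z t < 0 by exact: (fd_pos q2 mu0 _ b0' fT L0).
have hy t : tl < t -> HD y t (z t) by move=> /(f.1 _)[].
have hz t : tl < t -> HD z t ((a t + b t * `|y t| `^ (q - 2)) * y t).
  by move=> /(f.1 _)[_ h]; apply: HD_cv h _; rewrite /psi; ring.
have yT : y (T + 1) <= y T.
  have := @HD_MVT _ y z T (T + 1); rewrite ltrDl => /(_ ltr01)[|c /andP[Tc _] e].
    by move=> t /andP[Tt _]; apply: hy; lra.
  have [_ h] := pos c Tc; have e1 : T + 1 - T = 1 by ring.
  by move: e; rewrite e1 mulr1; lra.
have yC t : T < t -> y t <= y T.
  move=> Tt; have [|c /andP[Tc _] e] := @HD_MVT _ y z T t Tt.
    by move=> s /andP[Ts _]; apply: hy; lra.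
  have [_ h] := pos c Tc; have h2 : 0 < t - T by lra.
  have : z c * (t - T) <= 0 by rewrite mulr_le0_ge0 ?ltW.
  lra.
have yT0 : 0 < y T by apply: lt_le_trans yT; have [] := pos (T + 1) ltac:(lra).
have mono s t : T < s -> s <= t -> y t / phi t <= y s / phi s.
  apply: (@fd_quotient_noninc q a mu T phi zeta 1 y z (fun t => a t + b t * `|y t| `^ (q - 2)) (y T)) => //.
  - by move=> r Tr; apply: hy; lra.
  - by move=> r Tr; apply: hz; lra.
  - by move=> r /pos[].
  - by move=> r Tr; rewrite lerDl mulr_ge0 ?powR_ge0 ?b0'.
have key t : T < t -> y t / phi t <= y T / phi T.
  move=> Tt; rewrite leNgt; apply/negP => h.
  have cq : {for T, continuous (fun t => y t / phi t)}.
    have [hph _] := (hphi (T - 1)).1 T ltac:(lra).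
    exact: HD_cts (HD_M (hy T tlT) (HD_V hph (lt0r_neq0 (phi0 T)))).
  have e0 : 0 < y t / phi t - y T / phi T by lra.
  have [d d0 hd] := (cts_eps _ _).1 cq _ e0.
  pose s := Num.min (T + d / 2) t.
  have Ts : T < s by rewrite lt_min Tt andbT ltrDl divr_gt0.
  have st : s <= t by rewrite ge_min lexx orbT.
  have sd : s <= T + d / 2 by rewrite ge_min lexx.
  have := hd s; rewrite !ltr_norml => h3.
  have /h3 /andP[_ h4] : - d < s - T < d by apply/andP; split; lra.
  have := mono s t Ts st; lra.
have bd t : T <= t -> 0 <= y t * expR (mu * t) <= P / phi T * y T.
  move=> Tt; have yt : 0 <= y t.
    by move: Tt; rewrite le_eqVlt => /predU1P[<-|/pos[h _]]; exact: ltW.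
  rewrite mulr_ge0 ?expR_ge0//=.
  have k : y t / phi t <= y T / phi T.
    by move: Tt; rewrite le_eqVlt => /predU1P[<-//|]; exact: key.
  have -> : y t * expR (mu * t) = (y t / phi t) * (phi t * expR (mu * t)).
    by field; rewrite gt_eqF.
  have -> : P / phi T * y T = (y T / phi T) * P by ring.
  apply: ler_pM => //.
  - by rewrite divr_ge0// ltW.
  - by rewrite mulr_ge0 ?expR_ge0// ltW.
  - by apply: le_trans (hP t Tt); rewrite ler_norm.
split=> //; apply: (limp_le f.2 (N := T)) => t /bd /andP[_]; exact.
Qed.

(** Gronwall in both directions: E = y^2 + z^2 satisfies |E'| <= (1 + K) E. *)
Lemma ivp_zero y z A t1 t2 K : t1 <= t2 ->
  (forall t, t1 <= t <= t2 -> HD y t (z t)) -> (forall t, t1 <= t <= t2 -> HD z t (A t * y t)) ->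
  (forall t, t1 <= t <= t2 -> `|A t| <= K) ->
  (y t1 = 0 /\ z t1 = 0 -> y t2 = 0 /\ z t2 = 0) /\
  (y t2 = 0 /\ z t2 = 0 -> y t1 = 0 /\ z t1 = 0).
Proof.
move=> t12 hy hz hA.
pose E t := y t ^+ 2 + z t ^+ 2.
have hE t : t1 <= t <= t2 -> HD E t (2 * y t * z t * (1 + A t)).
  by move=> tt; have h1 := hy _ tt; have h2 := hz _ tt; rewrite /E; hd idtac; ring.
have bd t : t1 <= t <= t2 -> `|2 * y t * z t * (1 + A t)| <= (1 + K) * E t.
  move=> tt; rewrite normrM mulrC; apply: ler_pM => //.
    by apply: (le_trans (ler_normD _ _)); rewrite normr1 lerD2l hA.
  rewrite /E ler_norml; have := sqr_ge0 (y t + z t); have := sqr_ge0 (y t - z t).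
  by rewrite sqrrB sqrrD => h1 h2; apply/andP; split; lra.
have E0 t : E t <= 0 -> y t = 0 /\ z t = 0.
  move=> h; have h1 := sqr_ge0 (y t); have h2 := sqr_ge0 (z t).
  have e1 : y t ^+ 2 = 0 by apply/eqP; rewrite eq_le h1 andbT; move: h; rewrite /E; lra.
  have e2 : z t ^+ 2 = 0 by apply/eqP; rewrite eq_le h2 andbT; move: h; rewrite /E; lra.
  by split; apply/eqP; rewrite -sqrf_eq0; apply/eqP.
split=> -[ya za]; apply: E0.
  have : E t2 * expR (- (1 + K) * t2) <= E t1 * expR (- (1 + K) * t1).
    apply: (HD_ge (f := fun t => E t * expR (- (1 + K) * t))
      (df := fun t => (2 * y t * z t * (1 + A t) - (1 + K) * E t) * expR (- (1 + K) * t)) t12).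
      by move=> t tt; have h1 := hE _ tt; hd idtac; ring.
    move=> t tt; rewrite mulr_le0_ge0 ?expR_ge0//.
    by have := bd t tt; rewrite ler_norml => /andP[_]; rewrite subr_le0.
  rewrite {2}/E ya za expr0n /= addr0 mul0r => h.
  by rewrite -(pmulr_lle0 _ (expR_gt0 (- (1 + K) * t2))).
have : E t1 * expR ((1 + K) * t1) <= E t2 * expR ((1 + K) * t2).
  apply: (HD_le (f := fun t => E t * expR ((1 + K) * t))
    (df := fun t => (2 * y t * z t * (1 + A t) + (1 + K) * E t) * expR ((1 + K) * t)) t12).
    by move=> t tt; have h1 := hE _ tt; hd idtac; ring.
  move=> t tt; rewrite mulr_ge0 ?expR_ge0//.
  by have := bd t tt; rewrite ler_norml => /andP[h _]; lra.
rewrite {2}/E ya za expr0n /= addr0 mul0r => h.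
by rewrite -(pmulr_lle0 _ (expR_gt0 ((1 + K) * t1))).
Qed.

Lemma sol_coef q a b y z t : sol_at q a b y z t ->
  HD z t ((a t + b t * `|y t| `^ (q - 2)) * y t).
Proof. by move=> [_ h]; apply: HD_cv h _; rewrite /psi; ring. Qed.

Lemma coef_cts q a b y t : 2 < q -> cts a -> cts b -> {for t, continuous y} ->
  {for t, continuous (fun t => a t + b t * `|y t| `^ (q - 2))}.
Proof.
move=> q2 ca cb cy; apply: cvgD; first exact: ca.
apply: cvgM; first exact: cb.
have p : 0 < q - 2 by lra.
exact: (@continuous_comp _ _ _ y (fun v => `|v| `^ (q - 2)) t cy (@cts_powR _ _ p (y t))).
Qed.

Lemma sol_ivp q a b y z t1 t2 : 2 < q -> cts a -> cts b -> t1 <= t2 ->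
  (forall t, t1 <= t <= t2 -> sol_at q a b y z t) ->
  (y t1 = 0 /\ z t1 = 0 -> y t2 = 0 /\ z t2 = 0) /\
  (y t2 = 0 /\ z t2 = 0 -> y t1 = 0 /\ z t1 = 0).
Proof.
move=> q2 ca cb t12 h.
have [K _ hK] : exists2 K, 0 < K & forall t, t1 <= t <= t2 -> `|a t + b t * `|y t| `^ (q - 2)| <= K.
  apply: (@cts_bounded _ (fun t => a t + b t * `|y t| `^ (q - 2))) => t tt.
  by apply: coef_cts => //; have [h1 _] := h _ tt; exact: HD_cts h1.
apply: (@ivp_zero y z (fun t => a t + b t * `|y t| `^ (q - 2)) t1 t2 K) => //.
  by move=> t /h[].
by move=> t /h; exact: sol_coef.
Qed.

(** A double zero would propagate to +oo and force the limit L to be 0. *)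
Lemma fd_simple_zeros q a b mu tl y z L : 2 < q -> cts a -> cts b ->
  fdsol q a b mu tl y z L -> L != 0 -> forall t, tl < t -> y t = 0 -> z t != 0.
Proof.
move=> q2 ca cb f L0 t tt yt; apply/eqP => zt; move/eqP: L0; apply.
apply: (limp_uniq f.2); apply: (@limp_ext _ (fun=> 0) _ t); last exact: limp_c.
move=> s ts; have [h _] := @sol_ivp q a b y z t s q2 ca cb ts
  (fun r (hr : t <= r <= s) => f.1 r (lt_le_trans tt (proj1 (andP hr)))).
by have [-> _] := h (conj yt zt); rewrite mul0r.
Qed.

Lemma sol_refl q a b y z t : sol_at q a b y z (- t) ->
  sol_at q (fun s => a (- s)) (fun s => b (- s)) (fun s => y (- s)) (fun s => - z (- s)) t.
Proof.
move=> [hy hz]; split.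
  by apply: HD_cv (HD_comp (HD_N (HD_id t)) hy) _; ring.
by apply: HD_cv (HD_N (HD_comp (HD_N (HD_id t)) hz)) _; ring.
Qed.

End Convexity.

(** * Counting zeros *)

Section Counting.
Variable R : realType.
Implicit Types (A B : set R) (j k : nat).

(** A lower bound on the number of elements that makes sense before the set is known to be
    finite. *)
Definition many k A := exists2 e : nat -> R, forall i, (i < k)%N -> A (e i) &
  forall i j, (i < k)%N -> (j < k)%N -> e i = e j -> i = j.

Lemma card_enum A k : (A #= `I_k)%card -> exists e : nat -> R,
  [/\ forall i, (i < k)%N -> A (e i),
      forall i j, (i < k)%N -> (j < k)%N -> e i = e j -> i = j &
      forall x, A x -> exists2 i, (i < k)%N & e i = x].
Proof.
move=> /card_esym /card_set_bijP[e [h1 h2 h3]]; exists e; split.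
- by move=> i ik; exact: h1.
- by move=> i j ik jk; apply: h2; rewrite inE.
- by move=> x /h3[i ik <-]; exists i.
Qed.

Lemma enum_card A k (e : nat -> R) : (forall i, (i < k)%N -> A (e i)) ->
  (forall i j, (i < k)%N -> (j < k)%N -> e i = e j -> i = j) ->
  (forall x, A x -> exists2 i, (i < k)%N & e i = x) -> (A #= `I_k)%card.
Proof.
move=> h1 h2 h3; apply: card_esym; apply/card_set_bijP; exists e; split.
- by move=> i /= ik; exact: h1.
- by move=> i j; rewrite !inE /=; exact: h2.
- by move=> x /h3[i ik <-]; exists i.
Qed.

Lemma card_unique A j k : (A #= `I_j)%card -> (A #= `I_k)%card -> j = k.
Proof. by move=> h1 h2; apply/card_eq_II; exact: card_eq_trans (card_esym h1) h2. Qed.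

Lemma many_le A j k : (A #= `I_j)%card -> many k A -> (k <= j)%N.
Proof.
move=> hA [e h1 h2]; rewrite -card_le_II.
have h3 : (e @` `I_k #= `I_k)%card.
  by apply: inj_card_eq => x y; rewrite !inE; exact: h2.
rewrite -(card_le_eql h3) -(card_le_eqr hA); apply: subset_card_le.
by move=> _ [i ik <-]; exact: h1.
Qed.

Lemma card_many A j k : (A #= `I_j)%card -> (k <= j)%N -> many k A.
Proof.
move=> /card_enum[e [h1 h2 _]] kj; exists e => [i ik|i i' ik i'k].
  by apply: h1; exact: leq_trans kj.
by apply: h2; exact: leq_trans kj.
Qed.

Lemma many_sub A B k : A `<=` B -> many k A -> many k B.
Proof. by move=> AB [e h1 h2]; exists e => // i ik; apply: AB; exact: h1. Qed.

Lemma card_sub A B k : A `<=` B -> (B #= `I_k)%card ->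
  exists2 j, (j <= k)%N & (A #= `I_j)%card.
Proof.
move=> AB hB.
have /finite_setP[j hA] : finite_set A.
  by apply: sub_finite_set AB _; apply/finite_setP; exists k.
exists j => //; apply: many_le hB _; apply: many_sub AB _; exact: card_many hA _.
Qed.

Lemma card_add1 A k (x : R) : (A #= `I_k)%card -> ~ A x -> (A `|` [set x] #= `I_k.+1)%card.
Proof.
move=> /card_enum[e [h1 h2 h3]] nAx.
apply: (@enum_card _ _ (fun i => if (i < k)%N then e i else x)).
- by move=> i ik; case: ifP => h; [left; exact: h1|right].
- move=> i j ik jk; case: ifP => hi; case: ifP => hj; first exact: h2.
  + by move=> exj; case: nAx; rewrite -exj; exact: h1.
  + by move=> exj; case: nAx; rewrite exj; exact: h1.
  + by move=> _; lia.
- move=> y [/h3[i ik <-]|->]; first by exists i; [lia|rewrite ik].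
  by exists k => //; rewrite ltnn.
Qed.

Lemma card_remove A k (x : R) : (A #= `I_k.+1)%card -> A x ->
  ([set y | A y /\ y <> x] #= `I_k)%card.
Proof.
move=> hA Ax.
have [j _ hj] : exists2 j, (j <= k.+1)%N & ([set y | A y /\ y <> x] #= `I_j)%card.
  by apply: card_sub hA => y [].
have h : ([set y | A y /\ y <> x] `|` [set x] #= `I_j.+1)%card.
  by apply: card_add1 => // -[].
have e : [set y | A y /\ y <> x] `|` [set x] = A.
  apply/seteqP; split => [y [[]//|->//]|y Ay].
  by case: (eqVneq y x) => [->|/eqP h']; [right|left].
by rewrite e in h; have [<-] := card_unique h hA.
Qed.

Lemma card_min A k : (A #= `I_k.+1)%card -> exists2 m, A m & forall x, A x -> m <= x.
Proof.
elim: k A => [|k IH] A hA.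
  have [e [h1 _ h3]] := card_enum hA; exists (e 0%N); first exact: h1.
  by move=> x /h3[[|i]//= _ <-].
have [e [h1 _ _]] := card_enum hA.
have hx := h1 0%N isT; set x := e 0%N in hx.
have [m [Am _] hm] := IH _ (card_remove hA hx).
exists (Num.min x m); first by rewrite /Num.min; case: ifP.
move=> y Ay; case: (eqVneq y x) => [->|/eqP h]; first by rewrite ge_min lexx.
by rewrite ge_min hm ?orbT.
Qed.

(** Stands for the minimum of finitely many positive radii. *)
Lemma small_all k (P : nat -> R -> Prop) :
  (forall i r s, P i r -> 0 < s -> s <= r -> P i s) ->
  (forall i, (i < k)%N -> exists2 r, 0 < r & P i r) ->
  exists2 r, 0 < r & forall i, (i < k)%N -> P i r.
Proof.
move=> mono; elim: k => [|k IH] h; first by exists 1.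
have [|r r0 hr] := IH; first by move=> i ik; apply: h; exact: ltnW.
have [s s0 hs] := h k (ltnSn k).
exists (Num.min r s) => [|i]; first by rewrite lt_min r0.
have m0 : 0 < Num.min r s by rewrite lt_min r0.
rewrite ltnS leq_eqVlt => /predU1P[->|ik].
  by apply: mono hs _ _ => //; rewrite ge_min lexx orbT.
by apply: mono (hr i ik) _ _ => //; rewrite ge_min lexx.
Qed.

End Counting.

(** * Finiteness and stability of simple zeros *)

Section Zeros.
Variable R : realType.
Implicit Types (y z : R -> R) (ta tb t : R) (k : nat).

Definition zero_set y := [set t | y t = 0].
Definition zeros_in y ta tb := [set t : R | ta <= t <= tb /\ y t = 0].

Lemma sign_near z t : {for t, continuous z} -> z t != 0 -> exists2 d, 0 < d &
  forall s, `|s - t| <= d -> 0 < z s * z t /\ `|z t| / 2 <= `|z s|.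
Proof.
move=> cz zt; have n0 : 0 < `|z t| / 2 by rewrite divr_gt0// normr_gt0.
have [d d0 hd] := (cts_eps _ _).1 cz _ n0.
exists (d / 2) => [|s hs]; first by rewrite divr_gt0.
have := hd s => /(_ ltac:(lra)) h.
have h2 : `|z t| / 2 <= `|z s|.
  by have := ler_normD (z t - z s) (z s); rewrite subrK distrC; lra.
split=> //.
have -> : z s * z t = z t ^+ 2 + (z s - z t) * z t by ring.
have e : `|z t| ^+ 2 = z t ^+ 2 by rewrite real_normK ?num_real.
have h3 : `|(z s - z t) * z t| < `|z t| ^+ 2 / 2.
  by rewrite normrM expr2 mulrAC ltr_pM2r// normr_gt0.
have p : 0 < `|z t| ^+ 2 by rewrite exprn_gt0// normr_gt0.
by move: h3; rewrite ltr_norml => /andP[h3 _]; lra.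
Qed.

Lemma one_zero y z (c ta tb t1 t2 : R) :
  (forall t, ta <= t <= tb -> HD y t (z t)) -> (forall t, ta <= t <= tb -> 0 < z t * c) ->
  ta <= t1 <= tb -> ta <= t2 <= tb -> y t1 = 0 -> y t2 = 0 -> t1 = t2.
Proof.
move=> hy hz.
have main s1 s2 : ta <= s1 -> s2 <= tb -> s1 < s2 -> y s1 = 0 -> y s2 = 0 -> False.
  move=> a1 a2 s12 y1 y2.
  have : y s1 * c < y s2 * c.
    apply: (HD_lt (f := fun t => y t * c) (df := fun t => z t * c) s12).
      by move=> t /andP[h1 h2]; apply: HD_cv (HD_M (hy t _) (HD_c _ _)) _; [rewrite (le_trans a1)// (le_trans h2)|ring].
    by move=> t /andP[h1 h2]; apply: hz; rewrite (le_trans a1 (ltW h1)) (le_trans (ltW h2)).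
  by rewrite y1 y2 ltxx.
move=> /andP[a1 b1] /andP[a2 b2] y1 y2.
have [h|h|//] := ltgtP t1 t2; exfalso; [exact: (main t1 t2)|exact: (main t2 t1)].
Qed.

(** Every point of the compact interval has a ball with at most one zero: near a zero y is strictly
    monotone, elsewhere it keeps its sign. *)
Lemma zeros_finite y z ta tb : (forall t, ta <= t <= tb -> HD y t (z t)) ->
  (forall t, ta <= t <= tb -> {for t, continuous z}) ->
  (forall t, ta <= t <= tb -> y t = 0 -> z t != 0) -> finite_set (zeros_in y ta tb).
Proof.
move=> hy cz hz.
have /choice[d hd] : forall t, exists d, ta <= t <= tb -> 0 < d /\
    finite_set (zeros_in y ta tb `&` ball t d).
  move=> t; case: (boolP (ta <= t <= tb)) => tt; last by exists 0.
  have [yt|yt] := eqVneq (y t) 0; last first.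
    have [d d0 hd] := sign_near (HD_cts (hy _ tt)) yt.
    exists d => _; split=> //; apply: (sub_finite_set _ (finite_set0 R)) => s /= [[_ ys]].
    rewrite /ball /= => st; have [|h _] := hd s; first by rewrite distrC ltW.
    by move: h; rewrite ys mul0r ltxx.
  have [d d0 hd] := sign_near (cz _ tt) (hz _ tt yt).
  exists d => _; split=> //; apply: (sub_finite_set _ (finite_set1 t)) => s /= [[ss ys]].
  rewrite /ball /= => st.
  move: tt ss => /andP[at_ tb'] /andP[as_ sb].
  apply: (@one_zero y z (z t) (Num.max ta (t - d)) (Num.min tb (t + d))) => //.
  - move=> r; rewrite ge_max le_min => /andP[/andP[h1 _] /andP[h2 _]]; apply: hy; by rewrite h1.
  - move=> r; rewrite ge_max le_min => /andP[/andP[_ h1] /andP[_ h2]].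
    by have [|//] := hd r; rewrite ler_norml; apply/andP; split; lra.
  - by move: st; rewrite ltr_norml ge_max le_min => /andP[h1 h2]; rewrite as_ sb /=; apply/andP; split; lra.
  - by rewrite ge_max le_min at_ tb' /=; apply/andP; split; lra.
have := @segment_compact R ta tb; rewrite compact_cover.
move=> /(_ R [set t | ta <= t <= tb] (fun t => ball t (d t)))[|t|D' hD' hc].
- by move=> t /= /hd[d0 _]; exact: ball_open.
- rewrite /= in_itv /= => tt; exists t => //=.
  by have [d0 _] := hd t tt; exact: ballxx.
have fS := finite_fset D'; move: hc fS; set S := (X in cover X _) => hc fS.
have hf : finite_set (\bigcup_(t in S) (zeros_in y ta tb `&` ball t (d t))).
  by apply: bigcup_finite => // t /= /hD'; rewrite inE => /hd[].
apply: sub_finite_set hf => t [tt yt].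
have [|s Ds st] := hc t; first by rewrite /= in_itv.
by exists s.
Qed.

(** A sum of tents around the points e i. In [zeros_stable], |yh| + g is positive on the whole
    compact interval, which gives a lower bound for |yh| off the balls without treating their
    complement. *)
Lemma bump k (e : nat -> R) (rho : R) : 0 < rho -> exists g : R -> R,
  [/\ cts g, forall t, 0 <= g t, forall i, (i < k)%N -> 0 < g (e i) &
   forall t, 0 < g t -> exists2 i, (i < k)%N & `|t - e i| < rho].
Proof.
move=> rho0; elim: k => [|k [g [cg g0 ge hg]]].
  exists (fun=> 0); split=> //; [exact: cts_c|by move=> t; rewrite ltxx].
exists (fun t => g t + Num.max 0 (rho - `|t - e k|)); split.
- apply: cts_D => // t; apply: continuous_max; first exact: cts_c.
  apply: cts_D; first exact: cts_c.
  apply: cts_N; apply: cts_abs; apply: cts_D; [exact: cts_id|exact: cts_c].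
- by move=> t; rewrite addr_ge0// le_max lexx.
- move=> i; rewrite ltnS leq_eqVlt => /predU1P[->|ik].
    by rewrite subrr normr0 subr0 ltr_wpDl// lt_max rho0 orbT.
  by rewrite ltr_pwDl ?ge// le_max lexx.
- move=> t h; case: (ltP 0 (rho - `|t - e k|)) => h2.
    by exists k => //; lra.
  have /hg[i ik hi] : 0 < g t by move: h; rewrite max_l// addr0.
  by exists i => //; exact: ltnW.
Qed.

(** Near a zero of yh a close z keeps a sign and y changes sign, so y has exactly one zero there;
    elsewhere |yh| exceeds the perturbation. The endpoint conditions prevent zeros from crossing ta
    or tb. *)
Lemma zeros_stable yh zh ta tb k :
  (forall t, ta <= t <= tb -> HD yh t (zh t)) ->
  (forall t, ta <= t <= tb -> {for t, continuous zh}) ->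
  (forall t, ta <= t <= tb -> yh t = 0 -> zh t != 0) ->
  yh ta != 0 -> yh tb != 0 -> (zeros_in yh ta tb #= `I_k)%card ->
  exists2 eps : R, 0 < eps & forall y z, (forall t, ta <= t <= tb -> HD y t (z t)) ->
    (forall t, ta <= t <= tb -> `|y t - yh t| < eps /\ `|z t - zh t| < eps) ->
    (zeros_in y ta tb #= `I_k)%card.
Proof.
move=> hy cz hz ya yb /card_enum[e [e1 e2 e3]].
have ein i : (i < k)%N -> ta < e i /\ e i < tb.
  move=> ik; have [/andP[h1 h2] h3] := e1 i ik; split.
    rewrite lt_neqAle h1 andbT; apply: contraNneq ya => ->; by rewrite h3.
  rewrite lt_neqAle h2 andbT; apply: contraNneq yb => <-; by rewrite h3.
have enz i : (i < k)%N -> zh (e i) != 0.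
  by move=> ik; have [h1 h2] := e1 i ik; exact: hz.
have [rho rho0 hrho] : exists2 rho, 0 < rho & forall i, (i < k)%N ->
    [/\ ta <= e i - rho, e i + rho <= tb,
      forall t, `|t - e i| <= rho -> 0 < zh t * zh (e i) /\ `|zh (e i)| / 2 <= `|zh t| &
      forall j, (j < k)%N -> j != i -> 2 * rho < `|e i - e j|].
  apply: small_all => [i r s [h1 h2 h3 h4] s0 sr|i ik].
    split; [lra|lra|by move=> t ht; apply: h3; lra|].
    by move=> j jk ji; have := h4 j jk ji; lra.
  have [h1 h2] := ein i ik; have [h3 _] := e1 i ik.
  have [d d0 hd] := sign_near (cz _ h3) (enz i ik).
  have [r r0 hr] : exists2 r, 0 < r & forall j, (j < k)%N -> j != i -> 2 * r < `|e i - e j|.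
    apply: small_all => [j r s h s0 sr ji|j jk]; first by have := h ji; lra.
    case: (eqVneq j i) => [_|ji]; first by exists 1.
    have p : 0 < `|e i - e j|.
      by rewrite normr_gt0 subr_eq0; apply: contra ji => /eqP /(e2 _ _ ik jk) ->.
    by exists (`|e i - e j| / 4) => [|_]; lra.
  exists (Num.min (Num.min d r) (Num.min (e i - ta) (tb - e i))).
    by rewrite !lt_min d0 r0 !subr_gt0 h1.
  set m := Num.min _ _.
  have m1 : m <= d by rewrite /m !ge_min lexx.
  have m2 : m <= r by rewrite /m !ge_min lexx orbT.
  have m3 : m <= e i - ta by rewrite /m !ge_min lexx !orbT.
  have m4 : m <= tb - e i by rewrite /m !ge_min lexx !orbT.
  split; [lra|lra|by move=> t ht; apply: hd; lra|].
  by move=> j jk ji; have := hr j jk ji; lra.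
have inn i t : (i < k)%N -> `|t - e i| <= rho -> ta <= t <= tb.
  move=> ik; have [h1 h2 _ _] := hrho i ik; rewrite ler_distl => /andP[h3 h4].
  by apply/andP; split; lra.
have rr i : `|e i + rho - e i| <= rho /\ `|e i - rho - e i| <= rho.
  rewrite addrAC subrr add0r addrAC subrr add0r normrN gtr0_norm//.
have ends i : (i < k)%N -> 0 < yh (e i + rho) * zh (e i) /\ yh (e i - rho) * zh (e i) < 0.
  move=> ik; have [_ _ h3 _] := hrho i ik; have [_ h4] := e1 i ik.
  have mono s t : `|s - e i| <= rho -> `|t - e i| <= rho -> s < t ->
      yh s * zh (e i) < yh t * zh (e i).
    move=> hs ht st.
    apply: (HD_lt (f := fun t => yh t * zh (e i)) (df := fun t => zh t * zh (e i)) st).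
      move=> r /andP[sr rt]; apply: HD_cv (HD_M (hy r _) (HD_c _ _)) _; last by ring.
      by apply: (inn i) => //; move: hs ht; rewrite !ler_distl => /andP[? ?] /andP[? ?]; apply/andP; split; lra.
    move=> r /andP[sr rt]; apply: (proj1 (h3 r _)).
    by move: hs ht; rewrite !ler_distl => /andP[? ?] /andP[? ?]; apply/andP; split; lra.
  have [r1 r2] := rr i; have r3 : `|e i - e i| <= rho by rewrite subrr normr0 ltW.
  have := mono (e i) (e i + rho) r3 r1; have := mono (e i - rho) (e i) r2 r3.
  by rewrite h4 mul0r ltrDl gtrBl => h5 h6; split; [exact: h6|exact: h5].
have [g [cg g0 ge hg]] := bump k e rho0.
have [m m0 hm] : exists2 m : R, 0 < m & forall t, ta <= t <= tb -> m <= `|yh t| + g t.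
  apply: (@cts_posmin _ (fun t => `|yh t| + g t)) => t tt.
    apply: cvgD; last exact: cg.
    exact: (@continuous_comp _ _ _ yh (fun v : R => `|v|) t (HD_cts (hy t tt)) (@norm_continuous _ _ _)).
  have [yt|yt] := eqVneq (yh t) 0.
    by have [i ik <-] := e3 t (conj tt yt); rewrite ltr_wpDl// ge.
  by rewrite ltr_pwDl// normr_gt0.
have [eps eps0 heps] : exists2 eps, 0 < eps & forall i, (i < k)%N ->
    [/\ eps <= `|zh (e i)| / 2, eps <= `|yh (e i + rho)| & eps <= `|yh (e i - rho)|].
  apply: small_all => [i r s [h1 h2 h3] s0 sr|i ik]; first by split; lra.
  have [h1 h2] := ends i ik.
  have p1 : 0 < `|yh (e i + rho)| by rewrite normr_gt0; apply: contraTneq h1 => ->; rewrite mul0r ltxx.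
  have p2 : 0 < `|yh (e i - rho)| by rewrite normr_gt0; apply: contraTneq h2 => ->; rewrite mul0r ltxx.
  have p3 : 0 < `|zh (e i)| / 2 by rewrite divr_gt0// normr_gt0 enz.
  exists (Num.min (`|zh (e i)| / 2) (Num.min `|yh (e i + rho)| `|yh (e i - rho)|)).
    by rewrite !lt_min p1 p2 p3.
  by rewrite !ge_min !lexx !orbT.
exists (Num.min eps m); first by rewrite lt_min eps0.
move=> y z hy' close.
have c1 t : ta <= t <= tb -> [/\ `|y t - yh t| < eps, `|y t - yh t| < m & `|z t - zh t| < eps].
  by move=> /close[]; rewrite !lt_min => /andP[h1 h2] /andP[h3 _].
have zsign i t : (i < k)%N -> `|t - e i| <= rho -> 0 < z t * zh (e i).
  move=> ik ht; have [_ _ h _] := hrho i ik; have [h1 h2] := h t ht.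
  have [_ _ h3] := c1 t (inn i t ik ht); have [h4 _ _] := heps i ik.
  have -> : z t * zh (e i) = zh t * zh (e i) + (z t - zh t) * zh (e i) by ring.
  have p : 0 < `|zh (e i)| by rewrite normr_gt0 enz.
  have h5 : `|(z t - zh t) * zh (e i)| < zh t * zh (e i).
    rewrite -[ltRHS](gtr0_norm h1) !normrM ltr_pM2r//; lra.
  by move: h5; rewrite ltr_norml => /andP[h5 _]; lra.
have psign (u v c : R) : 0 < v * c -> `|u - v| < `|v| -> 0 < u * c.
  move=> vc uv; have -> : u * c = v * c + (u - v) * c by ring.
  have c0 : 0 < `|c| by rewrite normr_gt0; apply: contraTneq vc => ->; rewrite mulr0 ltxx.
  have : `|(u - v) * c| < v * c by rewrite -[ltRHS](gtr0_norm vc) !normrM ltr_pM2r.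
  by rewrite ltr_norml => /andP[h _]; lra.
have /choice[tau htau] : forall i, exists t, (i < k)%N -> `|t - e i| <= rho /\ y t = 0.
  move=> i; case: (ltnP i k) => ik; last by exists 0.
  have [r1 r2] := rr i; have [E1 E2] := ends i ik; have [_ H2 H3] := heps i ik.
  have [q1 _ _] := c1 _ (inn i _ ik r1); have [q2 _ _] := c1 _ (inn i _ ik r2).
  have s1 : 0 < y (e i + rho) * zh (e i) by apply: (psign _ _ _ E1); lra.
  have E2' : 0 < yh (e i - rho) * - zh (e i) by rewrite mulrN oppr_gt0.
  have s2 : 0 < y (e i - rho) * - zh (e i) by apply: (psign _ _ _ E2'); lra.
  have [|||t tt yt] := @IVT0 _ y (e i - rho) (e i + rho).
  - lra.
  - by move=> t ht; apply: HD_cts (hy' t _); apply: (inn i) => //; rewrite ler_distl.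
  - rewrite -(@ler_pM2r _ (zh (e i) ^+ 2)); last by rewrite exprn_even_gt0// enz.
    rewrite mul0r; have := mulr_gt0 s1 s2; lra.
  by exists t => _; rewrite ler_distl.
apply: (@enum_card _ _ _ tau).
- move=> i ik; have [h1 h2] := htau i ik; split=> //; exact: inn h1.
- move=> i j ik jk tij; apply/eqP/negP => /negP ij.
  have [h1 _] := htau i ik; have [h2 _] := htau j jk.
  have [_ _ _ h3] := hrho i ik; rewrite eq_sym in ij; have := h3 j jk ij.
  rewrite tij in h1.
  have := ler_normB (tau j - e j) (tau j - e i).
  have -> : tau j - e j - (tau j - e i) = e i - e j by ring.
  lra.
- move=> t [tt yt].
  have [_ h1 _] := c1 t tt; rewrite yt sub0r normrN in h1.
  have /hg[i ik hi] : 0 < g t by have := hm t tt; lra.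
  exists i => //; have [h2 h3] := htau i ik.
  apply: (@one_zero y z (zh (e i)) (e i - rho) (e i + rho)) => //.
  + by move=> r hr; apply: hy'; apply: (inn i) => //; rewrite ler_distl.
  + by move=> r hr; apply: zsign => //; rewrite ler_distl.
  + by rewrite -ler_distl.
  + by rewrite -ler_distl ltW.
Qed.

End Zeros.

(** * Bounds for solutions with few zeros *)

Section NodalBounds.
Variable R : realType.
Implicit Types (y z a b : R -> R) (s t q : R) (k : nat).

Lemma const_sign y s t : s <= t -> (forall r, s <= r <= t -> {for r, continuous y}) ->
  (forall r, s < r < t -> y r != 0) ->
  (forall r, s <= r <= t -> 0 <= y r) \/ (forall r, s <= r <= t -> y r <= 0).
Proof.
move=> st cy nz.
case: (pselect (exists2 r, s <= r <= t & y r < 0)) => [[r1 h1 y1]|h1]; last first.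
  by left=> r hr; rewrite leNgt; apply/negP => yr; apply: h1; exists r.
right=> r2 h2; rewrite leNgt; apply/negP => y2.
have main (u v : R) : s <= u <= t -> s <= v <= t -> u <= v -> y u * y v < 0 -> False.
  move=> /andP[su ut] /andP[sv vt] uv yuv.
  have [||c /andP[uc cv] yc] := @IVT0 _ y u v uv.
  - by move=> r /andP[ur rv]; apply: cy; rewrite (le_trans su ur) (le_trans rv vt).
  - exact: ltW.
  have uc' : u < c.
    by rewrite lt_neqAle uc andbT; apply/negP => /eqP e; move: yuv; rewrite e yc mul0r ltxx.
  have cv' : c < v.
    by rewrite lt_neqAle cv andbT; apply/negP => /eqP e; move: yuv; rewrite -e yc mulr0 ltxx.
  by have := nz c; rewrite (le_lt_trans su uc') (lt_le_trans cv' vt) yc eqxx => /(_ isT).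
have [h|h] := leP r1 r2.
  by apply: (main r1 r2) => //; rewrite nmulr_rlt0.
by apply: (main r2 r1) => //; [exact: ltW|rewrite pmulr_rlt0].
Qed.

Lemma psi_ge0 q (y : R) : 0 <= y -> 0 <= psi q y.
Proof. by move=> y0; rewrite /psi mulr_ge0 ?powR_ge0. Qed.

Section Frame.
Variables (q lam Bm D T0 T1 : R) (a b : R -> R).
Hypotheses (q2 : 2 < q) (lam0 : 0 < lam) (Bm0 : 0 <= Bm) (T01 : T0 <= T1).
Hypotheses (ca : cts a) (cb : cts b).
Hypothesis a0 : forall t, T0 <= t <= T1 -> 0 <= a t <= lam ^+ 2.
Hypothesis b0 : forall t, T0 <= t <= T1 -> - Bm <= b t <= 0.

Definition solves y z s t := forall r, s <= r <= t -> sol_at q a b y z r.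

Lemma solves_opp y z s t : solves y z s t -> solves (fun r => - y r) (fun r => - z r) s t.
Proof.
move=> h r hr; have [h1 h2] := h r hr; split; first exact: HD_N.
by apply: HD_cv (HD_N h2) _; rewrite psiN; ring.
Qed.

(** On a nodal interval with y >= 0 the nonlinear term is nonpositive, so y'' <= lam^2 y bounds y
    and y' from above independently of it. The nonlinearity enters only the lower bound for y',
    where y is already bounded. *)
Lemma nodal_step (C : R) : 0 <= C -> exists2 C' : R, 0 <= C' & forall y z s t,
  T0 <= s -> s <= t -> t <= T1 -> solves y z s t -> (forall r, s < r < t -> y r != 0) ->
  `|y s| <= C -> `|z s| <= C -> `|y t| <= C' /\ `|z t| <= C'.
Proof.
move=> C0; pose d := T1 - T0.
have d0 : 0 <= d by rewrite /d subr_ge0.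
pose C1 := (C + lam * C) * expR (lam * d).
have C10 : 0 <= C1 by rewrite mulr_ge0 ?expR_ge0// addr_ge0// mulr_ge0// ltW.
pose Y := C + C1 * d.
have Y0 : 0 <= Y by rewrite addr_ge0// mulr_ge0.
have psiY : 0 <= psi q Y by exact: psi_ge0.
pose C' := C + C1 + C1 * d + Bm * psi q Y * d.
have p1 : 0 <= C1 * d by rewrite mulr_ge0.
have p2 : 0 <= Bm * psi q Y * d by rewrite !mulr_ge0.
exists C'; first by rewrite /C'; lra.
have main y z s t : T0 <= s -> s <= t -> t <= T1 -> solves y z s t ->
  (forall r, s <= r <= t -> 0 <= y r) -> `|y s| <= C -> `|z s| <= C ->
  `|y t| <= C' /\ `|z t| <= C'.
  move=> Ts st tT hs y0 ys zs.
  have zb r : s <= r <= t -> z r <= C1.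
    move=> /andP[sr rt].
    have : (z r + lam * y r) * expR (- lam * r) <= (z s + lam * y s) * expR (- lam * s).
      apply: (HD_ge (f := fun t => (z t + lam * y t) * expR (- lam * t))
       (df := fun t => (a t * y t + b t * psi q (y t) - lam ^+ 2 * y t) * expR (- lam * t)) sr).
        move=> u /andP[su ur]; have [h1 h2] := hs u ltac:(by rewrite su (le_trans ur)).
        by hd idtac; ring.
      move=> u /andP[su ur]; rewrite mulr_le0_ge0 ?expR_ge0//.
      have hu : s <= u <= t by rewrite su (le_trans ur).
      have hT : T0 <= u <= T1 by rewrite (le_trans Ts su) (le_trans ur (le_trans rt tT)).
      have /andP[_ h3] := a0 hT; have /andP[_ h4] := b0 hT.
      have h5 : a u * y u <= lam ^+ 2 * y u by rewrite ler_wpM2r// y0.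
      have h6 : b u * psi q (y u) <= 0 by apply: mulr_le0_ge0 => //; apply/psi_ge0/y0.
      lra.
    move=> h; have h2 : z r + lam * y r <= (z s + lam * y s) * expR (lam * (r - s)).
      rewrite -(ler_pM2r (expR_gt0 (- lam * r))); apply: (le_trans h).
      rewrite -mulrA -expRD le_eqVlt; apply/orP; left; apply/eqP; congr (_ * expR _); ring.
    have h3 : (z s + lam * y s) * expR (lam * (r - s)) <= C1.
      apply: (le_trans (y := (C + lam * C) * expR (lam * (r - s)))).
        rewrite ler_wpM2r ?expR_ge0//; apply: lerD; first exact: le_trans (ler_norm _) zs.
        by rewrite ler_pM2l//; exact: le_trans (ler_norm _) ys.
      rewrite ler_wpM2l//; first by rewrite addr_ge0// mulr_ge0// ltW.
      by rewrite ler_expR ler_pM2l// /d; lra.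
    have h4 : 0 <= lam * y r by apply: mulr_ge0; [exact: ltW|apply: y0; rewrite sr].
    lra.
  have yb r : s <= r <= t -> y r <= Y.
    move=> /andP[sr rt].
    have : y r - C1 * r <= y s - C1 * s.
      apply: (HD_ge (f := fun t => y t - C1 * t) (df := fun t => z t - C1) sr).
        move=> u /andP[su ur]; have [h1 _] := hs u ltac:(by rewrite su (le_trans ur)).
        by hd idtac; ring.
      by move=> u /andP[su ur]; rewrite subr_le0 zb// su (le_trans ur).
    have : C1 * (r - s) <= C1 * d by rewrite ler_wpM2l// /d; lra.
    have := le_trans (ler_norm _) ys; rewrite /Y; lra.
  have st' : s <= t <= t by rewrite st lexx.
  have zl : - C - Bm * psi q Y * d <= z t.
    have : z s + Bm * psi q Y * s <= z t + Bm * psi q Y * t.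
      apply: (HD_le (f := fun t => z t + Bm * psi q Y * t)
        (df := fun t => a t * y t + b t * psi q (y t) + Bm * psi q Y) st).
        by move=> u /hs[_ h2]; hd idtac; ring.
      move=> u /[dup] hu /andP[su ut].
      have hT : T0 <= u <= T1 by rewrite (le_trans Ts su) (le_trans ut tT).
      have /andP[h3 _] := a0 hT; have /andP[h4 h5] := b0 hT.
      have h6 : 0 <= a u * y u by rewrite mulr_ge0 ?y0.
      have h7 : psi q (y u) <= psi q Y by apply: psi_homo => //; exact: yb.
      have h8 : 0 <= psi q (y u) by apply/psi_ge0/y0.
      have h9 : - b u * psi q (y u) <= Bm * psi q Y by apply: ler_pM => //; lra.
      lra.
    have : Bm * psi q Y * (t - s) <= Bm * psi q Y * d.
      by rewrite ler_wpM2l ?mulr_ge0// /d; lra.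
    by move: zs; rewrite ler_norml => /andP[h _]; lra.
  have yt0 := y0 t st'; have yt1 := yb t st'; have zt := zb t st'.
  rewrite (ger0_norm yt0) ler_norml; split; first by move: yt1; rewrite /C' /Y; lra.
  by apply/andP; split; rewrite /C'; lra.
move=> y z s t Ts st tT hs nz ys zs.
have [|h|h] := @const_sign y s t st _ nz.
- by move=> r /hs[h _]; exact: HD_cts h.
- exact: main hs h ys zs.
have h' r : s <= r <= t -> 0 <= - y r by move=> /h; rewrite oppr_ge0.
have := main _ _ s t Ts st tT (solves_opp hs) h'.
by rewrite !normrN; apply.
Qed.

(** Iterates [nodal_step] from zero to zero, which is why the bound depends on the number of
    zeros. *)
Lemma nodal_bound_exact k (C : R) : 0 <= C -> exists2 C' : R, 0 <= C' & forall y z s t,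
  T0 <= s -> s <= t -> t <= T1 -> solves y z s t ->
  ([set r | s < r < t /\ y r = 0] #= `I_k)%card ->
  `|y s| <= C -> `|z s| <= C -> `|y t| <= C' /\ `|z t| <= C'.
Proof.
elim: k C => [|k IH] C C0.
  have [C' C'0 h] := nodal_step C0; exists C' => // y z s t Ts st tT hs hc.
  apply: h => // r hr; apply/eqP => yr.
  by have [e [_ _ h3]] := card_enum hc; have [] := h3 r (conj hr yr).
have [C1 C10 h1] := nodal_step C0; have [C2 C20 h2] := IH C1 C10.
exists C2 => // y z s t Ts st tT hs hc ys zs.
have [m [/andP[sm mt] ym] hm] := card_min hc.
have [|||||y1 z1] := h1 y z s m Ts (ltW sm).
- by rewrite (le_trans (ltW mt)).
- by move=> r /andP[r1 r2]; apply: hs; rewrite r1 (le_trans r2)// ltW.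
- move=> r /andP[r1 r2]; apply/eqP => yr.
  have := hm r; rewrite /= r1 (lt_trans r2 mt) => /(_ (conj isT yr)); lra.
- exact: ys.
- exact: zs.
apply: (h2 y z m t) => //.
- by rewrite (le_trans Ts)// ltW.
- exact: ltW.
- by move=> r /andP[r1 r2]; apply: hs; rewrite r2 (le_trans (ltW sm)).
have e : [set r | m < r < t /\ y r = 0] =
    [set r | [set r | s < r < t /\ y r = 0] r /\ r <> m].
  apply/seteqP; split=> r /=; last first.
    move=> [[/andP[sr rt] yr] rm]; split=> //; rewrite rt andbT lt_neqAle.
    apply/andP; split; first by apply/eqP => e; apply: rm.
    by apply: hm; split => //; rewrite sr.
  move=> [/andP[mr rt] yr]; split; first by rewrite rt (lt_trans sm).
  by move=> e; move: mr; rewrite e ltxx.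
rewrite e; apply: card_remove => //.
by split => //; rewrite sm.
Qed.

Lemma nodal_bound k (C : R) : 0 <= C -> exists2 C' : R, 0 <= C' & forall y z s t,
  T0 <= s -> s <= t -> t <= T1 -> solves y z s t ->
  finite_set [set r | s < r < t /\ y r = 0] -> ~ many k.+1 [set r | s < r < t /\ y r = 0] ->
  `|y s| <= C -> `|z s| <= C -> `|y t| <= C' /\ `|z t| <= C'.
Proof.
move=> C0.
have [C' C'0 h] : exists2 C' : R, 0 <= C' & forall j, (j <= k)%N -> forall y z s t,
  T0 <= s -> s <= t -> t <= T1 -> solves y z s t ->
  ([set r | s < r < t /\ y r = 0] #= `I_j)%card ->
  `|y s| <= C -> `|z s| <= C -> `|y t| <= C' /\ `|z t| <= C'.
  elim: k => [|k [C1 C10 h1]].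
    have [C1 C10 h1] := nodal_bound_exact 0 C0; exists C1 => // j; rewrite leqn0 => /eqP ->.
    exact: h1.
  have [C2 C20 h2] := nodal_bound_exact k.+1 C0.
  exists (C1 + C2) => [|j]; first exact: addr_ge0.
  rewrite leq_eqVlt => /predU1P[->|jk] y z s t Ts st tT hs hc ys zs.
    by have [h3 h4] := h2 _ _ _ _ Ts st tT hs hc ys zs; lra.
  by have [h3 h4] := h1 j jk _ _ _ _ Ts st tT hs hc ys zs; lra.
exists C' => // y z s t Ts st tT hs /finite_setP[j hj] nm.
apply: (h j) => //; rewrite leqNgt; apply/negP => kj; apply: nm; exact: card_many hj kj.
Qed.

End Frame.

(** After time h the slope is at most - kap h y(m + h); during another h the value falls by at least
    kap h^2 y(m + h) >= y(m + h), hence reaches 0. *)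
Lemma concave_hit y z (kap m h : R) : 0 < h -> 1 <= kap * h ^+ 2 ->
  (forall t, m <= t <= m + 2 * h -> HD y t (z t)) ->
  (exists w : R -> R, (forall t, m <= t <= m + 2 * h -> HD z t (w t)) /\
    forall t, m <= t <= m + 2 * h -> w t <= - kap * y t) ->
  (forall t, m <= t <= m + 2 * h -> 0 < y t) -> z m <= 0 -> False.
Proof.
move=> h0 kh hy [w [hz hw]] y0 zm.
have kap0 : 0 < kap.
  by rewrite ltNge; apply/negP => k0; have := mulr_le0_ge0 k0 (sqr_ge0 h); lra.
have znoninc s t : m <= s -> s <= t -> t <= m + 2 * h -> z t <= z s.
  move=> ms st th; apply: (HD_ge (df := w) st) => r /andP[sr rt].
    by apply: hz; rewrite (le_trans ms sr) (le_trans rt th).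
  have hr : m <= r <= m + 2 * h by rewrite (le_trans ms sr) (le_trans rt th).
  apply: (le_trans (hw r hr)); rewrite mulNr oppr_le0 mulr_ge0// ltW// y0//.
have z0 t : m <= t <= m + 2 * h -> z t <= 0.
  by move=> /andP[h1 h2]; apply: le_trans zm; exact: znoninc.
have ynoninc s t : m <= s -> s <= t -> t <= m + 2 * h -> y t <= y s.
  move=> ms st th; apply: (HD_ge (df := z) st) => r /andP[sr rt].
    by apply: hy; rewrite (le_trans ms sr) (le_trans rt th).
  by apply: z0; rewrite (le_trans ms sr) (le_trans rt th).
set Y := y (m + h).
have Y0 : 0 < Y by apply: y0; apply/andP; split; lra.
have z1 : z (m + h) <= - (kap * Y * h).
  have : z (m + h) + kap * Y * (m + h) <= z m + kap * Y * m.
    apply: (HD_ge (f := fun t => z t + kap * Y * t) (df := fun t => w t + kap * Y)); first lra.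
      move=> t /andP[t1 t2]; have h1 := hz t ltac:(by apply/andP; split; lra).
      by hd idtac; ring.
    move=> t /andP[t1 t2]; have ht : m <= t <= m + 2 * h by apply/andP; split; lra.
    have h1 := hw t ht; have h2 : kap * Y <= kap * y t by rewrite ler_pM2l// ynoninc//; lra.
    lra.
  lra.
have : y (m + 2 * h) + kap * Y * h * (m + 2 * h) <= y (m + h) + kap * Y * h * (m + h).
  apply: (HD_ge (f := fun t => y t + kap * Y * h * t) (df := fun t => z t + kap * Y * h)); first lra.
    move=> t /andP[t1 t2]; have h1 := hy t ltac:(by apply/andP; split; lra).
    by hd idtac; ring.
  move=> t /andP[t1 t2]; have := znoninc (m + h) t; lra.
have := y0 (m + 2 * h) ltac:(by apply/andP; split; lra).
have : Y <= Y * (kap * h ^+ 2) by rewrite ler_peMr// ltW.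
rewrite -/Y; lra.
Qed.

Lemma reflect_HD y z t : HD y (- t) (z (- t)) -> HD (fun s => y (- s)) t (- z (- t)).
Proof. by move=> h; apply: HD_cv (HD_comp (HD_N (HD_id t)) h) _; ring. Qed.

Lemma concave_hit_any y z w (kap m h : R) : 0 < h -> 1 <= kap * h ^+ 2 ->
  (forall t, m - 2 * h <= t <= m + 2 * h -> HD y t (z t)) ->
  (forall t, m - 2 * h <= t <= m + 2 * h -> HD z t (w t)) ->
  (forall t, m - 2 * h <= t <= m + 2 * h -> w t <= - kap * y t) ->
  (forall t, m - 2 * h <= t <= m + 2 * h -> 0 < y t) -> False.
Proof.
move=> h0 kh hy hz hw y0.
have [zm|zm] := leP (z m) 0.
  have up t : m <= t <= m + 2 * h -> m - 2 * h <= t <= m + 2 * h.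
    by move=> /andP[h1 h2]; apply/andP; split; lra.
  apply: (@concave_hit y z kap m h) => //.
  - by move=> t /up; exact: hy.
  - by exists w; split=> t /up; [exact: hz|exact: hw].
  - by move=> t /up; exact: y0.
have up t : - m <= t <= - m + 2 * h -> m - 2 * h <= - t <= m + 2 * h.
  by move=> /andP[h1 h2]; apply/andP; split; lra.
apply: (@concave_hit (fun t => y (- t)) (fun t => - z (- t)) kap (- m) h) => //.
- by move=> t /up ht; apply: reflect_HD; exact: hy.
- exists (fun t => w (- t)); split=> t /up ht; last exact: hw.
  by have := HD_N (reflect_HD (hz _ ht)); rewrite opprK.
- by move=> t /up; exact: y0.
- by rewrite opprK oppr_le0 ltW.
Qed.

(** A positive slope at t forces growth on [t - h, t], because (z + lam y) e^(- lam r) is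
    nonincreasing; as y starts nonnegative, y t is then at least a multiple of z t. A negative slope
    is treated by reflection. *)
Lemma slope_bound y z w (lam h t : R) : 0 < h -> 0 < lam ->
  (forall r, t - h <= r <= t + h -> HD y r (z r)) ->
  (forall r, t - h <= r <= t + h -> HD z r (w r)) ->
  (forall r, t - h <= r <= t + h -> w r <= lam ^+ 2 * y r) ->
  (forall r, t - h <= r <= t + h -> 0 <= y r) ->
  `|z t| <= y t * expR (2 * lam * h) / h.
Proof.
move=> h0 lam0.
have main y1 z1 w1 t1 : (forall r, t1 - h <= r <= t1 -> HD y1 r (z1 r)) ->
  (forall r, t1 - h <= r <= t1 -> HD z1 r (w1 r)) ->
  (forall r, t1 - h <= r <= t1 -> w1 r <= lam ^+ 2 * y1 r) ->
  (forall r, t1 - h <= r <= t1 -> 0 <= y1 r) -> z1 t1 <= y1 t1 * expR (2 * lam * h) / h.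
  move=> hy hz hw y0.
  have tt : t1 - h <= t1 <= t1 by apply/andP; split; lra.
  have ts : t1 - h <= t1 - h <= t1 by apply/andP; split; lra.
  have yt := y0 _ tt; have ys := y0 _ ts.
  rewrite ler_pdivlMr// .
  pose c := z1 t1 * expR (- lam * h).
  have [zt|zt] := leP (z1 t1) 0.
    apply: (le_trans (y := 0)); first by rewrite mulr_le0_ge0// ltW.
    by rewrite mulr_ge0 ?expR_ge0.
  have c0 : 0 < c by rewrite mulr_gt0 ?expR_gt0.
  have u r : t1 - h <= r <= t1 -> c <= z1 r + lam * y1 r.
    move=> /andP[r1 r2].
    have : (z1 t1 + lam * y1 t1) * expR (- lam * t1) <= (z1 r + lam * y1 r) * expR (- lam * r).
      apply: (HD_ge (f := fun t => (z1 t + lam * y1 t) * expR (- lam * t))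
        (df := fun t => (w1 t - lam ^+ 2 * y1 t) * expR (- lam * t)) r2).
        move=> v /andP[v1 v2]; have hv : t1 - h <= v <= t1 by rewrite v2 (le_trans r1).
        by have h1 := hy _ hv; have h2 := hz _ hv; hd idtac; ring.
      move=> v /andP[v1 v2]; have hv : t1 - h <= v <= t1 by rewrite v2 (le_trans r1).
      by rewrite mulr_le0_ge0 ?expR_ge0// subr_le0 hw.
    move=> H; rewrite -(ler_pM2r (expR_gt0 (- lam * r))); apply: le_trans H.
    rewrite /c -mulrA -expRD; apply: ler_pM.
    - exact: ltW.
    - exact: expR_ge0.
    - by rewrite lerDl mulr_ge0// ltW.
    - by rewrite ler_expR; have : lam * (t1 - r) <= lam * h; [rewrite ler_pM2l//; lra|lra].
  have E : y1 (t1 - h) * expR (lam * (t1 - h)) - c * expR (lam * (t1 - h)) * (t1 - h) <=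
      y1 t1 * expR (lam * t1) - c * expR (lam * (t1 - h)) * t1.
    apply: (HD_le (f := fun t => y1 t * expR (lam * t) - c * expR (lam * (t1 - h)) * t)
      (df := fun t => (z1 t + lam * y1 t) * expR (lam * t) - c * expR (lam * (t1 - h)))); first lra.
      by move=> v hv; have h1 := hy _ hv; hd idtac; ring.
    move=> v /[dup] hv /andP[v1 v2]; rewrite subr_ge0; apply: ler_pM; [exact: ltW|exact: expR_ge0|exact: u|].
    by rewrite ler_expR ler_pM2l.
  have E2 : c * expR (lam * (t1 - h)) * h <= y1 t1 * expR (lam * t1).
    have := mulr_ge0 ys (expR_ge0 (lam * (t1 - h))); lra.
  have e : z1 t1 * h = c * expR (lam * (t1 - h)) * h * expR (2 * lam * h - lam * t1).
    transitivity (z1 t1 * h * (expR (- lam * h) * expR (lam * (t1 - h)) * expR (2 * lam * h - lam * t1))).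
      rewrite -!expRD (_ : - lam * h + lam * (t1 - h) + (2 * lam * h - lam * t1) = 0); last by ring.
      by rewrite expR0 mulr1.
    by rewrite /c; ring.
  rewrite e; apply: (le_trans (y := y1 t1 * expR (lam * t1) * expR (2 * lam * h - lam * t1))).
    by rewrite ler_pM2r ?expR_gt0.
  rewrite -mulrA -expRD le_eqVlt; apply/orP; left; apply/eqP; congr (_ * expR _); ring.
move=> hy hz hw y0; rewrite ler_norml lerNl; apply/andP; split; last first.
  have up r : t - h <= r <= t -> t - h <= r <= t + h by move=> /andP[h1 h2]; apply/andP; split; lra.
  by apply: (main y z w) => r /up; [exact: hy|exact: hz|exact: hw|exact: y0].
have up r : - t - h <= r <= - t -> t - h <= - r <= t + h.
  by move=> /andP[h1 h2]; apply/andP; split; lra.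
have := main (fun s => y (- s)) (fun s => - z (- s)) (fun s => w (- s)) (- t).
rewrite opprK; apply=> r /up hr; [|..|exact: y0].
- by apply: reflect_HD; exact: hy.
- by have := HD_N (reflect_HD (hz _ hr)); rewrite opprK.
- exact: hw.
Qed.

(** A bound at some point with no assumption on the data: a solution that is large on the whole
    middle part of a nodal interval would be so concave there that it vanishes. Where it is not
    large, [slope_bound] controls the derivative. *)
Lemma calm_point q lam (l bm : R) : 2 < q -> 0 < lam -> 0 < l -> 0 < bm ->
  exists2 C : R, 0 <= C & forall a b y z (s : R),
  (forall t, s <= t <= s + l -> a t <= lam ^+ 2) -> (forall t, s <= t <= s + l -> b t <= - bm) ->
  solves q a b y z s (s + l) -> (forall t, s < t < s + l -> y t != 0) ->
  exists2 t, s <= t <= s + l & `|y t| <= C /\ `|z t| <= C.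
Proof.
move=> q2 lam0 l0 bm0.
(* The middle part has half-length 2 h, and a margin h on each side is kept for [slope_bound]. *)
pose h := l / 12; have h0 : 0 < h by rewrite divr_gt0.
pose kap := (h ^+ 2)^-1.
have h20 : 0 < h ^+ 2 by rewrite exprn_gt0.
have kap0 : 0 < kap by rewrite invr_gt0.
have kh : 1 <= kap * h ^+ 2 by rewrite mulVf ?gt_eqF.
(* When y^(q-2) >= Yp the equation gives y'' <= (lam^2 - bm Yp) y = - kap y. *)
pose Yp := (lam ^+ 2 + kap) / bm.
have Yp0 : 0 < Yp by rewrite divr_gt0// addr_gt0// exprn_gt0.
pose Y := Yp `^ ((q - 2)^-1).
have qq : 0 < q - 2 by lra.
have Y0 : 0 < Y by rewrite powR_gt0.
have YE : Y `^ (q - 2) = Yp by rewrite /Y -powRrM mulVf ?gt_eqF// powRr1// ltW.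
pose C := Y + Y * expR (2 * lam * h) / h.
have CY : 0 <= Y * expR (2 * lam * h) / h by rewrite divr_ge0 ?mulr_ge0 ?expR_ge0// ltW.
exists C; first by rewrite addr_ge0// ltW.
have main a b y z (s : R) : (forall t, s <= t <= s + l -> a t <= lam ^+ 2) ->
  (forall t, s <= t <= s + l -> b t <= - bm) -> solves q a b y z s (s + l) ->
  (forall t, s <= t <= s + l -> 0 <= y t) -> (forall t, s < t < s + l -> y t != 0) ->
  exists2 t, s <= t <= s + l & `|y t| <= C /\ `|z t| <= C.
  move=> ha hb hs y0 nz.
  have wup t : s <= t <= s + l -> a t * y t + b t * psi q (y t) <= lam ^+ 2 * y t.
    move=> tt; have h1 : a t * y t <= lam ^+ 2 * y t by rewrite ler_wpM2r ?y0 ?ha.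
    have h2 : b t * psi q (y t) <= 0.
      by rewrite mulr_le0_ge0//; [have := hb t tt; lra|apply/psi_ge0/y0].
    lra.
  pose m := s + l / 2.
  have ml : l = 12 * h by rewrite /h; field.
  have [t /andP[t1 t2] yt] : exists2 t, m - 2 * h <= t <= m + 2 * h & y t < Y.
    apply: contrapT => nex.
    have big t : m - 2 * h <= t <= m + 2 * h -> Y <= y t.
      by move=> tt; rewrite leNgt; apply/negP => yt; apply: nex; exists t.
    have inn t : m - 2 * h <= t <= m + 2 * h -> s <= t <= s + l.
      by rewrite /m => /andP[h1 h2]; apply/andP; split; lra.
    apply: (@concave_hit_any y z (fun t => a t * y t + b t * psi q (y t)) kap m h) => //.
    - by move=> t /inn /hs[].
    - by move=> t /inn /hs[].
    - move=> t /[dup] /inn tt /big yY.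
      have yt : 0 < y t by exact: lt_le_trans yY.
      have e1 : psi q (y t) = y t * y t `^ (q - 2) by rewrite /psi gtr0_norm.
      have h1 : Yp <= y t `^ (q - 2).
        by rewrite -YE; apply: ge0_ler_powR => //; rewrite ?nnegrE ltW.
      have h2 : b t * psi q (y t) <= - bm * (y t * Yp).
        rewrite e1; apply: (le_trans (y := - bm * (y t * y t `^ (q - 2)))).
          by rewrite ler_wpM2r ?hb// mulr_ge0 ?powR_ge0// ltW.
        by rewrite !mulNr lerN2 ler_pM2l// ler_pM2l.
      have h3 : a t * y t <= lam ^+ 2 * y t by rewrite ler_wpM2r ?ha ?y0.
      have h4 : bm * (y t * Yp) = (lam ^+ 2 + kap) * y t by rewrite /Yp; field; rewrite gt_eqF.
      lra.
    - by move=> t /big; exact: lt_le_trans.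
  have inn r : t - h <= r <= t + h -> s <= r <= s + l.
    by rewrite /m in t1 t2 => /andP[h1 h2]; apply/andP; split; lra.
  have tt : s <= t <= s + l by apply: inn; apply/andP; split; lra.
  exists t => //.
  have yn : `|y t| <= Y by rewrite ger0_norm ?y0// ltW.
  split; first by rewrite /C; lra.
  apply: (le_trans (y := y t * expR (2 * lam * h) / h)).
    apply: (@slope_bound y z (fun t => a t * y t + b t * psi q (y t))) => //.
    - by move=> r /inn /hs[].
    - by move=> r /inn /hs[].
    - by move=> r /inn; exact: wup.
    - by move=> r /inn; exact: y0.
  have : y t * expR (2 * lam * h) / h <= Y * expR (2 * lam * h) / h.
    by rewrite ler_pM2r ?invr_gt0// ler_pM2r ?expR_gt0// ltW.
  rewrite /C; lra.
move=> a b y z s ha hb hs nz.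
have [||h1|h1] := @const_sign y s (s + l) _ _ nz.
- by rewrite lerDl ltW.
- by move=> r /hs[h1 _]; exact: HD_cts h1.
- exact: main hs h1 nz.
have h1' t : s <= t <= s + l -> 0 <= - y t by move=> /h1; rewrite oppr_ge0.
have nz' t : s < t < s + l -> - y t != 0 by move=> /nz; rewrite oppr_eq0.
have [t tt] := main a b _ _ s ha hb (solves_opp hs) h1' nz'.
by rewrite !normrN => h2; exists t.
Qed.

(* b may vanish at T, but among k+1 equal intervals where b is bounded away from 0 one carries no zero; the
   solution is bounded at some point of it, hence at T since it has few zeros in between. *)
Lemma oscillation q a b (t0 T : R) k : 2 < q -> t0 < T -> cts a -> cts b ->
  (forall t, t0 <= t <= T -> 0 <= a t) -> (forall t, t0 <= t < T -> b t < 0) -> b T <= 0 ->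
  exists2 C : R, 0 <= C & forall y z, solves q a b y z t0 T ->
    (forall t, t0 <= t <= T -> y t = 0 -> z t != 0) ->
    ~ many k.+1 (zeros_in y t0 T) -> `|y T| <= C /\ `|z T| <= C.
Proof.
move=> q2 t0T ca cb a0 b0 bT.
have [A A0 hA] : exists2 A : R, 0 < A & forall t, t0 <= t <= T -> `|a t| <= A by apply: cts_bounded.
have [Bm Bm0 hB] : exists2 A : R, 0 < A & forall t, t0 <= t <= T -> `|b t| <= A by apply: cts_bounded.
pose lam := A + 1.
have lam0 : 0 < lam by rewrite /lam; lra.
have lamA t : t0 <= t <= T -> 0 <= a t <= lam ^+ 2.
  move=> tt; rewrite a0//=; have := hA t tt; have := ler_norm (a t).
  have := sqr_ge0 A; rewrite /lam sqrrD; lra.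
have bB t : t0 <= t <= T -> - Bm <= b t <= 0.
  move=> tt; have := hB t tt; rewrite ler_norml => /andP[-> _] /=.
  move: tt => /andP[h1]; rewrite le_eqVlt => /predU1P[->//|h2].
  by apply/ltW/b0; rewrite h1.
pose t1 := (t0 + T) / 2.
have t01 : t0 < t1 by rewrite /t1; lra.
have t1T : t1 < T by rewrite /t1; lra.
have [bm bm0 hbm] : exists2 bm : R, 0 < bm & forall t, t0 <= t <= t1 -> bm <= - b t.
  apply: (@cts_posmin _ (fun t => - b t)) => t; first by move=> _; exact: cts_N.
  by move=> /andP[h1 h2]; rewrite oppr_gt0 b0// h1 (le_lt_trans h2).
pose l := (t1 - t0) / k.+1%:R.
have k0 : 0 < k.+1%:R :> R by rewrite ltr0n.
have l0 : 0 < l by rewrite divr_gt0// subr_gt0.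
have lk : t0 + k.+1%:R * l = t1 by rewrite /l; field; rewrite gt_eqF.
have [C C0 hC] := calm_point q2 lam0 l0 bm0.
have [C' C'0 hC'] := nodal_bound q2 lam0 (ltW Bm0) (ltW t0T) lamA bB k C0.
exists C' => // y z hs simple nm.
have fin : finite_set (zeros_in y t0 T).
  apply: (@zeros_finite _ y z) => //; first by move=> t /hs[].
  by move=> t /hs[_ h]; exact: HD_cts h.
pose e i := t0 + i%:R * l.
have ein i : (i < k.+1)%N -> t0 <= e i /\ e i + l <= t1.
  move=> ik; split; first by rewrite lerDl mulr_ge0// ltW.
  rewrite -lk /e -addrA lerD2l -[X in _ + X]mul1r -mulrDl ler_pM2r//.
  by rewrite natr1 ler_nat.
have [i ik hi] : exists2 i, (i < k.+1)%N & forall t, e i < t < e i + l -> y t != 0.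
  apply: contrapT => nex; apply: nm.
  have /choice[tau htau] : forall i, exists t, (i < k.+1)%N -> e i < t < e i + l /\ y t = 0.
    move=> i; case: (ltnP i k.+1) => ik; last by exists 0.
    apply: contrapT => nt; apply: nex; exists i => // t ht; apply/eqP => yt.
    by apply: nt; exists t.
  exists tau => [i ik|i j ik jk tij].
    have [/andP[h1 h2] h3] := htau i ik; have [h4 h5] := ein i ik; split=> //.
    by apply/andP; split; lra.
  have [/andP[h1 h2] _] := htau i ik; have [/andP[h3 h4] _] := htau j jk.
  rewrite tij in h1 h2.
  have main u v : e u < tau j -> tau j < e v + l -> (u <= v)%N.
    move=> hu hv; rewrite -ltnS -(ltr_nat R) -(ltr_pM2r l0) -natr1.
    by rewrite /e in hu hv; rewrite mulrDl mul1r; lra.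
  by apply/eqP; rewrite eqn_leq !main.
have [h1 h2] := ein i ik.
have inn t : e i <= t <= e i + l -> t0 <= t <= T.
  by move=> /andP[h3 h4]; rewrite (le_trans h1 h3) (le_trans h4)// (le_trans h2)// ltW.
have [||||t tt [yt zt]] := hC a b y z (e i).
- by move=> t /inn /lamA /andP[].
- by move=> t /andP[h3 h4]; rewrite lerNr hbm// (le_trans h1 h3) (le_trans h4 h2).
- by move=> t /inn; exact: hs.
- exact: hi.
have /andP[h3 h4] := inn t tt.
have sub : [set r | t < r < T /\ y r = 0] `<=` zeros_in y t0 T.
  by move=> r [/andP[h5 h6] h7]; split=> //; rewrite (ltW h6) andbT (le_trans h3)// ltW.
apply: (hC' y z t T) => //.
- by move=> r /andP[h5 h6]; apply: hs; rewrite h6 andbT (le_trans h3 h5).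
- exact: sub_finite_set sub fin.
- by move=> h; apply: nm; exact: many_sub sub h.
Qed.

End NodalBounds.

(** * The damped equation near the origin *)

Section Lyapunov.
Variable R : realType.
Implicit Types (x p : R -> R) (s t : R).

Lemma powR_mono (x y r : R) : 0 <= r -> 0 <= x -> x <= y -> x `^ r <= y `^ r.
Proof.
by move=> r0 x0 xy; apply: ge0_ler_powR; rewrite // nnegrE// (le_trans x0).
Qed.

Lemma abs_mul_le (x y : R) : `|x * y| <= y ^+ 2 / 2 + x ^+ 2 / 2.
Proof.
have h1 := sqr_ge0 (x + y); have h2 := sqr_ge0 (x - y).
by rewrite sqrrD in h1; rewrite sqrrB in h2; rewrite ler_norml; apply/andP; split; lra.
Qed.

(** Y is where the two terms balance, B Y^(q-2) = A; beyond it the power dominates. *)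
Lemma young_quadratic (q A B : R) : 2 < q -> 0 < A -> 0 < B ->
  exists2 C : R, 0 < C & forall x : R, A * x ^+ 2 <= B * `|x| `^ q + C.
Proof.
move=> q2 A0 B0; have qq : 0 < q - 2 by lra.
pose Y := (A / B) `^ ((q - 2)^-1).
have AB : 0 < A / B by rewrite divr_gt0.
have YE : Y `^ (q - 2) = A / B by rewrite /Y -powRrM mulVf ?gt_eqF// powRr1// ltW.
have Y0 : 0 < Y by rewrite powR_gt0.
have Y20 : 0 < A * Y ^+ 2 by rewrite mulr_gt0// exprn_gt0.
exists (A * Y ^+ 2) => // x.
have xq : `|x| `^ q = x ^+ 2 * `|x| `^ (q - 2) by rewrite -mul_psi// /psi; ring.
have [xY|Yx] := leP `|x| Y.
  have : x ^+ 2 <= Y ^+ 2 by rewrite -[x ^+ 2]real_normK ?num_real// lerXn2r ?nnegrE// ltW.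
  move=> h; have h2 : A * x ^+ 2 <= A * Y ^+ 2 by rewrite ler_pM2l.
  by have := mulr_ge0 (ltW B0) (powR_ge0 `|x| q); lra.
have h : A / B <= `|x| `^ (q - 2).
  by rewrite -YE; apply: powR_mono; exact: ltW.
have h2 : B * (A / B) * x ^+ 2 <= B * `|x| `^ (q - 2) * x ^+ 2.
  by rewrite ler_wpM2r ?sqr_ge0// ler_pM2l.
have e : B * (A / B) = A by field; rewrite gt_eqF.
by rewrite e in h2; rewrite xq; lra.
Qed.

Variables (q gam cI kmin kmax C1 sa : R) (c k k' del : R -> R).
Hypotheses (q2 : 2 < q) (gam0 : 0 < gam) (cI0 : 0 < cI) (kmin0 : 0 < kmin) (C10 : 0 < C1).
Hypothesis hC1 : forall x : R, (cI + 1) / 2 * x ^+ 2 <= kmin / (2 * q) * `|x| `^ q + C1.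
Hypothesis hk : forall s, sa <= s -> HD k s (k' s).
Hypothesis kb : forall s, sa <= s -> kmin <= k s <= kmax.
Hypothesis hdel : forall s, sa <= s -> HD del s (- (`|c s - cI| + 2 / kmin * `|k' s|)).
Hypothesis del0 : forall s, sa <= s -> 0 <= del s.

Let q0 : 0 < q. Proof. by move: (q2); lra. Qed.

Definition xeq x p s :=
  HD x s (p s) /\ HD p s (- gam * p s + c s * x s - k s * psi q (x s)).

Definition energy s (x p : R) : R := p ^+ 2 / 2 - cI / 2 * x ^+ 2 + k s / q * `|x| `^ q.
(** The energy of the autonomous limit, made coercive by C1. Its derivative contains errors from c
    and k varying with s; [del] is their integral up to +oo, so the factor e^del decreases fast
    enough to absorb them. At x = p = 0 the value tends to C1 as del -> 0. *)
Definition lyap s (x p : R) : R := (energy s x p + C1) * expR (del s).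

Lemma energy_coercive s (x p : R) : sa <= s ->
  p ^+ 2 / 2 + x ^+ 2 / 2 + kmin / (2 * q) * `|x| `^ q <= energy s x p + C1.
Proof.
move=> ss; have /andP[h1 _] := kb ss; have h2 := hC1 x; have h3 := powR_ge0 `|x| q.
have h4 : kmin / q * `|x| `^ q <= k s / q * `|x| `^ q.
  by rewrite ler_wpM2r// ler_pM2r// invr_gt0.
have e : kmin / q * `|x| `^ q = kmin / (2 * q) * `|x| `^ q + kmin / (2 * q) * `|x| `^ q.
  by field; rewrite gt_eqF.
rewrite /energy; lra.
Qed.

Lemma energy_le_lyap s (x p : R) : sa <= s -> energy s x p + C1 <= lyap s x p.
Proof.
move=> ss; rewrite /lyap ler_peMr//.
  apply: le_trans (energy_coercive x p ss).
  rewrite !addr_ge0 ?divr_ge0 ?sqr_ge0// mulr_ge0 ?powR_ge0// divr_ge0 ?ltW//.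
  by rewrite mulr_gt0.
by rewrite -expR0 ler_expR del0.
Qed.

Lemma lyap_bound s (x p : R) : sa <= s -> x ^+ 2 <= 2 * lyap s x p /\ p ^+ 2 <= 2 * lyap s x p.
Proof.
move=> ss; have h1 := energy_coercive x p ss; have h2 := energy_le_lyap x p ss.
have h3 : 0 <= kmin / (2 * q) * `|x| `^ q.
  by rewrite mulr_ge0 ?powR_ge0// divr_ge0 ?ltW// mulr_gt0.
have := sqr_ge0 x; have := sqr_ge0 p; split; lra.
Qed.

(** The errors (c - cI) x p and k' |x|^q / q are bounded through [energy_coercive] by |del'| times
    energy + C1, which the derivative of e^del cancels. Only the dissipation remains. *)
Lemma HD_lyap x p s : sa <= s -> xeq x p s ->
  exists2 v, HD (fun s => lyap s (x s) (p s)) s v & v <= - gam * p s ^+ 2.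
Proof.
move=> ss [hx hp].
have hK := hk ss; have hD := hdel ss.
have hP : HD (fun s => `|x s| `^ q) s (p s * (q * psi q (x s))).
  exact: HD_comp hx (HD_pow q2 (x s)).
pose e := `|c s - cI| + 2 / kmin * `|k' s|.
exists ((- gam * p s ^+ 2 + (c s - cI) * x s * p s + k' s / q * `|x s| `^ q
   - e * (energy s (x s) (p s) + C1)) * expR (del s)).
  have hE : HD (fun s => energy s (x s) (p s)) s
     (- gam * p s ^+ 2 + (c s - cI) * x s * p s + k' s / q * `|x s| `^ q).
    rewrite /energy; eapply HD_cv.
      apply: HD_D.
        apply: HD_D; first by apply: HD_M; [exact: HD_sqr hp|exact: HD_c].
        by apply: HD_N; apply: HD_M; [exact: HD_c|exact: HD_sqr hx].
      apply: HD_M; last exact: hP.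
      by apply: HD_M; [exact: hK|exact: HD_c].
    by cbv beta; field; rewrite gt_eqF.
  rewrite /lyap; eapply HD_cv.
    by apply: HD_M; [apply: HD_D; [exact: hE|exact: HD_c]|exact: HD_exp hD].
  by cbv beta; rewrite /e; ring.
have coe := energy_coercive (x s) (p s) ss.
have E1 : (c s - cI) * x s * p s <= `|c s - cI| * (p s ^+ 2 / 2 + x s ^+ 2 / 2).
  apply: (le_trans (ler_norm _)); rewrite -mulrA normrM ler_wpM2l//.
  exact: abs_mul_le.
have E2 : k' s / q * `|x s| `^ q <= 2 / kmin * `|k' s| * (kmin / (2 * q) * `|x s| `^ q).
  have -> : 2 / kmin * `|k' s| * (kmin / (2 * q) * `|x s| `^ q) = `|k' s| * (`|x s| `^ q / q).
    by field; rewrite !gt_eqF.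
  rewrite -mulrA (mulrC _^-1) ler_wpM2r ?ler_norm// divr_ge0 ?powR_ge0// ltW//.
have X0 : 0 <= kmin / (2 * q) * `|x s| `^ q.
  by rewrite mulr_ge0 ?powR_ge0// divr_ge0 ?ltW// mulr_gt0.
have Y0 : 0 <= p s ^+ 2 / 2 + x s ^+ 2 / 2 by rewrite addr_ge0// divr_ge0 ?sqr_ge0.
have E3 : `|c s - cI| * (p s ^+ 2 / 2 + x s ^+ 2 / 2) <= `|c s - cI| * (energy s (x s) (p s) + C1).
  by rewrite ler_wpM2l//; lra.
have km0 : 0 <= 2 / kmin * `|k' s| by rewrite mulr_ge0// divr_ge0// ltW.
have E4 : 2 / kmin * `|k' s| * (kmin / (2 * q) * `|x s| `^ q) <=
    2 / kmin * `|k' s| * (energy s (x s) (p s) + C1) by rewrite ler_wpM2l//; lra.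
have d1 : 1 <= expR (del s) by rewrite -expR0 ler_expR del0.
have gp : 0 <= gam * p s ^+ 2 by rewrite mulr_ge0 ?sqr_ge0// ltW.
apply: (le_trans (y := (- gam * p s ^+ 2) * expR (del s))).
  by rewrite ler_pM2r ?expR_gt0// /e mulrDl; lra.
have : gam * p s ^+ 2 * 1 <= gam * p s ^+ 2 * expR (del s) by rewrite ler_wpM2l.
rewrite mulNr mulr1; lra.
Qed.

Lemma lyap_noninc x p s1 s2 : sa <= s1 -> s1 <= s2 -> (forall s, s1 <= s <= s2 -> xeq x p s) ->
  lyap s2 (x s2) (p s2) <= lyap s1 (x s1) (p s1).
Proof.
move=> ss1 s12 h.
have /choice[v hv] : forall s, exists v, s1 <= s <= s2 ->
    HD (fun s => lyap s (x s) (p s)) s v /\ v <= - gam * p s ^+ 2.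
  move=> s; case: (boolP (s1 <= s <= s2)) => [/[dup] hs /andP[h1 h2]|_]; last by exists 0.
  by have [v v1 v2] := HD_lyap (le_trans ss1 h1) (h s hs); exists v.
apply: (HD_ge (f := fun s => lyap s (x s) (p s)) (df := v) s12) => s /hv[h1 h2] //.
by apply: (le_trans h2); rewrite mulNr oppr_le0 mulr_ge0 ?sqr_ge0// ltW.
Qed.

(** An orbit that has fallen below C1 can therefore have no further zero. *)
Lemma lyap_at_zero s (p : R) : sa <= s -> C1 <= lyap s 0 p.
Proof.
move=> ss; apply: le_trans (energy_le_lyap 0 p ss); rewrite /energy.
rewrite normr0 powR0 ?gt_eqF// expr0n /= !mulr0 subr0 addr0 lerDr.
by rewrite divr_ge0// sqr_ge0.
Qed.

(** Once below C1 the energy stays at most - d, and only the term - cI x^2 / 2 can make it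
    negative. *)
Lemma lyap_small_away x p s0 : sa <= s0 -> (forall s, s0 <= s -> xeq x p s) ->
  lyap s0 (x s0) (p s0) < C1 -> exists2 m : R, 0 < m & forall s, s0 <= s -> m <= `|x s|.
Proof.
move=> ss0 h V0.
pose d := C1 - lyap s0 (x s0) (p s0).
have d0 : 0 < d by rewrite subr_gt0.
have dc : 0 < 2 * d / cI by rewrite divr_gt0// mulr_gt0.
exists (Num.sqrt (2 * d / cI)); first by rewrite sqrtr_gt0.
move=> s s0s; have ss := le_trans ss0 s0s.
have V1 : lyap s (x s) (p s) <= lyap s0 (x s0) (p s0).
  by apply: lyap_noninc => // r /andP[r1 _]; exact: h.
have E1 := energy_le_lyap (x s) (p s) ss.
have k0 : 0 <= k s / q * `|x s| `^ q.
  have /andP[h1 _] := kb ss; rewrite mulr_ge0 ?powR_ge0// divr_ge0 ?ltW//.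
  exact: lt_le_trans h1.
have h1 : d <= cI / 2 * x s ^+ 2.
  by have := sqr_ge0 (p s); move: E1 k0 V1; rewrite /energy /d; lra.
rewrite -sqrtr_sqr ler_sqrt ?sqr_ge0//.
rewrite ler_pdivrMr//; lra.
Qed.

Lemma lyap_continuous s (x0 p0 e : R) : 0 < e -> exists2 d : R, 0 < d & forall x p : R,
  `|x - x0| < d -> `|p - p0| < d -> `|lyap s x p - lyap s x0 p0| < e.
Proof.
move=> e0.
pose f (x : R) := (k s / q * `|x| `^ q - cI / 2 * x ^+ 2 + C1) * expR (del s).
pose g (p : R) := p ^+ 2 / 2 * expR (del s).
have lE (x p : R) : lyap s x p = f x + g p by rewrite /lyap /energy /f /g; ring.
have cf : cts f.
  apply: (@cts_HD _ _ (fun x : R => (k s / q * (q * psi q x) - cI / 2 * (2 * x)) * expR (del s))) => x.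
  have h := HD_pow q2 x; rewrite /f.
  eapply HD_cv.
    apply: HD_M; last exact: HD_c.
    apply: HD_D; last exact: HD_c.
    apply: HD_D; first by apply: HD_M; [exact: HD_c|exact: h].
    by apply: HD_N; apply: HD_M; [exact: HD_c|exact: HD_sqr (HD_id x)].
  by cbv beta; ring.
have cg : cts g.
  apply: (@cts_HD _ _ (fun p : R => p * expR (del s))) => p.
  by rewrite /g; hd idtac; field.
have e2 : 0 < e / 2 by lra.
have [d1 d10 h1] := (cts_eps _ _).1 (cf x0) _ e2.
have [d2 d20 h2] := (cts_eps _ _).1 (cg p0) _ e2.
exists (Num.min d1 d2) => [|x p]; first by rewrite lt_min d10.
rewrite !lt_min => /andP[/h1 H1 _] /andP[_ /h2 H2].
rewrite !lE; have -> : f x + g p - (f x0 + g p0) = (f x - f x0) + (g p - g p0) by ring.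
apply: (le_lt_trans (ler_normD _ _)); lra.
Qed.

(** Half of (x^2)' + gam x^2. It vanishes at the zeros of x, and near the saddle it is nondecreasing
    along orbits, because c - k |x|^(q-2) is positive there. *)
Definition virial s (x p : R -> R) : R := x s * p s + gam / 2 * x s ^+ 2.

Lemma HD_virial x p s : xeq x p s ->
  HD (fun s => virial s x p) s (p s ^+ 2 + (c s - k s * `|x s| `^ (q - 2)) * x s ^+ 2).
Proof.
by move=> [hx hp]; rewrite /virial; hd idtac; rewrite /psi; field.
Qed.

Variables (sl r0 : R).
Hypotheses (sasl : sa <= sl) (r00 : 0 < r0).
Hypothesis r0small : kmax * r0 `^ (q - 2) <= cI / 4.
Hypothesis cclose : forall s, sl <= s -> `|c s - cI| <= cI / 4.
Hypothesis delsmall : forall s, sl <= s -> C1 * del s <= cI * r0 ^+ 2 / 32.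

Let up s : sl <= s -> sa <= s. Proof. exact: le_trans. Qed.

(** The Lyapunov loss during an excursion of |x| from r0 / 2 to r0: with speed at least p0 = sqrt cI
    r0 / 4, the dissipation gam p^2 integrates to at least gam p0 times the distance r0 / 2. *)
Definition drop : R := gam * (Num.sqrt cI * r0 / 4) * (r0 / 2).

Lemma drop_gt0 : 0 < drop.
Proof. by rewrite !mulr_gt0 ?invr_gt0 ?sqrtr_gt0. Qed.

Lemma coef_pos s (x : R) : sl <= s -> `|x| <= r0 -> cI / 2 <= c s - k s * `|x| `^ (q - 2).
Proof.
move=> ss xr; have := cclose ss; rewrite ler_norml => /andP[h1 _].
have /andP[k1 k2] := kb (up ss).
have h2 : `|x| `^ (q - 2) <= r0 `^ (q - 2) by apply: powR_le => //; move: (q2); lra.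
have h3 : k s * `|x| `^ (q - 2) <= kmax * r0 `^ (q - 2).
  by apply: ler_pM => //; apply: le_trans k1; exact: ltW.
by move: (r0small) => h4; lra.
Qed.

Lemma lyap_lower s (x p : R) : sl <= s -> C1 <= lyap s x p -> - (cI * r0 ^+ 2 / 32) <= energy s x p.
Proof.
move=> ss h; have h2 := delsmall ss; rewrite /lyap in h.
have h3 := expR_ge1Dx (- del s).
have : C1 * expR (- del s) <= energy s x p + C1.
  rewrite -(ler_pM2r (expR_gt0 (del s))) -mulrA -expRD addNr expR0 mulr1//.
have : C1 * (1 + - del s) <= C1 * expR (- del s) by rewrite ler_pM2l.
lra.
Qed.

(** At a level not below C1 the energy is at least - cI r0^2 / 32. For |x| <= r0 the power term
    takes at most half of cI x^2 / 2, and x^2 >= r0^2 / 4, so p^2 / 2 >= cI r0^2 / 16 - cI r0^2 /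
    32. *)
Lemma speed_lower s (x p : R) : sl <= s -> C1 <= lyap s x p -> r0 / 2 <= `|x| <= r0 ->
  (Num.sqrt cI * r0 / 4) ^+ 2 <= p ^+ 2.
Proof.
move=> ss /(lyap_lower ss); rewrite /energy => h /andP[x1 x2].
have -> : (Num.sqrt cI * r0 / 4) ^+ 2 = cI * r0 ^+ 2 / 16.
  by rewrite !exprMn sqr_sqrtr ?ltW//; field.
have xq : `|x| `^ q = x ^+ 2 * `|x| `^ (q - 2) by rewrite -mul_psi// /psi; ring.
have x20 := sqr_ge0 x.
have hx : r0 ^+ 2 / 4 <= x ^+ 2.
  have -> : r0 ^+ 2 / 4 = (r0 / 2) ^+ 2 by field.
  by rewrite -[leRHS]real_normK ?num_real// lerXn2r ?nnegrE// divr_ge0// ltW.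
have /andP[k1 k2] := kb (up ss).
have h2 : `|x| `^ (q - 2) <= r0 `^ (q - 2) by apply: powR_le => //; move: (q2); lra.
have h3 : k s * `|x| `^ (q - 2) <= cI / 4.
  apply: le_trans (r0small).
  by apply: ler_pM => //; apply: le_trans k1; exact: ltW.
have h4 : k s / q * `|x| `^ q <= cI / 4 * x ^+ 2.
  rewrite xq; have -> : k s / q * (x ^+ 2 * `|x| `^ (q - 2)) = k s * `|x| `^ (q - 2) * x ^+ 2 / q.
    by ring.
  rewrite ler_pdivrMr//.
  have e1 : k s * `|x| `^ (q - 2) * x ^+ 2 <= cI / 4 * x ^+ 2 by rewrite ler_wpM2r.
  have e2 : cI / 4 * x ^+ 2 * 1 <= cI / 4 * x ^+ 2 * q.
    rewrite ler_wpM2l//; last by move: (q2); lra.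
    by rewrite mulr_ge0// divr_ge0// ltW.
  lra.
have h5 : cI * (r0 ^+ 2 / 4) <= cI * x ^+ 2 by rewrite ler_pM2l.
lra.
Qed.

(** The speed bound keeps p from changing sign, and x increases, so p >= p0 throughout; then lyap +
    gam p0 x is nonincreasing. *)
Lemma drop_positive x p s1 s2 : sl <= s1 -> s1 <= s2 -> (forall s, s1 <= s <= s2 -> xeq x p s) ->
  C1 <= lyap s2 (x s2) (p s2) -> (forall s, s1 <= s <= s2 -> r0 / 2 <= x s <= r0) ->
  x s1 = r0 / 2 -> x s2 = r0 -> drop <= lyap s1 (x s1) (p s1) - lyap s2 (x s2) (p s2).
Proof.
move=> ss1 s12 h V2 hx x1 x2.
pose p0 := Num.sqrt cI * r0 / 4.
have p00 : 0 < p0 by rewrite !mulr_gt0 ?invr_gt0 ?sqrtr_gt0.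
have Vs s : s1 <= s <= s2 -> C1 <= lyap s (x s) (p s).
  move=> /andP[h1 h2]; apply: (le_trans V2); apply: lyap_noninc => //.
    by apply: up; apply: le_trans h1.
  by move=> r /andP[r1 r2]; apply: h; rewrite (le_trans h1).
have psq s : s1 <= s <= s2 -> p0 ^+ 2 <= p s ^+ 2.
  move=> /[dup] hs /andP[h1 h2]; apply: (speed_lower (le_trans ss1 h1) (Vs s hs)).
  by have /andP[h3 h4] := hx s hs; rewrite ger0_norm ?h3// (le_trans _ h3)// divr_ge0// ltW.
have s12' : s1 < s2.
  rewrite lt_neqAle s12 andbT; apply/negP => /eqP e; rewrite e x2 in x1; move: (r00); lra.
have ppos : forall s, s1 <= s <= s2 -> p0 <= p s.
  have pnz s : s1 < s < s2 -> p s != 0.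
    move=> /andP[h1 h2]; apply/eqP => e; have := psq s (introT andP (conj (ltW h1) (ltW h2))); rewrite e expr0n /=.
    by have := exprn_gt0 2 p00; lra.
  have [|h1|h1] := @const_sign _ p s1 s2 s12 _ pnz.
  - by move=> s /h[_ hp]; exact: HD_cts hp.
  - move=> s hs; have := psq s hs; rewrite -[leRHS]real_normK ?num_real//.
    by rewrite (ger0_norm (h1 s hs)) ler_sqr ?nnegrE ?h1// ltW.
  - have : x s2 <= x s1.
      apply: (HD_ge (df := p) s12); first by move=> s /h[].
      exact: h1.
    by rewrite x1 x2; move: (r00); lra.
have /choice[v hv] : forall s, exists v, s1 <= s <= s2 ->
    HD (fun s => lyap s (x s) (p s)) s v /\ v <= - gam * p s ^+ 2.
  move=> s; case: (boolP (s1 <= s <= s2)) => [/[dup] hs /andP[h1 h2]|_]; last by exists 0.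
  by have [v v1 v2] := HD_lyap (up (le_trans ss1 h1)) (h s hs); exists v.
have : lyap s2 (x s2) (p s2) + gam * p0 * x s2 <= lyap s1 (x s1) (p s1) + gam * p0 * x s1.
  apply: (HD_ge (f := fun s => lyap s (x s) (p s) + gam * p0 * x s)
    (df := fun s => v s + gam * p0 * p s) s12).
    move=> s hs; have [h1 _] := hv s hs; have [h2 _] := h s hs.
    by apply: HD_cv (HD_D h1 (HD_M (HD_c _ _) h2)) _; ring.
  move=> s hs; have [_ h2] := hv s hs; have h3 := ppos s hs.
  have : gam * (p0 * p s) <= gam * (p s * p s).
    by rewrite ler_pM2l// ler_pM2r//; exact: lt_le_trans h3.
  lra.
rewrite x1 x2 /drop -/p0; lra.
Qed.

Lemma xeq_opp x p s : xeq x p s -> xeq (fun s => - x s) (fun s => - p s) s.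
Proof.
move=> [hx hp]; split; first exact: HD_N.
by apply: HD_cv (HD_N hp) _; rewrite psiN; ring.
Qed.

Lemma lyapN s (x p : R) : lyap s (- x) (- p) = lyap s x p.
Proof. by rewrite /lyap /energy !sqrrN normrN. Qed.

Lemma lyap_drop x p s1 s2 : sl <= s1 -> s1 <= s2 -> (forall s, s1 <= s <= s2 -> xeq x p s) ->
  C1 <= lyap s2 (x s2) (p s2) -> `|x s1| <= r0 / 2 -> r0 <= `|x s2| ->
  drop <= lyap s1 (x s1) (p s1) - lyap s2 (x s2) (p s2).
Proof.
move=> ss1 s12 h V2 x1 x2.
have cx s : s1 <= s <= s2 -> {for s, continuous (fun s => `|x s|)}.
  move=> /h[hx _]; exact: (@continuous_comp _ _ _ x (fun v : R => `|v|) s (HD_cts hx) (@norm_continuous _ _ _)).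
have r2 : r0 / 2 < r0 by move: (r00); lra.
have [|||t1 /andP[t11 t12] [xt1 pos1]] := @last_nonpos _ (fun s => `|x s| - r0 / 2) s1 s2 s12.
- by move=> s /cx cs; apply: cvgD; [exact: cs|exact: cvg_cst].
- by rewrite subr_le0.
- by rewrite subr_gt0 (lt_le_trans r2).
have xt1' : `|x t1| = r0 / 2 by apply/eqP; rewrite -subr_eq0 xt1.
(* In reversed time [last_nonpos] gives the first arrival at r0 after the last exit t1 from r0 /
   2. *)
have [||||t2' /andP[t21 t22] [xt2 pos2]] := @last_nonpos _ (fun s => r0 - `|x (- s)|) (- s2) (- t1).
- by rewrite lerN2 ltW.
- move=> s /andP[h1 h2]; apply: cvgD; first exact: cvg_cst.
  apply: cvgN.
  have hs : s1 <= - s <= s2 by apply/andP; split; lra.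
  have [hx _] := h _ hs; have hd := HD_comp (HD_N (HD_id s)) hx.
  exact: (@continuous_comp _ _ _ (fun s => x (- s)) (fun v : R => `|v|) s (HD_cts hd) (@norm_continuous _ _ _)).
- by rewrite opprK subr_le0.
- by rewrite opprK xt1' subr_gt0.
pose t2 := - t2'.
have xt2' : `|x t2| = r0 by apply/esym/eqP; rewrite -subr_eq0; apply/eqP.
have t12' : t1 < t2 by rewrite /t2; lra.
have t2s2 : t2 <= s2 by rewrite /t2; lra.
have rng s : t1 <= s <= t2 -> r0 / 2 <= `|x s| <= r0.
  move=> /andP[h1 h2]; apply/andP; split.
    move: h1; rewrite le_eqVlt => /predU1P[<-|h1]; first by rewrite xt1'.
    by have := pos1 s; rewrite h1 (le_trans h2) // => /(_ isT); rewrite subr_gt0 => /ltW.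
  move: h2; rewrite le_eqVlt => /predU1P[->|h2]; first by rewrite xt2'.
  have := pos2 (- s); rewrite opprK => H.
  have /H : t2' < - s <= - t1 by rewrite /t2 in h2; apply/andP; split; lra.
  by rewrite subr_gt0 => /ltW.
have inn s : t1 <= s <= t2 -> s1 <= s <= s2.
  by move=> /andP[h1 h2]; apply/andP; split; lra.
have Vt2 : C1 <= lyap t2 (x t2) (p t2).
  apply: (le_trans V2); apply: lyap_noninc => //; first by apply: up; lra.
  by move=> s /andP[h1 h2]; apply: h; apply/andP; split; lra.
have Vt2' : lyap s2 (x s2) (p s2) <= lyap t2 (x t2) (p t2).
  apply: lyap_noninc => //; first by apply: up; lra.
  by move=> s /andP[h1 h2]; apply: h; apply/andP; split; lra.
have Vt1 : lyap t1 (x t1) (p t1) <= lyap s1 (x s1) (p s1).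
  apply: lyap_noninc => //; first by apply: up.
  by move=> s /andP[h1 h2]; apply: h; apply/andP; split; lra.
suff : drop <= lyap t1 (x t1) (p t1) - lyap t2 (x t2) (p t2) by lra.
have slt1 : sl <= t1 by exact: le_trans t11.
have nz s : t1 < s < t2 -> x s != 0.
  move=> /andP[h1 h2]; have /andP[h3 _] := rng s ltac:(by rewrite !ltW).
  by rewrite -normr_gt0; apply: lt_le_trans h3; rewrite divr_gt0.
have t11' : t1 <= t1 <= t2 by rewrite lexx ltW.
have t22' : t1 <= t2 <= t2 by rewrite lexx ltW.
have [|h1|h1] := @const_sign _ x t1 t2 (ltW t12') _ nz.
- by move=> s /inn /h[hx _]; exact: HD_cts hx.
- apply: drop_positive => //; [exact: ltW|by move=> s /inn; exact: h| | |].
  + by move=> s hs; have := rng s hs; rewrite (ger0_norm (h1 s hs)).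
  + by rewrite -(ger0_norm (h1 t1 t11')).
  + by rewrite -(ger0_norm (h1 t2 t22')).
- rewrite -lyapN -[X in _ <= _ - X]lyapN.
  apply: (@drop_positive (fun s => - x s) (fun s => - p s)) => //; [exact: ltW| | | | |].
  + by move=> s /inn /h /xeq_opp.
  + by rewrite lyapN.
  + by move=> s hs; have := rng s hs; rewrite (ler0_norm (h1 s hs)).
  + by rewrite -(ler0_norm (h1 t1 t11')).
  + by rewrite -(ler0_norm (h1 t2 t22')).
Qed.

(** Otherwise virial + (2 / gam) lyap would decrease at a positive rate forever while staying
    bounded. By the energy identity virial' = 2 p^2 + (c - cI) x^2 - 2 energy - (1 - 2/q) k |x|^q;
    the dissipation of the second term cancels 2 p^2, the energy is nearly nonnegative, and the last
    term is bounded away from 0. *)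
Lemma not_trapped_away x p s0 : limp del 0 -> limp c cI -> sl <= s0 ->
  (forall s, s0 <= s -> xeq x p s) -> (forall s, s0 <= s -> C1 <= lyap s (x s) (p s)) ->
  exists2 s, s0 <= s & `|x s| < r0 / 2.
Proof.
move=> dl cl ss0 h hV; apply: contrapT => nex.
have far s : s0 <= s -> r0 / 2 <= `|x s|.
  by move=> hs; rewrite leNgt; apply/negP => xs; apply: nex; exists s.
pose V0 := lyap s0 (x s0) (p s0).
have Vb s : s0 <= s -> lyap s (x s) (p s) <= V0.
  move=> hs; apply: lyap_noninc => //; first exact: up.
  by move=> r /andP[r1 _]; exact: h.
have V00 : 0 < V0 by apply: lt_le_trans (hV s0 (lexx _)).
(* A lower bound of the good term; each of the two errors will be at most rho / 4. *)
pose rho := (1 - 2 / q) * kmin * (r0 / 2) `^ q.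
have rho0 : 0 < rho.
  rewrite !mulr_gt0 ?powR_gt0 ?divr_gt0//.
  by rewrite subr_gt0 ltr_pdivrMr// mul1r.
have [|N1 hN1] := dl (rho / (8 * C1)); first by rewrite divr_gt0// mulr_gt0.
have [|N2 hN2] := cl (rho / (8 * V0)); first by rewrite divr_gt0// mulr_gt0.
pose t := Num.max s0 (Num.max N1 N2).
have ts0 : s0 <= t by rewrite le_max lexx.
have tN1 : N1 <= t by rewrite !le_max lexx orbT.
have tN2 : N2 <= t by rewrite !le_max lexx !orbT.
have /choice[v hv] : forall s, exists v, t <= s ->
    HD (fun s => lyap s (x s) (p s)) s v /\ v <= - gam * p s ^+ 2.
  move=> s; case: (leP t s) => hs; last by exists 0.
  have s0s := le_trans ts0 hs.
  by have [v v1 v2] := HD_lyap (up (le_trans ss0 s0s)) (h s s0s); exists v.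
pose G s := - (virial s x p + 2 / gam * lyap s (x s) (p s)).
pose G' s := - (p s ^+ 2 + (c s - k s * `|x s| `^ (q - 2)) * x s ^+ 2 + 2 / gam * v s).
apply: (@unbounded_growth _ G G' t (rho / 2) ((2 + gam + 2 / gam) * V0)).
- by rewrite divr_gt0.
- move=> s hs; have [h1 _] := hv s hs; have h2 := HD_virial (h s (le_trans ts0 hs)).
  by rewrite /G; apply: HD_cv (HD_N (HD_D h2 (HD_M (HD_c _ _) h1))) _; rewrite /G'; ring.
- move=> s hs; have s0s := le_trans ts0 hs; have sls := le_trans ss0 s0s.
  have [_ hvs] := hv s hs.
  have Es : - (C1 * del s) <= energy s (x s) (p s).
    have := hV s s0s; rewrite /lyap => h1.
    have : C1 * expR (- del s) <= energy s (x s) (p s) + C1.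
      by rewrite -(ler_pM2r (expR_gt0 (del s))) -mulrA -expRD addNr expR0 mulr1.
    have : C1 * (1 + - del s) <= C1 * expR (- del s) by rewrite ler_pM2l// expR_ge1Dx.
    lra.
  have D1 : C1 * del s <= rho / 8.
    have := hN1 s (le_trans tN1 hs); rewrite subr0 ltr_norml => /andP[_ h1].
    have -> : rho / 8 = C1 * (rho / (8 * C1)) by field; rewrite gt_eqF.
    by rewrite ler_pM2l// ltW.
  have [x2 p2] := lyap_bound (x s) (p s) (up sls).
  have Vs := Vb s s0s.
  have D2 : (c s - cI) * x s ^+ 2 <= rho / 4.
    have := hN2 s (le_trans tN2 hs) => h1.
    apply: (le_trans (ler_norm _)); rewrite normrM (ger0_norm (sqr_ge0 (x s))).
    have -> : rho / 4 = rho / (8 * V0) * (2 * V0) by field; rewrite gt_eqF.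
    by apply: ler_pM; [exact: normr_ge0|exact: sqr_ge0|exact: ltW|lra].
  have xq : `|x s| `^ q = x s ^+ 2 * `|x s| `^ (q - 2) by rewrite -mul_psi// /psi; ring.
  have D3 : rho <= (1 - 2 / q) * (k s * `|x s| `^ q).
    rewrite /rho -mulrA; have /andP[k1 _] := kb (up sls).
    rewrite ler_pM2l; last by rewrite subr_gt0 ltr_pdivrMr// mul1r.
    apply: ler_pM; [exact: ltW|exact: powR_ge0|exact: k1|].
    by apply: powR_mono; [exact: ltW|rewrite divr_ge0// ltW|exact: far].
  have D4 : 2 / gam * v s <= - 2 * p s ^+ 2.
    have -> : - 2 * p s ^+ 2 = 2 / gam * (- gam * p s ^+ 2) by field; rewrite gt_eqF.
    by rewrite ler_pM2l// divr_gt0.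
  have key : (c s - k s * `|x s| `^ (q - 2)) * x s ^+ 2 =
      (c s - cI) * x s ^+ 2 + p s ^+ 2 - 2 * energy s (x s) (p s)
      - (1 - 2 / q) * (k s * `|x s| `^ q).
    by rewrite /energy xq; field; rewrite gt_eqF.
  rewrite /G' key; lra.
- move=> s hs; have s0s := le_trans ts0 hs; have sls := le_trans ss0 s0s.
  have [x2 p2] := lyap_bound (x s) (p s) (up sls).
  have Vs := Vb s s0s; have Vp := hV s s0s.
  rewrite /G normrN /virial; apply: (le_trans (ler_normD _ _)).
  have g2 : 0 < 2 / gam by rewrite divr_gt0.
  have V0s : 0 <= lyap s (x s) (p s) by apply: le_trans Vp; exact: ltW.
  rewrite [X in _ + X]normrM (gtr0_norm g2) (ger0_norm V0s).
  have e1 : 2 / gam * lyap s (x s) (p s) <= 2 / gam * V0 by rewrite ler_pM2l.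
  have e2 : `|x s * p s + gam / 2 * x s ^+ 2| <= 2 * V0 + gam * V0.
    apply: (le_trans (ler_normD _ _)); apply: lerD.
      by apply: (le_trans (abs_mul_le _ _)); lra.
    have gx : 0 <= gam / 2 * x s ^+ 2 by rewrite mulr_ge0 ?sqr_ge0// divr_ge0// ltW.
    rewrite (ger0_norm gx).
    have : gam * x s ^+ 2 <= gam * (2 * V0) by rewrite ler_pM2l//; lra.
    lra.
  lra.
Qed.

(** Each excursion to r0 costs [drop], so none is possible once the Lyapunov function is within
    [drop] of its infimum. *)
Lemma eventually_small x p s0 : limp del 0 -> limp c cI -> sl <= s0 ->
  (forall s, s0 <= s -> xeq x p s) -> (forall s, s0 <= s -> C1 <= lyap s (x s) (p s)) ->
  exists2 s1, s0 <= s1 & forall s, s1 <= s -> `|x s| < r0.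
Proof.
move=> dl cl ss0 h hV.
pose S := [set lyap s (x s) (p s) | s in [set s | s0 <= s]].
have hS : has_inf S.
  split; first by exists (lyap s0 (x s0) (p s0)), s0 => /=.
  by exists C1 => _ [s /= hs <-]; exact: hV.
have [_ [s1 /= h1 <-] V1] := inf_adherent drop_gt0 hS.
have inner s2 : s1 <= s2 -> exists2 s, s2 <= s & `|x s| < r0 / 2.
  move=> h2; have s02 := le_trans h1 h2; apply: not_trapped_away => //.
  - exact: le_trans s02.
  - by move=> s hs; apply: h; exact: le_trans hs.
  - by move=> s hs; apply: hV; exact: le_trans hs.
have [s2 h2 x2] := inner s1 (lexx _).
have s02 := le_trans h1 h2.
exists s2 => // s s2s; rewrite ltNge; apply/negP => xs.
have s0s := le_trans s02 s2s.
have := @lyap_drop x p s2 s (le_trans ss0 s02) s2s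
  (fun r hr => h r (le_trans s02 (proj1 (andP hr)))) (hV s s0s) (ltW x2) xs.
have V2 : lyap s2 (x s2) (p s2) <= lyap s1 (x s1) (p s1).
  apply: lyap_noninc => //; first by apply: up; exact: le_trans h1.
  by move=> r /andP[r1 _]; apply: h; exact: le_trans r1.
have : inf S <= lyap s (x s) (p s) by apply: (ge_inf (proj2 hS)); exists s.
lra.
Qed.

Lemma virial_nondecr x p s1 s2 : sl <= s1 -> s1 <= s2 -> (forall s, s1 <= s <= s2 -> xeq x p s) ->
  (forall s, s1 <= s <= s2 -> `|x s| <= r0) -> virial s1 x p <= virial s2 x p.
Proof.
move=> ss1 s12 h hx; apply: (HD_le (f := fun s => virial s x p) s12) => s hs.
  exact: HD_virial (h s hs).
rewrite addr_ge0 ?sqr_ge0// mulr_ge0 ?sqr_ge0//.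
have /andP[h1 _] := hs.
apply: le_trans (coef_pos (le_trans ss1 h1) (hx s hs)); rewrite divr_ge0// ltW//.
Qed.

Lemma virial_incr x p s1 s2 : sl <= s1 -> s1 < s2 -> (forall s, s1 <= s <= s2 -> xeq x p s) ->
  (forall s, s1 <= s <= s2 -> `|x s| <= r0) -> (forall s, s1 <= s <= s2 -> x s = 0 -> p s != 0) ->
  virial s1 x p < virial s2 x p.
Proof.
move=> ss1 s12 h hx nz; apply: (HD_lt (f := fun s => virial s x p) s12) => s hs.
  exact: HD_virial (h s hs).
move: hs => /andP[h1 h2]; have hs : s1 <= s <= s2 by rewrite !ltW.
have c0 : 0 < c s - k s * `|x s| `^ (q - 2).
  apply: lt_le_trans (coef_pos (le_trans ss1 (ltW h1)) (hx s hs)); rewrite divr_gt0//.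
have [x0|x0] := eqVneq (x s) 0.
  by rewrite x0 expr0n mulr0 addr0 exprn_even_gt0// nz.
by rewrite ltr_wpDl ?sqr_ge0// mulr_gt0// exprn_even_gt0.
Qed.

(** A positive value q1 would persist; then (x^2)' + gam x^2 >= 2 q1 keeps x^2 away from 0, so the
    virial would grow at least linearly, although the Lyapunov function bounds it. *)
Lemma virial_nonpos x p s1 : sl <= s1 -> (forall s, s1 <= s -> xeq x p s) ->
  (forall s, s1 <= s -> `|x s| <= r0) -> forall s, s1 <= s -> virial s x p <= 0.
Proof.
move=> ss1 h hx sg hsg; rewrite leNgt; apply/negP => Q0.
set q1 := virial sg x p in Q0.
have ssg := le_trans ss1 hsg.
have Qge s : sg <= s -> q1 <= virial s x p.
  move=> hs; apply: virial_nondecr => // r /andP[r1 _]; [apply: h|apply: hx]; exact: le_trans r1.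
pose w := 2 * q1 / gam.
have w0 : 0 < w by rewrite divr_gt0// mulr_gt0.
have grow s : sg <= s -> w - w * expR (- gam * (s - sg)) <= x s ^+ 2.
  move=> hs.
  have : (x sg ^+ 2 - w) * expR (gam * sg) <= (x s ^+ 2 - w) * expR (gam * s).
    apply: (HD_le (f := fun s => (x s ^+ 2 - w) * expR (gam * s))
      (df := fun s => 2 * (virial s x p - q1) * expR (gam * s)) hs).
      move=> r /andP[r1 _]; have [hxr _] := h r (le_trans hsg r1).
      by hd idtac; rewrite /virial /w; field; rewrite gt_eqF.
    by move=> r /andP[r1 _]; rewrite mulr_ge0 ?expR_ge0// mulr_ge0// subr_ge0 Qge.
  move=> H; rewrite -(ler_pM2r (expR_gt0 (gam * s))).
  have e : (w - w * expR (- gam * (s - sg))) * expR (gam * s) = w * expR (gam * s) - w * expR (gam * sg).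
    have e' : expR (- gam * (s - sg)) * expR (gam * s) = expR (gam * sg).
      by rewrite -expRD; congr expR; ring.
    by rewrite mulrBl -(mulrA w) e'.
  rewrite e; have : 0 <= x sg ^+ 2 * expR (gam * sg) by rewrite mulr_ge0 ?sqr_ge0 ?expR_ge0.
  lra.
have [|N hN] := limp_expN gam0 (e := expR (- gam * sg) / 2); first by rewrite divr_gt0 ?expR_gt0.
pose t := Num.max sg N.
have tsg : sg <= t by rewrite le_max lexx.
have tN : N <= t by rewrite le_max lexx orbT.
have xbig s : t <= s -> w / 2 <= x s ^+ 2.
  move=> hs; have := grow s (le_trans tsg hs).
  have := hN s (le_trans tN hs); rewrite subr0 gtr0_norm ?expR_gt0// => H.
  have : expR (- gam * (s - sg)) <= 1 / 2.
    rewrite -(ler_pM2r (expR_gt0 (- gam * sg))) -expRD.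
    have -> : - gam * (s - sg) + - gam * sg = - gam * s by ring.
    lra.
  move=> H2; have : w * expR (- gam * (s - sg)) <= w * (1 / 2) by rewrite ler_pM2l.
  lra.
pose V0 := lyap s1 (x s1) (p s1).
apply: (@unbounded_growth _ (fun s => virial s x p)
  (fun s => p s ^+ 2 + (c s - k s * `|x s| `^ (q - 2)) * x s ^+ 2) t (cI / 2 * (w / 2)) (2 * V0 + gam * V0)).
- by rewrite mulr_gt0// divr_gt0.
- by move=> s hs; apply: HD_virial; apply: h; apply: (le_trans hsg); exact: le_trans hs.
- move=> s hs; have s1s : s1 <= s by apply: (le_trans hsg); exact: le_trans hs.
  have h1 := coef_pos (le_trans ss1 s1s) (hx s s1s).
  rewrite -[leLHS]add0r; apply: lerD; first exact: sqr_ge0.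
  apply: ler_pM => //; [by rewrite divr_ge0// ltW|by rewrite divr_ge0// ltW|exact: xbig].
- move=> s hs; have s1s : s1 <= s by apply: (le_trans hsg); exact: le_trans hs.
  have [x2 p2] := lyap_bound (x s) (p s) (up (le_trans ss1 s1s)).
  have Vs : lyap s (x s) (p s) <= V0.
    apply: lyap_noninc => //; first exact: up.
    by move=> r /andP[r1 _]; exact: h.
  rewrite /virial; apply: (le_trans (ler_normD _ _)); apply: lerD.
    by apply: (le_trans (abs_mul_le _ _)); lra.
  have gx : 0 <= gam / 2 * x s ^+ 2 by rewrite mulr_ge0 ?sqr_ge0// divr_ge0// ltW.
  rewrite (ger0_norm gx).
  have : gam * x s ^+ 2 <= gam * (2 * V0) by rewrite ler_pM2l//; lra.
  lra.
Qed.

(** Up to the second zero the level stays in [C1, C1 + drop), which leaves no room for an excursion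
    to r0. So the virial increases strictly between two points where it vanishes. *)
Lemma two_zeros_below_drop x p s1 s2 s3 : sl <= s1 -> s1 <= s2 -> s2 < s3 ->
  (forall s, s1 <= s -> xeq x p s) -> (forall s, s1 <= s -> x s = 0 -> p s != 0) ->
  lyap s1 (x s1) (p s1) < C1 + drop -> x s2 = 0 -> x s3 = 0 -> False.
Proof.
move=> ss1 s12 s23 h nz V1 x2 x3.
have s13 : s1 <= s3 by apply: (le_trans s12); exact: ltW.
have V3 : C1 <= lyap s3 (x s3) (p s3).
  by rewrite x3; apply: lyap_at_zero; apply: up; exact: le_trans s13.
have V2 : lyap s2 (x s2) (p s2) < C1 + drop.
  apply: le_lt_trans V1; apply: lyap_noninc => //; first exact: up.
  by move=> s /andP[h1 _]; exact: h.
have small s : s2 <= s <= s3 -> `|x s| <= r0.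
  move=> /andP[h1 h2]; rewrite leNgt; apply/negP => xs.
  have Vs : C1 <= lyap s (x s) (p s).
    apply: (le_trans V3); apply: lyap_noninc => //.
      by apply: up; apply: (le_trans ss1); exact: le_trans h1.
    by move=> r /andP[r1 _]; apply: h; apply: (le_trans s12); exact: le_trans r1.
  have x2' : `|x s2| <= r0 / 2 by rewrite x2 normr0 divr_ge0// ltW.
  have := @lyap_drop x p s2 s (le_trans ss1 s12) h1
    (fun r hr => h r (le_trans s12 (proj1 (andP hr)))) Vs x2' (ltW xs).
  lra.
have := @virial_incr x p s2 s3 (le_trans ss1 s12) s23
  (fun r hr => h r (le_trans s12 (proj1 (andP hr)))) small
  (fun r hr => nz r (le_trans s12 (proj1 (andP hr)))).
by rewrite /virial x2 x3 expr0n /= !mul0r !mulr0 addr0 ltxx.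
Qed.

Lemma small_above x p s1 s2 : sl <= s1 -> s1 <= s2 ->
  (forall s, s1 <= s -> xeq x p s) -> lyap s1 (x s1) (p s1) < C1 + drop ->
  `|x s2| <= r0 / 2 ->
  forall s, s2 <= s -> C1 <= lyap s (x s) (p s) -> `|x s| <= r0.
Proof.
move=> ss1 s12 h V1 x2 s s2s Vs; rewrite leNgt; apply/negP => xs.
have V2 : lyap s2 (x s2) (p s2) < C1 + drop.
  apply: le_lt_trans V1; apply: lyap_noninc => //; first exact: up.
  by move=> r /andP[h1 _]; exact: h.
have := @lyap_drop x p s2 s (le_trans ss1 s12) s2s
  (fun r hr => h r (le_trans s12 (proj1 (andP hr)))) Vs x2 (ltW xs).
lra.
Qed.

Lemma no_zero_below_drop x p s1 s2 : sl <= s1 -> s1 <= s2 ->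
  (forall s, s1 <= s -> xeq x p s) -> (forall s, s1 <= s -> x s = 0 -> p s != 0) ->
  lyap s1 (x s1) (p s1) < C1 + drop -> (forall s, s1 <= s -> C1 <= lyap s (x s) (p s)) ->
  x s2 = 0 -> False.
Proof.
move=> ss1 s12 h nz V1 hV x2.
have x2' : `|x s2| <= r0 / 2 by rewrite x2 normr0 divr_ge0// ltW.
have small s : s2 <= s -> `|x s| <= r0.
  by move=> hs; apply: (small_above ss1 s12 h V1 x2' hs); apply: hV; exact: le_trans hs.
have s23 : s2 < s2 + 1 by rewrite ltrDl.
have := @virial_incr x p s2 (s2 + 1) (le_trans ss1 s12) s23
  (fun r hr => h r (le_trans s12 (proj1 (andP hr))))
  (fun r hr => small r (proj1 (andP hr)))
  (fun r hr => nz r (le_trans s12 (proj1 (andP hr)))).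
have := @virial_nonpos x p s2 (le_trans ss1 s12) (fun r hr => h r (le_trans s12 hr)) small (s2 + 1) (ltW s23).
rewrite {2}/virial x2 expr0n /= mul0r mulr0 addr0; lra.
Qed.

Lemma leaves_without_zero x p s1 : sl <= s1 ->
  (forall s, s1 <= s -> xeq x p s) -> lyap s1 (x s1) (p s1) < C1 + drop ->
  `|x s1| <= r0 / 2 -> 0 < virial s1 x p ->
  (forall s, s1 <= s -> x s != 0) /\ exists2 s, s1 <= s & lyap s (x s) (p s) < C1.
Proof.
move=> ss1 h V1 x1 Q1; split.
  move=> s hs; apply/eqP => xs.
  have Vs r : s1 <= r <= s -> C1 <= lyap r (x r) (p r).
    move=> /andP[h1 h2]; apply: (le_trans (y := lyap s (x s) (p s))).
      by rewrite xs; apply: lyap_at_zero; apply: up; exact: le_trans hs.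
    apply: lyap_noninc => //; first by apply: up; exact: le_trans h1.
    by move=> u /andP[u1 _]; apply: h; exact: le_trans u1.
  have := @virial_nondecr x p s1 s ss1 hs (fun r hr => h r (proj1 (andP hr)))
    (fun r hr => small_above ss1 (lexx _) h V1 x1 (proj1 (andP hr)) (Vs r hr)).
  by rewrite {2}/virial xs expr0n /= mul0r mulr0 addr0; lra.
apply: contrapT => nex.
have hV s : s1 <= s -> C1 <= lyap s (x s) (p s).
  by move=> hs; rewrite leNgt; apply/negP => H; apply: nex; exists s.
have := virial_nonpos ss1 h (fun s hs => small_above ss1 (lexx _) h V1 x1 hs (hV s hs)) (lexx s1).
lra.
Qed.

End Lyapunov.

(** * Interface of the damped equation *)

Section Landing.
Variable R : realType.

(* What is used of the damped equation [xeq] at s = +oo: V is a Lyapunov function with value tending to C1 at the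
   saddle x = x' = 0, orbits which fall below C1 stay away from 0, and an orbit entering C1 + d has at most one
   more zero. *)
Record landing (q gam : R) (c k : R -> R) (sa C1 d sl r0 : R) (V : R -> R -> R -> R) : Prop :=
  Landing {
  landing_C1 : 0 < C1;
  landing_d : 0 < d;
  landing_r0 : 0 < r0;
  landing_sl : sa <= sl;
  landing_continuous : forall s x0 p0 e : R, 0 < e -> exists2 d : R, 0 < d & forall x p : R,
    `|x - x0| < d -> `|p - p0| < d -> `|V s x p - V s x0 p0| < e;
  landing_noninc : forall (x p : R -> R) s1 s2, sa <= s1 -> s1 <= s2 ->
    (forall s, s1 <= s <= s2 -> xeq q gam c k x p s) -> V s2 (x s2) (p s2) <= V s1 (x s1) (p s1);
  landing_bound : forall s x p : R, sa <= s -> x ^+ 2 <= 2 * V s x p;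
  landing_away : forall (x p : R -> R) s0, sa <= s0 -> (forall s, s0 <= s -> xeq q gam c k x p s) ->
    V s0 (x s0) (p s0) < C1 -> exists2 m : R, 0 < m & forall s, s0 <= s -> m <= `|x s|;
  landing_small : forall (x p : R -> R) s0, sl <= s0 -> (forall s, s0 <= s -> xeq q gam c k x p s) ->
    (forall s, s0 <= s -> C1 <= V s (x s) (p s)) ->
    exists2 s1, s0 <= s1 & forall s, s1 <= s -> `|x s| <= r0 /\ virial gam s x p <= 0;
  landing_virial : forall (x p : R -> R) s1 s2, sl <= s1 -> s1 < s2 ->
    (forall s, s1 <= s <= s2 -> xeq q gam c k x p s) -> (forall s, s1 <= s <= s2 -> `|x s| <= r0) ->
    (forall s, s1 <= s <= s2 -> x s = 0 -> p s != 0) -> virial gam s1 x p < virial gam s2 x p;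
  landing_two_zeros : forall (x p : R -> R) s1 s2 s3, sl <= s1 -> s1 <= s2 -> s2 < s3 ->
    (forall s, s1 <= s -> xeq q gam c k x p s) -> (forall s, s1 <= s -> x s = 0 -> p s != 0) ->
    V s1 (x s1) (p s1) < C1 + d -> x s2 = 0 -> x s3 = 0 -> False;
  landing_no_zero : forall (x p : R -> R) s1 s2, sl <= s1 -> s1 <= s2 ->
    (forall s, s1 <= s -> xeq q gam c k x p s) -> (forall s, s1 <= s -> x s = 0 -> p s != 0) ->
    V s1 (x s1) (p s1) < C1 + d -> (forall s, s1 <= s -> C1 <= V s (x s) (p s)) -> x s2 = 0 -> False;
  landing_leaves : forall (x p : R -> R) s1, sl <= s1 -> (forall s, s1 <= s -> xeq q gam c k x p s) ->
    V s1 (x s1) (p s1) < C1 + d -> `|x s1| <= r0 / 2 -> 0 < virial gam s1 x p ->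
    (forall s, s1 <= s -> x s != 0) /\ exists2 s, s1 <= s & V s (x s) (p s) < C1;
  landing_limit : forall x p : R -> R, limp x 0 -> limp p 0 -> limp (fun s => V s (x s) (p s)) C1 }.

Lemma landing_exists (q gam cI kI sa : R) (c k k' : R -> R) : 2 < q -> 0 < gam -> 0 < cI -> 0 < kI ->
  cts c -> Tail (fun s => `|c s - cI|) -> limp c cI ->
  (forall s, HD k s (k' s)) -> cts k' -> Tail (fun s => `|k' s|) -> limp k kI ->
  (forall s, sa <= s -> 0 < k s) ->
  exists C1 d sl r0 V, landing q gam c k sa C1 d sl r0 V.
Proof.
move=> q2 gam0 cI0 kI0 cc Tc lc hk ck' Tk lk k0.
have kI2 : 0 < kI / 2 by rewrite divr_gt0.
have q0 : 0 < q by lra.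
have [N hN] := lk _ kI2.
have [m1 m10 hm1] : exists2 m : R, 0 < m & forall t, sa <= t <= N -> m <= k t.
  apply: cts_posmin => t; first by move=> _; exact: HD_cts (hk t).
  by move=> /andP[h _]; exact: k0.
pose kmin := Num.min m1 (kI / 2).
have kmin0 : 0 < kmin by rewrite lt_min m10.
have [kmax kmax0 hkmax] := @limp_bounded _ k kI sa lk (fun t _ => HD_cts (hk t)).
have kb s : sa <= s -> kmin <= k s <= kmax.
  move=> ss; apply/andP; split; last by apply: le_trans (hkmax s ss); exact: ler_norm.
  have [sN|Ns] := leP s N; first by rewrite ge_min hm1// ss.
  have := hN s (ltW Ns); rewrite ltr_norml => /andP[h _].
  by rewrite ge_min; apply/orP; right; lra.
(* These weights make energy + C1 dominate x^2 / 2 and still keep half of the power term, as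
   [energy_coercive] requires. *)
have A0 : 0 < (cI + 1) / 2 by lra.
have B0 : 0 < kmin / (2 * q) by rewrite divr_gt0// mulr_gt0.
have [C1 C10 hC1] := young_quadratic q2 A0 B0.
have [del hdel ldel] := TailD Tc (TailZ (2 / kmin) Tk).
have del0 s : 0 <= del s.
  apply: (@tail_ge0 _ (fun s => `|c s - cI| + 2 / kmin * `|k' s|) del (s - 1)) => //.
    by move=> r _; rewrite addr_ge0// mulr_ge0// divr_ge0// ltW.
  by rewrite ltrBlDr ltrDl.
(* The radius where kmax r0^(q-2) = cI / 4, so that inside it the linear part dominates. *)
pose r0 := (cI / 4 / kmax) `^ ((q - 2)^-1).
have cik : 0 < cI / 4 / kmax by rewrite !divr_gt0.
have r00 : 0 < r0 by rewrite powR_gt0.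
have q20 : q - 2 != 0 by rewrite gt_eqF// subr_gt0.
have r0E : r0 `^ (q - 2) = cI / 4 / kmax by rewrite /r0 -powRrM mulVf// powRr1// ltW.
have r0s : kmax * r0 `^ (q - 2) <= cI / 4 by rewrite r0E mulrC divfK// gt_eqF.
have cI4 : 0 < cI / 4 by rewrite divr_gt0.
have [N1 hN1] := lc _ cI4.
have e2 : 0 < cI * r0 ^+ 2 / 32 / C1 by rewrite !divr_gt0// mulr_gt0// exprn_gt0.
have [N2 hN2] := ldel _ e2.
pose sl := Num.max sa (Num.max N1 N2).
have slsa : sa <= sl by rewrite le_max lexx.
have cclose s : sl <= s -> `|c s - cI| <= cI / 4.
  by rewrite !ge_max => /andP[_ /andP[h _]]; apply/ltW/hN1.
have dsmall s : sl <= s -> C1 * del s <= cI * r0 ^+ 2 / 32.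
  rewrite !ge_max => /andP[_ /andP[_ h]]; have := hN2 s h; rewrite subr0 (ger0_norm (del0 s)) => h2.
  by rewrite mulrC -ler_pdivlMr// ltW.
pose hk1 := fun s (_ : sa <= s) => hk s.
pose hd1 := fun s (_ : sa <= s) => hdel s.
pose d01 := fun s (_ : sa <= s) => del0 s.
exists C1, (drop gam cI r0), sl, r0, (lyap q cI C1 k del); split=> //.
- exact: drop_gt0.
- by move=> s x p e e0; exact: lyap_continuous.
- exact: (lyap_noninc q2 gam0 kmin0 hC1 hk1 kb hd1 d01).
- by move=> s x p ss; have [] := lyap_bound q2 kmin0 hC1 kb d01 x p ss.
- exact: (lyap_small_away q2 gam0 cI0 kmin0 hC1 hk1 kb hd1 d01).
- move=> x p s0 ss h hV.
  have [s1 s01 small] := eventually_small q2 gam0 cI0 kmin0 C10 hC1 hk1 kb hd1 d01 slsa r00 r0s dsmall ldel lc ss h hV.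
  exists s1 => // s hs; split; first exact/ltW/small.
  exact: (virial_nonpos q2 gam0 cI0 kmin0 hC1 hk1 kb hd1 d01 slsa r0s cclose (le_trans ss s01)
    (fun r hr => h r (le_trans s01 hr)) (fun r hr => ltW (small r hr)) hs).
- by move=> x p s1 s2; exact: (virial_incr q2 cI0 kmin0 kb slsa r0s cclose).
- exact: (two_zeros_below_drop q2 gam0 cI0 kmin0 C10 hC1 hk1 kb hd1 d01 slsa r00 r0s cclose dsmall).
- exact: (no_zero_below_drop q2 gam0 cI0 kmin0 C10 hC1 hk1 kb hd1 d01 slsa r00 r0s cclose dsmall).
- exact: (leaves_without_zero q2 gam0 cI0 kmin0 C10 hC1 hk1 kb hd1 d01 slsa r00 r0s cclose dsmall).
- move=> x p x0 p0.
  have e : (0 * 0 * (1 / 2) + - (cI / 2 * (0 * 0)) + kI * (1 / q) * 0 + C1) * expR 0 = C1.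
    by rewrite expR0; ring.
  rewrite -[X in limp _ X]e.
  have xq0 : limp (fun s => `|x s| `^ q) 0.
    have -> : 0 = `|0 : R| `^ q by rewrite normr0 powR0// gt_eqF.
    by apply: (@limp_comp _ x (fun v => `|v| `^ q)) => //; exact: (@cts_powR _ _ q0 0).
  apply: limpM; last by apply: (@limp_comp _ del expR) => //; exact: continuous_expR.
  apply: limpD; last exact: limp_c.
  apply: limpD.
    apply: limpD.
      apply: limpM; last by apply: (limp_ext (f := fun=> 1 / 2) (N := 0)); [move=> t _; rewrite mul1r|exact: limp_c].
      exact: limpM.
    by apply: limpN; apply: limpM; [exact: limp_c|exact: limpM].
  apply: limpM => //; apply: limpM => //.
  by apply: (limp_ext (f := fun=> 1 / q) (N := 0)); [move=> t _; rewrite mul1r|exact: limp_c].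
Qed.

End Landing.

(** * Selection of the parameters B_k *)

Section Select.
Variable R : realType.
Variables (LL : set R) (S Rr : nat -> set R).
Hypothesis LL0 : forall L, LL L -> 0 < L.
Hypothesis LLdown : forall L L', LL L -> 0 < L' -> L' < L -> LL L'.
Hypothesis SLL : forall k L, S k L -> LL L.
Hypothesis RLL : forall k L, Rr k L -> LL L.
Hypothesis total : forall L, LL L -> exists k, S k L \/ Rr k L.
Hypothesis SS : forall j k L, S j L -> S k L -> j = k.
Hypothesis RR : forall j k L, Rr j L -> Rr k L -> j = k.
Hypothesis SR : forall j k L, S j L -> Rr k L -> False.
Hypothesis Sopen : forall k L, S k L -> exists2 d : R, 0 < d & forall L', `|L' - L| < d -> S k L'.
Hypothesis Rnear : forall k L, Rr k L -> exists2 d : R, 0 < d & forall L', `|L' - L| < d ->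
  [\/ S k L', S k.+1 L' | Rr k L'].
Hypothesis Ssmall : exists2 d : R, 0 < d & forall L, 0 < L -> L < d -> S 0%N L.
Hypothesis unbounded : forall k, exists L j, (k < j)%N /\ (S j L \/ Rr j L).

Let above k : set R := [set L | exists2 j, (k < j)%N & S j L \/ Rr j L].
Let bk k := inf (above k).

Let above_inf k : has_inf (above k).
Proof.
split; first by have [L [j [h1 h2]]] := unbounded k; exists L, j.
by exists 0 => L [j _ [/SLL|/RLL] /LL0 /ltW].
Qed.

Let inf_between (A : set R) (e : R) : has_inf A -> 0 < e -> exists2 L, A L & inf A <= L < inf A + e.
Proof.
move=> hA e0; have [L AL h] := inf_adherent e0 hA; exists L => //.
by rewrite h andbT; apply: ge_inf => //; case: hA.
Qed.


Let bk_in k : 0 < bk k /\ LL (bk k).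
Proof.
have [d d0 hd] := Ssmall.
have b0 : d <= bk k.
  apply: lb_le_inf; first by case: (above_inf k).
  move=> L [j kj h]; rewrite leNgt; apply/negP => Ld.
  have L0 : 0 < L by case: h => [/SLL|/RLL] /LL0.
  have s0 := hd L L0 Ld; case: h => [h|h]; last exact: SR s0 h.
  by have e := SS h s0; rewrite e in kj.
have p := lt_le_trans d0 b0; split=> //.
have [L h /andP[h1 _]] := inf_between (above_inf k) ltr01; rewrite -/(bk k) in h1.
have LLL : LL L by case: h => j _ [/SLL|/RLL].
by move: h1; rewrite le_eqVlt => /predU1P[->//|h1]; exact: LLdown h1.
Qed.

Let below k L : 0 < L -> L < bk k -> exists2 j, (j <= k)%N & S j L \/ Rr j L.
Proof.
move=> L0 Lb; have [_ bL] := bk_in k.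
have [j h] := total (LLdown bL L0 Lb); exists j => //.
rewrite leqNgt; apply/negP => kj.
have : bk k <= L by apply: ge_inf; [case: (above_inf k)|exists j].
by rewrite leNgt Lb.
Qed.

(** The count at bk k is at most k, since a larger one would persist just to the left. At an S-point
    it would be constant nearby, while points with more than k zeros accumulate at bk k; so this is
    an R-point, and as the count can rise only by one it equals k. *)
Let bk_R k : Rr k (bk k).
Proof.
have [b0 bL] := bk_in k.
have acc e : 0 < e -> exists2 L, `|L - bk k| < e & exists2 j, (k < j)%N & S j L \/ Rr j L.
  move=> e0; have [L h /andP[h1 h2]] := inf_between (above_inf k) e0; rewrite -/(bk k) in h1 h2; exists L => //.
  by rewrite ger0_norm ?subr_ge0// ltrBlDl.
have low j : S j (bk k) \/ Rr j (bk k) -> (j <= k)%N.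
  move=> h; rewrite leqNgt; apply/negP => kj.
  have [d d0 hd] : exists2 d : R, 0 < d & forall L', `|L' - bk k| < d -> above k L'.
    case: h => [/Sopen|/Rnear] [d d0 hd]; exists d => // L' /hd.
      by move=> h; exists j => //; left.
    by case=> h; [exists j|exists j.+1|exists j]; rewrite ?ltnS ?(ltnW kj)//; [left|left|right].
  pose L := Num.max (bk k - d / 2) (bk k / 2).
  have h1 : L < bk k by rewrite gt_max; apply/andP; split; lra.
  have h2 : bk k - d / 2 <= L by rewrite le_max lexx.
  have /hd h3 : `|L - bk k| < d by rewrite ltr0_norm; lra.
  have : bk k <= L by apply: ge_inf => //; case: (above_inf k).
  lra.
have [j h] := total bL; have jk := low j h.
case: h => [h|h].
  have [d d0 hd] := Sopen h; have [L /hd Sj [i ki [h1|h1]]] := acc d d0.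
    by have e := SS Sj h1; rewrite e leqNgt ki in jk.
  by case: (SR Sj h1).
have [d d0 hd] := Rnear h; have [L /hd h1 [i ki h2]] := acc d d0.
have kj : (k <= j)%N.
  rewrite -ltnS; apply: (leq_trans ki).
  case: h1 => h1; case: h2 => h2; try by case: (SR h1 h2).
  - by rewrite (SS h2 h1).
  - by rewrite (SS h2 h1).
  - by case: (SR h2 h1).
  - by rewrite (RR h2 h1).
have e : j = k by lia.
by rewrite -[X in Rr X]e.
Qed.

Let bk_lt k : bk k < bk k.+1.
Proof.
rewrite lt_neqAle; apply/andP; split.
  apply/eqP => e; have h := bk_R k.+1; rewrite -e in h.
  by have := RR h (bk_R k); lia.
apply: lb_le_inf; first by case: (above_inf k.+1).
move=> L [j kj h]; apply: ge_inf; first by case: (above_inf k).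
by exists j => //; exact: ltnW.
Qed.

Let ball_lt (x y d : R) : x - d < y -> y < x + d -> `|y - x| < d.
Proof. by move=> h1 h2; rewrite ltr_norml; apply/andP; split; lra. Qed.

(** The R-points with k+1 zeros may accumulate at bk k.+1 from the left, so this point itself may
    not do. Instead let m be the supremum of the smaller parameters that are not of this kind; just
    below m some s is an S-point with k+1 zeros, and B is the first R-point with k+1 zeros after s.
    A count k+2 cannot occur, since everything lies below bk k.+1. *)
Let select_succ k : exists B s : R, [/\ bk k < s, s < B, B <= bk k.+1, Rr k.+1 B &
  forall L, s < L -> L < B -> S k.+1 L].
Proof.
have [b0 bL] := bk_in k.+1; have [b0' bL'] := bk_in k.
pose N := [set L | 0 < L < bk k.+1 /\ ~ Rr k.+1 L].
have Nbk : N (bk k).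
  by split; [rewrite b0' bk_lt|move=> h; have := RR h (bk_R k); lia].
have hN : has_sup N.
  by split; [exists (bk k)|exists (bk k.+1) => L [/andP[_ /ltW]]].
pose m := sup N.
have mb : m <= bk k.+1 by apply: ge_sup; [exists (bk k)|move=> L [/andP[_ /ltW]]].
have bm : bk k <= m by exact: sup_upper_bound.
have m0 : 0 < m by exact: lt_le_trans bm.
have mL : LL m by move: mb; rewrite le_eqVlt => /predU1P[->//|h]; exact: LLdown h.
have right L : m < L -> L < bk k.+1 -> Rr k.+1 L.
  move=> mL' Lb; apply: contrapT => nR.
  have : L <= m by apply: sup_upper_bound => //; split=> //; rewrite (lt_trans m0).
  by rewrite leNgt mL'.
have mR : Rr k.+1 m.
  move: mb; rewrite le_eqVlt => /predU1P[->|mb]; first exact: bk_R.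
  have pick d : 0 < d -> exists2 L, `|L - m| < d & Rr k.+1 L.
    move=> d0; pose L := Num.min (m + d / 2) ((m + bk k.+1) / 2).
    have h1 : m < L by rewrite lt_min; apply/andP; split; lra.
    have h2 : L <= m + d / 2 by rewrite ge_min lexx.
    have h3 : L <= (m + bk k.+1) / 2 by rewrite ge_min lexx orbT.
    by exists L; [apply: ball_lt; lra|apply: right; lra].
  have [j [h|h]] := total mL.
    by have [d d0 hd] := Sopen h; have [L /hd h1 h2] := pick d d0; case: (SR h1 h2).
  have [d d0 hd] := Rnear h; have [L /hd [h1|h1|h1] h2] := pick d d0.
  - by case: (SR h1 h2).
  - by case: (SR h1 h2).
  - by rewrite -(RR h1 h2).
have bm' : bk k < m.
  rewrite lt_neqAle bm andbT; apply/eqP => e; rewrite -e in mR.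
  by have := RR mR (bk_R k); lia.
have [d d0 hd] := Rnear mR.
have e0 : 0 < Num.min d (m - bk k) by rewrite lt_min d0 subr_gt0.
have left L : 0 < L -> L < m -> m - d < L -> ~ Rr k.+1 L -> S k.+1 L.
  move=> L0 Lm dL nR; have Lb : L < bk k.+1 by exact: lt_le_trans mb.
  have /hd[//|h|h//] : `|L - m| < d by apply: ball_lt; lra.
  by have [j jk [h'|h']] := below L0 Lb; [by rewrite -(SS h h') ltnn in jk|case: (SR h h')].
have [s [/andP[s0 sb] sR] hs] := sup_adherent e0 hN.
have sm : s <= m by apply: sup_upper_bound => //; split=> //; rewrite s0.
have sm' : s < m by rewrite lt_neqAle sm andbT; apply/eqP => e; apply: sR; rewrite e.
have m1 : Num.min d (m - bk k) <= d by rewrite ge_min lexx.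
have m2 : Num.min d (m - bk k) <= m - bk k by rewrite ge_min lexx orbT.
rewrite -/m in hs.
have sS : S k.+1 s by apply: left => //; lra.
pose M := [set L | s <= L /\ Rr k.+1 L].
have hM : has_inf M by split; [exists m|exists s => L []].
pose B := inf M.
have sB : s <= B by apply: lb_le_inf; [exists m|move=> L []].
have Bm : B <= m by apply: ge_inf; [case: hM|split].
have B0 : 0 < B by exact: lt_le_trans sB.
have BL : LL B by move: Bm; rewrite le_eqVlt => /predU1P[->//|h]; exact: LLdown h.
have BR : Rr k.+1 B.
  have pick e : 0 < e -> exists2 L, `|L - B| < e & Rr k.+1 L.
    move=> e1; have [L [_ h] /andP[h1 h2]] := inf_between hM e1; exists L => //.
    by apply: ball_lt; rewrite -/B in h1 h2; lra.
  have [j [h|h]] := total BL.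
    by have [d' d0' hd'] := Sopen h; have [L /hd' h1 h2] := pick d' d0'; case: (SR h1 h2).
  have [d' d0' hd'] := Rnear h; have [L /hd' [h1|h1|h1] h2] := pick d' d0'.
  - by case: (SR h1 h2).
  - by case: (SR h1 h2).
  - by rewrite -(RR h1 h2).
have sB' : s < B.
  by rewrite lt_neqAle sB andbT; apply/eqP => e; rewrite -e in BR; case: (SR sS BR).
exists B, s; split=> //; [lra|exact: le_trans mb|].
move=> L sL LB; apply: left; [lra|exact: lt_le_trans Bm|lra|].
move=> h; have : B <= L by apply: ge_inf; [case: hM|split=> //; exact: ltW].
by rewrite leNgt LB.
Qed.

Let select_zero : exists B : R, [/\ 0 < B, B <= bk 0%N, Rr 0%N B & forall L, 0 < L -> L < B -> S 0%N L].
Proof.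
have [b0 bL] := bk_in 0%N.
pose M := [set L | LL L /\ ~ S 0%N L].
have Mb : M (bk 0%N) by split=> // h; exact: SR h (bk_R 0%N).
have hM : has_inf M by split; [exists (bk 0%N)|exists 0 => L [/LL0 /ltW]].
pose B := inf M.
have [d d0 hd] := Ssmall.
have dB : d <= B.
  apply: lb_le_inf; first by exists (bk 0%N).
  by move=> L [LL' h]; rewrite leNgt; apply/negP => Ld; apply: h; apply: hd => //; exact: LL0.
have B0 : 0 < B by exact: lt_le_trans dB.
have Bb : B <= bk 0%N by apply: ge_inf; [case: hM|].
have BL : LL B by move: Bb; rewrite le_eqVlt => /predU1P[->//|h]; exact: LLdown h.
have low L : 0 < L -> L < B -> S 0%N L.
  move=> L0 LB; apply: contrapT => h.
  have : B <= L by apply: ge_inf; [case: hM|split=> //; exact: LLdown LB].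
  by rewrite leNgt LB.
have pick e : 0 < e -> exists2 L, `|L - B| < e & S 0%N L.
  move=> e1; pose L := Num.max (B - e / 2) (B / 2).
  have h1 : L < B by rewrite gt_max; apply/andP; split; lra.
  have h2 : B - e / 2 <= L by rewrite le_max lexx.
  have h3 : B / 2 <= L by rewrite le_max lexx orbT.
  by exists L; [apply: ball_lt; lra|apply: low => //; lra].
exists B; split=> //.
have [j [h|h]] := total BL; last first.
  have [e e1 he] := Rnear h; have [L /he [h1|h1|h1] h2] := pick e e1.
  - by rewrite (SS h2 h1).
  - by have := SS h2 h1.
  - by case: (SR h2 h1).
have [e e1 he] := Sopen h.
have j0 : j = 0%N by have [L /he h1 h2] := pick e e1; exact: SS h1 h2.
have [L [_ nS] /andP[h1 h2]] := inf_between hM e1.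
by case: nS; rewrite -j0; apply: he; apply: ball_lt; rewrite -/B in h1 h2; lra.
Qed.

(* bk k is the first L beyond which more than k zeros occur; since the count jumps by at most one at an R-point
   and is constant near an S-point, bk k is an R-point with k zeros. *)
Lemma select_bifurcations : exists B : nat -> R,
  [/\ forall k, 0 < B k, forall j k, (j < k)%N -> B j < B k, forall k, Rr k (B k),
    forall L, 0 < L -> L < B 0%N -> S 0%N L &
    forall k, (1 <= k)%N -> exists2 s : R, B k.-1 <= s < B k &
      forall L, s < L -> L < B k -> S k L].
Proof.
have [B0 [p0 q0 r0 l0]] := select_zero.
have /choice[f hf] : forall k, exists Bs : R * R, [/\ bk k < Bs.2, Bs.2 < Bs.1, Bs.1 <= bk k.+1,
    Rr k.+1 Bs.1 & forall L, Bs.2 < L -> L < Bs.1 -> S k.+1 L].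
  by move=> k; have [B [s h]] := select_succ k; exists (B, s).
pose B k := if k is j.+1 then (f j).1 else B0.
have Bbk k : B k <= bk k by case: k => [//|j]; have [] := hf j.
have step k : B k < B k.+1.
  by have [h1 h2 _ _ _] := hf k; rewrite /= (le_lt_trans (Bbk k))// (lt_trans h1).
have mono j k : (j < k)%N -> B j < B k.
  elim: k => [//|k IH]; rewrite ltnS leq_eqVlt => /predU1P[->//|/IH h].
  exact: lt_trans h (step k).
exists B; split=> //.
- by case=> [//|k]; exact: lt_trans p0 (mono 0%N k.+1 isT).
- by case=> [//|k]; have [] := hf k.
- move=> [//|k] _; have [h1 h2 _ _ h5] := hf k; exists (f k).2 => //.
  by rewrite h2 andbT (le_trans (Bbk k))// ltW.
Qed.

End Select.

(** * Selection of the parameters A_k *)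

Section Stability.
Variable R : realType.
Variables (q mu : R) (a b : R -> R).
Hypotheses (q2 : 2 < q) (mu0 : 0 < mu) (ca : cts a) (cb : cts b).
Hypothesis Ta : Tail (fun t => `|a t - mu ^+ 2|).
Hypothesis Tb : Tail (fun t => `|b t| * expR (- (mu * (q - 2)) * t)).
Local Notation fd := (fdsol q a b mu).

Definition zeros_from (y : R -> R) ta := [set t : R | ta <= t /\ y t = 0].

Lemma fd_HD tl y z L t : fd tl y z L -> tl < t -> HD y t (z t).
Proof. by move=> f h; have [] := f.1 t h. Qed.

Lemma fd_ctsz tl y z L t : fd tl y z L -> tl < t -> {for t, continuous z}.
Proof. by move=> f h; have [_ h2] := f.1 t h; exact: HD_cts h2. Qed.

Lemma fd_far tl y z L : fd tl y z L -> L != 0 ->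
  exists N : R, forall t, N <= t -> `|L| / 2 < `|y t| * expR (mu * t).
Proof.
move=> f L0; have e0 : 0 < `|L| / 2 by rewrite divr_gt0// normr_gt0.
have [N hN] := f.2 _ e0; exists N => t /hN h.
have : `|L| <= `|y t * expR (mu * t)| + `|L - y t * expR (mu * t)|.
  by apply: le_trans (ler_normD _ _); rewrite addrC subrK.
rewrite (distrC L) normrM (gtr0_norm (expR_gt0 (mu * t))); lra.
Qed.

Lemma far_nz (y : R -> R) (L t : R) : `|L| / 2 < `|y t| * expR (mu * t) -> y t != 0.
Proof.
by apply: contraTneq => ->; rewrite normr0 mul0r -leNgt divr_ge0.
Qed.

Lemma zeros_from_in y ta tb : (forall t, tb <= t -> y t != 0) ->
  zeros_from y ta = zeros_in y ta tb.
Proof.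
move=> h; apply/seteqP; split=> t /=; last by case=> /andP[h1 _] h2.
case=> h1 h2; split=> //; rewrite h1 /= leNgt; apply/negP => /ltW /h.
by rewrite h2 eqxx.
Qed.

Lemma fd_finite tl y z L ta : fd tl y z L -> L != 0 -> tl < ta ->
  exists j, (zeros_from y ta #= `I_j)%card.
Proof.
move=> f L0 h; have [N hN] := fd_far f L0.
rewrite (@zeros_from_in y ta N); last by move=> t /hN; exact: far_nz.
apply/finite_setP; have lt t : ta <= t <= N -> tl < t by move=> /andP[h1 _]; exact: lt_le_trans h1.
apply: (@zeros_finite _ y z) => t /lt ht.
- exact: fd_HD f ht.
- exact: fd_ctsz f ht.
- exact: fd_simple_zeros q2 ca cb f L0 _ ht.
Qed.

(** Up to some tb this is stability of simple zeros on a compact interval; beyond tb the asymptotics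
    give |yh| e^(mu t) > |Lh| / 2, which a small perturbation in the weighted norm cannot cancel. *)
Lemma fd_stable tl yh zh Lh ta j e : fd tl yh zh Lh -> Lh != 0 -> tl < ta -> yh ta != 0 ->
  (zeros_from yh ta #= `I_j)%card -> 0 < e -> exists2 dl : R, 0 < dl &
  forall L, `|L - Lh| < dl -> exists (tl' : R) (y z : R -> R),
    [/\ tl' < ta, fd tl' y z L, (zeros_from y ta #= `I_j)%card,
      `|y ta - yh ta| < e & `|z ta - zh ta| < e].
Proof.
move=> f L0 tla yta hj e0; have [N hN] := fd_far f L0.
pose tb := Num.max N ta.
have taN : ta <= tb by rewrite le_max lexx orbT.
have Ntb : N <= tb by rewrite le_max lexx.
have ftb t : tb <= t -> yh t != 0 by move=> h; apply: far_nz (hN t (le_trans Ntb h)).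
rewrite (zeros_from_in ta ftb) in hj.
have lt t : ta <= t <= tb -> tl < t by move=> /andP[h1 _]; exact: lt_le_trans h1.
have [eps eps0 heps] := zeros_stable (fun t h => fd_HD f (lt t h)) (fun t h => fd_ctsz f (lt t h))
  (fun t h => fd_simple_zeros q2 ca cb f L0 (lt t h)) yta (ftb _ (lexx _)) hj.
pose t1 := (tl + ta) / 2.
have tlt1 : tl < t1 by rewrite /t1; lra.
have t1ta : t1 < ta by rewrite /t1; lra.
have [M M0 hM] := fd_bounded f tlt1.
have [delta [C [d0 C0 hd]]] := fd_near q2 mu0 ca cb Ta Tb t1 (ltW M0).
pose w := expR (mu * ta).
have w0 : 0 < w by exact: expR_gt0.
pose m := Num.min (Num.min eps e * w) (`|Lh| / 2).
have m0 : 0 < m by rewrite lt_min mulr_gt0 ?lt_min ?eps0// divr_gt0// normr_gt0.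
exists (Num.min delta (m / C)); first by rewrite lt_min d0 divr_gt0.
move=> L; rewrite lt_min => /andP[h1 h2].
have [ep [y [z [ep0 f1 close]]]] := hd _ _ _ _ (fd_sub (ltW tlt1) f) (fun t h => hM t (ltW h)) h1.
have small : C * `|L - Lh| < m by rewrite mulrC -ltr_pdivlMr.
have key u t : ta <= t -> 0 <= u -> u * expR (mu * t) <= C * `|L - Lh| -> u < eps /\ u < e.
  move=> ht u0 h; have wt : w <= expR (mu * t) by rewrite ler_expR ler_pM2l.
  have : u * w < Num.min eps e * w.
    apply: (le_lt_trans (ler_wpM2l u0 wt)); apply: (le_lt_trans h).
    by apply: (lt_le_trans small); rewrite ge_min lexx.
  by rewrite ltr_pM2r// lt_min => /andP[].
have cl t : ta <= t -> (`|y t - yh t| < eps /\ `|y t - yh t| < e) /\ (`|z t - zh t| < eps /\ `|z t - zh t| < e).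
  move=> ht; have [c1 c2] := close t (lt_le_trans t1ta ht).
  by split; apply: (key _ t).
exists (t1 - ep), y, z.
have tt : t1 - ep < ta by lra.
have [[_ cy] [_ cz]] := cl ta (lexx _).
split=> //.
have yfar t : tb <= t -> y t != 0.
  move=> ht; apply/eqP => yt.
  have ht' : ta <= t by exact: le_trans ht.
  have [c1 _] := close t (lt_le_trans t1ta ht').
  have h3 := hN t (le_trans Ntb ht).
  rewrite yt sub0r normrN in c1.
  have : m <= `|Lh| / 2 by rewrite ge_min lexx orbT.
  lra.
rewrite (zeros_from_in ta yfar); apply: (heps y z).
  by move=> t /andP[h _]; apply: (fd_HD f1); lra.
by move=> t /andP[h _]; have [[p1 _] [p2 _]] := cl t h.
Qed.

End Stability.

(** * R-solutions followed from the origin, in reflected time s = - t *)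

Section Thresholds.
Variable R : realType.
Variables (q nu mu T Bm : R) (a b : R -> R).
Hypotheses (q2 : 2 < q) (nu0 : 0 < nu) (mu0 : 0 < mu) (ca : cts a) (cb : cts b).
Hypothesis a0 : forall s, 0 < a s.
Hypotheses (bpos : forall s, s <= T -> 0 <= b s) (bneg : forall s, T <= s -> b s <= 0).
Hypothesis Ta : Tail (fun t => `|a t - nu ^+ 2|).
Hypothesis Tb : Tail (fun t => `|b t| * expR (- (nu * (q - 2)) * t)).
Hypothesis la : limp a (nu ^+ 2).
Hypothesis hB : forall s, T <= s -> `|b s| * expR (- (nu * (q - 2)) * s) <= Bm.
Hypothesis Tal : Tail (fun t => `|a (- t) - mu ^+ 2|).
Local Notation fd := (fdsol q a b nu).

(** For small d the weighted solution is so small on s > T that |b| |y|^(q-2) < a; for s <= T the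
    sign of b helps. So y is convex where positive. *)
Lemma small_positive : exists2 d0 : R, 0 < d0 & forall d tl y z, 0 < d -> d < d0 ->
  fd tl y z d -> forall s, tl < s -> 0 < y s.
Proof.
have q20 : 0 < q - 2 by rewrite subr_gt0.
have [am am0 ham] : exists2 m : R, 0 < m & forall s, T <= s -> m <= a s.
  have e0 : 0 < nu ^+ 2 / 2 by rewrite divr_gt0// exprn_gt0.
  have [N hN] := la e0.
  have [m m0 hm] : exists2 m : R, 0 < m & forall t, T <= t <= N -> m <= a t by apply: cts_posmin.
  exists (Num.min m (nu ^+ 2 / 2)); first by rewrite lt_min m0.
  move=> s hs; rewrite ge_min; have [h|h] := leP s N; first by rewrite hm ?hs.
  by have := hN s (ltW h); rewrite ltr_norml => /andP[h1 _]; apply/orP; right; lra.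
have B1 : 0 < Num.max Bm 0 + 1.
  by have : 0 <= Num.max Bm 0 by [rewrite le_max lexx orbT]; lra.
have [delta [C [de0 C0 hd]]] := fd_near q2 nu0 ca cb Ta Tb T (@ler01 R).
pose r := (am / (Num.max Bm 0 + 1)) `^ ((q - 2)^-1).
have r0 : 0 < r by rewrite powR_gt0 ?divr_gt0.
have rE : r `^ (q - 2) = am / (Num.max Bm 0 + 1).
  by rewrite /r -powRrM mulVf ?gt_eqF// powRr1// ltW// divr_gt0.
exists (Num.min delta (r / C)); first by rewrite lt_min de0 divr_gt0.
move=> d tl y z d0; rewrite lt_min => /andP[h1 h2] f.
have ds : `|d - 0| < delta by rewrite subr0 gtr0_norm.
have [eps [y1 [z1 [eps0 f1 close]]]] := hd _ _ _ _ (fd_zero q a b nu T)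
  (fun t _ => ltac:(by rewrite mul0r normr0)) ds.
have small s : tl < s -> T < s -> `|y s| * expR (nu * s) <= r.
  move=> hs Ts; have Ts' : T - eps < s by lra.
  have [-> _] := fd_unique q2 nu0 Ta Tb f f1 hs Ts'.
  have [c1 _] := close s Ts; move: c1; rewrite !subr0 (gtr0_norm d0) => c1.
  by apply: (le_trans c1); apply: ltW; rewrite mulrC -ltr_pdivlMr.
have pos : forall s, tl < s -> 0 < y s /\ z s < 0; last by move=> s /pos[].
apply: (@positive_decreasing _ y z (fun t => a t * y t + b t * psi q (y t)) tl).
- by move=> s hs; exact: fd_HD f hs.
- by move=> s hs; have [] := f.1 s hs.
- move=> s hs ys.
  have -> : a s * y s + b s * psi q (y s) = (a s + b s * `|y s| `^ (q - 2)) * y s by rewrite /psi; ring.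
  rewrite mulr_gt0//; have [Ts|sT] := ltP T s; last by rewrite ltr_pwDl// mulr_ge0 ?bpos// powR_ge0.
  have h3 : (`|y s| * expR (nu * s)) `^ (q - 2) <= am / (Num.max Bm 0 + 1).
    by rewrite -rE; apply: powR_mono; [exact: ltW|rewrite mulr_ge0 ?expR_ge0|exact: small].
  have e1 : `|b s * `|y s| `^ (q - 2)| =
    (`|b s| * expR (- (nu * (q - 2)) * s)) * (`|y s| * expR (nu * s)) `^ (q - 2).
    rewrite normrM (ger0_norm (powR_ge0 _ _)) (powRM _ (normr_ge0 _) (expR_ge0 _)) expR_powR.
    rewrite mulrACA -expRD.
    have -> : - (nu * (q - 2)) * s + nu * s * (q - 2) = 0 by ring.
    by rewrite expR0 mulr1.
  have h4 : `|b s * `|y s| `^ (q - 2)| <= Num.max Bm 0 * (am / (Num.max Bm 0 + 1)).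
    rewrite e1; apply: ler_pM; [by rewrite mulr_ge0 ?expR_ge0|exact: powR_ge0| |exact: h3].
    by rewrite le_max (hB (ltW Ts)).
  have h5 : Num.max Bm 0 * (am / (Num.max Bm 0 + 1)) < am.
    rewrite mulrCA gtr_pMr// ltr_pdivrMr// mul1r; lra.
  have h6 := ham s (ltW Ts); have := ler_norm (- (b s * `|y s| `^ (q - 2))); rewrite normrN; lra.
- exact: fd_lim0 nu0 f.
- have [N hN] := f.2 d d0; exists N => s hs.
  have := hN s hs; rewrite ltr_norml => /andP[h _].
  by rewrite -(pmulr_lgt0 _ (expR_gt0 (nu * s))); lra.
Qed.

(** (y z)' = z^2 + a y^2 + b |y|^q, positive where b >= 0 by simplicity of the zeros. In particular
    there is at most one zero up to T. *)
Lemma radial_mono tl y z d s1 s2 : fd tl y z d -> d != 0 -> tl < s1 -> s1 < s2 -> s2 <= T ->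
  y s1 * z s1 < y s2 * z s2.
Proof.
move=> f d0 h1 h12 h2.
apply: (HD_lt (f := fun s => y s * z s)
  (df := fun s => z s * z s + y s * (a s * y s + b s * psi q (y s))) h12).
  move=> s /andP[hs _]; have [hy hz] := f.1 s (lt_le_trans h1 hs); exact: HD_M hy hz.
move=> s /andP[hs1 hs2]; have hs : tl < s by exact: lt_trans hs1.
have b1 : 0 <= y s * (b s * psi q (y s)).
  by rewrite mulrCA mulr_ge0 ?mul_psi ?powR_ge0// bpos// ltW// (lt_le_trans hs2).
have e : z s * z s + y s * (a s * y s + b s * psi q (y s)) =
  z s ^+ 2 + a s * y s ^+ 2 + y s * (b s * psi q (y s)) by ring.
rewrite e; apply: ltr_pwDl => //.
have [y0|y0] := eqVneq (y s) 0.
  have zs := fd_simple_zeros q2 ca cb f d0 hs y0.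
  by rewrite y0 expr0n mulr0 addr0 exprn_even_gt0.
by apply: ltr_wpDl; rewrite ?sqr_ge0// mulr_gt0 ?exprn_even_gt0.
Qed.

(** The solution need not be global: nearby solutions may blow up for s < T, and only the zeros
    before that count. *)
Definition oscillating k : set R := [set d | 0 < d /\ exists tl y z, fd tl y z d /\
  many k.+1 [set s : R | tl < s /\ y s = 0]].
Local Notation DD := oscillating.

Hypothesis nonempty : forall k, DD k !=set0.

Let nz (d : R) : 0 < d -> d != 0. Proof. by move=> h; rewrite gt_eqF. Qed.

(** Provides a closed left end where y does not vanish, as [fd_stable] requires. Such a point exists
    left of all the given zeros because the zeros from any later point on are finitely many. *)
Lemma many_from tl (y z : R -> R) d k : fd tl y z d -> d != 0 -> many k [set s : R | tl < s /\ y s = 0] ->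
  exists ta : R, [/\ tl < ta, y ta != 0 & many k (zeros_from y ta)].
Proof.
move=> f d0 [e he einj].
have [m ml hm] : exists2 m : R, tl < m & forall i, (i < k)%N -> m < e i.
  elim: k he einj => [|k IH] he einj; first by exists (tl + 1) => //; rewrite ltrDl.
  have [||m ml hm] := IH; [by move=> i hi; apply: he; exact: ltnW|by move=> i j hi hj; apply: einj; exact: ltnW|].
  have [ek _] := he k (ltnSn k).
  exists (Num.min m ((tl + e k) / 2)); first by rewrite lt_min ml; lra.
  move=> i; rewrite ltnS leq_eqVlt => /predU1P[->|/hm h]; rewrite gt_min; last by rewrite h.
  by apply/orP; right; lra.
have [[t /andP[t1 t2] yt]|no] : (exists2 t, tl < t < m & y t != 0) \/ (forall t, tl < t < m -> y t = 0).
- case: (pselect (exists2 t, tl < t < m & y t != 0)) => [h|h]; [by left|right=> t ht].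
  by apply/eqP/negPn/negP => yt; apply: h; exists t.
- exists t; split=> //; exists e => // i hi; have [_ ?] := he i hi; split=> //.
  by apply/ltW/(lt_trans t2)/hm.
pose t1 := (tl + m) / 2.
have t1m : t1 < m by rewrite /t1; lra.
have tlt : tl < t1 by rewrite /t1; lra.
have [j hj] := fd_finite q2 ca cb f d0 tlt.
have : many j.+1 (zeros_from y t1).
  pose dd := (m - t1) / j.+2%:R.
  have dd0 : 0 < dd by rewrite divr_gt0 ?ltr0n// subr_gt0.
  exists (fun i => t1 + i%:R * dd) => [i hi|i l _ _ /addrI /(mulIf (lt0r_neq0 dd0)) /eqP].
    have p : 0 <= i%:R * dd by rewrite mulr_ge0// ltW.
    have u : t1 + i%:R * dd < m.
      rewrite -ltrBrDl /dd mulrA ltr_pdivrMr ?ltr0n// mulrC ltr_pM2l ?subr_gt0// ltr_nat; exact: ltnW.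
    have c : t1 <= t1 + i%:R * dd by rewrite lerDl.
    by split; [exact: c|apply: no; rewrite u andbT (lt_le_trans tlt c)].
  by rewrite eqr_nat => /eqP.
by move/(many_le hj); rewrite ltnn.
Qed.

Lemma oscillating_open k d : DD k d -> exists2 dl : R, 0 < dl & forall d', `|d' - d| < dl -> DD k d'.
Proof.
move=> [d0 [tl [y [z [f hm]]]]].
have [ta [tla yta hm']] := many_from f (nz d0) hm.
have [j hj] := fd_finite q2 ca cb f (nz d0) tla.
have kj := many_le hj hm'.
have [dl dl0 hdl] := fd_stable q2 nu0 ca cb Ta Tb f (nz d0) tla yta hj (@ltr01 R).
exists (Num.min dl d); first by rewrite lt_min dl0.
move=> d'; rewrite lt_min => /andP[h1 h2].
have d'0 : 0 < d' by move: h2; rewrite ltr_norml => /andP[h _]; lra.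
have [tl' [y' [z' [tl'a f' hj' _ _]]]] := hdl d' h1.
split=> //; exists tl', y', z'; split=> //.
by apply: many_sub (card_many hj' kj) => s [h3 h4]; split=> //; exact: lt_le_trans h3.
Qed.

Let dk k := inf (DD k).

Let dk_inf k : has_inf (DD k).
Proof. by split=> //; exists 0 => d [/ltW]. Qed.

Let dk_pos k : 0 < dk k.
Proof.
have [d0 d00 hd] := small_positive; apply: (lt_le_trans d00).
apply: lb_le_inf => // d [dp [tl [y [z [f [e he _]]]]]].
rewrite leNgt; apply/negP => h; have [h1 h2] := he 0%N (ltn0Sn _).
by have := hd d tl y z dp h f _ h1; rewrite h2 ltxx.
Qed.

Let dk_near k (e : R) : 0 < e -> exists2 d, DD k d & `|d - dk k| < e.
Proof.
move=> e0; have [d hd he] := inf_adherent e0 (dk_inf k); exists d => //.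
have h : dk k <= d by apply: ge_inf => //; exact: (dk_inf k).2.
by rewrite ger0_norm ?subr_ge0// ltrBlDl.
Qed.

Let dk_notin k : ~ DD k (dk k).
Proof.
move=> /oscillating_open[dl dl0 hdl].
have d2 : 0 < dl / 2 by rewrite divr_gt0.
have : DD k (dk k - dl / 2).
  by apply: hdl; rewrite addrAC subrr sub0r normrN gtr0_norm// ltr_pdivrMr// ltr_pMr// ltr1n.
move=> h; have := ge_inf (dk_inf k).2 h; rewrite -/(dk k); lra.
Qed.

Let few k tl y z : fd tl y z (dk k) -> ~ many k.+1 [set s : R | tl < s /\ y s = 0].
Proof. by move=> f hm; apply: (@dk_notin k); split=> //; exists tl, y, z. Qed.

(** If y z < 0 at s, the same holds for nearby d, and by [radial_mono] their solutions have no zero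
    left of s. From s on they have as many zeros as the solution of dk k, at most k; but some nearby
    d has more. *)
Let radial_nonneg k tl y z : fd tl y z (dk k) -> forall s, tl < s -> s <= T -> 0 <= y s * z s.
Proof.
move=> f s hs sT; rewrite leNgt; apply/negP => neg.
have ys : y s != 0 by apply: contraTneq neg => ->; rewrite mul0r ltxx.
have d0 := nz (dk_pos k).
have [j hj] := fd_finite q2 ca cb f d0 hs.
have jk : (j < k.+1)%N.
  rewrite ltnNge; apply/negP => h; apply: (few f).
  by apply: many_sub (card_many hj h) => r [h1 h2]; split=> //; exact: lt_le_trans h1.
(* Perturbing y and z by less than e <= 1 changes the product y z by less than e P. *)
pose P := `|y s| + `|z s| + 1.
have P0 : 0 < P by rewrite ltr_wpDl// addr_ge0.
pose e := Num.min 1 (- (y s * z s) / P).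
have e0 : 0 < e by rewrite lt_min ltr01 divr_gt0// oppr_gt0.
have [dl dl0 hdl] := fd_stable q2 nu0 ca cb Ta Tb f d0 hs ys hj e0.
have [d [dp [tl1 [y1 [z1 [f1 hm]]]]] hd] := dk_near k dl0.
have [tl2 [y2 [z2 [h2 f2 hj2 cy cz]]]] := hdl d hd.
have neg2 : y2 s * z2 s < 0.
  have e1 : e <= 1 by rewrite ge_min lexx.
  have eP : e * P <= - (y s * z s) by rewrite -ler_pdivlMr// ge_min lexx orbT.
  have -> : y2 s * z2 s = y s * z s + ((y2 s - y s) * (z2 s - z s) + (y2 s - y s) * z s + y s * (z2 s - z s)) by ring.
  have : `|(y2 s - y s) * (z2 s - z s) + (y2 s - y s) * z s + y s * (z2 s - z s)| < e * P.
    apply: (le_lt_trans (ler_normD _ _)); have := ler_normD ((y2 s - y s) * (z2 s - z s)) ((y2 s - y s) * z s).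
    rewrite !normrM.
    have k1 : `|y2 s - y s| * `|z2 s - z s| < e * 1.
      by apply: ltr_pM => //; exact: lt_le_trans e1.
    have k2 : `|y2 s - y s| * `|z s| <= e * `|z s| by rewrite ler_wpM2r// ltW.
    have k3 : `|y s| * `|z2 s - z s| <= `|y s| * e by rewrite ler_wpM2l// ltW.
    rewrite /P; lra.
  rewrite ltr_norml => /andP[_]; lra.
have : many k.+1 (zeros_from y2 s).
  apply: many_sub hm => r [h3 h4].
  have sr : s <= r.
    rewrite leNgt; apply/negP => rs.
    have t1s : tl1 < s by exact: lt_trans rs.
    have [ey ez] := fd_unique q2 nu0 Ta Tb f1 f2 t1s h2.
    have := radial_mono f1 (nz dp) h3 rs sT; rewrite h4 mul0r ey ez; lra.
  split=> //; have tr : tl2 < r by exact: lt_le_trans sr.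
  by have [<- _] := fd_unique q2 nu0 Ta Tb f1 f2 h3 tr.
by move/(many_le hj2); rewrite leqNgt jk.
Qed.

(** If the solution stopped at ts >= T, having at most k zeros would bound it through [nodal_bound],
    as b <= 0 there. If ts < T, then y^2 is nondecreasing in s up to T by [radial_nonneg], so |y| <=
    |y T| on that part. Both contradict blow-up. *)
Let global_dk k : exists y z, forall tl, fd tl y z (dk k).
Proof.
have d0 := nz (dk_pos k).
have [y [z [g|[ts [f nb _]]]]] := fd_maximal q2 nu0 ca cb Ta Tb (dk k).
  by exists y, z.
exfalso.
pose s1 := ts + 1.
have s1t : ts < s1 by rewrite ltrDl.
have [M1 _ hM1] := fd_bounded f s1t.
suff [M2 hM2] : exists M2 : R, forall s, ts < s -> s <= s1 -> `|y s| <= M2.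
  apply: (nb (Num.max M1 (M2 * expR (nu * s1)))) => s hs; rewrite le_max.
  have [h|h] := leP s1 s; first by rewrite hM1.
  apply/orP; right; rewrite normrM (gtr0_norm (expR_gt0 _)).
  apply: ler_pM; [exact: normr_ge0|exact: expR_ge0|exact: hM2 (ltW h)|].
  by rewrite ler_expR ler_pM2l// ltW.
have [hT|hT] := ltP ts T; last first.
  have [lam [lam0 hlam]] : exists lam : R, 0 < lam /\ forall s, ts <= s <= s1 -> `|a s| <= lam ^+ 2.
    have [C C0 hC] := @cts_bounded _ a ts s1 (fun t _ => @ca t).
    exists (Num.sqrt C); split; first by rewrite sqrtr_gt0.
    by move=> s hs; rewrite sqr_sqrtr; [exact: hC|exact: ltW].
  have [Bb Bb0 hBb] := @cts_bounded _ b ts s1 (fun t _ => @cb t).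
  have rng t : - s1 <= t <= - ts -> ts <= - t <= s1 by move=> /andP[h1 h2]; apply/andP; split; lra.
  pose C0 := `|y s1| + `|z s1|.
  have C00 : 0 <= C0 by rewrite addr_ge0.
  have s1ts : - s1 <= - ts by lra.
  have ra t : - s1 <= t <= - ts -> 0 <= a (- t) <= lam ^+ 2.
    by move=> ht; rewrite (ltW (a0 _)) /=; apply: le_trans (hlam _ (rng t ht)); exact: ler_norm.
  have rb t : - s1 <= t <= - ts -> - Bb <= b (- t) <= 0.
    move=> ht; have h := hBb _ (rng t ht); have h1 : b (- t) <= 0.
      by apply: bneg; apply: (le_trans hT); have /andP[] := rng t ht.
    by rewrite h1 andbT; have := ler_norm (- b (- t)); rewrite normrN; lra.
  have [C' C'0 hC'] := nodal_bound q2 lam0 (ltW Bb0) s1ts ra rb k C00.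
  exists C' => s hs ss1.
  have h1 : - s1 <= - s by lra.
  have h2 : - s <= - ts by lra.
  have sol : solves q (fun t => a (- t)) (fun t => b (- t)) (fun t => y (- t)) (fun t => - z (- t)) (- s1) (- s).
    by move=> r /andP[r1 r2]; apply: sol_refl; apply: f.1; lra.
  have sub : [set r | - s1 < r < - s /\ y (- r) = 0] `<=` [set r | (- s1 <= r <= - s) /\ y (- r) = 0].
    by move=> r [/andP[r1 r2] h]; split=> //; rewrite !ltW.
  have [||||h _] := hC' (fun t => y (- t)) (fun t => - z (- t)) (- s1) (- s) (lexx _) h1 h2 sol.
  - apply: sub_finite_set sub _; apply: (@zeros_finite _ (fun t => y (- t)) (fun t => - z (- t))).
    + by move=> r /sol[].
    + by move=> r /sol[_ h]; exact: HD_cts h.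
    + move=> r /andP[r1 r2] yr; rewrite oppr_eq0; apply: (fd_simple_zeros q2 ca cb f d0) => //; lra.
  - move=> [e he einj]; apply: (few f); exists (fun i => - e i).
      by move=> i /he[/andP[r1 r2] h]; split=> //; lra.
    by move=> i j hi hj /oppr_inj; exact: einj.
  - by rewrite opprK /C0; have := normr_ge0 (z s1); lra.
  - by rewrite opprK normrN /C0; have := normr_ge0 (y s1); lra.
  by rewrite opprK in h.
have [C C0 hC] := @cts_bounded _ y T (Num.max T s1)
  (fun t h => HD_cts (fd_HD f (lt_le_trans hT (proj1 (andP h))))).
exists C => s hs ss1; have yT : `|y T| <= C by apply: hC; rewrite lexx le_max lexx.
have [h|h] := leP T s.
  by apply: hC; rewrite h le_max ss1 orbT.
apply: le_trans yT; rewrite -ler_sqr ?nnegrE// !real_normK ?num_real//.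
apply: (HD_le (f := fun s => y s ^+ 2) (df := fun s => 2 * y s * z s) (ltW h)).
  by move=> r /andP[r1 _]; apply: HD_sqr; apply: (fd_HD f); exact: lt_le_trans r1.
move=> r /andP[r1 r2]; rewrite -mulrA mulr_ge0//; apply: (radial_nonneg f) => //.
exact: lt_le_trans r1.
Qed.

Let nonzero_left k y z : (forall tl, fd tl y z (dk k)) -> forall s, s <= T -> y s != 0.
Proof.
move=> g s hs; apply/eqP => ys.
have s1 : s - 1 < s by rewrite ltrBlDr ltrDl.
have s2 : s - 2 < s - 1 by lra.
have := radial_mono (g (s - 2)) (nz (dk_pos k)) s2 s1 hs; rewrite ys mul0r.
have := radial_nonneg (g (s - 2)) s2 (le_trans (ltW s1) hs); lra.
Qed.

Let fast_left k y z : (forall tl, fd tl y z (dk k)) ->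
  exists L, limp (fun t => y (- t) * expR (mu * t)) L.
Proof.
move=> g; have sol s : sol_at q a b y z s by apply: (g (s - 1)).1; rewrite ltrBlDr ltrDl.
have HDy t : HD (fun t => y (- t)) t (- z (- t)) by have [] := sol_refl (sol (- t)).
pose A t := a (- t) + b (- t) * `|y (- t)| `^ (q - 2).
have HDz t : HD (fun t => - z (- t)) t (A t * y (- t)) by exact: sol_coef (sol_refl (sol (- t))).
have cN : cts (fun s : R => - s) by apply: cts_N; exact: cts_id.
have car := cts_comp ca cN.
have Aa t : - T < t -> a (- t) <= A t.
  by move=> ht; rewrite lerDl mulr_ge0 ?powR_ge0// bpos//; lra.
have bd t : - T < t -> `|y (- t)| <= `|y T|.
  move=> ht; rewrite -ler_sqr ?nnegrE// !real_normK ?num_real//.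
  have h : - t <= T by lra.
  apply: (HD_le (f := fun s => y s ^+ 2) (df := fun s => 2 * y s * z s) h).
    by move=> r _; apply: HD_sqr; have [] := sol r.
  move=> r /andP[_ r2]; rewrite -mulrA mulr_ge0//; apply: (radial_nonneg (g (r - 1))) => //.
  by rewrite ltrBlDr ltrDl.
have sgn u : u <= T -> y u * y T <= 0 -> False.
  move=> uT h; have [r /andP[_ r2] yr] := IVT0 uT (fun r _ => HD_cts (proj1 (sol r))) h.
  by have := nonzero_left g r2; rewrite yr eqxx.
have [p|p] := ltP 0 (y T).
  have pos t : - T < t -> 0 < y (- t).
    move=> ht; rewrite ltNge; apply/negP => h; apply: (sgn (- t)); first lra.
    by rewrite mulr_le0_ge0// ltW.
  have yC t : - T < t -> y (- t) <= `|y T| by move=> ht; apply: le_trans (bd t ht); exact: ler_norm.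
  exact: (bounded_pos_fd mu0 car Tal (fun t _ => HDy t) (fun t _ => HDz t) pos Aa yC).
have pos t : - T < t -> 0 < - y (- t).
  move=> ht; rewrite oppr_gt0 ltNge; apply/negP => h; apply: (sgn (- t)); first lra.
  by rewrite mulr_ge0_le0.
have yC t : - T < t -> - y (- t) <= `|y T|.
  by move=> ht; apply: le_trans (bd t ht); rewrite -normrN; exact: ler_norm.
have [L hL] := bounded_pos_fd mu0 car Tal (fun t _ => HD_N (HDy t))
  (fun t _ => HD_cv (HD_N (HDz t)) (esym (mulrN _ _))) pos Aa yC.
exists (- L); apply: (limp_ext (N := 0)) (limpN hL) => t _; by rewrite mulNr opprK.
Qed.

(** Some nearby d has k+1 zeros, of which at most one lies left of T; the remaining k are counted
    from T on, where the number of zeros is stable. *)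
Let exact_count k y z : (forall tl, fd tl y z (dk k)) -> (zero_set y #= `I_k)%card.
Proof.
move=> g; have d0 := nz (dk_pos k).
have T1 : T - 1 < T by rewrite ltrBlDr ltrDl.
have [j hj] := fd_finite q2 ca cb (g (T - 1)) d0 T1.
have e : zero_set y = zeros_from y T.
  apply/seteqP; split=> s /=; last by case.
  move=> ys; split=> //; rewrite leNgt; apply/negP => /ltW h.
  by have := nonzero_left g h; rewrite ys eqxx.
rewrite e.
have jk : (j < k.+1)%N.
  rewrite ltnNge; apply/negP => h; apply: (few (g (T - 1))).
  by apply: many_sub (card_many hj h) => r [h1 h2]; split=> //; exact: lt_le_trans h1.
have [dl dl0 hdl] := fd_stable q2 nu0 ca cb Ta Tb (g (T - 1)) d0 T1 (nonzero_left g (lexx T)) hj (@ltr01 R).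
have [d [dp [tl1 [y1 [z1 [f1 hm]]]]] hd] := dk_near k dl0.
have [tl2 [y2 [z2 [h2 f2 hj2 _ _]]]] := hdl d hd.
have inc r : tl1 < r -> y1 r = 0 -> T <= r -> zeros_from y2 T r.
  move=> hr yr Tr; split=> //; have tr : tl2 < r by exact: lt_le_trans Tr.
  by have [<- _] := fd_unique q2 nu0 Ta Tb f1 f2 hr tr.
suff h : (k < j.+1)%N by have -> : k = j by apply/eqP; rewrite eqn_leq -ltnS h -ltnS jk.
case: (pselect (exists2 r, tl1 < r < T & y1 r = 0)) => [[r /andP[r1 r2] yr]|nex].
  have c1 : (zeros_from y2 T `|` [set r] #= `I_j.+1)%card.
    by apply: card_add1 => // -[h _]; lra.
  apply: (many_le c1); apply: many_sub hm => u [u1 u2].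
  have [h|h] := leP T u; [by left; exact: inc|right].
  have [h3|h3|//] := ltgtP u r; exfalso.
    by have := radial_mono f1 (nz dp) u1 h3 (ltW r2); rewrite u2 yr !mul0r ltxx.
  by have := radial_mono f1 (nz dp) r1 h3 (ltW h); rewrite u2 yr !mul0r ltxx.
suff : (k < j)%N by exact: ltnW.
apply: (many_le hj2); apply: many_sub hm => u [u1 u2]; apply: inc => //.
by rewrite leNgt; apply/negP => h; apply: nex; exists u => //; rewrite u1.
Qed.

(* A k is the infimum of the set of d whose solution has more than k zeros. This set is open, so at A k there
   are at most k zeros; hence the solution is bounded up to T. Beyond T it must decay in modulus, since an
   increasing y^2 would persist for nearby d and prevent further zeros. *)
Theorem regular_thresholds : exists A : nat -> R,
  [/\ forall k, 0 < A k, forall j k, (j < k)%N -> A j < A k &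
    forall k, exists y z, [/\ forall tl, fd tl y z (A k), (zero_set y #= `I_k)%card &
      exists L, limp (fun t => y (- t) * expR (mu * t)) L]].
Proof.
exists dk; split=> //.
  move=> j k jk; have sub : DD k `<=` DD j.
    move=> d [dp [tl [y [z [f [e he einj]]]]]]; split=> //; exists tl, y, z; split=> //.
    by exists e => [i hi|i l hi hl]; [apply: he|apply: einj]; apply: leq_trans (leqW jk).
  rewrite lt_neqAle; apply/andP; split; last first.
    by apply: lb_le_inf => // d /sub h; exact: ge_inf (dk_inf j).2 _ h.
  apply/eqP => e; have [y [z g]] := global_dk k; have hk := exact_count g.
  rewrite -e in g; have jk' := card_unique (exact_count g) hk; by rewrite jk' ltnn in jk.
move=> k; have [y [z g]] := global_dk k; exists y, z; split=> //; first exact: exact_count g.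
exact: fast_left g.
Qed.

End Thresholds.

(** * The equation in logarithmic time *)

Section Core.
Variable R : realType.
Variables (q mu nu gam kI T : R) (a b k k' : R -> R).
Hypotheses (q2 : 2 < q) (mu0 : 0 < mu) (nu0 : 0 < nu) (gam0 : 0 < gam) (gamnu : gam / 2 < nu) (kI0 : 0 < kI).
Hypotheses (ca : cts a) (cb : cts b) (a0 : forall t, 0 < a t).
Hypotheses (bneg : forall t, t < T -> b t < 0) (bpos : forall t, T <= t -> 0 <= b t).
Hypothesis Ta : Tail (fun t => `|a t - mu ^+ 2|).
Hypothesis Tb : Tail (fun t => `|b t| * expR (- (mu * (q - 2)) * t)).
Hypothesis Tar : Tail (fun s => `|a (- s) - nu ^+ 2|).
Hypothesis lar : limp (fun s => a (- s)) (nu ^+ 2).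
Hypothesis bk : forall s, b (- s) = - k s * expR (- ((q - 2) * gam / 2) * s).
Hypotheses (hk : forall s, HD k s (k' s)) (ck' : cts k') (Tk : Tail (fun s => `|k' s|)) (lk : limp k kI).

Definition coefc s := a (- s) - gam ^+ 2 / 4.
(* The Emden-Fowler variable adapted to K ~ k0 r^delta0, and its derivative in s = - t. *)
Definition xof (y : R -> R) s := y (- s) * expR (- (gam / 2) * s).
Definition pof (y z : R -> R) s := (- z (- s) - gam / 2 * y (- s)) * expR (- (gam / 2) * s).

Local Notation c := coefc.
Local Notation fd := (fdsol q a b mu).

Let cI : R := nu ^+ 2 - gam ^+ 2 / 4.

(** This is gam / 2 < nu, and makes x = 0 a saddle of the limit equation. *)
Let cI0 : 0 < cI.
Proof.
rewrite /cI; have h : (gam / 2) ^+ 2 < nu ^+ 2.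
  by rewrite ltrXn2r// ?nnegrE ?divr_ge0// ltW.
by move: h; rewrite exprMn; lra.
Qed.

Let cneg : cts (fun s : R => - s). Proof. by apply: cts_N; exact: cts_id. Qed.
Let car : cts (fun s => a (- s)). Proof. exact: cts_comp. Qed.
Let cbr : cts (fun s => b (- s)). Proof. exact: cts_comp. Qed.

Let cc : cts c. Proof. by apply: cts_D car _; exact: cts_c. Qed.

Let Tc : Tail (fun s => `|c s - cI|).
Proof.
have [N hN N0] := Tar; exists N => // s; apply: HD_cv (hN s) _.
by congr (- `|_|); rewrite /c /cI; ring.
Qed.

Let lc : limp c cI.
Proof. by apply: limpD => //; exact: limp_c. Qed.

Let kpos s : - T < s -> 0 < k s.
Proof.
move=> sT; have := @bneg (- s); rewrite bk mulNr => /(_ ltac:(lra)).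
by rewrite oppr_lt0 pmulr_lgt0// expR_gt0.
Qed.

Lemma xeq_of y z s : sol_at q a b y z (- s) -> xeq q gam c k (xof y) (pof y z) s.
Proof.
move=> h; have [hy hz] := sol_refl h.
have e : psi q (xof y s) = expR (- ((q - 2) * gam / 2) * s) * (expR (- (gam / 2) * s) * psi q (y (- s))).
  by rewrite /xof mulrC psi_exp mulrA -expRD; congr (expR _ * _); field.
split.
  rewrite /xof /pof; eapply HD_cv.
    apply: HD_M; first exact: hy.
    by apply: HD_exp; apply: HD_M; [exact: HD_c|exact: HD_id].
  by cbv beta; field.
rewrite /pof; eapply HD_cv.
  apply: HD_M.
    apply: HD_D; first exact: hz.
    by apply: HD_N; apply: HD_M; [exact: HD_c|exact: hy].
  by apply: HD_exp; apply: HD_M; [exact: HD_c|exact: HD_id].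
by cbv beta; rewrite e /xof /c bk; field.
Qed.

(** The Lyapunov function bounds x from a point below T on, so no blow-up can occur where b < 0. *)
Lemma left_bounded y z tl L : fd tl y z L -> tl < T ->
  exists M : R, forall t, tl < t -> `|y t * expR (mu * t)| <= M.
Proof.
move=> f tlT; pose t0 := (tl + T) / 2.
have tt0 : tl < t0 by rewrite /t0; lra.
have t0T : t0 < T by rewrite /t0; lra.
have [M M0 hM] := fd_bounded f tt0.
have [|C1 [d [sl [r0 [V land]]]]] := @landing_exists R q gam cI kI (- t0) c k k' q2 gam0 cI0 kI0
  cc Tc lc hk ck' Tk lk.
  by move=> s hs; apply: kpos; lra.
pose V0 := V (- t0) (xof y (- t0)) (pof y z (- t0)).
pose E := expR (`|gam / 2 - mu| * (`|t0| + `|tl|)).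
exists (M + (1 + 2 * V0) * E) => t tt.
have V00 : 0 <= V0.
  by have := landing_bound land (xof y (- t0)) (pof y z (- t0)) (lexx (- t0)); have := sqr_ge0 (xof y (- t0)); rewrite /V0; lra.
have E0 : 0 < E by exact: expR_gt0.
have P0 : 0 <= (1 + 2 * V0) * E by rewrite mulr_ge0 ?ltW//; lra.
have [t0t|tt0'] := leP t0 t; first by have := hM t t0t; lra.
have s1 : - t0 <= - t by lra.
have V1 : V (- t) (xof y (- t)) (pof y z (- t)) <= V0.
  apply: (landing_noninc land (x := xof y) (p := pof y z) (lexx _) s1) => s /andP[h1 h2].
  by apply: xeq_of; apply: f.1; lra.
have x2 := landing_bound land (xof y (- t)) (pof y z (- t)) s1.
have x1 : `|xof y (- t)| <= 1 + 2 * V0.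
  have h : `|xof y (- t)| ^+ 2 <= 2 * V0 by rewrite real_normK ?num_real//; lra.
  have [h1|h1] := leP `|xof y (- t)| 1; first by lra.
  have : `|xof y (- t)| <= `|xof y (- t)| ^+ 2 by rewrite ler_eXnr// ltW.
  lra.
have e : y t * expR (mu * t) = xof y (- t) * expR ((mu - gam / 2) * t).
  by rewrite /xof opprK -mulrA -expRD; congr (_ * expR _); ring.
rewrite e normrM (gtr0_norm (expR_gt0 _)).
have : `|xof y (- t)| * expR ((mu - gam / 2) * t) <= (1 + 2 * V0) * E.
  apply: ler_pM; [exact: normr_ge0|exact: expR_ge0|exact: x1|].
  rewrite ler_expR; apply: (le_trans (ler_norm _)); rewrite normrM (distrC mu).
  apply: ler_wpM2l => //; rewrite ler_norml.
  have := ler_norm t0; have := ler_norm tl; have := ler_norm (- t0); have := ler_norm (- tl).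
  by rewrite !normrN => h1 h2 h3 h4; apply/andP; split; have := normr_ge0 t0; have := normr_ge0 tl; lra.
lra.
Qed.

Definition global (y z : R -> R) (L : R) := forall tl, fd tl y z L.
(** Passing the sign change T is enough: by [left_bounded] the solution is then global. This makes
    openness easy to check. *)
Definition admissible : set R := [set L | 0 < L /\ exists tl y z, tl < T /\ fd tl y z L].
Local Notation LL := admissible.

Lemma global_unique y z y' z' L : global y z L -> global y' z' L -> y = y' /\ z = z'.
Proof.
move=> g g'; split; apply/funext => t;
  have t1 : t - 1 < t by [rewrite ltrBlDr ltrDl].
  by have [] := fd_unique q2 mu0 Ta Tb (g (t - 1)) (g' (t - 1)) t1 t1.
by have [] := fd_unique q2 mu0 Ta Tb (g (t - 1)) (g' (t - 1)) t1 t1.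
Qed.

Lemma admissible_global L : LL L -> exists y z, global y z L.
Proof.
move=> [L0 [tl [y [z [tlT f]]]]].
have [y1 [z1 [g|[ts [f1 nb ts_min]]]]] := fd_maximal q2 mu0 ca cb Ta Tb L.
  by exists y1, z1.
have tsT : ts < T by apply: le_lt_trans tlT; exact: ts_min f.
by have [M hM] := left_bounded f1 tsT; case: (nb M).
Qed.

Lemma global_admissible y z L : 0 < L -> global y z L -> LL L.
Proof. by move=> L0 g; split=> //; exists (T - 1), y, z; split=> //; rewrite ltrBlDr ltrDl. Qed.

(** If the solution for L' stopped at some ts >= T, it would lie between 0 and the global solution
    for L on its whole domain, by comparison, and could not blow up. *)
Lemma admissible_down L L' : LL L -> 0 < L' -> L' < L -> LL L'.
Proof.
move=> hL L'0 L'L; have [y [z g]] := admissible_global hL.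
have [y1 [z1 [g1|[ts [f1 nb ts_min]]]]] := fd_maximal q2 mu0 ca cb Ta Tb L'.
  exact: global_admissible g1.
have [tsT|Tts] := ltP ts T; first by split=> //; exists ts, y1, z1.
have [M M0 hM] := fd_bounded (g (ts - 1)) (t0 := ts) ltac:(by rewrite ltrBlDr ltrDl).
case: (nb M) => t tt; apply: le_trans (hM t (ltW tt)).
have p := fd_pos q2 mu0 (fun t _ => a0 t) (fun t (h : ts < t) => bpos (le_trans Tts (ltW h))) f1 L'0 tt.
have [h _] := fd_comparison q2 mu0 (fun t _ => a0 t) (fun t (h : ts < t) => bpos (le_trans Tts (ltW h))) f1 (g ts) L'L tt.
rewrite !normrM ler_wpM2r//.
by rewrite (gtr0_norm p.1) (gtr0_norm (lt_trans p.1 h)) ltW.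
Qed.

Lemma global_near yh zh Lh t0 e : global yh zh Lh -> 0 < e -> exists2 dl : R, 0 < dl &
  forall L, 0 < L -> `|L - Lh| < dl -> LL L /\ forall y z, global y z L ->
    forall t, t0 <= t -> `|y t - yh t| < e /\ `|z t - zh t| < e.
Proof.
move=> g e0; pose t1 := Num.min t0 T - 1.
have t10 : t1 < t0.
  by have h : Num.min t0 T <= t0 by [rewrite ge_min lexx]; rewrite /t1; lra.
have t1T : t1 < T.
  by have h : Num.min t0 T <= T by [rewrite ge_min lexx orbT]; rewrite /t1; lra.
have [M M0 hM] := fd_bounded (g (t1 - 1)) (t0 := t1) ltac:(by rewrite ltrBlDr ltrDl).
have [delta [C [d0 C0 hd]]] := fd_near q2 mu0 ca cb Ta Tb t1 (ltW M0).
pose w := expR (mu * t1).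
have w0 : 0 < w by exact: expR_gt0.
have ew : 0 < e * w / C by rewrite divr_gt0// mulr_gt0.
exists (Num.min delta (e * w / C)); first by rewrite lt_min d0.
move=> L L0; rewrite lt_min => /andP[h1 h2].
have [eps [y1 [z1 [eps0 f1 close]]]] := hd _ _ _ _ (g t1) (fun t h => hM t (ltW h)) h1.
split; first by split=> //; exists (t1 - eps), y1, z1; split=> //; lra.
move=> y z gy t tt.
have t1t : t1 < t by lra.
have t1et : t1 - eps < t by lra.
have [-> ->] := fd_unique q2 mu0 Ta Tb (gy t1) f1 t1t t1et.
have [c1 c2] := close t t1t.
have small : C * `|L - Lh| < e * w by rewrite mulrC -ltr_pdivlMr.
have wt : w <= expR (mu * t) by rewrite ler_expR ler_pM2l// ltW.
have key u : 0 <= u -> u * expR (mu * t) <= C * `|L - Lh| -> u < e.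
  move=> u0 h; rewrite -(ltr_pM2r w0); apply: le_lt_trans small; apply: le_trans h.
  by rewrite ler_wpM2l.
by split; exact: key.
Qed.

Lemma global_sol y z L t : global y z L -> sol_at q a b y z t.
Proof. by move=> g; apply: (g (t - 1)).1; rewrite ltrBlDr ltrDl. Qed.

Lemma global_HD y z L t : global y z L -> HD y t (z t).
Proof. by move=> /global_sol h; have [] := h t. Qed.

Lemma global_ctsz y z L t : global y z L -> {for t, continuous z}.
Proof. by move=> /global_sol h; have [_ h2] := h t; exact: HD_cts h2. Qed.

Lemma global_simple y z L t : global y z L -> L != 0 -> y t = 0 -> z t != 0.
Proof.
move=> g L0; apply: (fd_simple_zeros q2 ca cb (g (t - 1)) L0).
by rewrite ltrBlDr ltrDl.
Qed.

Lemma global_pos y z L t : global y z L -> 0 < L -> T <= t -> 0 < y t.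
Proof.
move=> g L0.
have pos s : T < s -> 0 < y s /\ z s < 0.
  exact: (fd_pos q2 mu0 (fun t _ => a0 t) (fun t (h : T < t) => bpos (ltW h)) (g T) L0).
rewrite le_eqVlt => /predU1P[<-|/pos[]//].
have T1 : T < T + 1 by rewrite ltrDl.
have : y (T + 1) < y T.
  rewrite -[ltLHS]opprK ltrNl.
  apply: (HD_lt (f := fun t => - y t) (df := fun t => - z t) T1).
    by move=> s _; apply: HD_N; exact: global_HD g.
  by move=> s /andP[/pos[_ h] _]; rewrite oppr_gt0.
by have [h _] := pos _ T1; exact: lt_trans.
Qed.

Lemma xeq_global y z L s : global y z L -> xeq q gam c k (xof y) (pof y z) s.
Proof. by move=> g; apply: xeq_of; exact: global_sol g. Qed.

Lemma xof0 y s : (xof y s == 0) = (y (- s) == 0).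
Proof. by rewrite /xof mulf_eq0 [expR _ == 0]gt_eqF ?expR_gt0// orbF. Qed.

Lemma pof_nz y z L s : global y z L -> L != 0 -> xof y s = 0 -> pof y z s != 0.
Proof.
move=> g L0 /eqP; rewrite xof0 => /eqP ys; rewrite /pof ys mulr0 subr0.
apply: mulf_neq0; last by rewrite gt_eqF ?expR_gt0.
by rewrite oppr_eq0; exact: global_simple g L0 ys.
Qed.

(** Up to a positive factor the virial is the s-derivative of y^2 / 2, so its sign governs the
    monotonicity of |y|. *)
Lemma virial_of y z s : virial gam s (xof y) (pof y z) = - (y (- s) * z (- s)) * expR (- (gam / 2) * s) ^+ 2.
Proof. by rewrite /virial /xof /pof; field. Qed.

(** Makes the theory of [fdsol] available at - oo with rate nu. *)
Lemma reflected_tail : Tail (fun s => `|b (- s)| * expR (- (nu * (q - 2)) * s)).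
Proof.
have p : 0 < (q - 2) * (gam / 2 + nu).
  by apply: mulr_gt0; [rewrite subr_gt0|rewrite addr_gt0// divr_gt0].
have [C C0 hC] := @limp_bounded _ k kI 0 lk (fun t _ => HD_cts (hk t)).
apply: (@Tail_le _ _ (fun s => C * expR (- ((q - 2) * (gam / 2 + nu)) * s)) 0).
- apply: cts_M; first exact: cts_abs.
  by apply: cts_exp; apply: cts_M; [exact: cts_c|exact: cts_id].
- move=> s s0; rewrite normrM normr_id (gtr0_norm (expR_gt0 _)) bk normrM normrN (gtr0_norm (expR_gt0 _)).
  rewrite -mulrA -expRD.
  have -> : - ((q - 2) * gam / 2) * s + - (nu * (q - 2)) * s = - ((q - 2) * (gam / 2 + nu)) * s.
    by field.
  by rewrite ler_wpM2r ?expR_ge0// hC// ltW.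
- by apply: TailZ; exact: Tail_exp.
Qed.

Lemma global_reflect y z L d s0 : global y z L -> limp (fun s => y (- s) * expR (nu * s)) d ->
  fdsol q (fun s => a (- s)) (fun s => b (- s)) nu s0 (fun s => y (- s)) (fun s => - z (- s)) d.
Proof. by move=> g h; split=> // s _; apply: sol_refl; exact: global_sol g. Qed.

Section Types.
Variables (C1 d sl r0 : R) (V : R -> R -> R -> R).
Hypothesis land : landing q gam c k (1 - T) C1 d sl r0 V.

Let slT : - T < sl.
Proof. by have h := landing_sl land; move: h; lra. Qed.

Definition Vof y z s := V s (xof y s) (pof y z s).
Definition typeS y z := exists2 s, sl <= s & Vof y z s < C1.
Definition typeR y z := forall s, sl <= s -> C1 <= Vof y z s.

Lemma type_dichotomy y z : typeS y z \/ typeR y z.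
Proof.
case: (pselect (typeS y z)) => h; [by left|right=> s ss].
by rewrite leNgt; apply/negP => Vs; apply: h; exists s.
Qed.

Lemma typeSR y z : typeS y z -> typeR y z -> False.
Proof. by move=> [s ss Vs] /(_ s ss); rewrite leNgt Vs. Qed.

(* Here the Lyapunov function never drops below the saddle level, which makes y^2 eventually nonincreasing in s. *)
Lemma typeR_limit y z L : global y z L -> L != 0 -> typeR y z ->
  exists dd, limp (fun s => y (- s) * expR (nu * s)) dd.
Proof.
move=> g L0 tR.
have [s1 s1l small] := landing_small land (lexx sl) (fun s _ => xeq_global s g) tR.
have virn s : s1 <= s -> 0 <= y (- s) * z (- s).
  move=> hs; have [_ h] := small s hs; move: h; rewrite virial_of mulNr oppr_le0.
  by rewrite pmulr_lge0// exprn_gt0// expR_gt0.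
have nz s : s1 <= s -> y (- s) != 0.
  move=> hs; apply/eqP => ys.
  have s12 : s < s + 1 by rewrite ltrDl.
  have := landing_virial land (le_trans s1l hs) s12 (fun r _ => xeq_global r g)
    (fun r hr => (small r (le_trans hs (proj1 (andP hr)))).1) (fun r _ => @pof_nz y z L r g L0).
  rewrite {1}virial_of ys mul0r oppr0 mul0r.
  by have [_ h] := small (s + 1) (le_trans hs (ltW s12)); rewrite ltNge h.
have HDr s : HD (fun s => y (- s)) s (- z (- s)) by apply: reflect_HD; exact: global_HD g.
have sqn s t : s1 <= s -> s <= t -> y (- t) ^+ 2 <= y (- s) ^+ 2.
  move=> hs st; apply: (HD_ge (f := fun s => y (- s) ^+ 2)
    (df := fun s => - (2 * (y (- s) * z (- s)))) st).
    by move=> r _; apply: HD_cv (HD_sqr (HDr r)) _; ring.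
  by move=> r /andP[h1 _]; rewrite oppr_le0 mulr_ge0// virn// (le_trans hs).
have bd s : s1 <= s -> `|y (- s)| <= `|y (- s1)|.
  move=> hs; rewrite -ler_sqr ?nnegrE// !real_normK ?num_real//; exact: sqn.
(* As y is bounded, the nonlinear term is an exponentially small change of the coefficient, so
   [bounded_pos_fd] applies with A itself as the comparison coefficient. *)
pose A s := a (- s) + b (- s) * `|y (- s)| `^ (q - 2).
have cA : cts A.
  move=> s; apply: (@coef_cts _ q (fun s => a (- s)) (fun s => b (- s)) (fun s => y (- s))) => //.
  exact: HD_cts (HDr s).
have TA : Tail (fun s => `|A s - nu ^+ 2|).
  have [K K0 hK] := @limp_bounded _ k kI s1 lk (fun t _ => HD_cts (hk t)).
  pose Y := `|y (- s1)| `^ (q - 2).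
  have p : 0 < (q - 2) * gam / 2 by rewrite divr_gt0// mulr_gt0// subr_gt0.
  apply: (@Tail_le _ _ (fun s => `|a (- s) - nu ^+ 2| + K * Y * expR (- ((q - 2) * gam / 2) * s)) s1).
  - by apply: cts_abs; apply: cts_D cA _; exact: cts_c.
  - move=> s hs; rewrite normr_id.
    have -> : A s - nu ^+ 2 = (a (- s) - nu ^+ 2) + b (- s) * `|y (- s)| `^ (q - 2) by rewrite /A; ring.
    apply: (le_trans (ler_normD _ _)); rewrite lerD2l normrM bk normrM normrN (gtr0_norm (expR_gt0 _)).
    rewrite (ger0_norm (powR_ge0 _ _)) mulrAC ler_wpM2r ?expR_ge0//.
    apply: ler_pM; [exact: normr_ge0|exact: powR_ge0|exact: hK (ltW hs)|].
    by apply: powR_mono; [by rewrite subr_ge0 ltW| |apply: bd; exact: ltW].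
  - by apply: TailD => //; apply: TailZ; exact: Tail_exp.
have HDz s : HD (fun s => - z (- s)) s (A s * y (- s)).
  have := sol_refl (global_sol (- s) g); rewrite ?opprK.
  have h := sol_refl (y := y) (z := z) (t := s) (global_sol (- s) g).
  by move=> _; exact: sol_coef h.
have [h|h] : (forall s, s1 < s -> 0 < y (- s)) \/ (forall s, s1 < s -> 0 < - y (- s)).
  have sgn u v : s1 <= u -> u <= v -> y (- u) * y (- v) <= 0 -> False.
    move=> hu uv h.
    have [||r /andP[r1 r2] yr] := @IVT0 _ (fun s => y (- s)) u v uv.
    - by move=> r _; exact: HD_cts (HDr r).
    - exact: h.
    by have := nz r (le_trans hu r1); rewrite yr eqxx.
  have [h|h] := ltP 0 (y (- s1)); [left|right] => s hs.
    rewrite ltNge; apply/negP => ys; apply: (sgn s1 s (lexx _) (ltW hs)).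
    by rewrite mulr_ge0_le0// ltW.
  rewrite oppr_gt0 ltNge; apply/negP => ys; apply: (sgn s1 s (lexx _) (ltW hs)).
  by rewrite mulr_le0_ge0.
- have yC t : s1 < t -> y (- t) <= `|y (- s1)| by move=> ht; apply: le_trans (bd t (ltW ht)); exact: ler_norm.
  exact: (bounded_pos_fd nu0 cA TA (fun t _ => HDr t) (fun t _ => HDz t) h (fun t _ => lexx (A t)) yC).
- have yC t : s1 < t -> - y (- t) <= `|y (- s1)|.
    by move=> ht; apply: le_trans (bd t (ltW ht)); rewrite -normrN; exact: ler_norm.
  have [dd hdd] := bounded_pos_fd nu0 cA TA (fun t _ => HD_N (HDr t))
    (fun t _ => HD_cv (HD_N (HDz t)) (esym (mulrN _ _))) h (fun t _ => lexx (A t)) yC.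
  exists (- dd); apply: limp_ext (limpN hdd) => // t _; by rewrite mulNr opprK.
Unshelve. all: exact: 0.
Qed.

Lemma limit_xp y z L dd : global y z L -> limp (fun s => y (- s) * expR (nu * s)) dd ->
  limp (xof y) 0 /\ limp (pof y z) 0.
Proof.
move=> g h.
have f := global_reflect 0 g h.
have z0 := fd_z0 q2 nu0 Tar reflected_tail f.
have p : 0 < gam / 2 + nu by rewrite addr_gt0// divr_gt0.
have E0 := limp_expN p.
have ex s : expR (nu * s) * expR (- (gam / 2 + nu) * s) = expR (- (gam / 2) * s).
  by rewrite -expRD; congr expR; ring.
split.
  rewrite -(mulr0 dd); apply: limp_ext (limpM h E0) => // s _.
  by rewrite -mulrA ex.
have -> : 0 = 0 * 0 - (gam / 2 + nu) * (dd * 0) :> R by ring.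
apply: (@limp_ext _ (fun s => (- z (- s) + nu * y (- s)) * expR (nu * s) * expR (- (gam / 2 + nu) * s)
   - (gam / 2 + nu) * (y (- s) * expR (nu * s) * expR (- (gam / 2 + nu) * s))) _ 0).
  by move=> s _; rewrite -!mulrA ex /pof; ring.
apply: limpD; first exact: limpM z0 E0.
by apply: limpN; apply: limpM; [exact: limp_c|exact: limpM].
Unshelve. all: exact: 0.
Qed.

Lemma typeR_low y z L : global y z L -> L != 0 -> typeR y z -> exists2 s, sl <= s & Vof y z s < C1 + d.
Proof.
move=> g L0 tR; have [dd hdd] := typeR_limit g L0 tR.
have [hx hp] := limit_xp g hdd.
have lV := landing_limit land hx hp.
have [N hN] := lV d (landing_d land).
exists (Num.max sl N); first by rewrite le_max lexx.
have := hN (Num.max sl N); rewrite le_max lexx orbT ltr_norml => /(_ isT) /andP[_].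
by rewrite ltrBlDl.
Qed.

Let saT s : sl <= s -> 1 - T <= s.
Proof. by apply: le_trans; exact: landing_sl land. Qed.

Lemma typeS_away y z L s0 : global y z L -> sl <= s0 -> Vof y z s0 < C1 ->
  exists2 m : R, 0 < m & forall s, s0 <= s -> m <= `|xof y s|.
Proof. by move=> g s0l; exact: (landing_away land (saT s0l) (fun s _ => xeq_global s g)). Qed.

(** y e^(nu s) equals x e^((gam / 2 + nu) s), and |x| stays above a positive constant. *)
Lemma typeS_blowup y z L : global y z L -> typeS y z ->
  (forall M, exists N, forall s, N <= s -> M <= y (- s) * expR (nu * s)) \/
  (forall M, exists N, forall s, N <= s -> y (- s) * expR (nu * s) <= M).
Proof.
move=> g [s0 s0l Vs]; have [m m0 hm] := typeS_away g s0l Vs.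
have nz s : s0 <= s -> y (- s) != 0.
  by move=> hs; rewrite -xof0 -normr_gt0; apply: lt_le_trans (hm s hs).
have HDr s : HD (fun s => y (- s)) s (- z (- s)) by apply: reflect_HD; exact: global_HD g.
have sgn u v : s0 <= u -> u <= v -> y (- u) * y (- v) <= 0 -> False.
  move=> hu uv h.
  have [||r /andP[r1 r2] yr] := @IVT0 _ (fun s => y (- s)) u v uv.
  - by move=> r _; exact: HD_cts (HDr r).
  - exact: h.
  by have := nz r (le_trans hu r1); rewrite yr eqxx.
have p : 0 < gam / 2 + nu by rewrite addr_gt0// divr_gt0.
have big M : exists N, forall s, N <= s -> M <= `|y (- s)| * expR (nu * s).
  exists (Num.max s0 (M / m / (gam / 2 + nu))) => s; rewrite ge_max => /andP[hs Ns].
  have -> : `|y (- s)| * expR (nu * s) = `|xof y s| * expR ((gam / 2 + nu) * s).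
    rewrite /xof normrM (gtr0_norm (expR_gt0 _)) -mulrA -expRD; congr (_ * expR _); ring.
  apply: (le_trans (y := m * ((gam / 2 + nu) * s))).
    by rewrite [leRHS]mulrC -ler_pdivrMr// [leRHS]mulrC -ler_pdivrMr.
  apply: (le_trans (y := m * expR ((gam / 2 + nu) * s))).
    rewrite ler_pM2l//; apply: le_trans (expR_ge1Dx _); lra.
  by rewrite ler_wpM2r ?expR_ge0// hm.
have [h|h] := ltP 0 (y (- s0)); [left|right] => M.
  have [N hN] := big M; exists (Num.max s0 N) => s; rewrite ge_max => /andP[hs Ns].
  have ys : 0 < y (- s).
    rewrite ltNge; apply/negP => ys; apply: (sgn s0 s (lexx _) hs).
    by rewrite mulr_ge0_le0// ltW.
  by have := hN s Ns; rewrite gtr0_norm.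
have [N hN] := big (- M); exists (Num.max s0 N) => s; rewrite ge_max => /andP[hs Ns].
have ys : y (- s) <= 0.
  rewrite leNgt; apply/negP => ys; apply: (sgn s0 s (lexx _) hs).
  by rewrite mulr_le0_ge0// ltW.
by have := hN s Ns; rewrite ler0_norm// mulNr lerN2.
Qed.


Lemma zero_set_loc y z L ta : global y z L -> 0 < L -> (forall t, t < ta -> y t != 0) ->
  zero_set y = zeros_in y ta T.
Proof.
move=> g L0 nz; apply/seteqP; split=> t; last by case.
move=> /= yt; split=> //; apply/andP; split; rewrite leNgt; apply/negP => h.
  by have := nz t h; rewrite yt eqxx.
by have := global_pos g L0 (ltW h); rewrite yt ltxx.
Qed.

Lemma no_zero_left_S y z L s0 : global y z L -> sl <= s0 -> Vof y z s0 < C1 ->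
  forall t, t <= - s0 -> y t != 0.
Proof.
move=> g s0l Vs t ht; have [m m0 hm] := typeS_away g s0l Vs.
rewrite -[t]opprK -xof0 -normr_gt0; apply: lt_le_trans (hm (- t) _) => //; lra.
Qed.

Lemma no_zero_left_R y z L s1 : global y z L -> L != 0 -> typeR y z -> sl <= s1 ->
  Vof y z s1 < C1 + d -> forall t, t <= - s1 -> y t != 0.
Proof.
move=> g L0 tR s1l Vs t ht; apply/eqP => yt.
have ht' : s1 <= - t by lra.
apply: (landing_no_zero land s1l ht' (fun s _ => xeq_global s g)
  (fun s _ => @pof_nz y z L s g L0) Vs (fun s hs => tR s (le_trans s1l hs))).
by apply/eqP; rewrite xof0 opprK yt.
Qed.

Lemma finite_zeros y z L : global y z L -> 0 < L -> exists j, (zero_set y #= `I_j)%card.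
Proof.
move=> g L0; apply/finite_setP.
have L0' : L != 0 by rewrite gt_eqF.
have [ta nz] : exists ta, forall t, t < ta -> y t != 0.
  have [[s0 s0l Vs]|tR] := type_dichotomy y z.
    by exists (- s0) => t /ltW; exact: no_zero_left_S g s0l Vs t.
  have [s1 s1l Vs] := typeR_low g L0' tR.
  by exists (- s1) => t /ltW; exact: (no_zero_left_R g L0' tR s1l Vs).
rewrite (zero_set_loc g L0 nz).
apply: (@zeros_finite _ y z) => t _; first exact: global_HD g.
  exact: global_ctsz g.
exact: global_simple g L0'.
Qed.

Lemma stable_count yh zh Lh ta j : global yh zh Lh -> 0 < Lh -> yh ta != 0 ->
  (zeros_in yh ta T #= `I_j)%card -> exists2 dl : R, 0 < dl & forall L, 0 < L -> `|L - Lh| < dl ->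
    LL L /\ forall y z, global y z L -> (zeros_in y ta T #= `I_j)%card.
Proof.
move=> g L0 yta hj.
have L0' : Lh != 0 by rewrite gt_eqF.
have yT : yh T != 0 by rewrite gt_eqF// (global_pos g L0).
have [eps e0 heps] := zeros_stable (fun t _ => @global_HD _ _ _ t g) (fun t _ => @global_ctsz _ _ _ t g)
  (fun t _ => @global_simple _ _ _ t g L0') yta yT hj.
have [dl dl0 hdl] := global_near ta g e0.
exists dl => // L LL0 /(hdl L LL0)[hL close]; split=> // y z gy.
apply: (heps y z); first by move=> t _; exact: global_HD gy.
by move=> t /andP[h1 _]; exact: close.
Qed.

Lemma V_near yh zh Lh s e : global yh zh Lh -> 0 < e -> exists2 dl : R, 0 < dl & forall L, 0 < L ->
  `|L - Lh| < dl -> LL L /\ forall y z, global y z L ->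
   [/\ `|Vof y z s - Vof yh zh s| < e, `|xof y s - xof yh s| < e & `|pof y z s - pof yh zh s| < e].
Proof.
move=> g e0.
have [d1 d10 hd1] := landing_continuous land s (xof yh s) (pof yh zh s) e0.
pose w := expR (- (gam / 2) * s).
have w0 : 0 < w by exact: expR_gt0.
have g1 : 0 < 1 + gam / 2 by rewrite addr_gt0// divr_gt0.
pose m := Num.min d1 e.
have m0 : 0 < m by rewrite lt_min d10.
have e1 : 0 < m / w / (1 + gam / 2) by rewrite !divr_gt0.
have [dl dl0 hdl] := global_near (- s) g e1.
exists dl => // L L0 /(hdl L L0)[hL close]; split=> // y z gy.
have [h1 h2] := close y z gy (- s) (lexx _).
set u := m / w / (1 + gam / 2) in h1 h2 e1.
have uw : (1 + gam / 2) * u * w = m by rewrite /u; field; rewrite !gt_eqF// addr_gt0.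
have gu : 0 < gam / 2 * u by rewrite mulr_gt0// divr_gt0.
have X : `|xof y s - xof yh s| < m.
  rewrite /xof -mulrBl normrM (gtr0_norm w0) -uw ltr_pM2r//; lra.
have P : `|pof y z s - pof yh zh s| < m.
  rewrite /pof -mulrBl normrM (gtr0_norm w0) -uw ltr_pM2r//.
  have -> : - z (- s) - gam / 2 * y (- s) - (- zh (- s) - gam / 2 * yh (- s)) =
    - (z (- s) - zh (- s)) - gam / 2 * (y (- s) - yh (- s)) by ring.
  apply: (le_lt_trans (ler_normB _ _)); rewrite normrN normrM.
  have g2 : 0 < gam / 2 by rewrite divr_gt0.
  rewrite (gtr0_norm g2).
  have : gam / 2 * `|y (- s) - yh (- s)| < gam / 2 * u by rewrite ltr_pM2l.
  lra.
have md : m <= d1 by rewrite ge_min lexx.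
have me : m <= e by rewrite ge_min lexx orbT.
split; [apply: hd1; exact: lt_le_trans md|exact: lt_le_trans me|exact: lt_le_trans me].
Qed.

Definition Sset j : set R := [set L | LL L /\ exists y z, [/\ global y z L, (zero_set y #= `I_j)%card & typeS y z]].
Definition Rset j : set R := [set L | LL L /\ exists y z, [/\ global y z L, (zero_set y #= `I_j)%card & typeR y z]].

Lemma SR_total L : LL L -> exists j, Sset j L \/ Rset j L.
Proof.
move=> hL; have [y [z g]] := admissible_global hL; have [L0 _] := hL.
have [j hj] := finite_zeros g L0; exists j.
by have [h|h] := type_dichotomy y z; [left|right]; split=> //; exists y, z.
Qed.

Lemma SS_unique i j L : Sset i L -> Sset j L -> i = j.
Proof.
move=> [_ [y [z [g hi _]]]] [_ [y' [z' [g' hj _]]]].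
by have [e _] := global_unique g g'; rewrite -e in hj; exact: card_unique hi hj.
Qed.

Lemma RR_unique i j L : Rset i L -> Rset j L -> i = j.
Proof.
move=> [_ [y [z [g hi _]]]] [_ [y' [z' [g' hj _]]]].
by have [e _] := global_unique g g'; rewrite -e in hj; exact: card_unique hi hj.
Qed.

Lemma SR_disjoint i j L : Sset i L -> Rset j L -> False.
Proof.
move=> [_ [y [z [g _ hS]]]] [_ [y' [z' [g' _ hR]]]].
by have [e e'] := global_unique g g'; rewrite -e -e' in hR; exact: typeSR hS hR.
Qed.

(** Falling below C1 at s0 is an open condition and excludes zeros left of - s0; those in [- s0, T]
    are stable, and there are none beyond T. *)
Lemma S_open j L : Sset j L -> exists2 dl : R, 0 < dl & forall L', `|L' - L| < dl -> Sset j L'.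
Proof.
move=> [[L0 _] [y [z [g hj [s0 s0l Vs]]]]].
have nz := no_zero_left_S g s0l Vs.
rewrite (zero_set_loc (ta := - s0) g L0) in hj; last by move=> t /ltW; exact: nz.
have [d1 d10 h1] := stable_count g L0 (nz _ (lexx _)) hj.
have e0 : 0 < C1 - Vof y z s0 by rewrite subr_gt0.
have [d2 d20 h2] := V_near s0 g e0.
exists (Num.min (Num.min d1 d2) L) => [|L']; first by rewrite !lt_min d10 d20.
rewrite !lt_min => /andP[/andP[H1 H2] H3].
have L'0 : 0 < L' by move: H3; rewrite ltr_norml => /andP[h _]; lra.
have [hL' c1] := h1 L' L'0 H1; have [_ c2] := h2 L' L'0 H2.
split=> //; have [y' [z' g']] := admissible_global hL'; exists y', z'.
have [V' _ _] := c2 _ _ g'.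
have Vs' : Vof y' z' s0 < C1 by move: V'; rewrite ltr_norml => /andP[_]; lra.
split=> //; last by exists s0.
rewrite (zero_set_loc (ta := - s0) g' L'0); first exact: c1 g'.
by move=> t /ltW; exact: (no_zero_left_S g' s0l Vs').
Qed.

(** Nearby solutions also reach the level C1 + d at s1, where at most one further zero is possible,
    and none if they are again of type R. *)
Lemma R_near j L : Rset j L -> exists2 dl : R, 0 < dl & forall L', `|L' - L| < dl ->
  [\/ Sset j L', Sset j.+1 L' | Rset j L'].
Proof.
move=> [[L0 _] [y [z [g hj tR]]]].
have L0' : L != 0 by rewrite gt_eqF.
have [s1 s1l Vs] := typeR_low g L0' tR.
have nz := no_zero_left_R g L0' tR s1l Vs.
rewrite (zero_set_loc (ta := - s1) g L0) in hj; last by move=> t /ltW; exact: nz.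
have [d1 d10 h1] := stable_count g L0 (nz _ (lexx _)) hj.
have e0 : 0 < C1 + d - Vof y z s1 by rewrite subr_gt0.
have [d2 d20 h2] := V_near s1 g e0.
exists (Num.min (Num.min d1 d2) L) => [|L']; first by rewrite !lt_min d10 d20.
rewrite !lt_min => /andP[/andP[H1 H2] H3].
have L'0 : 0 < L' by move: H3; rewrite ltr_norml => /andP[h _]; lra.
have L'0' : L' != 0 by rewrite gt_eqF.
have [hL' c1] := h1 L' L'0 H1; have [_ c2] := h2 L' L'0 H2.
have [y' [z' g']] := admissible_global hL'.
have [V' _ _] := c2 _ _ g'.
have Vs' : Vof y' z' s1 < C1 + d by move: V'; rewrite ltr_norml => /andP[_]; lra.
have hj' := c1 _ _ g'.
have [tS|tR'] := type_dichotomy y' z'; last first.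
  apply: Or33; split=> //; exists y', z'; split=> //.
  rewrite (zero_set_loc (ta := - s1) g' L'0)// => t /ltW.
  exact: (no_zero_left_R g' L'0' tR' s1l Vs').
case: (pselect (exists2 t, t < - s1 & y' t = 0)) => [[t ht yt]|nex]; last first.
  apply: Or31; split=> //; exists y', z'; split=> //.
  rewrite (zero_set_loc (ta := - s1) g' L'0)// => t ht.
  by apply/eqP => yt; apply: nex; exists t.
apply: Or32; split=> //; exists y', z'; split=> //.
have -> : zero_set y' = zeros_in y' (- s1) T `|` [set t].
  apply/seteqP; split=> r /=; last by case=> [[]//|->].
  move=> yr; have [rs|sr] := ltP r (- s1).
    right; have two u v : u < - s1 -> v < - s1 -> u < v -> y' u = 0 -> y' v = 0 -> False.
      move=> hu hv uv yu yv.
      have hv' : s1 <= - v by lra.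
      have uv' : - v < - u by lra.
      apply: (landing_two_zeros land s1l hv' uv' (fun s _ => xeq_global s g')
        (fun s _ => @pof_nz y' z' L' s g' L'0') Vs').
        by apply/eqP; rewrite xof0 opprK yv.
      by apply/eqP; rewrite xof0 opprK yu.
    by have [h|h|//] := ltgtP r t; exfalso; [exact: (two r t)|exact: (two t r)].
  left; split=> //; rewrite sr /= leNgt; apply/negP => h.
  by have := global_pos g' L'0 (ltW h); rewrite yr ltxx.
apply: card_add1 => // -[/andP[h _] _]; lra.
Qed.

Lemma global_zero : global (fun=> 0) (fun=> 0) 0.
Proof. by move=> tl; exact: fd_zero. Qed.

(** A small solution is positive and decreasing in t down to t1, so its virial at s1 is positive
    while its level is close to C1: it leaves the saddle without a zero. *)
Lemma S_small : exists2 dl : R, 0 < dl & forall L, 0 < L -> L < dl -> Sset 0 L.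
Proof.
have d0 := landing_d land; have r00 := landing_r0 land.
have lV := landing_limit land (limp_c 0) (limp_c 0).
have d2 : 0 < d / 2 by rewrite divr_gt0.
have [N hN] := lV _ d2.
pose s1 := Num.max sl N.
have s1l : sl <= s1 by rewrite le_max lexx.
have V1 : `|V s1 0 0 - C1| < d / 2 by apply: hN; rewrite le_max lexx orbT.
have m0 : 0 < Num.min (d / 2) (r0 / 2) by rewrite lt_min d2 divr_gt0.
have [d3 d30 h3] := V_near s1 global_zero m0.
pose t1 := - s1 - 1.
have [am am0 ham] : exists2 m : R, 0 < m & forall t, t1 <= t <= T -> m <= a t by apply: cts_posmin.
have [Bm Bm0 hBm] : exists2 m : R, 0 < m & forall t, t1 <= t <= T -> `|b t| <= m by apply: cts_bounded.
have q20 : 0 < q - 2 by rewrite subr_gt0.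
(* Below this size the nonlinear term changes the coefficient a by at most half of its minimum. *)
pose eta := (am / 2 / Bm) `^ ((q - 2)^-1).
have ab : 0 < am / 2 / Bm by rewrite !divr_gt0.
have eta0 : 0 < eta by exact: powR_gt0.
have etaE : Bm * eta `^ (q - 2) = am / 2.
  by rewrite /eta -powRrM mulVf ?gt_eqF// powRr1 ?ltW// mulrC divfK// gt_eqF.
have [d4 d40 h4] := global_near t1 global_zero eta0.
exists (Num.min d3 d4) => [|L L0]; first by rewrite lt_min d30.
rewrite lt_min => /andP[H3 H4].
have LE : `|L - 0| = L by rewrite subr0 gtr0_norm.
have [hL c3] := h3 L L0 ltac:(by rewrite LE); have [_ c4] := h4 L L0 ltac:(by rewrite LE).
split=> //; have [y [z g]] := admissible_global hL; exists y, z.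
have small t : t1 <= t -> `|y t| < eta by move=> ht; have [h _] := c4 _ _ g t ht; rewrite subr0 in h.
have pos t : t1 < t -> 0 < y t /\ z t < 0.
  apply: (@positive_decreasing _ y z (fun t => a t * y t + b t * psi q (y t)) t1).
  - by move=> s _; exact: global_HD g.
  - by move=> s _; have [] := global_sol s g.
  - move=> s hs ys.
    have -> : a s * y s + b s * psi q (y s) = (a s + b s * `|y s| `^ (q - 2)) * y s by rewrite /psi; ring.
    rewrite mulr_gt0//; have [Ts|sT] := leP T s.
      by rewrite ltr_pwDl// mulr_ge0 ?bpos// powR_ge0.
    have ht : t1 <= s <= T by rewrite !ltW.
    have h1 := ham s ht; have h2 := hBm s ht.
    have h5 : `|y s| `^ (q - 2) <= eta `^ (q - 2) by apply: powR_mono; [exact: ltW|exact: normr_ge0|apply/ltW/small/ltW].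
    have h6 : `|b s * `|y s| `^ (q - 2)| <= am / 2.
      rewrite -etaE normrM (ger0_norm (powR_ge0 _ _)); apply: ler_pM => //; exact: powR_ge0.
    by move: h6; rewrite ler_norml => /andP[h6 _]; lra.
  - exact: fd_lim0 mu0 (g t1).
  - have [N' hN'] := (g t1).2 L L0; exists N' => s hs.
    have := hN' s hs; rewrite ltr_norml => /andP[h _].
    by rewrite -(pmulr_lgt0 _ (expR_gt0 (mu * s))); lra.
have [Vc xc _] := c3 _ _ g.
have x0 : xof (fun=> 0) s1 = 0 by rewrite /xof mul0r.
have p0 : pof (fun=> 0) (fun=> 0) s1 = 0 by rewrite /pof; ring.
rewrite /Vof x0 p0 -/(Vof y z s1) in Vc; rewrite x0 subr0 in xc.
rewrite lt_min in Vc; rewrite lt_min in xc.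
move: Vc xc => /andP[Vc _] /andP[_ xc].
have Vs : V s1 (xof y s1) (pof y z s1) < C1 + d.
  by move: Vc V1; rewrite !ltr_norml => /andP[_ h1] /andP[_ h2]; rewrite /Vof in h1; lra.
have vir : 0 < virial gam s1 (xof y) (pof y z).
  have [h1 h2] := pos (- s1) ltac:(rewrite /t1; lra).
  rewrite virial_of -mulrN mulr_gt0 ?exprn_gt0 ?expR_gt0// mulr_gt0// oppr_gt0//.
have [nzs [s2 s12 Vs2]] := landing_leaves land s1l (fun s _ => xeq_global s g) Vs (ltW xc) vir.
split=> //; last by exists s2 => //; exact: le_trans s12.
have -> : zero_set y = set0.
  apply/seteqP; split=> // t /= yt.
  have [ht|ht] := ltP t1 t; first by have [h _] := pos t ht; move: h; rewrite yt ltxx.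
  have := nzs (- t) ltac:(by rewrite /t1 in ht; lra); rewrite xof0 opprK yt eqxx//.
by rewrite II0.
Qed.

(** If no count exceeded j, [oscillation] would bound y T and [fd_bound_by_initial] would bound L
    and the weighted solution by one M for all admissible L. Then [fd_near] gives a step [delta]
    uniform in L, which leads past the supremum of the admissible set. *)
Lemma SR_unbounded j : exists L i, (j < i)%N /\ (Sset i L \/ Rset i L).
Proof.
apply: contrapT => nex.
have few y z L : LL L -> global y z L -> ~ many j.+1 (zero_set y).
  move=> hL g hm; have [L0 _] := hL; have [i hi] := finite_zeros g L0.
  apply: nex; exists L, i; split; first exact: many_le hi hm.
  by have [h|h] := type_dichotomy y z; [left|right]; split=> //; exists y, z.
have t0T : T - 1 < T by rewrite ltrBlDr ltrDl.
have bT : b T <= 0.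
  rewrite leNgt; apply/negP => h.
  have [d1 d10 hd1] := (cts_eps _ _).1 (@cb T) _ h.
  have := hd1 (T - d1 / 2); rewrite addrAC subrr add0r normrN gtr0_norm ?divr_gt0//.
  have h2 : d1 / 2 < d1 by lra.
  move=> /(_ h2); rewrite ltr_norml => /andP[h3 _].
  have : b (T - d1 / 2) < 0 by apply: bneg; lra.
  lra.
have [C C0 hC] := @oscillation R q a b (T - 1) T j q2 t0T ca cb (fun t _ => ltW (a0 t))
  (fun t ht => bneg (proj2 (andP ht))) bT.
have [C2 C20 hC2] := fd_bound_by_initial q2 mu0 ca a0 Ta bpos.
have yT L y z : LL L -> global y z L -> `|y T| <= C.
  move=> hL g; have [L0 _] := hL.
  have [] := hC y z (fun t _ => global_sol t g) (fun t _ => @global_simple y z L t g ltac:(by rewrite gt_eqF)) _ => //.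
  by move=> hm; apply: (few y z L hL g); apply: many_sub hm => t [].
pose M := C2 * C.
have M0 : 0 <= M by rewrite mulr_ge0// ltW.
have [delta [C3 [de0 _ hde]]] := fd_near q2 mu0 ca cb Ta Tb T M0.
have bd L y z : LL L -> global y z L -> L <= M /\ forall t, T < t -> `|y t * expR (mu * t)| <= M.
  move=> hL g; have [L0 _] := hL.
  have [h1 h2] := hC2 (T - 1) y z L t0T (g _) L0.
  have h3 : C2 * y T <= M by rewrite ler_pM2l//; apply: le_trans (yT L y z hL g); exact: ler_norm.
  split; first exact: le_trans h3.
  by move=> t /ltW /h1 /andP[p1 p2]; rewrite ger0_norm//; exact: le_trans h3.
have hS : has_sup LL.
  split.
    have [dl dl0 hdl] := S_small; exists (dl / 2).
    by have [] := hdl (dl / 2) ltac:(by rewrite divr_gt0) ltac:(by rewrite ltr_pdivrMr// ltr_pMr// ltr1n).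
  exists M => L hL; have [y [z g]] := admissible_global hL; by have [] := bd L y z hL g.
have de2 : 0 < delta / 2 by rewrite divr_gt0.
have [L hL Ls] := sup_adherent de2 hS.
have [y [z g]] := admissible_global hL; have [L0 _] := hL.
have [_ hY] := bd L y z hL g.
have hd : `|L + delta / 2 - L| < delta.
  by rewrite addrAC subrr add0r gtr0_norm// ltr_pdivrMr// ltr_pMr// ltr1n.
have [eps [y1 [z1 [eps0 f1 _]]]] := hde _ _ _ _ (g T) hY hd.
have : L + delta / 2 <= sup LL.
  apply: sup_upper_bound => //; split; first by rewrite addr_gt0.
  by exists (T - eps), y1, z1; split=> //; rewrite ltrBlDr ltrDl.
lra.
Qed.

End Types.

Definition blowup_left (y : R -> R) :=
  (forall M, exists N, forall s, N <= s -> M <= y (- s) * expR (nu * s)) \/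
  (forall M, exists N, forall s, N <= s -> y (- s) * expR (nu * s) <= M).

Theorem core_fast_decay : exists B : nat -> R,
  [/\ forall k, 0 < B k, forall j k, (j < k)%N -> B j < B k,
    forall k, exists y z, [/\ global y z (B k), (zero_set y #= `I_k)%card &
      exists dd, limp (fun s => y (- s) * expR (nu * s)) dd],
    forall L, 0 < L -> L < B 0%N -> exists y z,
      [/\ global y z L, (zero_set y #= `I_0)%card & blowup_left y] &
    forall k, (1 <= k)%N -> exists2 s : R, B k.-1 <= s < B k &
      forall L, s < L -> L < B k -> exists y z,
      [/\ global y z L, (zero_set y #= `I_k)%card & blowup_left y]].
Proof.
have [|C1 [d [sl [r0 [V land]]]]] := @landing_exists R q gam cI kI (1 - T) c k k' q2 gam0 cI0 kI0
  cc Tc lc hk ck' Tk lk.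
  by move=> s hs; apply: kpos; lra.
have [||||||||||||B [B0 Bm BR BS0 BSk]] := @select_bifurcations R LL (Sset C1 sl V) (Rset C1 sl V).
- by move=> L [].
- exact: admissible_down.
- by move=> j L [].
- by move=> j L [].
- exact: SR_total land.
- exact: SS_unique.
- exact: RR_unique.
- exact: SR_disjoint.
- exact: S_open land.
- exact: R_near land.
- exact: S_small land.
- exact: SR_unbounded land.
have Sres j L : Sset C1 sl V j L -> exists y z,
    [/\ global y z L, (zero_set y #= `I_j)%card & blowup_left y].
  move=> [_ [y [z [g hj hS]]]]; exists y, z; split=> //; exact (typeS_blowup land g hS).
exists B; split=> //.
- move=> j; have [[L0 _] [y [z [g hj hR]]]] := BR j; exists y, z; split=> //.
  by apply: (typeR_limit land g _ hR); rewrite gt_eqF.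
- by move=> L h1 h2; apply: Sres; exact: BS0.
- move=> j j1; have [s hs h] := BSk j j1; exists s => // L h1 h2; apply: Sres; exact: h.
Qed.

Theorem core_regular : exists A : nat -> R,
  [/\ forall j, 0 < A j, forall i j, (i < j)%N -> A i < A j &
    forall j, exists y z, [/\ forall t, sol_at q a b y z t /\ (y t = 0 -> z t != 0),
      (zero_set y #= `I_j)%card,
      limp (fun s => y (- s) * expR (nu * s)) (A j) & exists L, limp (fun t => y t * expR (mu * t)) L]].
Proof.
have car2 : cts (fun s => a (- s)) by exact: car.
have NN (f : R -> R) : (fun s => f (- - s)) = f by apply/funext => s; rewrite opprK.
have [C C0 hC] := @limp_bounded _ k kI (- T) lk (fun t _ => HD_cts (hk t)).
have p0 : 0 < (q - 2) * (gam / 2 + nu).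
  by apply: mulr_gt0; [rewrite subr_gt0|rewrite addr_gt0// divr_gt0].
have [|||||A [Apos Ainc hA]] := @regular_thresholds _ q nu mu (- T) (C * expR ((q - 2) * (gam / 2 + nu) * T))
  (fun s => a (- s)) (fun s => b (- s)) q2 nu0 mu0 car cbr (fun s => a0 (- s)) _ _ Tar reflected_tail lar.
- by move=> s hs; apply: bpos; lra.
- move=> s; rewrite le_eqVlt => /predU1P[<-|hs]; last by apply/ltW/bneg; lra.
  rewrite opprK leNgt; apply/negP => bT.
  have [dl dl0 hdl] := (cts_eps _ _).1 (@cb T) _ bT.
  have d2 : dl / 2 < dl by lra.
  have := hdl (T - dl / 2); rewrite addrAC subrr add0r normrN gtr0_norm ?divr_gt0//.
  move=> /(_ d2); rewrite ltr_norml => /andP[h3 _].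
  have : b (T - dl / 2) < 0 by apply: bneg; lra.
  lra.
- move=> s hs; rewrite bk normrM normrN (gtr0_norm (expR_gt0 _)) -[leLHS]mulrA -expRD.
  apply: ler_pM; [exact: normr_ge0|exact: expR_ge0|exact: hC|].
  have -> : - ((q - 2) * gam / 2) * s + - (nu * (q - 2)) * s = (q - 2) * (gam / 2 + nu) * - s by field.
  by rewrite ler_expR ler_pM2l//; lra.
- by rewrite (NN (fun t => `|a t - mu ^+ 2|)).
- move=> j; have [B [Bpos _ hB _ _]] := core_fast_decay.
  (* Seen from the origin, the R-solution with j+1 zeros shows that [oscillating j] is nonempty,
     after a change of sign if dd < 0. *)
  have [y [z [g hj [dd hdd]]]] := hB j.+1.
  have f := global_reflect (- T) g hdd.
  have L0 : B j.+1 != 0 by rewrite gt_eqF.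
  have dd0 : dd != 0.
    apply/eqP => d0; rewrite d0 in f.
    have h : - T < 1 - T by rewrite ltrDr.
    have [ey ez] := fd_unique q2 nu0 Tar reflected_tail f (fd_zero q _ _ nu (- T)) h h.
    by have := global_simple g L0 ey; move/eqP: ez; rewrite oppr_eq0 => /eqP ->; rewrite eqxx.
  have hm : many j.+1 [set s : R | - T < s /\ y (- s) = 0].
    have [e [e1 e2 _]] := card_enum hj; exists (fun i => - e i).
      move=> i /e1 ei; split; last by rewrite opprK.
      by rewrite ltrN2 ltNge; apply/negP => h; have := global_pos g (Bpos _) h; rewrite ei ltxx.
    by move=> i l hi hl /oppr_inj; exact: e2.
  have [dpos|dneg|d0] := ltgtP 0 dd; last by rewrite d0 eqxx in dd0.
    by exists dd; split=> //; exists (- T), (fun s => y (- s)), (fun s => - z (- s)).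
  exists (- dd); split; first by rewrite oppr_gt0.
  exists (- T), (fun s => - y (- s)), (fun s => - - z (- s)); split; first exact: fd_opp f.
  by apply: many_sub hm => s [h1 h2]; split=> //; rewrite h2 oppr0.
exists A; split=> // j; have [y [z [g hj [L hL]]]] := hA j.
exists (fun t => y (- t)), (fun t => - z (- t)); split.
- move=> t; have t1 : - t - 1 < - t by rewrite ltrBlDr ltrDl.
  split; first by have := sol_refl ((g (- t - 1)).1 (- t) t1); rewrite !NN.
  move=> yt; rewrite oppr_eq0; apply: (fd_simple_zeros q2 car cbr (g (- t - 1)) _ t1 yt).
  by rewrite gt_eqF.
- have [e [e1 e2 e3]] := card_enum hj.
  apply: (@enum_card _ _ _ (fun i => - e i)).
  + by move=> i hi; rewrite /zero_set /= opprK; exact: e1.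
  + by move=> i l hi hl /oppr_inj; exact: e2.
  + by move=> x /e3[i hi ei]; exists i => //; rewrite ei opprK.
- by have [_ h] := g 0; apply: (limp_ext (N := 0)) h => t _; rewrite opprK.
- by exists L.
Qed.

End Core.

(** * Change of variable *)

Section LogarithmicTime.
Variable R : realType.

Lemma expR_ln (r : R) : 0 < r -> expR (ln r) = r.
Proof. by move=> r0; rewrite lnK// posrE. Qed.

Lemma near_oo_exp (P : set R) : (\forall r \near +oo, P r) <->
  exists N, forall t, N <= t -> P (expR t).
Proof.
split=> [[M [_ hM]]|[N hN]].
  exists M => t Mt; apply: hM; apply: (le_lt_trans Mt).
  by apply: lt_le_trans (expR_ge1Dx t); rewrite ltrDr.
exists (expR N); split; first exact: num_real.
move=> r hr; have r0 : 0 < r by apply: lt_trans hr; exact: expR_gt0.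
by rewrite -(expR_ln r0); apply: hN; rewrite -ler_expR expR_ln// ltW.
Qed.

Lemma near_0_exp (P : set R) : (\forall r \near 0^'+, P r) <->
  exists N, forall s, N <= s -> P (expR (- s)).
Proof.
split=> [[e /= e0 he]|[N hN]].
  exists (- ln e + 1) => s hs; apply: he; last exact: expR_gt0.
  rewrite /= sub0r normrN gtr0_norm ?expR_gt0// -ltr_ln ?posrE ?expR_gt0// expRK; lra.
exists (expR (- N)) => /=; first exact: expR_gt0.
move=> r; rewrite /= sub0r normrN => hr r0.
rewrite -(expR_ln r0) -[ln r]opprK; apply: hN.
by rewrite lerNr -ler_expR expR_ln// ltW// -[r]gtr0_norm.
Qed.

Lemma cvg_oo_exp (g : R -> R) L : (g r @[r --> +oo] --> L) <-> limp (fun t => g (expR t)) L.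
Proof.
split=> [/cvgrPdist_lt h e /h /near_oo_exp[N hN]|h].
  by exists N => t /hN; rewrite distrC.
apply/cvgrPdist_lt => e /h[N hN]; apply/near_oo_exp; exists N => t /hN.
by rewrite distrC.
Qed.

Lemma cvg_0_exp (g : R -> R) L : (g r @[r --> 0^'+] --> L) <-> limp (fun s => g (expR (- s))) L.
Proof.
split=> [/cvgrPdist_lt h e /h /near_0_exp[N hN]|h].
  by exists N => t /hN; rewrite distrC.
apply/cvgrPdist_lt => e /h[N hN]; apply/near_0_exp; exists N => t /hN.
by rewrite distrC.
Qed.

Lemma increment_le (D : set R) (g F : R -> R) (a b : R) : measurable D ->
  lebesgue_measure.-integrable D (fun r => (g r)%:E) -> `[a, b] `<=` D -> a <= b ->
  (forall r, a <= r <= b -> {for r, continuous (fun r => `|g r|)}) ->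
  (forall r, a <= r <= b -> HD F r `|g r|) ->
  F b - F a <= fine (\int[lebesgue_measure]_(r in D) `|g r|%:E).
Proof.
move=> mD ig sub; rewrite le_eqVlt => /predU1P[->|ab] cg hF.
  by rewrite subrr fine_ge0// integral_ge0.
have ia : lebesgue_measure.-integrable D (fun r => `|g r|%:E) by exact: (integrable_abse ig).
have cF r : a <= r <= b -> {for r, continuous F} by move=> /hF; exact: HD_cts.
have e : (\int[lebesgue_measure]_(r in `[a, b]) `|g r|%:E = (F b)%:E - (F a)%:E)%E.
  apply: continuous_FTC2 => //; first exact: within_itv.
    split; first by move=> r; rewrite in_itv => /andP[h1 h2]; apply: (HD_derivable (hF r _)); rewrite !ltW.
      by apply: cvg_at_right_filter; apply: (cF a); rewrite lexx ltW.
    by apply: cvg_at_left_filter; apply: (cF b); rewrite lexx ltW.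
  by move=> r; rewrite in_itv => /andP[h1 h2]; apply: HD_derive1; apply: hF; rewrite !ltW.
rewrite -lee_fin EFinB -e fineK; last by apply: integrable_fin_num.
apply: ge0_subset_integral => //; exact: measurable_int ia.
Qed.

Lemma Tail_increasing (f F : R -> R) (M : R) : (forall t, 0 <= f t) -> (forall t, HD F t (f t)) ->
  (forall t, 0 < t -> F t <= M) -> Tail f.
Proof.
move=> f0 hF hM.
have [l _ hl] := @noninc_limp _ (fun t => - F t) (fun t => - f t) 0 (- M)
  (fun t _ => HD_N (hF t)) (fun t _ => ltac:(by rewrite oppr_le0)) (fun t h => ltac:(by rewrite lerN2 hM)).
exists (fun t => - F t + - l); last by rewrite -(subrr l); apply: limpD => //; exact: limp_c.
by move=> t; apply: HD_cv (HD_D (HD_N (hF t)) (HD_c (- l) t)) (addr0 _).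
Qed.

Lemma HD_ln (r : R) : 0 < r -> HD (@ln R) r r^-1.
Proof. exact: is_derive1_ln. Qed.

Lemma HD_at_exp (y : R -> R) (t l : R) : HD y t l -> HD (fun r => y (ln r)) (expR t) (l / expR t).
Proof.
move=> h; have r0 := expR_gt0 t.
apply: HD_cv (HD_comp (HD_ln r0) (f := y) _) _; first by rewrite expRK; exact: h.
exact: mulrC.
Qed.

Let quot_cts (g : R -> R) (l r : R) : 0 < r -> (forall r, 0 < r -> {for r, continuous g}) ->
  {for r, continuous (fun r => `|(g r - l) / r|)}.
Proof.
move=> r0 cg; apply: cvg_norm; apply: cvgM.
  by apply: cvgB; [exact: cg|exact: cvg_cst].
apply: cvgV; first by rewrite gt_eqF.
exact: cvg_id.
Qed.

(** Under r = e^t the measure dr / r becomes dt. Lebesgue integrability is used only to bound the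
    increments of an antiderivative, which is monotone and so converges. *)
Lemma Tail_oo (g : R -> R) l : (forall r, 0 < r -> {for r, continuous g}) ->
  lebesgue_measure.-integrable `[1, +oo[ (fun r => ((g r - l) / r)%:E) ->
  Tail (fun t => `|g (expR t) - l|).
Proof.
move=> cg ig.
have cf : cts (fun t => `|g (expR t) - l|).
  apply: cts_abs; apply: cts_D; last exact: cts_c.
  move=> t; apply: (@continuous_comp _ _ _ (@expR R) g); first exact: continuous_expR.
  exact/cg/expR_gt0.
have [F hF] := antiderivative cf.
pose I := fine (\int[lebesgue_measure]_(r in `[1%R, +oo[) `|(g r - l) / r|%:E)%E.
apply: (@Tail_increasing _ F (F 0 + I)) => // t t0.
have e1 : 1 <= expR t by rewrite -[leLHS]expR0 ler_expR ltW.
have pos (r : R) : 1 <= r <= expR t -> 0 < r by move=> /andP[h _]; lra.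
have := @increment_le `[1, +oo[ (fun r => (g r - l) / r) (fun r => F (ln r)) 1 (expR t).
rewrite expRK ln1 -/I => h; rewrite -lerBlDl; apply: h => //.
- by apply: subset_itvl; rewrite bnd_simp.
- by move=> r /pos r0; exact: quot_cts.
- move=> r /pos r0; have := HD_at_exp (hF (ln r)); rewrite expR_ln// => hr.
  by apply: HD_cv hr _; rewrite normrM [`|r^-1|]gtr0_norm// invr_gt0.
Qed.

Lemma Tail_zero (g : R -> R) l : (forall r, 0 < r -> {for r, continuous g}) ->
  lebesgue_measure.-integrable `]0, 1] (fun r => ((g r - l) / r)%:E) ->
  Tail (fun s => `|g (expR (- s)) - l|).
Proof.
move=> cg ig.
have cf : cts (fun t => `|g (expR t) - l|).
  apply: cts_abs; apply: cts_D; last exact: cts_c.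
  move=> t; apply: (@continuous_comp _ _ _ (@expR R) g); first exact: continuous_expR.
  exact/cg/expR_gt0.
have [F hF] := antiderivative cf.
pose I := fine (\int[lebesgue_measure]_(r in `]0%R, 1%R]) `|(g r - l) / r|%:E)%E.
apply: (@Tail_increasing _ (fun s => - F (- s)) (- F 0 + I)) => //.
  move=> s; apply: HD_cv (HD_N (HD_comp (HD_N (HD_id s)) (hF (- s)))) _.
  by rewrite mulN1r opprK.
move=> t t0.
have e1 : expR (- t) <= 1 by rewrite -[leRHS]expR0 ler_expR oppr_le0 ltW.
have pos (r : R) : expR (- t) <= r <= 1 -> 0 < r.
  by move=> /andP[h _]; apply: lt_le_trans h; exact: expR_gt0.
have := @increment_le `]0, 1] (fun r => (g r - l) / r) (fun r => F (ln r)) (expR (- t)) 1.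
rewrite expRK ln1 -/I => h; rewrite -lerBlDl opprK addrC; apply: h => //.
- by move=> r; rewrite /= !in_itv /= => h; rewrite (pos r h) /=; case/andP: h.
- by move=> r /pos r0; exact: quot_cts.
- move=> r /pos r0; have := HD_at_exp (hF (ln r)); rewrite expR_ln// => hr.
  by apply: HD_cv hr _; rewrite normrM [`|r^-1|]gtr0_norm// invr_gt0.
Qed.

End LogarithmicTime.

(** * The exponent inequalities *)

Section Exponents.
Variable R : realType.
Implicit Types n q eta delta : R.

Lemma disc_gt0 n eta : eta < hardy_const n -> 0 < disc n eta.
Proof. by rewrite /hardy_const /disc sqrtr_gt0; lra. Qed.

Lemma half_disc_sqr n eta : eta < hardy_const n ->
  (disc n eta / 2) ^+ 2 = ((n - 2) / 2) ^+ 2 - eta.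
Proof.
rewrite /hardy_const /disc => h; rewrite expr_div_n sqr_sqrtr; last by move: h; lra.
by field.
Qed.

Lemma lower_star_gt2 n q : 2 < n -> lower_star n < q -> 2 < q.
Proof.
move=> n2; apply: lt_trans; rewrite /lower_star ltr_pdivlMr; lra.
Qed.

(** At r = 0 this becomes gam / 2 < nu; at infinity, with beta for eta, it is the integrability of b
    e^(- mu (q - 2) t). *)
Lemma ell_gt n q eta delta : 2 < n -> eta < hardy_const n -> -2 < delta ->
  lower_star_of n eta < ell q delta -> 2 + delta < (q - 2) * ((n - 2) / 2 + disc n eta / 2).
Proof.
move=> n2 /disc_gt0 D0 d2; rewrite /lower_star_of /ell ltr_pM2l//.
have X0 : 0 < n - 2 + disc n eta by lra.
have Y0 : 0 < 2 + delta by lra.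
by rewrite ltr_pdivrMr// mulrAC ltr_pdivlMr// => h; move: h; lra.
Qed.

(** This becomes gam > 0. *)
Lemma ell_lt n q delta : 2 < n -> -2 < delta ->
  ell q delta < upper_star n -> (q - 2) * ((n - 2) / 2) < 2 + delta.
Proof.
move=> n2 d2; rewrite /upper_star /ell.
have X0 : 0 < n - 2 by lra.
have Y0 : 0 < 2 + delta by lra.
rewrite -mulrA ltr_pM2l// ltr_pdivrMr// mulrAC ltr_pdivlMr// => h; move: h; lra.
Qed.

End Exponents.

(** * The transformation between u(r) and y(t) *)

Section EmdenFowler.
Variable R : realType.
Variables (n q : R) (h K : R -> R) (eta beta : R).
Hypotheses (n2 : 2 < n) (q2 : 2 < q).

Definition omega : R := (n - 2) / 2.
(* In t = ln r, emden u solves y'' = a y + b y |y|^(q-2) with a = emden_a and b = emden_b. *)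
Definition emden_a (t : R) := omega ^+ 2 - h (expR t).
Definition emden_b (t : R) := K (expR t) * expR ((2 - omega * (q - 2)) * t).
Definition emden (u : R -> R) (t : R) := u (expR t) * expR (omega * t).
Definition demden (u : R -> R) (t : R) :=
  (derive1 u (expR t) * expR t + omega * u (expR t)) * expR (omega * t).
Definition radial (y : R -> R) (r : R) := y (ln r) * expR (- omega * ln r).
Let f := power_nonlinearity K q.
Let mu := disc n beta / 2.
Let nu := disc n eta / 2.

Let HD_expR (t : R) : HD (@expR R) t (expR t).
Proof. by apply: HD_cv (HD_exp (HD_id t)) _; rewrite mulr1. Qed.

Lemma sol_at_of D u t : solution_on n h f D u -> D (expR t) ->
  sol_at q emden_a emden_b (emden u) (demden u) t.
Proof.
move=> hu Dt; have [d1 d2] := hu _ Dt.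
set r := expR t in Dt d1 d2 *.
set u1 := derive1 u r in d2 *; set u2 := derive1 (derive1 u) r in d2 *.
rewrite /f /power_nonlinearity -/(psi q (u r)) => eqn.
have E : HD (fun s => expR (omega * s)) t (expR (omega * t) * omega).
  by apply: HD_cv (HD_exp (HD_M (HD_c omega t) (HD_id t))) _; ring.
have H0 : HD (fun s => u (expR s)) t (r * u1) := HD_comp (HD_expR t) (derivable_HD d1).
have H1 : HD (fun s => derive1 u (expR s)) t (r * u2) := HD_comp (HD_expR t) (derivable_HD d2).
split.
  by apply: HD_cv (HD_M H0 E) _; rewrite /demden -/r -/u1; ring.
have H2 := HD_M (HD_D (HD_M H1 (HD_expR t)) (HD_M (HD_c omega t) H0)) E.
apply: HD_cv H2 _; rewrite -/r -/u1 /emden_a /emden_b /emden -/r.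
have r0 : r != 0 by rewrite gt_eqF// expR_gt0.
have e : psi q (u r * expR (omega * t)) * expR ((2 - omega * (q - 2)) * t) =
   r ^+ 2 * expR (omega * t) * psi q (u r).
  rewrite [u r * _]mulrC psi_exp mulrAC -expRD /r -expRM_natl -expRD.
  by congr (expR _ * _); ring.
have -> : K r * expR ((2 - omega * (q - 2)) * t) * psi q (u r * expR (omega * t)) =
  K r * (r ^+ 2 * expR (omega * t) * psi q (u r)) by rewrite -e; ring.
have -> : u2 = K r * psi q (u r) - (n - 1) / r * u1 - h r / r ^+ 2 * u r by move: eqn; lra.
by rewrite /omega; field.
Qed.

Lemma radial_HD y z t : HD y t (z t) ->
  HD (radial y) (expR t) ((z t - omega * y t) * expR (- (omega + 1) * t)).
Proof.
move=> hy; have E : HD (fun s => y s * expR (- omega * s)) t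
    (z t * expR (- omega * t) + y t * (expR (- omega * t) * - omega)).
  apply: HD_M => //.
  by apply: HD_cv (HD_exp (HD_M (HD_c (- omega) t) (HD_id t))) _; ring.
apply: HD_cv (HD_at_exp E) _.
have -> : expR (- (omega + 1) * t) = expR (- omega * t) / expR t.
  by rewrite -expRN -expRD; congr expR; ring.
by ring.
Qed.

Definition dradial (y z : R -> R) (r : R) := (z (ln r) - omega * y (ln r)) * expR (- (omega + 1) * ln r).

Lemma derive1_radial y z : (forall t, HD y t (z t)) -> forall r, 0 < r -> derive1 (radial y) r = dradial y z r.
Proof.
move=> hy r r0; rewrite -{1}(expR_ln r0); exact: HD_derive1 (radial_HD (hy _)).
Qed.

Lemma radial_solution y z : (forall t, sol_at q emden_a emden_b y z t) -> solution n h f (radial y).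
Proof.
move=> hy r; rewrite /= in_itv /= andbT => r0.
have hy1 t : HD y t (z t) by have [] := hy t.
set t := ln r; have rE : r = expR t by rewrite expR_ln.
have D1 : HD (radial y) r (dradial y z r) by rewrite {1}rE /dradial -/t; exact: radial_HD.
have [_ hz] := hy t.
pose w := emden_a t * y t + emden_b t * psi q (y t).
have E : HD (fun s => (z s - omega * y s) * expR (- (omega + 1) * s)) t
    ((w - omega * z t) * expR (- (omega + 1) * t) +
     (z t - omega * y t) * (expR (- (omega + 1) * t) * - (omega + 1))).
  apply: HD_M.
    apply: HD_cv (HD_D hz (HD_N (HD_M (HD_c omega t) (hy1 t)))) _.
    by rewrite /w; ring.
  by apply: HD_cv (HD_exp (HD_M (HD_c (- (omega + 1)) t) (HD_id t))) _; ring.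
have E2 := HD_at_exp E; rewrite -rE in E2.
have D2 : HD (derive1 (radial y)) r
   ((w - omega * z t - (omega + 1) * (z t - omega * y t)) * expR (- (omega + 1) * t) / r).
  apply: (HD_near (f := dradial y z)); last by apply: HD_cv E2 _; ring.
  near=> s; rewrite (derive1_radial hy1)//; near: s; exact: lt_nbhsr.
split; [exact: HD_derivable D1|exact: HD_derivable D2|].
rewrite (HD_derive1 D2) (HD_derive1 D1) /f /power_nonlinearity -/(psi q (radial y r)).
rewrite /dradial /radial -/t /w /emden_a /emden_b -rE.
have rn : r != 0 by rewrite gt_eqF.
have -> : expR (- (omega + 1) * t) = expR (- omega * t) / r.
  by rewrite rE -expRN -expRD; congr expR; ring.
rewrite [y t * expR _]mulrC psi_exp.
have -> : expR ((q - 1) * (- omega * t)) = expR ((2 - omega * (q - 2)) * t) * expR (- omega * t) / r ^+ 2.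
  by rewrite rE -expRM_natl -expRN -!expRD; congr expR; ring.
by rewrite /omega; field.
Unshelve. all: by end_near.
Qed.

Lemma emden_radial y : emden (radial y) = y.
Proof.
apply/funext => t; rewrite /emden /radial expRK -mulrA -expRD.
by rewrite mulNr addNr expR0 mulr1.
Qed.

Lemma limit_zeroP u d : limit_at_zero n eta u d <->
  limp (fun s => emden u (- s) * expR (nu * s)) d.
Proof.
rewrite /limit_at_zero cvg_0_exp.
suff -> : (fun s => u (expR (- s)) * expR (- s) `^ kappa n eta) = (fun s => emden u (- s) * expR (nu * s)) by [].
apply/funext => s; rewrite expR_powR /emden -mulrA -expRD; congr (_ * expR _).
by rewrite /kappa /omega /nu; field.
Qed.

Lemma limit_inftyP u L : limit_at_infty n beta u L <->
  limp (fun t => emden u t * expR (mu * t)) L.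
Proof.
rewrite /limit_at_infty cvg_oo_exp.
suff -> : (fun t => u (expR t) * expR t `^ (n - 2 - kappa n beta)) = (fun t => emden u t * expR (mu * t)) by [].
apply/funext => s; rewrite expR_powR /emden -mulrA -expRD; congr (_ * expR _).
by rewrite /kappa /omega /mu; field.
Qed.

Lemma radial_blowup y : blowup_left nu y ->
  radial y r * r `^ kappa n eta @[r --> 0^'+] --> +oo \/
  radial y r * r `^ kappa n eta @[r --> 0^'+] --> -oo.
Proof.
have e s : radial y (expR (- s)) * expR (- s) `^ kappa n eta = y (- s) * expR (nu * s).
  rewrite /radial expRK expR_powR -mulrA -expRD; congr (_ * expR _).
  by rewrite /kappa /omega /nu; field.
case=> H; [left; apply/cvgryPge|right; apply/cvgrNyPle] => A; apply/near_0_exp;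
  have [N hN] := H A; exists N => s hs; rewrite e; exact: hN.
Qed.

Lemma radial_zeros y z k : (forall t, HD y t (z t)) -> (forall t, y t = 0 -> z t != 0) ->
  (zero_set y #= `I_k)%card -> exactly_nondegenerate_zeros k (radial y).
Proof.
move=> hy simple hk.
have u0 r : radial y r = 0 -> y (ln r) = 0.
  by move/eqP; rewrite /radial mulf_eq0 [expR _ == 0]gt_eqF ?expR_gt0// orbF => /eqP.
split.
  have [e [e1 e2 e3]] := card_enum hk.
  apply: (@enum_card _ _ _ (fun i => expR (e i))).
  - by move=> i /e1 ei; split; [exact: expR_gt0|rewrite /radial expRK ei mul0r].
  - by move=> i j hi hj /expR_inj; exact: e2.
  - move=> x [x0 /u0 /e3[i hi ei]]; exists i => //.
    by rewrite ei expR_ln.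
move=> r r0 /u0 yr.
rewrite (@derive1_radial y z)// /dradial yr mulr0 subr0 mulf_neq0 ?simple//.
by rewrite gt_eqF ?expR_gt0.
Qed.

Lemma radial_is_v y z L : 0 < mu -> Tail (fun t => `|emden_a t - mu ^+ 2|) ->
  Tail (fun t => `|emden_b t| * expR (- (mu * (q - 2)) * t)) ->
  (forall t, sol_at q emden_a emden_b y z t) -> limp (fun t => y t * expR (mu * t)) L ->
  is_v n h f beta L (radial y).
Proof.
move=> mu0 Ta Tb hy hL; split; first exact: radial_solution hy.
  by apply/limit_inftyP; rewrite emden_radial.
move=> rho w rho0 hw /limit_inftyP lw r hr.
(* The midpoint is positive even when rho = 0, so its logarithm is meaningful. *)
pose r1 := (rho + r) / 2.
have r1r : r1 < r by rewrite /r1; lra.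
have rhor1 : rho < r1 by rewrite /r1; lra.
have r10 : 0 < r1 by lra.
have r0 : 0 < r by lra.
have fw : fdsol q emden_a emden_b mu (ln r1) (emden w) (demden w) L.
  split=> // t ht; apply: sol_at_of hw _; rewrite /= in_itv /= andbT.
  by apply: (lt_trans rhor1); rewrite -[ltLHS](expR_ln r10) ltr_expR.
have fy : fdsol q emden_a emden_b mu (ln r1) y z L by split.
have lr : ln r1 < ln r by rewrite ltr_ln ?posrE.
have [e _] := fd_unique q2 mu0 Ta Tb fw fy lr lr.
rewrite /radial -e /emden expR_ln// -mulrA -expRD mulNr subrr expR0 mulr1//.
Qed.

Lemma radial_is_u y z d : 0 < nu -> Tail (fun s => `|emden_a (- s) - nu ^+ 2|) ->
  Tail (fun s => `|emden_b (- s)| * expR (- (nu * (q - 2)) * s)) ->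
  (forall t, sol_at q emden_a emden_b y z t) -> limp (fun s => y (- s) * expR (nu * s)) d ->
  is_u n h f eta d (radial y).
Proof.
move=> nu0 Ta Tb hy hd; split; first exact: radial_solution hy.
  by apply/limit_zeroP; rewrite emden_radial.
move=> rho w rho0 hw /limit_zeroP lw r /andP[r0 hr].
have fw : fdsol q (fun s => emden_a (- s)) (fun s => emden_b (- s)) nu (- ln rho)
    (fun s => emden w (- s)) (fun s => - demden w (- s)) d.
  split; last exact: lw.
  move=> s hs; apply: sol_refl; apply: sol_at_of hw _; rewrite /= in_itv /= expR_gt0 /=.
  by rewrite -(expR_ln rho0) ltr_expR; lra.
have fy : fdsol q (fun s => emden_a (- s)) (fun s => emden_b (- s)) nu (- ln rho)
    (fun s => y (- s)) (fun s => - z (- s)) d.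
  by split=> // s _; apply: sol_refl.
have lr : - ln rho < - ln r by rewrite ltrN2 ltr_ln ?posrE.
have [e _] := fd_unique q2 nu0 Ta Tb fw fy lr lr.
rewrite !opprK in e.
rewrite /radial -e /emden expR_ln// -mulrA -expRD mulNr subrr expR0 mulr1//.
Qed.

End EmdenFowler.

(** * The conditions on h and K in logarithmic time *)

Section Coefficients.
Variable R : realType.
Implicit Types (n q eta delta t s : R) (h K : R -> R).

Lemma cts_at_exp (g : R -> R) : (forall r, 0 < r -> {for r, continuous g}) ->
  cts (fun t => g (expR t)).
Proof.
move=> cg t; apply: (@continuous_comp _ _ _ (@expR R) g); first exact: continuous_expR.
exact/cg/expR_gt0.
Qed.

Lemma emden_a_gt0 n h t : (forall r, 0 < r -> h r < hardy_const n) -> 0 < emden_a n h t.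
Proof.
move=> hh; have := hh _ (expR_gt0 t); rewrite /emden_a /omega /hardy_const; lra.
Qed.

Lemma emden_a_sub n h eta t : eta < hardy_const n ->
  `|emden_a n h t - (disc n eta / 2) ^+ 2| = `|h (expR t) - eta|.
Proof.
move=> he; rewrite half_disc_sqr// distrC; congr `|_|; rewrite /emden_a /omega; ring.
Qed.

(** The sign at r0 itself is not prescribed and comes from continuity. *)
Lemma sign_change_ge0 K r0 : 0 < r0 -> {for r0, continuous K} ->
  (forall r, r0 < r -> 0 < K r) -> forall r, r0 <= r -> 0 <= K r.
Proof.
move=> r00 cK Kpos r; rewrite le_eqVlt => /predU1P[<-|/Kpos/ltW//].
rewrite leNgt; apply/negP => Kn; have p : 0 < - K r0 by rewrite oppr_gt0.
have [d d0 hd] := (cts_eps _ _).1 cK _ p.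
have dd : d / 2 < d by lra.
have := hd (r0 + d / 2); rewrite addrAC subrr add0r gtr0_norm ?divr_gt0// => /(_ dd).
have : 0 < K (r0 + d / 2) by apply: Kpos; rewrite ltrDl divr_gt0.
by move=> h1; rewrite ltr_norml => /andP[_]; lra.
Qed.

Lemma emden_b_Tail n q K (mu koo delta : R) : (forall r, 0 < r -> {for r, continuous K}) ->
  2 + delta < (q - 2) * (omega n + mu) ->
  little_o +oo (fun r => K r - koo * r `^ delta) (fun r => r `^ delta) ->
  Tail (fun t => `|emden_b n q K t| * expR (- (mu * (q - 2)) * t)).
Proof.
move=> cK hp /(_ 1 ltr01) /near_oo_exp[N hN].
have p0 : 0 < (q - 2) * (omega n + mu) - (2 + delta) by rewrite subr_gt0.
apply: (@Tail_le _ _ (fun t => (1 + `|koo|) * expR (- ((q - 2) * (omega n + mu) - (2 + delta)) * t)) N).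
- apply: cts_M; first apply: cts_abs.
    apply: cts_M; first exact: cts_at_exp.
    by apply: cts_exp; apply: cts_M; [exact: cts_c|exact: cts_id].
  by apply: cts_exp; apply: cts_M; [exact: cts_c|exact: cts_id].
- move=> t /ltW /hN; rewrite expR_powR (gtr0_norm (expR_gt0 _)) mul1r => hK.
  have K1 : `|K (expR t)| <= (1 + `|koo|) * expR (t * delta).
    have e : K (expR t) = (K (expR t) - koo * expR (t * delta)) + koo * expR (t * delta) by ring.
    rewrite e; apply: (le_trans (ler_normD _ _)).
    by rewrite mulrDl mul1r normrM (gtr0_norm (expR_gt0 _)) lerD2r.
  rewrite normrM normr_id (gtr0_norm (expR_gt0 _)) /emden_b normrM (gtr0_norm (expR_gt0 _)).
  rewrite -[leLHS]mulrA -expRD.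
  have -> : - ((q - 2) * (omega n + mu) - (2 + delta)) * t =
    t * delta + ((2 - omega n * (q - 2)) * t + - (mu * (q - 2)) * t) by ring.
  by rewrite [in leRHS]expRD mulrA ler_wpM2r ?expR_ge0.
- by apply: TailZ; exact: Tail_exp.
Qed.

(** The function - K(r) r^(- delta) at r = e^(- s), the coefficient k of the damped equation;
    [dratio] is its derivative in s. *)
Definition ratio K delta s : R := - K (expR (- s)) * expR (delta * s).
Definition dratio K delta s : R :=
  (derive1 K (expR (- s)) * expR (- s) - delta * K (expR (- s))) * expR (delta * s).

Lemma HD_ratio K delta s : (forall r, 0 < r -> derivable K r 1) ->
  HD (ratio K delta) s (dratio K delta s).
Proof.
move=> dK; apply: HD_cv (HD_M (HD_N (HD_comp (HD_exp (HD_N (HD_id s))) (derivable_HD (dK _ (expR_gt0 _)))))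
  (HD_exp (HD_M (HD_c delta s) (HD_id s)))) _.
by rewrite /dratio; ring.
Qed.

(** The chain rule multiplies the r-derivative by r = e^(- s), so the hypothesis gives |dratio| <=
    e^(- (1 + w) s) eventually. *)
Lemma dratio_Tail K delta (w : R) : 0 < w -> (forall r, 0 < r -> derivable K r 1) ->
  cts (dratio K delta) ->
  r `^ (- w) * derive1 (fun r => K r * r `^ (- delta)) r @[r --> 0^'+] --> 0 ->
  Tail (fun s => `|dratio K delta s|).
Proof.
move=> w0 dK cd /cvg_0_exp /(_ 1 ltr01)[N hN].
set G := (fun r => K r * r `^ (- delta)) in hN.
have HG s : derive1 G (expR (- s)) = dratio K delta s / expR (- s).
  have hk : HD (fun t => - ratio K delta (- t)) (- s) (dratio K delta s).
    by have := HD_N (HD_comp (HD_N (HD_id (- s))) (HD_ratio delta (- - s) dK)); rewrite opprK => h1;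
      apply: HD_cv h1 _; ring.
  apply: HD_derive1; apply: HD_near (HD_at_exp hk).
  near=> r; have r0 : 0 < r by near: r; apply: lt_nbhsr; exact: expR_gt0.
  rewrite /ratio /G opprK expR_ln// mulNr opprK; congr (_ * _).
  by rewrite -[in RHS](expR_ln r0) expR_powR; congr expR; ring.
apply: (@Tail_le _ _ (fun s => expR (- (1 + w) * s)) N).
- exact: cts_abs.
- move=> s /ltW /hN; rewrite subr0 HG expR_powR normrM (gtr0_norm (expR_gt0 _)).
  rewrite normrM normfV (gtr0_norm (expR_gt0 _)) mulrCA -expRN -expRD => h1.
  rewrite normr_id -[leLHS]mulr1 -[X in _ * X](expR0 R).
  have -> : 0 = (- s * - w + - - s) + (- (1 + w) * s) :> R by ring.
  by rewrite expRD mulrA ler_piMl ?expR_ge0// ltW.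
- by apply: Tail_exp; rewrite addr_gt0.
Unshelve. all: by end_near.
Qed.

Lemma ratio_limit K (k0 delta : R) : little_o 0^'+ (fun r => K r - k0 * r `^ delta) (fun r => r `^ delta) ->
  limp (ratio K delta) (- k0).
Proof.
move=> O0 e e0; have e2 : 0 < e / 2 by rewrite divr_gt0.
have /near_0_exp[N hN] := O0 _ e2; exists N => s /hN.
rewrite expR_powR (gtr0_norm (expR_gt0 _)) => h1.
have E : expR (- s * delta) * expR (delta * s) = 1.
  by rewrite -expRD (_ : _ + _ = 0) ?expR0//; ring.
have -> : ratio K delta s - - k0 = - (K (expR (- s)) - k0 * expR (- s * delta)) * expR (delta * s).
  by rewrite -[k0 in LHS]mulr1 -E /ratio; ring.
rewrite normrM normrN (gtr0_norm (expR_gt0 _)).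
apply: (@le_lt_trans _ _ (e / 2)); last by lra.
by rewrite -[leRHS]mulr1 -[X in _ <= _ * X]E mulrA ler_wpM2r ?expR_ge0.
Qed.

Lemma emden_b_ratio n q K delta s : 2 < q ->
  emden_b n q K (- s) = - ratio K delta s *
    expR (- ((q - 2) * (2 * (2 + delta) / (q - 2) - (n - 2)) / 2) * s).
Proof.
move=> q2; rewrite /emden_b /ratio [- K _ * _]mulNr opprK -[RHS]mulrA -expRD; congr (_ * expR _).
by rewrite /omega; field; lra.
Qed.

End Coefficients.

Theorem corollary1p3 (R : realType) (n q : R) (h K : R -> R)
    (eta beta delta0 deltaoo : R) :
  2 < n ->
  lower_star n < q < upper_star n ->
  condH n h eta beta ->
  condK K delta0 deltaoo ->
  lower_star_of n eta < ell q delta0 < upper_star n ->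
  lower_star_of n beta < ell q deltaoo ->
  ((ell q deltaoo)%:E < I_of n beta)%E ->
  let f := power_nonlinearity K q in
  (exists B : nat -> R,
    [/\ forall k : nat, 0 < B k,
        forall j k : nat, (j < k)%N -> B j < B k,
        forall k : nat,
          exists2 v, is_v n h f beta (B k) v & Rf_solution n h f eta beta k v,
        forall L : R, 0 < L < B 0%N ->
          exists2 v, is_v n h f beta L v & Sf_solution n h f eta beta 0 v &
        forall k : nat, (1 <= k)%N ->
          exists2 Bstar : R, B k.-1 <= Bstar < B k &
            forall L : R, Bstar < L < B k ->
              exists2 v, is_v n h f beta L v &
                Sf_solution n h f eta beta k v]) /\
  (exists A : nat -> R,
    [/\ forall k : nat, 0 < A k,
        forall j k : nat, (j < k)%N -> A j < A k &
        forall k : nat,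
          exists2 u, is_u n h f eta (A k) u & Rf_solution n h f eta beta k u]).
Proof.
move=> n2 /andP[lq _] [hd [lh0 heta] ih0 [lhoo hbeta] ihoo].
move=> [Kd [r0 r00 [Kneg Kpos]] [d0 doo] [k0 [koo [/andP[k00 koo0] O0 Ooo]]] [w w0 [g0 _]]].
move=> /andP[le0 lu0] loo _ f.
have q2 := lower_star_gt2 n2 lq.
pose mu := disc n beta / 2; pose nu := disc n eta / 2.
have mu0 : 0 < mu by rewrite divr_gt0// disc_gt0.
have nu0 : 0 < nu by rewrite divr_gt0// disc_gt0.
have ch r : 0 < r -> {for r, continuous h}.
  by move=> /hd[dh _]; exact: HD_cts (derivable_HD dh).
have dK r : 0 < r -> derivable K r 1 by move=> /Kd[].
have cK r : 0 < r -> {for r, continuous K} by move=> /dK dk; exact: HD_cts (derivable_HD dk).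
pose a := emden_a n h; pose b := emden_b n q K.
have cN : cts (fun s : R => - s) by apply: cts_N; exact: cts_id.
have ca : cts a by apply: cts_D; [exact: cts_c|apply: cts_N; exact: cts_at_exp].
have cb : cts b.
  apply: cts_M; first exact: cts_at_exp.
  by apply: cts_exp; apply: cts_M; [exact: cts_c|exact: cts_id].
have a0 t : 0 < a t by apply: emden_a_gt0 => r /hd[].
pose T := ln r0.
have bneg t : t < T -> b t < 0.
  move=> tT; rewrite pmulr_llt0 ?expR_gt0//; apply: Kneg.
  by rewrite expR_gt0 -(expR_ln r00) ltr_expR.
have bpos t : T <= t -> 0 <= b t.
  move=> tT; rewrite mulr_ge0 ?expR_ge0//; apply: (sign_change_ge0 r00 (cK _ r00) Kpos).
  by rewrite -(expR_ln r00) ler_expR.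
have Ta : Tail (fun t => `|a t - mu ^+ 2|).
  have [N hN N0] := Tail_oo ch ihoo; exists N => // t.
  by rewrite emden_a_sub.
have Tar : Tail (fun s => `|a (- s) - nu ^+ 2|).
  have [N hN N0] := Tail_zero ch ih0; exists N => // t.
  by rewrite emden_a_sub.
have Tb : Tail (fun t => `|b t| * expR (- (mu * (q - 2)) * t)).
  exact: emden_b_Tail cK (ell_gt n2 hbeta doo loo) Ooo.
have lar : limp (fun s => a (- s)) (nu ^+ 2).
  rewrite half_disc_sqr//; apply: limpD; first exact: limp_c.
  by apply: limpN; exact/cvg_0_exp.
(* Chosen so that y e^(gam t / 2) = u r^((2 + delta0)/(q - 2)), the scaling that turns K ~ k0
   r^delta0 into an asymptotically constant coefficient. *)
pose gam := 2 * (2 + delta0) / (q - 2) - (n - 2).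
have q20 : 0 < q - 2 by rewrite subr_gt0.
have gam0 : 0 < gam.
  have := ell_lt n2 d0 lu0; rewrite /gam subr_gt0 ltr_pdivlMr//; lra.
have gamnu : gam / 2 < nu.
  have := ell_gt n2 heta d0 le0; rewrite /gam /nu mulrC -ltr_pdivrMr// -[2 * _ / _]mulrA; lra.
have kI0 : 0 < - k0 by rewrite oppr_gt0.
have bk s := emden_b_ratio n K delta0 s q2.
have hk s := HD_ratio delta0 s dK.
have cex : cts (fun s : R => expR (- s)) by exact: cts_exp.
have ck' : cts (dratio K delta0).
  apply: cts_M; last by apply: cts_exp; apply: cts_M; [exact: cts_c|exact: cts_id].
  apply: cts_D.
    apply: cts_M (cex); apply: (@cts_comp _ (fun t => derive1 K (expR t)) _ _ cN).
    by apply: cts_at_exp => r /Kd[].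
  apply: cts_N; apply: cts_M; first exact: cts_c.
  exact: (@cts_comp _ (fun t => K (expR t)) _ (cts_at_exp cK) cN).
have Tk := dratio_Tail w0 dK ck' g0.
have lk := ratio_limit O0.
have Trb := reflected_tail q2 nu0 gam0 cb bk hk lk.
have vres y z L k : global q mu a b y z L -> 0 < L -> (zero_set y #= `I_k)%card ->
  [/\ is_v n h f beta L (radial n y), fd_solution n h f beta (radial n y),
    solution n h f (radial n y) & exactly_nondegenerate_zeros k (radial n y)].
  move=> g L0 hk'; have sol t := global_sol t g.
  have [_ hL] := g 0.
  have isv := radial_is_v q2 mu0 Ta Tb sol hL.
  have [s1 s2 _] := isv; split=> //; first by split=> //; exists L.
  apply: (@radial_zeros _ n y z _) => // t; first by have [] := sol t.
  by apply: (global_simple q2 ca cb g); rewrite gt_eqF.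
split.
  have [B [Bpos Binc BR BS0 BS]] := core_fast_decay q2 mu0 nu0 gam0 gamnu kI0 ca cb a0 bneg bpos
    Ta Tb Tar lar bk hk ck' Tk lk.
  exists B; split=> //.
  - move=> k; have [y [z [g hz [dd hdd]]]] := BR k.
    have [h1 h2 h3 h4] := vres y z _ k g (Bpos k) hz; exists (radial n y) => //; split=> //.
    by split=> //; exists dd; apply/limit_zeroP; rewrite emden_radial.
  - move=> L /andP[L0 LB]; have [y [z [g hz bl]]] := BS0 L L0 LB.
    have [h1 h2 h3 h4] := vres y z _ 0%N g L0 hz; exists (radial n y) => //; split=> //.
    by split=> //; exact: radial_blowup.
  - move=> k k1; have [s hs hS] := BS k k1; exists s => // L /andP[sL LB].
    have [y [z [g hz bl]]] := hS L sL LB.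
    have L0 : 0 < L by apply: lt_trans sL; apply: lt_le_trans (proj1 (andP hs)).
    have [h1 h2 h3 h4] := vres y z _ k g L0 hz; exists (radial n y) => //; split=> //.
    by split=> //; exact: radial_blowup.
have [A [Apos Ainc hA]] := core_regular q2 mu0 nu0 gam0 gamnu kI0 ca cb a0 bneg bpos
    Ta Tb Tar lar bk hk ck' Tk lk.
exists A; split=> // k; have [y [z [sol hz hd0 [L hL]]]] := hA k.
have sol1 t : sol_at q a b y z t by have [] := sol t.
have isu := radial_is_u q2 nu0 Tar Trb sol1 hd0.
have [s1 s2 _] := isu; exists (radial n y) => //; split.
- by split=> //; exists (A k).
- by split=> //; exists L; apply/limit_inftyP; rewrite emden_radial.
apply: (@radial_zeros _ n y z _) => // t; first by have [] := sol1 t.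
by have [] := sol t.
Qed.
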